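(* Let $\Omega\subset\mathbb{R}^n$ be a special Lipschitz domain, $p\in(1,+\infty)$ and $s\in(-n/p',+\infty)$. Then, canonically and with equivalence of norms, $$(\dot{\mathrm{H}}^{s,p}_0(\Omega))'=\dot{\mathrm{H}}^{-s,p'}(\Omega)\qquad\text{and}\qquad(\dot{\mathrm{H}}^{s,p}(\Omega))'=\dot{\mathrm{H}}^{-s,p'}_0(\Omega).$$
   Context: $n\geqslant2$, $p'$ is the Hölder conjugate of $p$. A special Lipschitz domain is $\Omega=\{(x',x_n)\in\mathbb{R}^{n-1}\times\mathbb{R}: x_n>\phi(x')\}$ with $\phi:\mathbb{R}^{n-1}\to\mathbb{R}$ globally Lipschitz. Littlewood–Paley family: fix $\varphi\in\mathrm{C}_c^\infty(\mathbb{R}^n)$ radial, real, non-negative, $\operatorname{supp}\varphi\subset B(0,4/3)$, $\varphi=1$ on $B(0,3/4)$; $\varphi_j(\xi)=\varphi(2^{-j}\xi)$, $\psi_j(\xi)=\varphi_j(\xi/2)-\varphi_j(\xi)$, $\dot{\Delta}_j=\mathcal{F}^{-1}\psi_j\mathcal{F}$, $j\in\mathbb{Z}$. $\mathcal{S}'_h(\mathbb{R}^n)$ is the set of $u\in\mathcal{S}'(\mathbb{R}^n)$ such that for all $\Theta\in\mathrm{C}_c^\infty(\mathbb{R}^n)$, $\lVert\mathcal{F}^{-1}\Theta(\lambda\cdot)\mathcal{F}u\rVert_{\mathrm{L}^\infty}\to0$ as $\lambda\to+\infty$. $\dot{\mathrm{H}}^{s,p}(\mathbb{R}^n)$ is the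 normed space (not complete in general) of $u\in\mathcal{S}'_h(\mathbb{R}^n)$ with $\lVert u\rVert_{\dot{\mathrm{H}}^{s,p}}=\lVert\sum_{j}(-\Delta)^{s/2}\dot{\Delta}_ju\rVert_{\mathrm{L}^p}<\infty$. $\dot{\mathrm{H}}^{s,p}(\Omega)$ is the space of restrictions to $\Omega$ of elements of $\dot{\mathrm{H}}^{s,p}(\mathbb{R}^n)$ with the quotient norm; $\dot{\mathrm{H}}^{s,p}_0(\Omega)=\{u\in\dot{\mathrm{H}}^{s,p}(\mathbb{R}^n):\operatorname{supp}u\subset\overline{\Omega}\}$ with the norm of $\dot{\mathrm{H}}^{s,p}(\mathbb{R}^n)$. The duality bracket on $\dot{\mathrm{H}}^{s,p}(\mathbb{R}^n)\times\dot{\mathrm{H}}^{-s,p'}(\mathbb{R}^n)$ is $\langle u,v\rangle_{\mathbb{R}^n}=\sum_{|j-j'|\leqslant1}\int\dot{\Delta}_ju\,\dot{\Delta}_{j'}v$. The canonical identifications are: $u\in\dot{\mathrm{H}}^{-s,p'}(\Omega)$ acts on $v\in\dot{\mathrm{H}}^{s,p}_0(\Omega)$ by $\langle\tilde u,v\rangle_{\mathbb{R}^n}$ with $\tilde u\in\dot{\mathrm{H}}^{-s,p'}(\mathbb{R}^n)$ any extension of $u$; $u\in\dot{\mathrm{H}}^{-s,p'}_0(\Omega)$ acts on $v\in\dot{\mathrm{H}}^{s,p}(\Omega)$ by $\langle u,\tilde v\rangle_{\mathbb{R}^n}$ with $\tilde v\in\dot{\mathrm{H}}^{s,p}(\mathbb{R}^n)$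 any extension of $v$. *)

(* Defs.v *)
From HB Require Import structures.
From mathcomp Require Import all_boot all_order all_algebra complex.
From mathcomp Require Import all_classical all_reals all_analysis.

Set Implicit Arguments.
Unset Strict Implicit.
Unset Printing Implicit Defensive.
Import Order.TTheory GRing.Theory Num.Theory.
Import numFieldNormedType.Exports.

Local Open Scope classical_set_scope.
Local Open Scope ring_scope.

Definition measure_rV_display : measure_display -> measure_display.
Proof. exact. Qed.

Section measurable_rV.
Context {d} {T : sigmaRingType d} (n : nat).

Definition rV_coor (i : 'I_n) (x : 'rV[T]_n) : T := x ord0 i.

Let rV_set0 : g_sigma_preimage rV_coor set0.
Proof. exact: sigma_algebra0. Qed.

Let rV_setC A : g_sigma_preimage rV_coor A -> g_sigma_preimage rV_coor (~` A).
Proof. exact: sigma_algebraC. Qed.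

Let rV_bigcup (F : _^nat) : (forall i, g_sigma_preimage rV_coor (F i)) ->
  g_sigma_preimage rV_coor (\bigcup_i (F i)).
Proof. exact: sigma_algebra_bigcup. Qed.

(* product sigma-algebra, as the library does for [n.-tuple T] *)
HB.instance Definition _ := @isMeasurable.Build (measure_rV_display d)
  'rV[T]_n (g_sigma_preimage rV_coor) rV_set0 rV_setC rV_bigcup.

Lemma measurable_rV_coor (i : 'I_n) : measurable_fun setT (rV_coor i).
Proof.
move=> _ Y mY; rewrite setTI; apply: sub_sigma_algebra => /=.
rewrite -bigcup_seq/=; exists i => /=; first by rewrite mem_index_enum.
by exists Y => //; rewrite setTI.
Qed.

End measurable_rV.

Lemma measurable_fun_rV d1 d2 (T1 : measurableType d1) (T2 : measurableType d2)
    n (f : T1 -> 'rV[T2]_n) :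
  (forall i, measurable_fun setT (fun x => f x ord0 i)) -> measurable_fun setT f.
Proof.
move=> mf.
have sub : g_sigma_preimage (fun i => rV_coor i \o f) `<=` measurable.
  apply: smallest_sub; first exact: sigma_algebra_measurable.
  case: n f mf => [|n] f mf; first by rewrite big_ord0.
  rewrite -bigcup_mkord_ord; apply: bigcup_sub => i Ii.
  by move=> A [B mB <-]; exact: mf.
by move=> _ A mA; apply: sub; rewrite g_sigma_preimage_comp; exists A.
Qed.

Section lebesgue_rV.
Context {R : realType}.

Definition rV_cons n (z : R * 'rV[R]_n) : 'rV[R]_n.+1 :=
  \row_i oapp (z.2 ord0) z.1 (unlift ord0 i).

Definition rV_uncons n (x : 'rV[R]_n.+1) : R * 'rV[R]_n :=
  (x ord0 ord0, col' ord0 x).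

Lemma rV_consE0 n (z : R * 'rV[R]_n) : rV_cons z ord0 ord0 = z.1.
Proof. by rewrite mxE unlift_none. Qed.

Lemma rV_consES n (z : R * 'rV[R]_n) i : rV_cons z ord0 (lift ord0 i) = z.2 ord0 i.
Proof. by rewrite mxE liftK. Qed.

Lemma rV_consK n : cancel (@rV_cons n) (@rV_uncons n).
Proof.
move=> z; rewrite /rV_uncons rV_consE0 [RHS]surjective_pairing; congr pair.
by apply/rowP => i; rewrite mxE rV_consES.
Qed.

Lemma measurable_rV_cons n : measurable_fun setT (@rV_cons n).
Proof.
apply: measurable_fun_rV => i.
case: (unliftP ord0 i) => [j|] ->.
  rewrite (_ : (fun _ => _) = rV_coor j \o snd).
    by apply: measurableT_comp => //; exact: measurable_rV_coor.
  by apply/funext => z; rewrite rV_consES.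
rewrite (_ : (fun _ => _) = fst)//.
by apply/funext => z; rewrite rV_consE0.
Qed.

Lemma measurable_rV_uncons n : measurable_fun setT (@rV_uncons n).
Proof.
apply/measurable_fun_pairP; split; first exact: measurable_rV_coor.
apply: measurable_fun_rV => i.
rewrite (_ : (fun _ => _) = rV_coor (lift ord0 i)); first exact: measurable_rV_coor.
by apply/funext => z; rewrite /= mxE.
Qed.

Section step.
Variables (n : nat) (mu : {sigma_finite_measure set 'rV[R]_n -> \bar R}).

Definition lebesgue_rV_step : set 'rV[R]_n.+1 -> \bar R :=
  pushforward (@lebesgue_measure R \x mu)%E (@rV_cons n).

Let step0 : lebesgue_rV_step set0 = 0%E.
Proof. by rewrite /lebesgue_rV_step /pushforward preimage_set0 measure0. Qed.

Let step_ge0 A : (0 <= lebesgue_rV_step A)%E.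
Proof. by rewrite /lebesgue_rV_step /pushforward. Qed.

Let step_sigma_additive : semi_sigma_additive lebesgue_rV_step.
Proof.
move=> F mF tF mUF.
have mpre A : measurable A -> measurable (@rV_cons n @^-1` A).
  by move=> mA; rewrite -[_ @^-1` _]setTI; exact: measurable_rV_cons.
rewrite /lebesgue_rV_step /pushforward preimage_bigcup.
apply: measure_semi_sigma_additive => [i||]; first exact: mpre.
  apply/trivIsetP => /= i j _ _ ij; rewrite -preimage_setI.
  by move/trivIsetP : tF => /(_ _ _ _ _ ij) ->//; rewrite preimage_set0.
by rewrite -preimage_bigcup; exact: mpre.
Qed.

HB.instance Definition _ := isMeasure.Build _ _ _ lebesgue_rV_step
  step0 step_ge0 step_sigma_additive.

Let sigma_finite_step : sigma_finite setT lebesgue_rV_step.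
Proof.
have /sigma_finiteP[F [TF ndF Foo]] := sigma_finiteT (@lebesgue_measure R).
have /sigma_finiteP[G [TG ndG Goo]] := sigma_finiteT mu.
exists (fun k => @rV_uncons n @^-1` (F k `*` G k)).
  rewrite -preimage_bigcup -(preimage_setT (@rV_uncons n)); congr (_ @^-1` _).
  rewrite -setXTT TF TG predeqE => -[x y]; split.
    move=> [/= [i _ Fix] [j _ Gjy]]; exists (maxn i j) => //; split.
    - by move: x Fix; exact/subsetPset/ndF/leq_maxl.
    - by move: y Gjy; exact/subsetPset/ndG/leq_maxr.
  by move=> [k _ []/= ? ?]; split; exists k.
move=> k; have [mF Fk] := Foo k; have [mG Gk] := Goo k; split.
  by rewrite -[_ @^-1` _]setTI; apply: measurable_rV_uncons => //;
    exact: measurableX.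
rewrite /lebesgue_rV_step /pushforward -comp_preimage.
rewrite (_ : _ \o _ = id); last by apply/funext => z; exact: rV_consK.
by rewrite preimage_id product_measure1E// lte_mul_pinfty// ge0_fin_numE.
Qed.

HB.instance Definition _ := Measure_isSigmaFinite.Build _ _ _ lebesgue_rV_step
  sigma_finite_step.

End step.

Fixpoint lebesgue_rV n : {sigma_finite_measure set 'rV[R]_n -> \bar R} :=
  if n is m.+1 then lebesgue_rV_step (lebesgue_rV m)
  else \d_(0 : 'rV[R]_0).

Lemma lebesgue_rV_box n (A : 'I_n -> set R) : (forall i, measurable (A i)) ->
  lebesgue_rV n [set x | forall i, A i (x ord0 i)]
  = (\prod_(i < n) lebesgue_measure (A i))%E.
Proof.
elim: n A => [|n IHn] A mA.
  by rewrite big_ord0 /= diracE mem_set// => -[].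
pose B := [set v : 'rV[R]_n | forall i, A (lift ord0 i) (v ord0 i)].
have mB : measurable B.
  rewrite (_ : B = \big[setI/setT]_(i < n) (rV_coor i @^-1` A (lift ord0 i))).
    apply: bigsetI_measurable => i _; rewrite -[_ @^-1` _]setTI.
    exact: measurable_rV_coor.
  rewrite -bigcap_seq; apply/seteqP; split => v /=; first by move=> Bv i _; exact: Bv.
  by move=> h i; apply: h => /=; rewrite mem_index_enum.
rewrite big_ord_recl /= /lebesgue_rV_step /pushforward.
set C := _ @^-1` _; suff -> : C = A ord0 `*` B.
  rewrite product_measure1E//; last exact: (mA ord0).
  by congr mule; exact: (IHn (fun i => A (lift ord0 i))).
rewrite /C eqEsubset; split => -[x v] /=.
  move=> h; split => [|i]; first by have := h ord0; rewrite rV_consE0.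
  by have := h (lift ord0 i); rewrite rV_consES.
move=> [Ax Bv] i; case: (unliftP ord0 i) => [j|] ->.
  by rewrite rV_consES; exact: Bv.
by rewrite rV_consE0.
Qed.

End lebesgue_rV.

Section functions.
Context {R : realType} {n : nat}.
Local Notation E := 'rV[R]_n.
Local Notation C := R[i].
Local Notation leb := (lebesgue_rV n).
Implicit Types (f g : E -> C) (x y : E).

(* [`|x|] on row vectors is the sup norm, hence a separate Euclidean norm *)
Definition dotprod x y : R := \sum_(i < n) x ord0 i * y ord0 i.
Definition enorm x : R := Num.sqrt (dotprod x x).
Definition eball (r : R) : set E := [set x | enorm x < r].

Definition modulus (z : C) : R := Normc.normc z.

Definition ofreal (f : E -> R) : E -> C := fun x => (f x)%:C%C.

Definition pderiv (i : 'I_n) f : E -> C := fun x =>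
  ('D_(delta_mx ord0 i) (fun y => complex.Re (f y) : R^o) x
   +i* 'D_(delta_mx ord0 i) (fun y => complex.Im (f y) : R^o) x)%C.

Definition pderivs (a : seq 'I_n) f : E -> C := foldr pderiv f a.

Definition smooth f := forall a x,
  differentiable (fun y => complex.Re (pderivs a f y) : R^o) x /\
  differentiable (fun y => complex.Im (pderivs a f y) : R^o) x.

Definition fsupport f : set E := closure [set x | f x != 0].
Definition Cc_smooth (O : set E) : set (E -> C) :=
  [set f | [/\ smooth f, compact (fsupport f) & fsupport f `<=` O]].

Definition schwartz_le (N : nat) (M : R) f := forall (a : seq 'I_n) x,
  (size a <= N)%N -> (1 + enorm x) ^+ N * modulus (pderivs a f x) <= M.
Definition schwartz : set (E -> C) :=
  [set f | smooth f /\ forall N, exists M, schwartz_le N M f].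

Definition cmeasurable f :=
  measurable_fun setT (fun x => complex.Re (f x)) /\
  measurable_fun setT (fun x => complex.Im (f x)).
Definition cintegrable f :=
  leb.-integrable setT (fun x => (complex.Re (f x))%:E) /\
  leb.-integrable setT (fun x => (complex.Im (f x))%:E).
Definition cintegral f : C :=
  ((\int[leb]_x complex.Re (f x)) +i* (\int[leb]_x complex.Im (f x)))%C.

Definition cis (t : R) : C := (cos t +i* sin t)%C.

Definition fourier f : E -> C := fun xi =>
  cintegral (fun x => cis (- dotprod x xi) * f x).
Definition ifourier f : E -> C := fun x =>
  ((2 * pi) ^- n)%:C%C * cintegral (fun xi => cis (dotprod x xi) * f xi).

(* A functional on a space [D] of functions is represented by its extension
   by zero to all of [E -> C]; equality of functionals is then Leibniz
   equality. This applies to [D = schwartz] (elements of S'(R^n)) and to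
   [D = Cc_smooth O] (distributions on [O]). *)
Definition dist := (E -> C) -> C.
Implicit Types (u v w : dist).

Definition ext0 (D : set (E -> C)) u : dist := patch (fun=> 0) D u.

Definition tempered : set dist := [set u | [/\
  forall f, ~ schwartz f -> u f = 0,
  forall (c : C) f g, schwartz f -> schwartz g ->
    u (fun x => c * f x + g x) = c * u f + u g &
  exists N (K : R), forall f M,
    schwartz f -> schwartz_le N M f -> modulus (u f) <= K * M]].

Definition dfourier u : dist := ext0 schwartz (fun f => u (fourier f)).
Definition difourier u : dist := ext0 schwartz (fun f => u (ifourier f)).
Definition dmul (m : E -> C) u : dist :=
  ext0 schwartz (fun f => u (fun x => m x * f x)).

Definition multiplier (m : E -> C) u : dist := difourier (dmul m (dfourier u)).

Definition represents f u := [/\ tempered u, cmeasurable f &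
  forall phi, schwartz phi ->
    cintegrable (fun x => f x * phi x) /\
    u phi = cintegral (fun x => f x * phi x)].

(* +oo when [u] is not a function; all representatives are a.e. equal *)
Definition dLnorm (p : \bar R) u : \bar R :=
  ereal_inf [set Lnorm leb p (fun x => (modulus (f x))%:E)
            | f in [set f | represents f u]].

Definition fun_of u : E -> C := xget (fun=> 0) [set f | represents f u].

(* sums over Z: both ends of the range tend to infinity independently *)
Definition zsum (a : int -> C) (z : C) :=
  (fun MN : nat * nat =>
     modulus (\sum_(k < (MN.1 + MN.2)%N) a ((k : nat)%:Z - MN.1%:Z) - z))
    @ (\oo, \oo) --> (0 : R).

(* the series converges to [w] in the weak-* topology of S'(R^n) *)
Definition dzsum (U : int -> dist) w := tempered w /\
  forall phi, schwartz phi -> zsum (fun j => U j phi) (w phi).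

Definition dsupport u : set E := [set x | forall O : set E,
  open O -> O x -> exists2 phi, Cc_smooth O phi & u phi <> 0].

Definition Sh' : set dist := [set u | tempered u /\
  forall Theta, Cc_smooth setT Theta ->
    dLnorm +oo (multiplier (fun xi => Theta (lambda *: xi)) u)
      @[lambda --> (+oo : set_system R)] --> 0%E].

Definition LP_cutoff (chi : E -> R) := [/\
  Cc_smooth (eball (4 / 3)) (ofreal chi),
  forall x y, enorm x = enorm y -> chi x = chi y,
  forall x, 0 <= chi x &
  forall x, eball (3 / 4) x -> chi x = 1].

Section LittlewoodPaley.
Variable chi : E -> R.

Definition LP_phi (j : int) : E -> R := fun xi => chi ((2 : R) ^ (- j) *: xi).
Definition LP_psi (j : int) : E -> R := fun xi =>
  LP_phi j (2^-1 *: xi) - LP_phi j xi.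

Definition Delta (j : int) u : dist := multiplier (ofreal (LP_psi j)) u.

(* (- Laplacian)^(s/2) Delta_j; the symbol vanishes near the origin, where
   [powR] takes its conventional value *)
Definition fracDelta (s : R) (j : int) u : dist :=
  multiplier (ofreal (fun xi => enorm xi `^ s * LP_psi j xi)) u.

(* the set below has at most one element, and [ereal_inf set0 = +oo] *)
Definition Hnorm (s p : R) u : \bar R :=
  ereal_inf [set dLnorm p%:E w | w in dzsum (fun j => fracDelta s j u)].

Definition Hdot (s p : R) : set dist :=
  [set u | Sh' u /\ (Hnorm s p u < +oo)%E].

Definition bracket u v : C := xget 0 (zsum (fun j =>
  \sum_(k <- [:: j - 1; j; j + 1])
    cintegral (fun x => fun_of (Delta j u) x * fun_of (Delta k v) x))).

Definition restriction (Omega : set E) u : dist := ext0 (Cc_smooth Omega) u.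

Definition HdotO (Omega : set E) (s p : R) : set dist :=
  restriction Omega @` Hdot s p.

Definition HnormO (Omega : set E) (s p : R) U : \bar R :=
  ereal_inf [set Hnorm s p u
            | u in [set u | Hdot s p u /\ restriction Omega u = U]].

Definition Hdot0 (Omega : set E) (s p : R) : set dist :=
  [set u | Hdot s p u /\ dsupport u `<=` closure Omega].

End LittlewoodPaley.

(* [X] is a subspace of [dist] with norm [N]; as above, functionals on [X] are
   extended by zero *)
Definition dual (X : set dist) (N : dist -> \bar R) : set (dist -> C) :=
  [set l | [/\
    forall v, ~ X v -> l v = 0,
    forall (c : C) u v, X u -> X v ->
      l (fun f => c * u f + v f) = c * l u + l v &
    exists K : R, forall v, X v -> ((modulus (l v))%:E <= K%:E * N v)%E]].

Definition dual_norm (X : set dist) (N : dist -> \bar R) (l : dist -> C)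
    : \bar R :=
  ereal_sup [set (modulus (l v))%:E | v in [set v | X v /\ (N v <= 1)%E]].

Definition dual_iso (Y : set dist) (NY : dist -> \bar R)
    (X : set dist) (NX : dist -> \bar R) (J : dist -> dist -> C) := [/\
  set_bij Y (dual X NX) J,
  forall (c : C) u v, Y u -> Y v ->
    J (fun f => c * u f + v f) = (fun w => c * J u w + J v w) &
  exists c1 c2 : R, [/\ 0 < c1, 0 < c2 & forall u, Y u ->
    (c1%:E * NY u <= dual_norm X NX (J u) <= c2%:E * NY u)%E]].

End functions.

(* [x'] is [col' ord_max x] and [x_n] is [x ord0 ord_max] *)
Definition special_lipschitz (R : realType) (m : nat) (Omega : set 'rV[R]_m.+1) :=
  exists2 phi : 'rV[R]_m -> R^o, lipschitz phi &
    Omega = [set x | phi (col' ord_max x) < x ord0 ord_max].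

(* Main.v *)
(* The bracket is an L^p pairing of lifted data: if [w1] and [w2] are the sums
   of the series (-Delta)^(-s/2) Delta_j u and (-Delta)^(s/2) Delta_j v, then
   <u,v> is the integral of [w1 * w2].  Functionals on a subspace are therefore
   represented, with the same norm, by the duality of L^p (through uniform
   convexity) followed by the inverse lift, which exists since s > -n/p'.

   The point is that <u,v> = 0 when u is supported in the closure of the domain
   and v vanishes in it.  Write the domain as {G > 0} with G Lipschitz and
   G(x + t d) = G(x) + t; exchanging u and v, let s >= 0.  Mollifying u and
   taking a translated finite difference of v of order k > s yields functions
   of L^q and L^p with separated supports, whose pairing vanishes.  The
   differences are removed by letting their steps tend to infinity, where
   translates tend weakly to 0; then the mollification and the translation are
   removed by letting their parameters tend to 0. *)
Require Import Defs.
From HB Require Import structures.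
From mathcomp Require Import all_boot all_order all_algebra complex.
From mathcomp Require Import all_classical all_reals all_analysis.
From mathcomp Require Import measurable_realfun ess_sup_inf.
From mathcomp Require Import ring lra zify.

Set Implicit Arguments.
Unset Strict Implicit.
Unset Printing Implicit Defensive.
Import Order.TTheory GRing.Theory Num.Theory.
Import numFieldNormedType.Exports.

Local Open Scope classical_set_scope.
Local Open Scope ring_scope.

(** The spaces are not complete, so no minimisation can be carried out inside them. The extremal
    argument takes place in [L^p], on the image of a subspace under the lift; this image need not be
    closed, and the minimiser may lie only in its closure.

    The condition on [s] concerns low frequencies. The piece of frequency [2 ^ j] of a Schwartz
    function has a lift of order [s] with [L^p] norm at most of order [2^(j (s + n/p'))], which is
    summable as [j] tends to minus infinity. The same estimate puts inverse lifts in [S'_h] and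
    Schwartz functions in the spaces.

    The obstacle to vanishing is that lifts and frequency cut-offs destroy supports. To turn [u] and
    [v] into functions, only operations that move supports in a controlled way are allowed. For
    [s >= 0] the defect of [u] is at high frequencies, and convolution with a compactly supported
    kernel repairs it; the defect of [v] is the factor [|xi|^-s] at low frequencies, and it is
    repaired by a symbol that vanishes to high order at 0. Differences along [d] have such a symbol
    and push the support of [v] away from the domain. *)

Lemma le_of_eq d (T : porderType d) (a b : T) : a = b -> (a <= b)%O.
Proof. by move=> ->. Qed.

(** * Affine changes of variables for Lebesgue measure *)

Section affine1.
Context {R : realType}.
Local Notation mu := (@lebesgue_measure R).

Definition affine (c a : R) : measurableTypeR R -> measurableTypeR R :=
  fun x => c * x + a.

Lemma measurable_affine (c a : R) : measurable_fun setT (affine c a).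
Proof. by apply: measurable_funD => //; exact: measurable_funM. Qed.

(** Uniqueness of Lebesgue measure reduces the claim to half-open intervals. For negative [c] the
    preimage of []x, y]] is closed on the left and open on the right, which does not change its
    length. *)
Lemma lebesgue_measure_affine (c a : R) : c != 0 ->
  forall A, measurable A ->
  lebesgue_measure A = (`|c|%:E * pushforward mu (affine c a) A)%E.
Proof.
move=> c0 A mA.
have nc0 : 0 <= `|c| by [].
have mm := measurable_affine c a.
rewrite (lebesgue_measure_unique (mu := mscale (NngNum nc0)
  (pushforward mu (affine c a))) _ mA)//.
move=> _ [[x y] _ <-] /=; rewrite /mscale /= /pushforward.
have [c_gt0|c_lt0|] := ltgtP 0 c; last by move=> h; rewrite -h eqxx in c0.
- rewrite (_ : _ @^-1` _ = `]((x - a) / c), ((y - a) / c)]%classic); last first.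
    apply/seteqP; split => t /=; rewrite !in_itv/= /affine ltr_pdivrMr// ler_pdivlMr// => /andP[h1 h2]; apply/andP; split; lra.
  rewrite !lebesgue_measure_itv/= !lte_fin ltr_pM2r ?invr_gt0//.
  rewrite ltrD2r; case: ifPn => _; last by rewrite mule0.
  rewrite gtr0_norm// -!EFinD -EFinM; congr EFin; field; lra.
- rewrite (_ : _ @^-1` _ = `[((y - a) / c), ((x - a) / c)[%classic); last first.
    apply/seteqP; split => t /=; rewrite !in_itv/= /affine ltr_ndivlMr// ler_ndivrMr// => /andP[h1 h2]; apply/andP; split; lra.
  rewrite !lebesgue_measure_itv/= !lte_fin ltr_nM2r ?invr_lt0//.
  rewrite ltrD2r; case: ifPn => _; last by rewrite mule0.
  rewrite ltr0_norm// -!EFinD -EFinM; congr EFin; field; lra.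
Qed.

Lemma ge0_integral_affine (c a : R) (f : R -> \bar R) : c != 0 ->
  measurable_fun setT f -> (forall x, 0 <= f x)%E ->
  (\int[mu]_x f (c * x + a)%R = (`|c|^-1)%:E * \int[mu]_x f x)%E.
Proof.
move=> c0 mf f0.
have nc0 : 0 <= `|c| by [].
have mm := measurable_affine c a.
have E : (\int[mu]_x f x)%E =
    (\int[mscale (NngNum nc0) (pushforward mu (affine c a))]_x f x)%E.
  move=> m; apply: (@eq_measure_integral _ (measurableTypeR R) R setT _ mu) => A mA _.
  exact: (lebesgue_measure_affine a c0 mA).
rewrite (E mm).
rewrite (@ge0_integral_mscale _ (measurableTypeR R) R
  (pushforward mu (affine c a)) setT measurableT (NngNum nc0) f mf
  (fun x _ => f0 x))//=.
rewrite (@ge0_integral_pushforward _ _ (measurableTypeR R) (measurableTypeR R)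
  R _ mm mu setT f measurableT mf (fun x _ => f0 x)).
by rewrite preimage_setT muleA -EFinM mulVf ?normr_eq0// mul1e.
Qed.

End affine1.

Section rV.
Context {R : realType}.
Local Notation mu := (@lebesgue_measure R).

(** The measure on [n.+1] coordinates is the image of a product under [rV_cons], so Tonelli's
    theorem splits off the first coordinate. The inductions on the dimension below rest on this. *)
Lemma ge0_integral_rVS n (f : 'rV[R]_n.+1 -> \bar R) :
  measurable_fun setT f -> (forall x, 0 <= f x)%E ->
  (\int[lebesgue_rV n.+1]_x f x =
   \int[mu]_x \int[lebesgue_rV n]_v f (rV_cons (x, v)))%E.
Proof.
move=> mf f0.
have mc : measurable_fun (setT : set (measurableTypeR R * 'rV[R]_n)%type) (@rV_cons R n).
  exact: measurable_rV_cons.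
have := @ge0_integral_pushforward _ _ (measurableTypeR R * _)%type _ R _ mc
  (mu \x lebesgue_rV n)%E
  setT f measurableT mf (fun x _ => f0 x).
rewrite preimage_setT fubini_tonelli1; last 2 first.
- exact: (measurableT_comp mf mc).
- by move=> x; exact: f0.
by move=> <-; apply: eq_measure_integral => A mA _.
Qed.

Lemma measurable_rV_affine n (c : R) (a : 'rV[R]_n) :
  measurable_fun setT (fun x : 'rV[R]_n => c *: x + a).
Proof.
apply: measurable_fun_rV => i.
rewrite (_ : (fun _ => _) = (fun x => c * rV_coor i x + a ord0 i)).
  apply: measurable_funD => //; apply: measurable_funM => //.
  exact: measurable_rV_coor.
by apply/funext => x; rewrite !mxE.
Qed.

Lemma ge0_integral_rV_affine n (c : R) (a : 'rV[R]_n) (f : 'rV[R]_n -> \bar R) :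
  c != 0 -> measurable_fun setT f -> (forall x, 0 <= f x)%E ->
  (\int[lebesgue_rV n]_x f (c *: x + a)%R =
   (`|c| ^- n)%:E * \int[lebesgue_rV n]_x f x)%E.
Proof.
move=> c0; elim: n a f => [|n IHn] a f mf f0.
  rewrite expr0 invr1 mul1e; apply: eq_integral => x _; congr f.
  by apply/rowP => -[].
have mcons x : measurable_fun setT (fun v => rV_cons (x, v) : 'rV[R]_n.+1).
  apply: measurableT_comp; first exact: measurable_rV_cons.
  exact: measurable_pair1.
rewrite ge0_integral_rVS//; last first.
  by apply: measurableT_comp => //; exact: measurable_rV_affine.
rewrite [in RHS]ge0_integral_rVS//.
pose F x := (\int[lebesgue_rV n]_v f (rV_cons (x, v)))%E.
have mF : measurable_fun (setT : set (measurableTypeR R)) F.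
  apply: (@measurable_fun_fubini_tonelli_F _ _ _ _ _ (lebesgue_rV n)
     (fun z => f (rV_cons z))) => //.
  by apply: measurableT_comp => //; exact: measurable_rV_cons.
have F0 x : (0 <= F x)%E by apply: integral_ge0.
(* The tail of the vector is handled by the induction hypothesis with the tail of [a], the first
   coordinate by [ge0_integral_affine]. *)
transitivity (\int[mu]_x ((`|c| ^- n)%:E * F (c * x + a ord0 ord0)%R))%E.
  apply: eq_integral => x _.
  rewrite -(IHn (col' ord0 a) (fun v => f (rV_cons (_, v))))//; last first.
    by apply: measurableT_comp => //; exact: mcons.
  apply: eq_integral => v _; congr f; apply/rowP => i; rewrite !mxE.
  by case: (unliftP ord0 i) => [j|] -> /=; rewrite ?unlift_none ?liftK ?mxE.
rewrite ge0_integralZl//; last first.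
- exact: (measurableT_comp mF (measurable_affine c (a ord0 ord0))).
rewrite (ge0_integral_affine _ c0 mF F0) muleA -EFinM; congr (_%:E * _)%E.
by rewrite exprS invfM mulrC.
Qed.

End rV.

(** * Measurability of continuous functions *)

Section meas_cont.
Context {R : realType} {n : nat}.
Local Notation E := 'rV[R]_n.

Lemma measurable_rV_forall (A : 'I_n -> set R) : (forall i, measurable (A i)) ->
  measurable [set x : E | forall i, A i (x ord0 i)].
Proof.
move=> mA.
rewrite (_ : [set _ | _] = \big[setI/setT]_(i < n) (rV_coor i @^-1` A i)).
  apply: bigsetI_measurable => i _; rewrite -[_ @^-1` _]setTI.
  exact: measurable_rV_coor.
rewrite -bigcap_seq; apply/seteqP; split => v /=; first by move=> Bv i _; exact: Bv.
by move=> h i; apply: h => /=; rewrite mem_index_enum.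
Qed.

(** The sigma-algebra is generated by coordinates, not by open sets. So [f] is obtained as the
    pointwise limit of [f \o r k], where [r k] rounds every coordinate down to a multiple of
    [1 / k.+1]; such a function takes one value on each of countably many cubes. *)
Lemma continuous_measurable_rV (f : E -> R) : continuous f ->
  measurable_fun setT f.
Proof.
move=> cf.
pose r (k : nat) (x : E) : E := \row_i ((Num.floor (k.+1%:R * x ord0 i))%:~R / k.+1%:R).
apply: (@measurable_fun_cvg _ _ R setT (fun k x => f (r k x))); last first.
  move=> x _; apply: (@continuous_cvg _ _ _ _ _ (fun k => r k x) f); first exact: cf.
  apply/cvg_ballP => e e0; near=> k; split => // i j.
  rewrite /ball /= !ord1 mxE.
  set t := x _ _.
  have k0 : 0 < k.+1%:R :> R by rewrite ltr0n.
  have /andP[h1 h2] := floor_itv (k.+1%:R * t).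
  have kk : k.+1%:R * (k.+1%:R)^-1 = 1 :> R by rewrite divff// gt_eqF.
  set fl := (Num.floor _)%:~R in h1 *.
  rewrite intrD in h2; rewrite -/fl in h2.
  have ki : 0 < (k.+1%:R)^-1 :> R by rewrite invr_gt0.
  have b1 : fl / k.+1%:R <= t by rewrite ler_pdivrMr// mulrC.
  have b2 : t < fl / k.+1%:R + k.+1%:R^-1.
    by rewrite -[X in _ + X]div1r -mulrDl ltr_pdivlMr// mulrC.
  have b3 : k.+1%:R^-1 < e.
    by near: k; exact: near_infty_natSinv_lt (PosNum e0).
  by rewrite ger0_norm ?subr_ge0// ltrBlDl (lt_trans b2)// ltrD2l.
move=> k _ B mB; rewrite setTI.
have -> : (fun x => f (r k x)) @^-1` B =
   \bigcup_(z : 'rV[int]_n) (if f (\row_i ((z ord0 i)%:~R / k.+1%:R)) \in B then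
      [set x : E | forall i, ((fun t : R => Num.floor (k.+1%:R * t)) @^-1` [set z ord0 i]) (x ord0 i)] else set0).
  apply/seteqP; split => x /=.
    move=> Bx; exists (\row_i Num.floor (k.+1%:R * x ord0 i)) => //.
    rewrite ifT /=; first by move=> i; rewrite mxE.
    rewrite inE; congr (B (f _)) : Bx.
    by apply/rowP => i; rewrite !mxE.
  move=> [z _]; case: ifPn => //; rewrite inE => + h; congr (B (f _)).
  by apply/rowP => i; rewrite !mxE h.
apply: countable_bigcupT_measurable => [|z].
  exact: countableP.
case: ifPn => // _; apply: (measurable_rV_forall (A := fun i => _)) => i.
rewrite (_ : _ @^-1` _ = `[((z ord0 i)%:~R / k.+1%:R), ((z ord0 i + 1)%:~R / k.+1%:R)[%classic)//.
have k0 : 0 < k.+1%:R :> R by rewrite ltr0n.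
apply/seteqP; split => t /=; rewrite in_itv/= ler_pdivrMr// ltr_pdivlMr// (mulrC t).
  by move=> <-; exact: floor_itv.
by move=> h; apply: floor_def.
Unshelve. all: by end_near. Qed.

End meas_cont.

(** * Integrals of products of one-variable functions *)

Section decay.
Lemma measurable_EFin d (T : measurableType d) (R : realType) (f : T -> R) :
  measurable_fun setT f -> measurable_fun setT (fun x => (f x)%:E).
Proof. by move=> mf; apply: (measurableT_comp (@EFin_measurable _ setT) mf). Qed.

Context {R : realType}.
Local Notation mu := (@lebesgue_measure R).

(** Serves twice: for the majorant in [jb_integrable] and for the Gaussian integral. *)
Lemma ge0_integral_rV_prod n (g : R -> R) (G : R) : measurable_fun setT g ->
  (forall t, 0 <= g t) -> (\int[mu]_t (g t)%:E)%E = G%:E ->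
  (\int[lebesgue_rV n]_x (\prod_(i < n) g (x ord0 i))%:E = (G ^+ n)%:E)%E.
Proof.
move=> mg g0 gG.
have mprod k : measurable_fun setT (fun x : 'rV[R]_k => \prod_(i < k) g (x ord0 i)).
  apply: measurable_prod => i _; apply: (measurableT_comp mg).
  exact: measurable_rV_coor.
elim: n => [|n IHn].
  rewrite expr0 (eq_integral (cst 1%:E)); last by move=> x _; rewrite big_ord0.
  by rewrite integral_cst// /= diracE mem_set// mule1.
rewrite ge0_integral_rVS; last 2 first.
- apply: measurable_EFin; exact: mprod.
- by move=> x; rewrite lee_fin prodr_ge0.
transitivity (\int[mu]_t ((g t)%:E * (G ^+ n)%:E))%E.
  apply: eq_integral => t _.
  rewrite -IHn -ge0_integralZl//; last 3 first.
  - apply: measurable_EFin; exact: mprod.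
  - by move=> x _; rewrite lee_fin prodr_ge0.
  - by rewrite lee_fin.
  apply: eq_integral => v _; rewrite -EFinM big_ord_recl; congr (_ %:E).
  rewrite rV_consE0; congr (_ * _); apply: eq_bigr => i _.
  by rewrite rV_consES.
have G0 : 0 <= G by rewrite -lee_fin -gG integral_ge0// => t _; rewrite lee_fin.
rewrite ge0_integralZr//.
- by rewrite gG -EFinM exprS.
- exact: measurable_EFin.
- by move=> t _; rewrite lee_fin.
- by rewrite lee_fin exprn_ge0.
Qed.

Lemma integral_oneDsqrV : (\int[mu]_t (1 + t ^+ 2)^-1%:E = pi%:E)%E.
Proof.
have cont : continuous (fun t : R => (1 + t ^+ 2)^-1).
  exact: continuous_oneDsqrV.
rewrite ge0_symfun_integralT//.
- rewrite (_ : [set x | _] = `[0, +oo[%classic); last first.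
    by apply/seteqP; split => x/=; rewrite in_itv/= andbT.
  by rewrite integral0y_oneDsqr -EFinM mulrCA divff ?mulr1// pnatr_eq0.
- by move=> x; rewrite invr_ge0 addr_ge0// sqr_ge0.
- by move=> x /=; rewrite sqrrN.
Qed.

Lemma integral_gauss_half :
  (\int[mu]_t (expR (- (t ^+ 2 / 2)))%:E = (Num.sqrt (2 * pi))%:E)%E.
Proof.
have s0 : 0 < Num.sqrt (2 : R) by rewrite sqrtr_gt0.
have := @ge0_integral_affine R (Num.sqrt 2)^-1 0 (fun t => (gauss_fun t)%:E).
have mg : measurable_fun setT (fun t : R => (gauss_fun t)%:E).
  by apply: measurable_EFin; exact: measurable_gauss_fun.
have g0 (t : R) : (0 <= (gauss_fun t)%:E)%E by rewrite lee_fin gauss_fun_ge0.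
rewrite gt_eqF ?invr_gt0// => /(_ isT mg g0).
rewrite integralT_gauss -EFinM ger0_norm ?invr_ge0// invrK => h.
rewrite sqrtrM// -h; apply: eq_integral => x _; congr (_ %:E).
by rewrite addr0 /gauss_fun exprMn exprVn sqr_sqrtr// mulrC.
Qed.
End decay.

(** * Euclidean norm and polynomial weights *)

Section enorm.
Context {R : realType} {n : nat}.
Local Notation E := 'rV[R]_n.
Implicit Types x y : E.

Lemma dotprodC x y : dotprod x y = dotprod y x.
Proof. by apply: eq_bigr => i _; rewrite mulrC. Qed.

Lemma dotprodDl x y z : dotprod (x + y) z = dotprod x z + dotprod y z.
Proof. by rewrite -big_split; apply: eq_bigr => i _; rewrite mxE mulrDl. Qed.

Lemma dotprodZl (c : R) x y : dotprod (c *: x) y = c * dotprod x y.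
Proof. by rewrite mulr_sumr; apply: eq_bigr => i _; rewrite mxE mulrA. Qed.

Lemma dotprodDr x y z : dotprod x (y + z) = dotprod x y + dotprod x z.
Proof. by rewrite dotprodC dotprodDl !(dotprodC x). Qed.

Lemma dotprodZr (c : R) x y : dotprod x (c *: y) = c * dotprod x y.
Proof. by rewrite dotprodC dotprodZl dotprodC. Qed.

Lemma dotprodNl x y : dotprod (- x) y = - dotprod x y.
Proof. by rewrite -scaleN1r dotprodZl mulN1r. Qed.

Lemma dotprodNr x y : dotprod x (- y) = - dotprod x y.
Proof. by rewrite -scaleN1r dotprodZr mulN1r. Qed.

Lemma dotprod0l x : dotprod 0 x = 0.
Proof. by rewrite -(scale0r 0) dotprodZl mul0r. Qed.

Lemma dotprod0r x : dotprod x 0 = 0.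
Proof. by rewrite dotprodC dotprod0l. Qed.

Lemma dotprod_ge0 x : 0 <= dotprod x x.
Proof. by apply: sumr_ge0 => i _; rewrite -expr2 sqr_ge0. Qed.

Lemma dotprod_delta x i : dotprod x (delta_mx ord0 i) = x ord0 i.
Proof.
rewrite /dotprod (bigD1 i)//= mxE !eqxx mulr1 big1 ?addr0// => j ji.
by rewrite mxE eqxx (negbTE ji) mulr0.
Qed.

Lemma enorm_ge0 x : 0 <= enorm x. Proof. exact: sqrtr_ge0. Qed.
Hint Resolve enorm_ge0 : core.

Lemma sqr_enorm x : enorm x ^+ 2 = dotprod x x.
Proof. by rewrite sqr_sqrtr// dotprod_ge0. Qed.

Lemma enormZ (c : R) x : enorm (c *: x) = `|c| * enorm x.
Proof.
by rewrite /enorm dotprodZl dotprodZr mulrA -expr2 sqrtrM ?sqr_ge0// sqrtr_sqr.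
Qed.

Lemma enormN x : enorm (- x) = enorm x.
Proof. by rewrite -scaleN1r enormZ normrN1 mul1r. Qed.

Lemma enorm0 : enorm (0 : E) = 0.
Proof. by rewrite /enorm dotprod0l sqrtr0. Qed.

Lemma sqr_coord_le x i : x ord0 i ^+ 2 <= dotprod x x.
Proof.
rewrite /dotprod (bigD1 i)//= -expr2 lerDl sumr_ge0// => j _.
by rewrite -expr2 sqr_ge0.
Qed.

Lemma coord_le_enorm x i : `|x ord0 i| <= enorm x.
Proof. by rewrite -sqrtr_sqr ler_wsqrtr// sqr_coord_le. Qed.

Lemma enorm_eq0 x : enorm x = 0 -> x = 0.
Proof.
move=> x0; apply/rowP => i; rewrite mxE; apply/eqP.
by rewrite -normr_le0 -x0 coord_le_enorm.
Qed.

Lemma dotprod_le x y : `|dotprod x y| <= enorm x * enorm y.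
Proof.
suff H (z w : E) : dotprod z w <= enorm z * enorm w.
  by rewrite ler_norml lerNl -dotprodNl -(enormN x) H enormN H.
have [/enorm_eq0->|z0] := eqVneq (enorm z) 0; first by rewrite dotprod0l enorm0 mul0r.
have [/enorm_eq0->|w0] := eqVneq (enorm w) 0; first by rewrite dotprod0r enorm0 mulr0.
have zp : 0 < enorm z by rewrite lt_neqAle eq_sym z0 /=.
have wp : 0 < enorm w by rewrite lt_neqAle eq_sym w0 /=.
(* With [a], [b] the two norms and [d] the product, the square of this vector is
   [2 * (a * b) * (a * b - d)]; dividing by [a * b > 0] gives Cauchy-Schwarz. *)
have := dotprod_ge0 (enorm w *: z - enorm z *: w).
rewrite !(dotprodDl, dotprodDr, dotprodNl, dotprodNr, dotprodZl, dotprodZr).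
rewrite -!sqr_enorm (dotprodC w).
set a := enorm z in zp *; set b := enorm w in wp *; set d := dotprod z w.
rewrite [X in 0 <= X](_ : _ = 2 * (a * b) * (a * b - d)); last by ring.
by rewrite pmulr_rge0 ?mulr_gt0// subr_ge0.
Qed.

Lemma enormD x y : enorm (x + y) <= enorm x + enorm y.
Proof.
rewrite -(ler_pXn2r (n := 2))// ?nnegrE ?addr_ge0// sqr_enorm.
rewrite dotprodDl !dotprodDr (dotprodC y x) -!sqr_enorm sqrrD.
have := le_trans (ler_norm _) (dotprod_le x y); lra.
Qed.

Lemma enorm_le_norm x : enorm x <= n%:R * `|x|.
Proof.
suff: enorm x <= \sum_(i < n) `|x ord0 i|.
  move=> /le_trans; apply; rewrite -[n in n%:R]card_ord -sumr_const mulr_suml.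
  by apply: ler_sum => i _; rewrite mul1r [leRHS]mx_normrE (le_bigmax _ (fun i : 'I_1 * 'I_n => `|x i.1 i.2|) (ord0, i)).
rewrite -(ler_pXn2r (n := 2))// ?nnegrE ?sumr_ge0// sqr_enorm /dotprod.
rewrite expr2 mulr_suml ler_sum// => i _.
apply: (le_trans (ler_norm _)); rewrite normrM ler_wpM2l//.
by rewrite (bigD1 i)//= lerDl sumr_ge0.
Qed.

Lemma norm_le_enorm x : `|x| <= enorm x.
Proof.
rewrite [leLHS]mx_normrE; apply/bigmax_leP; split => // -[i j] _ /=.
by rewrite ord1 coord_le_enorm.
Qed.

Lemma enorm_continuous : continuous (@enorm R n).
Proof.
have cd : continuous (fun x : E => dotprod x x).
  move=> x; apply: (continuous_big (add_continuous (s := R))) => i _ y.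
  by apply: (@continuousM _ E (fun x : E => x ord0 i) (fun x : E => x ord0 i)); exact: coord_continuous.
move=> x; apply: (continuous_comp (f := fun x => dotprod x x)); first exact: cd.
exact: sqrt_continuous.
Qed.

Lemma measurable_enorm : measurable_fun setT (@enorm R n).
Proof. apply: continuous_measurable_rV; exact: enorm_continuous. Qed.

(** The Japanese bracket in a form that is submultiplicative under addition ([jbD]): a translation
    by [a] costs only the factor [jb a]. *)
Definition jb x : R := 1 + enorm x.

Lemma jb_ge1 x : 1 <= jb x. Proof. by rewrite lerDl. Qed.
Lemma jb_gt0 x : 0 < jb x. Proof. by rewrite (lt_le_trans ltr01)// jb_ge1. Qed.

Lemma jbD x y : jb (x + y) <= jb x * jb y.
Proof.
rewrite /jb; have := enormD x y; have := enorm_ge0 x; have := enorm_ge0 y.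
set a := enorm x; set b := enorm y; set c := enorm (x + y); nra.
Qed.

Lemma jbV_continuous N : continuous (fun x => (jb x) ^- N).
Proof.
move=> x; apply: (@continuousV _ _ (fun x => jb x ^+ N)).
  by rewrite gt_eqF// exprn_gt0// jb_gt0.
apply: (continuous_comp (f := jb) (g := fun t : R => t ^+ N)).
  by apply: continuousD; [exact: cst_continuous|exact: enorm_continuous].
exact: exprn_continuous.
Qed.

(** The square of [jb x] dominates [1 + t ^+ 2] for each coordinate [t] of [x]. Hence
    [jb x ^- (2 * n)] lies below a product of [n] one-variable functions, each of integral [pi]. *)
Lemma jb_integrable N : (2 * n <= N)%N ->
  (lebesgue_rV n).-integrable setT (fun x => ((jb x) ^- N)%:E).
Proof.
move=> nN.
have mj : measurable_fun setT (fun x => (jb x) ^- N).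
  apply: continuous_measurable_rV; exact: jbV_continuous.
have mg : measurable_fun setT (fun t : R => (1 + t ^+ 2)^-1).
  apply: continuous_measurable_fun; exact: continuous_oneDsqrV.
apply/integrableP; split; first exact: measurable_EFin.
apply: (@le_lt_trans _ _ (pi ^+ n)%:E); last exact: ltry.
rewrite -(@ge0_integral_rV_prod _ n _ pi mg)//; last 2 first.
- by move=> t; rewrite invr_ge0 addr_ge0// sqr_ge0.
- exact: integral_oneDsqrV.
apply: ge0_le_integral => //.
- by apply: measurableT_comp => //; exact: measurable_EFin.
- apply: measurable_EFin; apply: measurable_prod => i _.
  by apply: (measurableT_comp mg); exact: measurable_rV_coor.
move=> x _ /=; rewrite lee_fin ger0_norm; last by rewrite invr_ge0 exprn_ge0// ltW// jb_gt0.
rewrite prodfV lef_pV2 ?posrE ?exprn_gt0 ?jb_gt0 ?prodr_gt0//; last first.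
  by move=> i _; rewrite ltr_pwDl// sqr_ge0.
apply: (@le_trans _ _ (jb x ^+ (2 * n))); last by rewrite ler_weXn2l// jb_ge1.
rewrite exprM -[X in _ <= _ ^+ X]card_ord -prodr_const; apply: ler_prod => i _.
rewrite addr_ge0 ?sqr_ge0//= /jb sqrrD expr1n mul1r sqr_enorm.
have := sqr_coord_le x i; have := enorm_ge0 x; lra.
Qed.

End enorm.
#[global] Hint Extern 0 (is_true (0 <= enorm _)) => solve[apply: enorm_ge0] : core.
#[global] Hint Extern 0 (is_true (0 < jb _)) => solve[apply: jb_gt0] : core.
#[global] Hint Extern 0 (is_true (1 <= jb _)) => solve[apply: jb_ge1] : core.

(** * Complex modulus and complex-valued integrals *)

Section modulus.
Context {R : realType}.
Local Notation C := R[i].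
Implicit Types z w : C.

Lemma modulusE z : modulus z = Num.sqrt (complex.Re z ^+ 2 + complex.Im z ^+ 2).
Proof. by case: z. Qed.

Lemma modulus_ge0 z : 0 <= modulus z.
Proof. by rewrite modulusE sqrtr_ge0. Qed.

Lemma modulus0 : modulus (0 : C) = 0. Proof. exact: Normc.normc0. Qed.
Lemma modulus1 : modulus (1 : C) = 1. Proof. exact: Normc.normc1. Qed.
Lemma modulusM z w : modulus (z * w) = modulus z * modulus w.
Proof. exact: Normc.normcM. Qed.
Lemma modulusN z : modulus (- z) = modulus z. Proof. exact: normcN. Qed.
Lemma modulusD z w : modulus (z + w) <= modulus z + modulus w.
Proof. exact: le_normcD. Qed.
Lemma modulusB z w : modulus (z - w) <= modulus z + modulus w.
Proof. by rewrite -(modulusN w) modulusD. Qed.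
Lemma modulus_sum I (r : seq I) (P : pred I) (F : I -> C) :
  modulus (\sum_(i <- r | P i) F i) <= \sum_(i <- r | P i) modulus (F i).
Proof.
elim/big_ind2 : _ => //; first by rewrite modulus0.
by move=> x1 x2 y1 y2 h1 h2; rewrite (le_trans (modulusD _ _))// lerD.
Qed.

Lemma modulus_eq0 z : modulus z = 0 -> z = 0.
Proof. exact: Normc.eq0_normc. Qed.

Lemma modulus_gt0 z : z != 0 -> 0 < modulus z.
Proof.
move=> z0; rewrite lt_neqAle modulus_ge0 andbT; apply/eqP => h.
by move: z0; rewrite (modulus_eq0 (esym h)) eqxx.
Qed.

Lemma modulus_ofreal (r : R) : modulus r%:C%C = `|r|.
Proof. by rewrite modulusE /= expr0n addr0 sqrtr_sqr. Qed.

Lemma sqr_modulus z : modulus z ^+ 2 = complex.Re z ^+ 2 + complex.Im z ^+ 2.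
Proof. by rewrite modulusE sqr_sqrtr// addr_ge0// sqr_ge0. Qed.

Lemma Re_le_modulus z : `|complex.Re z| <= modulus z.
Proof. by rewrite modulusE -sqrtr_sqr ler_wsqrtr// lerDl sqr_ge0. Qed.

Lemma Im_le_modulus z : `|complex.Im z| <= modulus z.
Proof. by rewrite modulusE -sqrtr_sqr ler_wsqrtr// lerDr sqr_ge0. Qed.

Lemma modulus_le z : modulus z <= `|complex.Re z| + `|complex.Im z|.
Proof.
rewrite -(ler_pXn2r (n := 2))// ?nnegrE ?modulus_ge0 ?addr_ge0// sqr_modulus.
rewrite sqrrD !real_normK ?num_real//.
have : 0 <= `|complex.Re z| * `|complex.Im z| by rewrite mulr_ge0.
lra.
Qed.

Lemma ReM z w : complex.Re (z * w) =
  complex.Re z * complex.Re w - complex.Im z * complex.Im w.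
Proof. by case: z; case: w. Qed.

Lemma ImM z w : complex.Im (z * w) =
  complex.Re z * complex.Im w + complex.Im z * complex.Re w.
Proof. by case: z => a b; case: w => c d /=. Qed.

Lemma ReD z w : complex.Re (z + w) = complex.Re z + complex.Re w.
Proof. by case: z; case: w. Qed.

Lemma ImD z w : complex.Im (z + w) = complex.Im z + complex.Im w.
Proof. by case: z; case: w. Qed.

Lemma ReN z : complex.Re (- z) = - complex.Re z. Proof. by case: z. Qed.
Lemma ImN z : complex.Im (- z) = - complex.Im z. Proof. by case: z. Qed.

Lemma complex_eq z w : complex.Re z = complex.Re w ->
  complex.Im z = complex.Im w -> z = w.
Proof. by case: z => a b; case: w => c d /= -> ->. Qed.

Lemma modulus_cis (t : R) : modulus (cis t) = 1.
Proof. by rewrite modulusE /= cos2Dsin2 sqrtr1. Qed.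

Lemma cisD (s t : R) : cis (s + t) = cis s * cis t.
Proof. by apply: complex_eq; rewrite ?ReM ?ImM /= ?cosD// sinD addrC. Qed.

Lemma cis0 : cis (0 : R) = 1.
Proof. by apply: complex_eq; rewrite /= ?cos0 ?sin0. Qed.

Lemma modulus_conj z : modulus (z^*)%C = modulus z.
Proof. by case: z => a b; rewrite !modulusE /= sqrrN. Qed.

End modulus.
#[global] Hint Extern 0 (is_true (0 <= modulus _)) => solve[apply: modulus_ge0] : core.

Section cint.
Context {R : realType} {d : measure_display} {T : measurableType d}.
Variable mu : {measure set T -> \bar R}.
Local Notation C := R[i].
Implicit Types f g : T -> C.

(** These are the notions [cmeasurable], [cintegrable] and [cintegral] over an arbitrary measure
    space, because Fubini's theorem needs products. Over [lebesgue_rV] they are convertible with the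
    originals. *)
Definition cmeas f := measurable_fun setT (fun x => complex.Re (f x)) /\
  measurable_fun setT (fun x => complex.Im (f x)).
Definition cintgr f := mu.-integrable setT (fun x => (complex.Re (f x))%:E) /\
  mu.-integrable setT (fun x => (complex.Im (f x))%:E).
Definition cint f : C :=
  ((\int[mu]_x complex.Re (f x)) +i* (\int[mu]_x complex.Im (f x)))%C.

Lemma integrableRZ (r : R) (h : T -> R) : mu.-integrable setT (fun x => (h x)%:E) ->
  mu.-integrable setT (fun x => (r * h x)%:E).
Proof. by move=> ih; under eq_fun do rewrite EFinM; exact: integrableZl. Qed.

Lemma cmeas_cst (c : C) : cmeas (fun=> c).
Proof. by split; exact: measurable_cst. Qed.

Lemma cmeasD f g : cmeas f -> cmeas g -> cmeas (fun x => f x + g x).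
Proof.
move=> [f1 f2] [g1 g2]; split.
  by under eq_fun do rewrite ReD; exact: measurable_funD.
by under eq_fun do rewrite ImD; exact: measurable_funD.
Qed.

Lemma cmeasN f : cmeas f -> cmeas (fun x => - f x).
Proof.
move=> [f1 f2]; split.
  by under eq_fun do rewrite ReN; exact: measurableT_comp.
by under eq_fun do rewrite ImN; exact: measurableT_comp.
Qed.

Lemma cmeasM f g : cmeas f -> cmeas g -> cmeas (fun x => f x * g x).
Proof.
move=> [f1 f2] [g1 g2]; split.
  by under eq_fun do rewrite ReM; apply: measurable_funB; exact: measurable_funM.
by under eq_fun do rewrite ImM; apply: measurable_funD; exact: measurable_funM.
Qed.

Lemma cmeas_real (h : T -> R) : measurable_fun setT h -> cmeas (fun x => (h x)%:C%C).
Proof. by move=> mh; split => //=; exact: measurable_cst. Qed.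

Lemma cmeas_conj f : cmeas f -> cmeas (fun x => (f x)^*%C).
Proof.
move=> [f1 f2]; split.
  by rewrite (_ : (fun _ => _) = (fun x => complex.Re (f x)))//; apply/funext => x; case: (f x).
rewrite (_ : (fun _ => _) = (fun x => - complex.Im (f x))); first exact: measurableT_comp.
by apply/funext => x; case: (f x).
Qed.

Lemma cmeas_cis (h : T -> R) : measurable_fun setT h -> cmeas (fun x => cis (h x)).
Proof.
move=> mh; split => /=.
  by apply: (measurableT_comp (f := cos)) => //; apply: continuous_measurable_fun; exact: continuous_cos.
by apply: (measurableT_comp (f := sin)) => //; apply: continuous_measurable_fun; exact: continuous_sin.
Qed.

Lemma cmeas_modulus f : cmeas f -> measurable_fun setT (fun x => modulus (f x)).
Proof.
move=> [f1 f2]; under eq_fun do rewrite modulusE.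
have ms : measurable_fun setT (@Num.sqrt R).
  by apply: continuous_measurable_fun; exact: sqrt_continuous.
apply: (measurableT_comp ms).
by apply: measurable_funD; exact: measurable_funX.
Qed.

Lemma cintgr_le f (g : T -> R) : cmeas f -> mu.-integrable setT (fun x => (g x)%:E) ->
  (forall x, modulus (f x) <= g x) -> cintgr f.
Proof.
move=> [f1 f2] ig fg; split.
- apply: (le_integrable measurableT _ _ ig); first exact: measurable_EFin.
  move=> x _ /=; rewrite lee_fin (le_trans (Re_le_modulus _))//.
  by rewrite (le_trans (fg x))// ler_norm.
- apply: (le_integrable measurableT _ _ ig); first exact: measurable_EFin.
  move=> x _ /=; rewrite lee_fin (le_trans (Im_le_modulus _))//.
  by rewrite (le_trans (fg x))// ler_norm.
Qed.

Lemma cintgr_cmeas f : cintgr f -> cmeas f.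
Proof.
by move=> [/measurable_int f1 /measurable_int f2]; split; exact/measurable_EFinP.
Qed.

Lemma cintgr_modulus f : cintgr f -> mu.-integrable setT (fun x => (modulus (f x))%:E).
Proof.
move=> If; have mf := cintgr_cmeas If; case: If => f1 f2.
have := integrableD measurableT (integrable_abse f1) (integrable_abse f2).
apply: le_integrable => //; first by apply: measurable_EFin; exact: cmeas_modulus.
move=> x _ /=; rewrite lee_fin; apply: le_trans (ler_norm _); rewrite ger0_norm ?modulus_ge0//.
exact: modulus_le.
Qed.

Lemma cintgrD f g : cintgr f -> cintgr g -> cintgr (fun x => f x + g x).
Proof.
move=> [f1 f2] [g1 g2]; split.
  by under eq_fun do rewrite ReD EFinD; exact: integrableD.
by under eq_fun do rewrite ImD EFinD; exact: integrableD.
Qed.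

Lemma cintgrZ (c : C) f : cintgr f -> cintgr (fun x => c * f x).
Proof.
move=> If; apply: (@cintgr_le _ (fun x => modulus c * modulus (f x))).
- by apply: cmeasM; [exact: cmeas_cst|exact: cintgr_cmeas].
- by apply: integrableRZ; exact: cintgr_modulus.
- by move=> x; rewrite modulusM.
Qed.

Lemma cintD f g : cintgr f -> cintgr g ->
  cint (fun x => f x + g x) = cint f + cint g.
Proof.
move=> [f1 f2] [g1 g2]; apply: complex_eq; rewrite ?ReD ?ImD /=.
  rewrite -RintegralD//; by under eq_Rintegral do rewrite ReD.
by rewrite -RintegralD//; under eq_Rintegral do rewrite ImD.
Qed.

Lemma cintZ (c : C) f : cintgr f -> cint (fun x => c * f x) = c * cint f.
Proof.
move=> [f1 f2]; apply: complex_eq; rewrite ?ReM ?ImM /=.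
  rewrite -!RintegralZl// -RintegralB//; try exact: integrableRZ.
  by under eq_Rintegral do rewrite ReM.
rewrite -!RintegralZl// -RintegralD//; try exact: integrableRZ.
by under eq_Rintegral do rewrite ImM.
Qed.

Lemma cintN f : cintgr f -> cint (fun x => - f x) = - cint f.
Proof.
by move=> If; under eq_fun do rewrite -mulN1r; rewrite cintZ// mulN1r.
Qed.

Lemma cintgrN f : cintgr f -> cintgr (fun x => - f x).
Proof. by move=> If; under eq_fun do rewrite -mulN1r; exact: cintgrZ. Qed.

Lemma cintB f g : cintgr f -> cintgr g ->
  cint (fun x => f x - g x) = cint f - cint g.
Proof.
by move=> If Ig; rewrite cintD ?cintN//; exact: cintgrN.
Qed.

Lemma cint0 : cint (fun=> 0) = 0.
Proof.
by apply: complex_eq => /=; rewrite Rintegral_cst// mul0r.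
Qed.

(** Multiplication by the conjugate of the integral makes the integral real and nonnegative, so
    comparing real parts under the integral is enough. *)
Lemma modulus_cint_le f : cintgr f -> modulus (cint f) <= \int[mu]_x modulus (f x).
Proof.
move=> If; have Im := cintgr_modulus If.
set z := cint f; have [->|z0] := eqVneq z 0; first by rewrite modulus0 Rintegral_ge0.
have zp := modulus_gt0 z0.
rewrite -(ler_pM2l zp) -expr2 sqr_modulus.
have -> : complex.Re z ^+ 2 + complex.Im z ^+ 2 = complex.Re (z^*%C * cint f).
  by rewrite ReM -/z; case: (z) => a b /=; ring.
rewrite -cintZ// -RintegralZl//.
apply: le_Rintegral => //.
- case: (cintgrZ (z^*)%C If) => Ir _. exact: Ir.
- exact: (integrableRZ (modulus z) Im).
move=> x _; apply: (le_trans (ler_norm _)); apply: (le_trans (Re_le_modulus _)).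
by rewrite modulusM modulus_conj.
Qed.

Lemma eq_cint f g : f =1 g -> cint f = cint g.
Proof. by move=> /funext ->. Qed.

End cint.

(** * Fubini's theorem under domination by a product *)

Section Rfubini.
Context {R : realType} {d1 d2 : measure_display} {T1 : measurableType d1}
  {T2 : measurableType d2}.
Variable m1 : {sigma_finite_measure set T1 -> \bar R}.
Variable m2 : {sigma_finite_measure set T2 -> \bar R}.

Section real.
Variables (F : T1 * T2 -> R) (g : T1 -> R) (h : T2 -> R).
Hypotheses (mF : measurable_fun setT F)
  (ig : m1.-integrable setT (fun x => (g x)%:E))
  (ih : m2.-integrable setT (fun x => (h x)%:E))
  (Fgh : forall x y, `|F (x, y)| <= g x * h y).

(** Domination by [g x * h y] stands in for joint integrability: it also makes every section
    integrable, not only almost every one, so real-valued inner integrals are meaningful at each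
    point. *)
Lemma product_dominated_integrable :
  (m1 \x m2)%E.-integrable setT (fun z => (F z)%:E).
Proof.
have mFE := measurable_EFin mF.
apply/(integrable12ltyP _ _ mFE).
have mh : measurable_fun setT (fun y => `|h y|).
  by apply: measurableT_comp => //; apply/measurable_EFinP; exact: measurable_int ih.
have mg : measurable_fun setT (fun y => `|g y|).
  by apply: measurableT_comp => //; apply/measurable_EFinP; exact: measurable_int ig.
have /integrableP[_ ig2] := ig; have /integrableP[_ ih2] := ih.
have ihf : (\int[m2]_y `|h y|%:E)%E \is a fin_num.
  by rewrite ge0_fin_numE//; apply: integral_ge0.
apply: (@le_lt_trans _ _ (\int[m1]_x (`|g x|%:E * \int[m2]_y `|h y|%:E))%E).
  apply: ge0_le_integral => //.
  - by move=> x _; apply: integral_ge0 => y _.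
  - apply: (measurable_fun_fubini_tonelli_F (m2 := m2) (fun z => `|(F z)%:E|%E)) => //.
    exact: measurableT_comp.
  - by apply: emeasurable_funM => //; exact: measurable_EFin.
  move=> x _; rewrite -ge0_integralZl//; last exact: measurable_EFin.
  apply: ge0_le_integral => //.
  - apply: measurableT_comp => //.
    by apply: (measurableT_comp mFE); exact: measurable_pair1.
  - by apply: measurable_funeM; exact: measurable_EFin.
  - move=> y _; rewrite /= -EFinM lee_fin (le_trans (Fgh x y))//.
    by rewrite -normrM ler_norm.
rewrite ge0_integralZr//; last 2 first.
- exact: measurable_EFin.
- by apply: integral_ge0.
by rewrite lte_mul_pinfty// ?ge0_fin_numE//; apply: integral_ge0.
Qed.

Lemma section1_integrable x : m2.-integrable setT (fun y => (F (x, y))%:E).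
Proof.
apply: (le_integrable measurableT _ _ (integrableRZ (g x) ih)).
  by apply: measurable_EFin; apply: (measurableT_comp mF); exact: measurable_pair1.
by move=> y _ /=; rewrite lee_fin (le_trans (Fgh x y))// ler_norm.
Qed.

Lemma section2_integrable y : m1.-integrable setT (fun x => (F (x, y))%:E).
Proof.
apply: (le_integrable measurableT _ _ (integrableRZ (h y) ig)).
  by apply: measurable_EFin; apply: (measurableT_comp mF); exact: measurable_pair2.
by move=> x _ /=; rewrite lee_fin (le_trans (Fgh x y))// mulrC ler_norm.
Qed.

Lemma Rfubini : \int[m1]_x \int[m2]_y F (x, y) = \int[m2]_y \int[m1]_x F (x, y).
Proof.
rewrite /Rintegral; transitivity (fine (\int[m1]_x \int[m2]_y (F (x, y))%:E)%E).
  congr fine; apply: eq_integral => x _; rewrite fineK//.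
  by apply: integrable_fin_num => //; exact: section1_integrable.
rewrite (Fubini product_dominated_integrable); congr fine; apply: eq_integral => y _.
by rewrite fineK//; apply: integrable_fin_num => //; exact: section2_integrable.
Qed.

Lemma Rfubini_integrable1 :
  m1.-integrable setT (fun x => (\int[m2]_y F (x, y))%:E).
Proof.
have := integrable_fubini_F product_dominated_integrable.
apply: eq_integrable => // x _; rewrite /Rintegral fineK//.
by apply: integrable_fin_num => //; exact: section1_integrable.
Qed.

End real.

Section cplx.
Variables (F : T1 * T2 -> R[i]) (g : T1 -> R) (h : T2 -> R).
Hypotheses (mF : cmeas F)
  (ig : m1.-integrable setT (fun x => (g x)%:E))
  (ih : m2.-integrable setT (fun x => (h x)%:E))
  (Fgh : forall x y, modulus (F (x, y)) <= g x * h y).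

Let FR x y : `|complex.Re (F (x, y))| <= g x * h y.
Proof. exact: le_trans (Re_le_modulus _) (Fgh x y). Qed.
Let FI x y : `|complex.Im (F (x, y))| <= g x * h y.
Proof. exact: le_trans (Im_le_modulus _) (Fgh x y). Qed.

Lemma cfubini : cint m1 (fun x => cint m2 (fun y => F (x, y))) =
  cint m2 (fun y => cint m1 (fun x => F (x, y))).
Proof.
by case: mF => m_1 m_2; apply: complex_eq => /=;
  [exact: (@Rfubini (fun z => complex.Re (F z)) g h)|
   exact: (@Rfubini (fun z => complex.Im (F z)) g h)].
Qed.

Lemma cfubini_cintgr1 : cintgr m1 (fun x => cint m2 (fun y => F (x, y))).
Proof.
by case: mF => m_1 m_2; split => /=;
  [exact: (@Rfubini_integrable1 (fun z => complex.Re (F z)) g h)|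
   exact: (@Rfubini_integrable1 (fun z => complex.Im (F z)) g h)].
Qed.
End cplx.
End Rfubini.

(** * Affine substitutions in complex integrals *)

Section affine_cint.
Context {R : realType} {n : nat}.
Local Notation E := 'rV[R]_n.
Local Notation leb := (lebesgue_rV n).

Lemma integrable_rV_affine (c : R) (a : E) (f : E -> R) :
  c != 0 -> leb.-integrable setT (fun x => (f x)%:E) ->
  leb.-integrable setT (fun x => (f (c *: x + a))%:E).
Proof.
move=> c0 /integrableP[mf fi]; apply/integrableP; split.
  by apply: (measurableT_comp mf); exact: measurable_rV_affine.
rewrite (@ge0_integral_rV_affine _ _ c a (fun x => `|(f x)%:E|%E))//; last first.
  exact: measurableT_comp.
by rewrite lte_mul_pinfty// lee_fin invr_ge0 exprn_ge0.
Qed.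

Lemma Rintegral_rV_affine (c : R) (a : E) (f : E -> R) :
  c != 0 -> leb.-integrable setT (fun x => (f x)%:E) ->
  \int[leb]_x f (c *: x + a) = `|c| ^- n * \int[leb]_x f x.
Proof.
move=> c0 fi; have /integrableP[mf _] := fi.
rewrite /Rintegral integralE [in RHS]integralE.
have := integrable_pos_fin_num measurableT fi.
have := integrable_neg_fin_num measurableT fi.
rewrite (_ : (fun x => (f (c *: x + a))%:E)^\+%E =
  (fun x => (EFin \o f)^\+%E (c *: x + a))); last by apply/funext => x; rewrite !unlock.
rewrite (_ : (fun x => (f (c *: x + a))%:E)^\-%E =
  (fun x => (EFin \o f)^\-%E (c *: x + a))); last by apply/funext => x; rewrite !unlock.
rewrite (ge0_integral_rV_affine a c0 (measurable_funepos mf)) ?(ge0_integral_rV_affine a c0 (measurable_funeneg mf))//.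
move=> h1 h2; rewrite -muleBr ?fin_num_adde_defr ?fineM//.
by rewrite fin_numB h1 h2.
Qed.

Lemma cintgr_affine (c : R) (a : E) (f : E -> R[i]) : c != 0 ->
  cintgr leb f -> cintgr leb (fun x => f (c *: x + a)).
Proof.
by move=> c0 [f1 f2]; split;
 [exact: (@integrable_rV_affine c a (fun x => complex.Re (f x)))|
  exact: (@integrable_rV_affine c a (fun x => complex.Im (f x)))].
Qed.

Lemma cint_affine (c : R) (a : E) (f : E -> R[i]) : c != 0 ->
  cintgr leb f ->
  cint leb (fun x => f (c *: x + a)) = (`|c| ^- n)%:C%C * cint leb f.
Proof.
move=> c0 [f1 f2]; apply: complex_eq; rewrite ?ReM ?ImM /= mul0r ?subr0 ?addr0.
  exact: (@Rintegral_rV_affine c a (fun x => complex.Re (f x))).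
exact: (@Rintegral_rV_affine c a (fun x => complex.Im (f x))).
Qed.

Lemma cint_shift (a : E) (f : E -> R[i]) : cintgr leb f ->
  cint leb (fun x => f (x + a)) = cint leb f.
Proof.
move=> fi; have := cint_affine a (oner_neq0 R) fi.
rewrite normr1 expr1n invr1 mul1r => <-.
by apply: eq_cint => x; rewrite scale1r.
Qed.

Lemma cint_opp (f : E -> R[i]) : cintgr leb f ->
  cint leb (fun x => f (- x)) = cint leb f.
Proof.
move=> fi; have N10 : -1 != 0 :> R by rewrite oppr_eq0 oner_neq0.
have := cint_affine 0 N10 fi; rewrite normrN1 expr1n invr1 mul1r => <-.
by apply: eq_cint => x; rewrite scaleN1r addr0.
Qed.

End affine_cint.

(** * Partial derivatives of complex-valued functions *)

Section calculus.
Context {R : realType} {n : nat}.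
Local Notation E := 'rV[R]_n.
Local Notation C := R[i].
Implicit Types (f g : E -> C) (x y : E) (i : 'I_n).

Definition cdiff f x :=
  differentiable (fun y => complex.Re (f y) : R^o) x /\
  differentiable (fun y => complex.Im (f y) : R^o) x.

Lemma cdiff_cst (c : C) x : cdiff (fun=> c) x.
Proof. by split; exact: differentiable_cst. Qed.

Lemma cdiffD f g x : cdiff f x -> cdiff g x -> cdiff (fun y => f y + g y) x.
Proof.
move=> [f1 f2] [g1 g2]; split.
  by under eq_fun do rewrite ReD; exact: differentiableD.
by under eq_fun do rewrite ImD; exact: differentiableD.
Qed.

Lemma cdiffM f g x : cdiff f x -> cdiff g x -> cdiff (fun y => f y * g y) x.
Proof.
move=> [f1 f2] [g1 g2]; split.
  by under eq_fun do rewrite ReM; apply: differentiableB; exact: differentiableM.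
by under eq_fun do rewrite ImM; apply: differentiableD; exact: differentiableM.
Qed.

Lemma pderivD i f g x : cdiff f x -> cdiff g x ->
  pderiv i (fun y => f y + g y) x = pderiv i f x + pderiv i g x.
Proof.
move=> [f1 f2] [g1 g2]; apply: complex_eq; rewrite ?ReD ?ImD /=.
  under eq_fun do rewrite ReD.
  by rewrite deriveD//; exact: diff_derivable.
under eq_fun do rewrite ImD.
by rewrite deriveD//; exact: diff_derivable.
Qed.

Lemma pderivM i f g x : cdiff f x -> cdiff g x ->
  pderiv i (fun y => f y * g y) x = pderiv i f x * g x + f x * pderiv i g x.
Proof.
have dM (h k : E -> R) : differentiable (h : E -> R^o) x ->
    differentiable (k : E -> R^o) x ->
    'D_(delta_mx ord0 i) (fun y => h y * k y : R^o) x =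
    h x * 'D_(delta_mx ord0 i) (k : E -> R^o) x +
    k x * 'D_(delta_mx ord0 i) (h : E -> R^o) x.
  by move=> dh dk; rewrite deriveM//; exact: diff_derivable.
move=> [f1 f2] [g1 g2]; apply: complex_eq; rewrite ?ReD ?ImD ?ReM ?ImM /=.
  under eq_fun do rewrite ReM.
  rewrite deriveB; last 2 first.
  - by apply: diff_derivable; exact: differentiableM.
  - by apply: diff_derivable; exact: differentiableM.
  by rewrite !dM//; ring.
under eq_fun do rewrite ImM.
rewrite deriveD; last 2 first.
- by apply: diff_derivable; exact: differentiableM.
- by apply: diff_derivable; exact: differentiableM.
by rewrite !dM//; ring.
Qed.

Lemma pderiv_cst i (c : C) x : pderiv i (fun=> c) x = 0.
Proof. by apply: complex_eq => /=; rewrite derive_cst. Qed.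

Lemma cdiffZ (c : C) f x : cdiff f x -> cdiff (fun y => c * f y) x.
Proof. by move=> df; apply: cdiffM => //; exact: cdiff_cst. Qed.

Lemma pderivZ i (c : C) f x : cdiff f x ->
  pderiv i (fun y => c * f y) x = c * pderiv i f x.
Proof.
by move=> df; rewrite pderivM ?pderiv_cst ?mul0r ?add0r//; exact: cdiff_cst.
Qed.

Lemma differentiable_affine (c : R) (a : E) x :
  differentiable (fun y : E => c *: y + a) x.
Proof.
apply: differentiableD; last exact: differentiable_cst.
by apply: differentiableZ; exact: ex_diff.
Qed.

Lemma diff_affine (c : R) (a v : E) x :
  'd (fun y : E => c *: y + a) x v = c *: v.
Proof.
rewrite -deriveE; last exact: differentiable_affine.
rewrite deriveD; last 2 first.
- by apply: derivableZ; exact: derivable_id.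
- exact: derivable_cst.
by rewrite deriveZ ?derive_id ?derive_cst ?addr0//; exact: derivable_id.
Qed.

Lemma cdiff_affine (c : R) (a : E) f x :
  cdiff f (c *: x + a) -> cdiff (fun y => f (c *: y + a)) x.
Proof.
move=> [f1 f2]; split.
- exact: (differentiable_comp (differentiable_affine c a x) f1).
- exact: (differentiable_comp (differentiable_affine c a x) f2).
Qed.

Lemma derive_affine (c : R) (a v : E) (h : E -> R^o) x :
  differentiable h (c *: x + a) ->
  'D_v (fun y => h (c *: y + a)) x = c * 'D_v h (c *: x + a).
Proof.
move=> dh; have da := differentiable_affine c a x.
rewrite deriveE; last exact: (differentiable_comp da dh).
rewrite (_ : (fun _ => _) = h \o (fun y => c *: y + a))// diff_comp//=.
by rewrite diff_affine linearZ deriveE.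
Qed.

Lemma pderiv_affine i (c : R) (a : E) f x : cdiff f (c *: x + a) ->
  pderiv i (fun y => f (c *: y + a)) x = c%:C%C * pderiv i f (c *: x + a).
Proof.
move=> [f1 f2]; apply: complex_eq; rewrite ?ReM ?ImM /= mul0r ?subr0 ?addr0.
  exact: (derive_affine _ f1).
exact: (derive_affine _ f2).
Qed.

Lemma cdiff_ofreal (h : E -> R) x : differentiable (h : E -> R^o) x ->
  cdiff (ofreal h) x.
Proof. by move=> dh; split => //=; exact: differentiable_cst. Qed.

Lemma pderiv_ofreal i (h : E -> R) x :
  pderiv i (ofreal h) x = ('D_(delta_mx ord0 i) (h : E -> R^o) x)%:C%C.
Proof. by apply: complex_eq => //=; rewrite derive_cst. Qed.

Lemma differentiable_comp1 (h : R -> R) (g : E -> R) x :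
  differentiable (g : E -> R^o) x -> derivable h (g x) 1 ->
  differentiable (h \o g : E -> R^o) x.
Proof.
move=> dg dh; apply: (differentiable_comp (V' := R^o) (W' := R^o) dg).
exact/derivable1_diffP.
Qed.

Lemma derive_comp1 (h : R -> R) (g : E -> R) v x :
  differentiable (g : E -> R^o) x -> derivable h (g x) 1 ->
  'D_v (h \o g : E -> R^o) x = derive1 h (g x) * 'D_v (g : E -> R^o) x.
Proof.
move=> dg dh; rewrite deriveE; last exact: differentiable_comp1.
have dh' : differentiable (h : R^o -> R^o) (g x) by exact/derivable1_diffP.
rewrite (@diff_comp _ _ R^o R^o g h x dg dh') /=.
by rewrite deriv1E// -deriveE// mulrC.
Qed.

End calculus.

(** * Smooth functions and weighted bounds on derivatives *)

Section smooth.
Context {R : realType} {n : nat}.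
Local Notation E := 'rV[R]_n.
Local Notation C := R[i].
Implicit Types (f g m : E -> C) (x y : E) (i : 'I_n) (w : E -> R).

Lemma pderivs_rcons (a : seq 'I_n) i f :
  pderivs (rcons a i) f = pderivs a (pderiv i f).
Proof. by rewrite /pderivs foldr_rcons. Qed.

Lemma smoothP f : smooth f <-> (forall x, cdiff f x) /\ forall i, smooth (pderiv i f).
Proof.
split=> [sf|[df si]].
  split => [x|i a x]; first exact: (sf [::] x).
  by have := sf (rcons a i) x; rewrite pderivs_rcons.
move=> a; case/lastP: a => [|a i] x; first exact: df.
by rewrite pderivs_rcons; exact: si.
Qed.

Lemma smooth_cdiff f x : smooth f -> cdiff f x.
Proof. by move=> /smoothP[]. Qed.

Lemma smooth_pderiv f i : smooth f -> smooth (pderiv i f).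
Proof. by move=> /smoothP[]. Qed.
Hint Resolve smooth_cdiff smooth_pderiv : core.

(** A coinduction principle: membership in a class of differentiable functions closed under partial
    derivatives replaces formulas for derivatives of all orders. *)
Lemma smooth_coind (P : (E -> C) -> Prop) :
  (forall f, P f -> (forall x, cdiff f x) /\ forall i, P (pderiv i f)) ->
  forall f, P f -> smooth f.
Proof.
move=> HP f Pf a; elim/last_ind: a f Pf => [|a i IH] f Pf x.
  exact: (HP f Pf).1.
by rewrite pderivs_rcons; apply: IH; exact: (HP f Pf).2.
Qed.

Lemma smooth_cst (c : C) : smooth (fun _ : E => c).
Proof.
apply: (@smooth_coind (fun f => exists c : C, f = fun=> c)); last by exists c.
move=> f [{}c ->]; split => [x|i]; first exact: cdiff_cst.
by exists 0; apply/funext => x; rewrite pderiv_cst.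
Qed.

Lemma pderivDf i f g : smooth f -> smooth g ->
  pderiv i (fun x => f x + g x) = fun x => pderiv i f x + pderiv i g x.
Proof. by move=> sf sg; apply/funext => x; rewrite pderivD//; apply: smooth_cdiff. Qed.

Lemma pderivMf i f g : smooth f -> smooth g ->
  pderiv i (fun x => f x * g x) = fun x => pderiv i f x * g x + f x * pderiv i g x.
Proof. by move=> sf sg; apply/funext => x; rewrite pderivM//; apply: smooth_cdiff. Qed.

Lemma smoothD f g : smooth f -> smooth g -> smooth (fun x => f x + g x).
Proof.
move=> sf sg; apply: (@smooth_coind (fun h => exists f g,
  [/\ smooth f, smooth g & h = fun x => f x + g x])); last by exists f, g.
move=> _ [{}f [{}g [{}sf {}sg ->]]]; split => [x|i].
  by apply: cdiffD; exact: smooth_cdiff.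
by exists (pderiv i f), (pderiv i g); split; rewrite ?pderivDf//; exact: smooth_pderiv.
Qed.

(** The least class that contains products of smooth functions and that the product rule maps into
    itself; with it [smoothM] avoids the general Leibniz formula. *)
Inductive prodsum : (E -> C) -> Prop :=
| prodsumM f g : smooth f -> smooth g -> prodsum (fun x => f x * g x)
| prodsumD f g : prodsum f -> prodsum g -> prodsum (fun x => f x + g x).

Lemma smoothM f g : smooth f -> smooth g -> smooth (fun x => f x * g x).
Proof.
move=> sf sg; apply: (@smooth_coind prodsum); last exact: prodsumM.
move=> h {f g sf sg}; elim => {h}[f g sf sg|f g pf [df if_] pg [dg ig]]; split.
- by move=> x; apply: cdiffM; exact: smooth_cdiff.
- move=> i; rewrite pderivMf//; apply: prodsumD; apply: prodsumM => //; exact: smooth_pderiv.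
- by move=> x; exact: cdiffD.
- move=> i; rewrite (_ : pderiv i _ = fun x => pderiv i f x + pderiv i g x).
    exact: prodsumD.
  by apply/funext => x; rewrite pderivD.
Qed.

Lemma smoothZ (c : C) f : smooth f -> smooth (fun x => c * f x).
Proof. by move=> sf; apply: smoothM => //; exact: smooth_cst. Qed.

Lemma pderivZf i (c : C) f : smooth f ->
  pderiv i (fun x => c * f x) = fun x => c * pderiv i f x.
Proof. by move=> sf; apply/funext => x; rewrite pderivZ//; exact: smooth_cdiff. Qed.

Lemma smoothN f : smooth f -> smooth (fun x => - f x).
Proof. by move=> sf; under eq_fun do rewrite -mulN1r; exact: smoothZ. Qed.

Lemma smoothB f g : smooth f -> smooth g -> smooth (fun x => f x - g x).
Proof. by move=> sf sg; apply: smoothD => //; exact: smoothN. Qed.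

Lemma pderiv_affinef i (c : R) (a : E) f : smooth f ->
  pderiv i (fun y => f (c *: y + a)) = fun x => c%:C%C * pderiv i f (c *: x + a).
Proof. by move=> sf; apply/funext => x; rewrite pderiv_affine//; exact: smooth_cdiff. Qed.

Lemma smooth_affine (c : R) (a : E) f : smooth f -> smooth (fun y => f (c *: y + a)).
Proof.
move=> sf; apply: (@smooth_coind (fun h => exists2 f, smooth f & exists d : C,
  h = fun y => d * f (c *: y + a))); last first.
  by exists f => //; exists 1; apply/funext => y; rewrite mul1r.
move=> _ [{}f {}sf [d ->]].
have dfa x : cdiff (fun y => f (c *: y + a)) x by apply: cdiff_affine; exact: smooth_cdiff.
split => [x|i]; first exact: cdiffZ.
exists (pderiv i f); first exact: smooth_pderiv.
exists (d * c%:C%C); apply/funext => y; rewrite pderivZ// pderiv_affine ?mulrA//.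
exact: smooth_cdiff.
Qed.

Lemma cdiff_continuous f : (forall x, cdiff f x) ->
  continuous (fun x => complex.Re (f x)) /\ continuous (fun x => complex.Im (f x)).
Proof.
by move=> df; split => x; have [d1 d2] := df x;
  [exact: (differentiable_continuous d1)|exact: (differentiable_continuous d2)].
Qed.

Lemma smooth_cmeas f : smooth f -> cmeas f.
Proof.
move=> /smoothP[/cdiff_continuous[c1 c2] _].
by split; apply: continuous_measurable_rV.
Qed.

Lemma modulus_continuous f : (forall x, cdiff f x) -> continuous (fun x => modulus (f x)).
Proof.
move=> /cdiff_continuous[c1 c2] x.
rewrite (_ : (fun _ => _) = Num.sqrt \o
  (fun x => complex.Re (f x) ^+ 2 + complex.Im (f x) ^+ 2)); last first.
  by apply/funext => y; rewrite modulusE.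
apply: continuous_comp; last exact: sqrt_continuous.
have e (h : E -> R) : continuous h -> {for x, continuous (fun x => h x ^+ 2)}.
  move=> ch; apply: (@continuous_comp _ _ _ h (fun t : R => t ^+ 2)); first exact: ch.
  exact: exprn_continuous.
by apply: continuousD; apply: e.
Qed.

(** Seminorms are handled as pointwise bounds by a weight, so that no supremum is taken and the
    constants of products and dilations stay explicit. *)
Definition Bw (k : nat) w f :=
  forall (a : seq 'I_n) x, (size a <= k)%N -> modulus (pderivs a f x) <= w x.

Lemma Bw_le0 k w f x : Bw k w f -> modulus (f x) <= w x.
Proof. by move=> /(_ [::] x); apply. Qed.

Lemma BwS k w f : Bw k.+1 w f <->
  (forall x, modulus (f x) <= w x) /\ forall i, Bw k w (pderiv i f).
Proof.
split=> [b|[b0 b1]].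
  split=> [x|i a x ak]; first exact: Bw_le0 b.
  by rewrite -pderivs_rcons; apply: b; rewrite size_rcons.
move=> a x; case/lastP: a => [|a i]; first by move=> _; exact: b0.
by rewrite size_rcons ltnS pderivs_rcons => ?; exact: b1.
Qed.

Lemma Bw0 w f : Bw 0 w f <-> forall x, modulus (f x) <= w x.
Proof. by split=> [b x|b [|//] x _]; [exact: Bw_le0 b|exact: b]. Qed.

Lemma Bw_mono k k' w w' f : (k' <= k)%N -> (forall x, w x <= w' x) ->
  Bw k w f -> Bw k' w' f.
Proof.
by move=> kk ww b a x ak; rewrite (le_trans _ (ww x))// b// (leq_trans ak).
Qed.

Lemma Bw_ge0 k w f x : Bw k w f -> 0 <= w x.
Proof. by move=> /Bw_le0 h; exact: le_trans (modulus_ge0 _) (h x). Qed.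

Lemma Bw_pderiv k w f i : Bw k.+1 w f -> Bw k w (pderiv i f).
Proof. by move=> /BwS[]. Qed.

Lemma BwD k w1 w2 f g : smooth f -> smooth g -> Bw k w1 f -> Bw k w2 g ->
  Bw k (fun x => w1 x + w2 x) (fun x => f x + g x).
Proof.
elim: k f g => [|k IH] f g sf sg.
  by move=> /Bw0 bf /Bw0 bg; apply/Bw0 => x; rewrite (le_trans (modulusD _ _))// lerD.
move=> /BwS[f0 fi] /BwS[g0 gi]; apply/BwS; split => [x|i].
  by rewrite (le_trans (modulusD _ _))// lerD.
by rewrite pderivDf//; apply: IH => //; exact: smooth_pderiv.
Qed.

(** Each differentiation doubles the number of terms in the product rule, hence the factor
    [2 ^+ k]. *)
Lemma BwM k w1 w2 f g : smooth f -> smooth g -> Bw k w1 f -> Bw k w2 g ->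
  Bw k (fun x => 2 ^+ k * (w1 x * w2 x)) (fun x => f x * g x).
Proof.
elim: k f g => [|k IH] f g sf sg.
  move=> /Bw0 bf /Bw0 bg; apply/Bw0 => x.
  by rewrite expr0 mul1r modulusM ler_pM.
move=> /BwS[f0 fi] /BwS[g0 gi]; apply/BwS; split => [x|i].
  rewrite modulusM (@le_trans _ _ (w1 x * w2 x))//; first by rewrite ler_pM.
  by rewrite ler_peMl ?exprn_ege1 ?ler1n// mulr_ge0// (le_trans _ (f0 x), le_trans _ (g0 x)).
have kle w' h : (forall x, modulus (h x) <= w' x) -> (forall i, Bw k w' (pderiv i h)) -> Bw k w' h.
  by move=> h0 hi; apply: (@Bw_mono k.+1 _ w') => //; apply/BwS.
rewrite pderivMf//.
apply: (@Bw_mono k k (fun x => 2 ^+ k * (w1 x * w2 x) + 2 ^+ k * (w1 x * w2 x))) => //.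
  by move=> x; rewrite exprS; lra.
apply: BwD.
- by apply: smoothM => //; exact: smooth_pderiv.
- by apply: smoothM => //; exact: smooth_pderiv.
- by apply: IH => //; [exact: smooth_pderiv|exact: kle].
- by apply: IH => //; [exact: smooth_pderiv|exact: kle].
Qed.

Lemma BwZ k w (c : C) f : smooth f -> Bw k w f ->
  Bw k (fun x => modulus c * w x) (fun x => c * f x).
Proof.
elim: k f => [|k IH] f sf.
  by move=> /Bw0 bf; apply/Bw0 => x; rewrite modulusM ler_wpM2l.
move=> /BwS[f0 fi]; apply/BwS; split => [x|i]; first by rewrite modulusM ler_wpM2l.
by rewrite pderivZf//; apply: IH => //; exact: smooth_pderiv.
Qed.

Lemma BwB k w1 w2 f g : smooth f -> smooth g -> Bw k w1 f -> Bw k w2 g ->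
  Bw k (fun x => w1 x + w2 x) (fun x => f x - g x).
Proof.
move=> sf sg bf bg; apply: BwD => //; first exact: smoothN.
have := BwZ (-1) sg bg; rewrite modulusN modulus1.
rewrite (_ : (fun x => -1 * g x) = (fun x => - g x)); last by apply/funext => x; rewrite mulN1r.
by apply: Bw_mono => // x; rewrite mul1r.
Qed.

(** Every derivative brings a factor [c]; the maximum with 1 keeps one constant valid for all orders
    up to [k]. *)
Lemma Bw_affine k w (c : R) (a : E) f : smooth f -> Bw k w f ->
  Bw k (fun x => (Num.max 1 `|c|) ^+ k * w (c *: x + a)) (fun x => f (c *: x + a)).
Proof.
have m1 : 1 <= Num.max 1 `|c| by rewrite le_max lexx.
elim: k f => [|k IH] f sf.
  by move=> /Bw0 bf; apply/Bw0 => x; rewrite expr0 mul1r.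
move=> /[dup] bf /BwS[f0 fi]; apply/BwS; split => [x|i].
  rewrite (le_trans (f0 _))// ler_peMl ?exprn_ege1//; exact: Bw_ge0 bf.
rewrite pderiv_affinef//.
have := BwZ c%:C%C (smooth_affine c a (smooth_pderiv i sf)) (IH _ (smooth_pderiv i sf) (fi i)).
apply: Bw_mono => // x; rewrite modulus_ofreal exprS mulrA.
apply: ler_wpM2r; first exact: Bw_ge0 bf.
by apply: ler_wpM2r; [rewrite exprn_ge0// (le_trans ler01)|rewrite le_max lexx orbT].
Qed.

(** There are finitely many derivatives of order at most [k], and the constants are merged by
    summing over the directions at each order. *)
Lemma Bw_ex (k : nat) w f : (forall x, 0 <= w x) ->
  (forall a, exists c, forall x, modulus (pderivs a f x) <= c * w x) ->
  exists2 c, 0 <= c & Bw k (fun x => c * w x) f.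
Proof.
move=> w0; elim: k f => [|k IH] f H.
  have [c hc] := H [::]; exists `|c| => //; apply/Bw0 => x.
  by rewrite (le_trans (hc x))// ler_wpM2r// ler_norm.
have {}IH i : exists c, 0 <= c /\ Bw k (fun x => c * w x) (pderiv i f).
  case: (IH (pderiv i f)) => [a|c c0 hc]; last by exists c.
  by have [c hc] := H (rcons a i); exists c => x; rewrite -pderivs_rcons.
have [c0 h0] := H [::]; have [c hc] := choice IH.
have s0 : 0 <= \sum_i c i by apply: sumr_ge0 => i _; have [] := hc i.
exists (`|c0| + \sum_i c i); first by rewrite addr_ge0.
apply/BwS; split => [x|i].
  rewrite (le_trans (h0 x))// ler_wpM2r//.
  by rewrite (le_trans (ler_norm _))// lerDl.
have [ci bi] := hc i; apply: Bw_mono bi => // x; rewrite ler_wpM2r//.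
rewrite (bigD1 i)//= addrCA lerDl addr_ge0// sumr_ge0// => j _.
by have [] := hc j.
Qed.

End smooth.

(** * Schwartz functions and functions of slow growth *)

Section schwartz.
Context {R : realType} {n : nat}.
Local Notation E := 'rV[R]_n.
Local Notation C := R[i].
Implicit Types (f g m : E -> C) (x y : E) (i : 'I_n) (w : E -> R).

(** The order of differentiation [k] and the decay [N] are separate, whereas [schwartz_le] ties them
    to one index. A loss of either can then be recorded independently. *)
Definition Sle (k N : nat) (M : R) f := Bw k (fun x => M * jb x ^- N) f.

Lemma jbX_gt0 x N : 0 < jb x ^+ N. Proof. by rewrite exprn_gt0. Qed.
Lemma jbV_gt0 x N : 0 < jb x ^- N. Proof. by rewrite invr_gt0 exprn_gt0. Qed.
Lemma jbV_le1 x N : jb x ^- N <= 1. Proof. by rewrite invf_le1 ?jbX_gt0// exprn_ege1. Qed.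
Lemma jbV_anti x N N' : (N <= N')%N -> jb x ^- N' <= jb x ^- N.
Proof. by move=> NN; rewrite lef_pV2 ?posrE ?jbX_gt0// ler_weXn2l. Qed.

Lemma schwartz_leE N M f : schwartz_le N M f <-> Sle N N M f.
Proof.
split=> h a x.
  by move=> aN; rewrite ler_pdivlMr ?jbX_gt0// mulrC; exact: h.
by move=> aN; have := h a x aN; rewrite ler_pdivlMr ?jbX_gt0// mulrC.
Qed.

Lemma Sle_mono k k' N N' M M' f : (k' <= k)%N -> (N' <= N)%N -> 0 <= M -> M <= M' ->
  Sle k N M f -> Sle k' N' M' f.
Proof.
move=> kk NN M0 MM; apply: Bw_mono => // x.
by apply: ler_pM => //; [rewrite ltW// jbV_gt0|exact: jbV_anti].
Qed.

Lemma Sle_ge0 k N M f : Sle k N M f -> 0 <= M.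
Proof. by move=> /Bw_ge0 => /(_ 0); rewrite pmulr_lge0// jbV_gt0. Qed.

Lemma schwartzP f : schwartz f <-> smooth f /\ forall k N, exists M, Sle k N M f.
Proof.
split=> -[sf H]; split => //.
  move=> k N; have [M /schwartz_leE hM] := H (maxn k N); have M0 := Sle_ge0 hM.
  by exists M; apply: Sle_mono hM; rewrite ?leq_maxl ?leq_maxr.
by move=> N; have [M hM] := H N N; exists M; apply/schwartz_leE.
Qed.

Lemma schwartz_smooth f : schwartz f -> smooth f.
Proof. by case. Qed.

Lemma schwartz_Sle f k N : schwartz f -> exists M, Sle k N M f.
Proof. by move=> /schwartzP[_]. Qed.

Lemma schwartz_pderiv f i : schwartz f -> schwartz (pderiv i f).
Proof.
move=> /schwartzP[sf H]; apply/schwartzP; split; first exact: smooth_pderiv.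
by move=> k N; have [M hM] := H k.+1 N; exists M; exact: Bw_pderiv.
Qed.

Lemma schwartzD f g : schwartz f -> schwartz g -> schwartz (fun x => f x + g x).
Proof.
move=> /schwartzP[sf Hf] /schwartzP[sg Hg]; apply/schwartzP; split; first exact: smoothD.
move=> k N; have [M hM] := Hf k N; have [M' hM'] := Hg k N; exists (M + M').
by apply: Bw_mono (BwD sf sg hM hM') => // x; rewrite mulrDl.
Qed.

(** The multipliers of the Schwartz space: the growth exponent may depend on the order of
    differentiation. *)
Definition slow m := smooth m /\ forall k, exists M N,
  0 <= M /\ Bw k (fun x => M * jb x ^+ N) m.

Lemma slow_smooth m : slow m -> smooth m. Proof. by case. Qed.

Lemma SleM k N L M M' m f : smooth m -> smooth f ->
  Bw k (fun x => M * jb x ^+ L) m -> Sle k (N + L) M' f ->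
  Sle k N (2 ^+ k * (M * M')) (fun x => m x * f x).
Proof.
move=> sm sf bm bf; apply: Bw_mono (BwM sm sf bm bf) => // x.
apply: le_of_eq; rewrite exprD.
by field; rewrite !gt_eqF ?jbX_gt0.
Qed.

Lemma schwartz_slowM m f : slow m -> schwartz f -> schwartz (fun x => m x * f x).
Proof.
move=> [sm Hm] /schwartzP[sf Hf]; apply/schwartzP; split; first exact: smoothM.
move=> k N; have [M [L [M0 hM]]] := Hm k; have [M' hM'] := Hf k (N + L)%N.
by exists (2 ^+ k * (M * M')); exact: (SleM sm sf hM hM').
Qed.

Lemma slow_mono_exp k M N N' m : 0 <= M -> (N <= N')%N ->
  Bw k (fun x => M * jb x ^+ N) m -> Bw k (fun x => M * jb x ^+ N') m.
Proof.
by move=> M0 NN; apply: Bw_mono => // x; rewrite ler_wpM2l// ler_weXn2l.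
Qed.

Lemma slowM f g : slow f -> slow g -> slow (fun x => f x * g x).
Proof.
move=> [sf Hf] [sg Hg]; split; first exact: smoothM.
move=> k; have [M [N [M0 hM]]] := Hf k; have [M' [N' [M0' hM']]] := Hg k.
exists (2 ^+ k * (M * M')), (N + N')%N; split; first by rewrite mulr_ge0 ?exprn_ge0// mulr_ge0.
apply: Bw_mono (BwM sf sg hM hM') => // x.
by rewrite exprD le_eqVlt; apply/orP; left; apply/eqP; ring.
Qed.

Lemma slowD f g : slow f -> slow g -> slow (fun x => f x + g x).
Proof.
move=> [sf Hf] [sg Hg]; split; first exact: smoothD.
move=> k; have [M [N [M0 hM]]] := Hf k; have [M' [N' [M0' hM']]] := Hg k.
exists (M + M'), (maxn N N'); split; first by rewrite addr_ge0.
have := BwD sf sg (slow_mono_exp M0 (leq_maxl N N') hM)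
   (slow_mono_exp M0' (leq_maxr N N') hM').
by apply: Bw_mono => // x; rewrite mulrDl.
Qed.

Lemma slow_schwartz f : schwartz f -> slow f.
Proof.
move=> /schwartzP[sf H]; split => // k; have [M hM] := H k 0%N.
exists M, 0%N; split; first exact: Sle_ge0 hM.
by apply: Bw_mono hM => // x; rewrite !expr0 invr1.
Qed.

(* a class of functions closed under differentiation, each bounded by [w] up
   to a constant *)
Lemma slow_coind (P : (E -> C) -> Prop) :
  (forall f, P f -> [/\ forall x, cdiff f x, forall i, P (pderiv i f) &
     exists M N, 0 <= M /\ forall x, modulus (f x) <= M * jb x ^+ N]) ->
  forall f, P f -> slow f.
Proof.
move=> HP f Pf; split.
  by apply: (@smooth_coind _ _ P) Pf => {}f /HP[].
move=> k; elim: k f Pf => [|k IH] f Pf.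
  have [_ _ [M [N [M0 hM]]]] := HP f Pf.
  by exists M, N; split => //; apply/Bw0.
have [_ Pi [M [N [M0 hM]]]] := HP f Pf.
have {}IH i : exists MN : R * nat, 0 <= MN.1 /\
    Bw k (fun x => MN.1 * jb x ^+ MN.2) (pderiv i f).
  by have [M' [N' h]] := IH _ (Pi i); exists (M', N').
have [MN hMN] := choice IH.
have s0 : 0 <= \sum_i (MN i).1 by apply: sumr_ge0 => i _; have [] := hMN i.
exists (M + \sum_i (MN i).1), (N + \sum_i (MN i).2)%N; split; first by rewrite addr_ge0.
apply/BwS; split => [x|i].
  rewrite (le_trans (hM x))// ler_pM ?exprn_ge0 ?(ltW (jb_gt0 x))//.
    by rewrite lerDl.
  by rewrite ler_weXn2l// leq_addr.
have [m0 bi] := hMN i; apply: Bw_mono bi => // x.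
rewrite ler_pM ?exprn_ge0 ?(ltW (jb_gt0 x))//.
  by rewrite (bigD1 i)//= addrCA lerDl addr_ge0// sumr_ge0// => j _; have [] := hMN j.
by rewrite ler_weXn2l// (bigD1 i)//= addnCA leq_addr.
Qed.

Lemma slow_cst (c : C) : slow (fun _ : E => c).
Proof.
apply: (@slow_coind (fun f => exists c : C, f = fun=> c)); last by exists c.
move=> f [{}c ->]; split => [x|i|]; first exact: cdiff_cst.
  by exists 0; apply/funext => x; rewrite pderiv_cst.
by exists (modulus c), 0%N; split => // x; rewrite expr0 mulr1.
Qed.

Lemma slowZ (c : C) f : slow f -> slow (fun x => c * f x).
Proof. by move=> sf; apply: slowM => //; exact: slow_cst. Qed.

Lemma slowN f : slow f -> slow (fun x => - f x).
Proof. by move=> sf; under eq_fun do rewrite -mulN1r; exact: slowZ. Qed.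

Lemma slowB f g : slow f -> slow g -> slow (fun x => f x - g x).
Proof. by move=> sf sg; apply: slowD => //; exact: slowN. Qed.

Lemma slowX f k : slow f -> slow (fun x => f x ^+ k).
Proof.
move=> sf; elim: k => [|k IH]; first by under eq_fun do rewrite expr0; exact: slow_cst.
by under eq_fun do rewrite exprS; exact: slowM.
Qed.

Lemma slow_sum (I : Type) (r : seq I) (F : I -> E -> C) :
  (forall j, slow (F j)) -> slow (fun x => \sum_(j <- r) F j x).
Proof.
move=> sF; elim: r => [|a r IH]; first by under eq_fun do rewrite big_nil; exact: slow_cst.
by under eq_fun do rewrite big_cons; exact: slowD.
Qed.

Lemma schwartzZ (c : C) f : schwartz f -> schwartz (fun x => c * f x).
Proof. by move=> sf; apply: schwartz_slowM => //; exact: slow_cst. Qed.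

Lemma schwartzN f : schwartz f -> schwartz (fun x => - f x).
Proof. by move=> sf; under eq_fun do rewrite -mulN1r; exact: schwartzZ. Qed.

Lemma schwartzB f g : schwartz f -> schwartz g -> schwartz (fun x => f x - g x).
Proof. by move=> sf sg; apply: schwartzD => //; exact: schwartzN. Qed.

Lemma schwartz0 : schwartz (fun _ : E => 0 : C).
Proof.
apply/schwartzP; split; first exact: smooth_cst.
move=> k N; exists 0 => a x _; rewrite mul0r.
have -> : pderivs a (fun=> 0) = (fun=> 0) :> (E -> C).
  elim: a => //= i a ->; apply/funext => y; exact: pderiv_cst.
by rewrite modulus0.
Qed.

Lemma schwartz_sum (I : Type) (r : seq I) (F : I -> E -> C) :
  (forall j, schwartz (F j)) -> schwartz (fun x => \sum_(j <- r) F j x).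
Proof.
move=> sF; elim: r => [|a r IH]; first by under eq_fun do rewrite big_nil; exact: schwartz0.
by under eq_fun do rewrite big_cons; exact: schwartzD.
Qed.

Lemma schwartzM f g : schwartz f -> schwartz g -> schwartz (fun x => f x * g x).
Proof. by move=> sf sg; apply: schwartz_slowM => //; exact: slow_schwartz. Qed.

Lemma jbZ_le (c : R) x : jb (c *: x) <= Num.max 1 `|c| * jb x.
Proof.
have m1 : 1 <= Num.max 1 `|c| by rewrite le_max lexx.
rewrite /jb enormZ mulrDr mulr1 lerD// ler_wpM2r//.
by rewrite le_max lexx orbT.
Qed.

Lemma jb_affine_le (c : R) (a : E) x : jb (c *: x + a) <= Num.max 1 `|c| * jb a * jb x.
Proof.
rewrite (le_trans (jbD _ _))// mulrAC ler_wpM2r ?jbZ_le//.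
exact: ltW.
Qed.

Lemma jb_affine_ge (c : R) (a : E) x : c != 0 ->
  jb x <= Num.max 1 `|c^-1| * jb a * jb (c *: x + a).
Proof.
move=> c0; rewrite {1}(_ : x = c^-1 *: (c *: x + a) + (- (c^-1 *: a))); last first.
  by rewrite scalerDr scalerA mulVf// scale1r addrK.
rewrite -scalerBr; apply: (le_trans (jbZ_le _ _)).
rewrite -mulrA ler_wpM2l ?le_max ?ler01// mulrC.
by rewrite (le_trans (jbD _ _))// /jb enormN.
Qed.

Lemma schwartz_affine (c : R) (a : E) f : c != 0 -> schwartz f ->
  schwartz (fun x => f (c *: x + a)).
Proof.
move=> c0 /schwartzP[sf H]; apply/schwartzP; split; first exact: smooth_affine.
move=> k N; have [M hM] := H k N; have M0 := Sle_ge0 hM.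
have D0 : 0 < Num.max 1 `|c^-1| * jb a.
  by rewrite mulr_gt0// lt_max ltr01.
exists (Num.max 1 `|c| ^+ k * M * (Num.max 1 `|c^-1| * jb a) ^+ N).
apply: Bw_mono (Bw_affine c a sf hM) => // x.
have m1 : 0 <= Num.max 1 `|c| by rewrite le_max ler01.
set D := _ * jb a in D0 *.
have h : jb x ^+ N <= D ^+ N * jb (c *: x + a) ^+ N.
  rewrite -exprMn lerXn2r ?nnegrE ?mulr_ge0 ?(ltW D0) ?(ltW (jb_gt0 _))//.
  exact: jb_affine_ge.
have h2 : jb (c *: x + a) ^- N <= D ^+ N * jb x ^- N.
  by rewrite ler_pdivlMr ?jbX_gt0// ler_pdivrMl ?jbX_gt0// mulrC.
by rewrite -!mulrA ler_wpM2l ?exprn_ge0// ler_wpM2l.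
Qed.

Lemma slow_affine (c : R) (a : E) m : slow m -> slow (fun x => m (c *: x + a)).
Proof.
move=> [sm H]; split; first exact: smooth_affine.
move=> k; have [M [N [M0 hM]]] := H k.
have m0 : 0 <= Num.max 1 `|c| by rewrite le_max ler01.
have D0 : 0 <= Num.max 1 `|c| * jb a by rewrite mulr_ge0// ltW.
exists (Num.max 1 `|c| ^+ k * M * (Num.max 1 `|c| * jb a) ^+ N), N; split.
  by rewrite !mulr_ge0 ?exprn_ge0.
apply: Bw_mono (Bw_affine c a sm hM) => // x.
set D := _ * jb a in D0 *.
have h : jb (c *: x + a) ^+ N <= D ^+ N * jb x ^+ N.
  rewrite -exprMn lerXn2r ?nnegrE ?mulr_ge0 ?(ltW (jb_gt0 _))//.
  exact: jb_affine_le.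
by rewrite -!mulrA ler_wpM2l ?exprn_ge0// ler_wpM2l.
Qed.

Lemma Sle_integrable N M f : (2 * n <= N)%N -> cmeas f -> Sle 0 N M f ->
  cintgr (lebesgue_rV n) f.
Proof.
move=> nN mf /Bw0 bf; apply: (cintgr_le mf (integrableRZ M (jb_integrable nN))).
exact: bf.
Qed.

Lemma schwartz_cintgr f : schwartz f -> cintgr (lebesgue_rV n) f.
Proof.
move=> sf; have [M hM] := schwartz_Sle 0 (2 * n)%N sf.
by apply: Sle_integrable hM => //; apply: smooth_cmeas; exact: schwartz_smooth.
Qed.

End schwartz.

(** * Taylor estimates and particular smooth functions *)

Section differential.
Context {R : realType} {n : nat}.
Local Notation E := 'rV[R]_n.
Local Notation C := R[i].
Implicit Types (f g m : E -> C) (x y v : E) (i : 'I_n).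

Lemma line_differentiable x v (t : R) : differentiable (fun t : R^o => x + t *: v) t.
Proof.
apply: differentiableD; first exact: differentiable_cst.
exact: differentiableZl.
Qed.

Lemma line_diff x v (t s : R) : 'd (fun t : R^o => x + t *: v) t s = s *: v.
Proof.
rewrite -deriveE; last exact: line_differentiable.
rewrite deriveD; last 2 first.
- exact: derivable_cst.
- by apply: diff_derivable; exact: differentiableZl.
rewrite derive_cst add0r deriveE; last exact: differentiableZl.
by rewrite diffZl//= diff_val.
Qed.

Lemma line_is_derive (h : E -> R) x v (t : R) :
  differentiable (h : E -> R^o) (x + t *: v) ->
  is_derive t 1 (fun t : R => h (x + t *: v)) ('D_v (h : E -> R^o) (x + t *: v)).
Proof.
move=> dh; have dc := differentiable_comp (line_differentiable x v t) dh.
apply: DeriveDef; first by apply: diff_derivable; exact: dc.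
rewrite deriveE; last exact: dc.
by rewrite (diff_comp (line_differentiable x v t) dh) /= line_diff scale1r deriveE.
Qed.

Lemma mvt_line (h : E -> R) x v : (forall y, differentiable (h : E -> R^o) y) ->
  exists2 t, 0 <= t <= 1 & h (x + v) - h x = 'D_v (h : E -> R^o) (x + t *: v).
Proof.
move=> dh.
have /= := @MVT_segment R (fun t => h (x + t *: v)) (fun t => 'D_v (h : E -> R^o) (x + t *: v)) 0 1 ler01.
case=> [t _||t t01].
- exact: line_is_derive.
- apply: continuous_subspaceT => t; apply: differentiable_continuous.
  exact: (differentiable_comp (line_differentiable x v t) (dh _)).
- rewrite scale1r scale0r addr0 subr0 mulr1 => ->; exists t => //; move: t01; rewrite in_itv.
Qed.

Lemma derive_sum_coord (h : E -> R) v y : differentiable (h : E -> R^o) y ->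
  'D_v (h : E -> R^o) y = \sum_i v ord0 i * 'D_(delta_mx ord0 i) (h : E -> R^o) y.
Proof.
move=> dh; rewrite deriveE// {1}(row_sum_delta v) linear_sum.
by apply: eq_bigr => i _; rewrite linearZ /= deriveE.
Qed.

(** Real and imaginary parts have different intermediate points, hence the factor 2. *)
Lemma mvt_le f x v (B : R) : (forall y, cdiff f y) ->
  (forall t i, 0 <= t <= 1 -> modulus (pderiv i f (x + t *: v)) <= B) ->
  modulus (f (x + v) - f x) <= 2 * B * \sum_i `|v ord0 i|.
Proof.
move=> df hB.
have key (h : E -> R) : (forall y, differentiable (h : E -> R^o) y) ->
    (forall t i, 0 <= t <= 1 -> `|'D_(delta_mx ord0 i) (h : E -> R^o) (x + t *: v)| <= B) ->
    `|h (x + v) - h x| <= B * \sum_i `|v ord0 i|.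
  move=> dh hh; have [t t01 ->] := mvt_line x v dh.
  rewrite derive_sum_coord// (le_trans (ler_norm_sum _ _ _))// mulr_sumr.
  by apply: ler_sum => i _; rewrite normrM mulrC ler_wpM2r// hh.
apply: (le_trans (modulus_le _)).
rewrite -mulrA mulr_natl mulr2n lerD//.
- rewrite ReD ReN; apply: (key (fun y => complex.Re (f y))) => [y|t i t01].
    by have [] := df y.
  exact: le_trans (Re_le_modulus (pderiv i f (x + t *: v))) (hB _ _ _).
- rewrite ImD ImN; apply: (key (fun y => complex.Im (f y))) => [y|t i t01].
    by have [] := df y.
  exact: le_trans (Im_le_modulus (pderiv i f (x + t *: v))) (hB _ _ _).
Qed.

Lemma sum_coord_le v : \sum_i `|v ord0 i| <= n%:R * enorm v.
Proof.
rewrite -[n in n%:R]card_ord -sumr_const mulr_suml.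
by apply: ler_sum => i _; rewrite mul1r coord_le_enorm.
Qed.

Lemma sum_coord_delta i (s : R) :
  \sum_j `|(s *: delta_mx ord0 i : E) ord0 j| = `|s|.
Proof.
rewrite (bigD1 i)//= !mxE !eqxx mulr1 big1 ?addr0// => j ji.
by rewrite !mxE (negbTE ji) mulr0 normr0.
Qed.

(** The factor 4 is the 2 of [mvt_le], applied to the derivative, times 2 for the real and imaginary
    parts. *)
Lemma taylor2_le f x i (t B : R) : smooth f ->
  (forall s j, `|s| <= `|t| ->
     modulus (pderiv j (pderiv i f) (x + s *: delta_mx ord0 i)) <= B) ->
  modulus (f (x + t *: delta_mx ord0 i) - f x - t%:C%C * pderiv i f x) <=
    4 * B * t ^+ 2.
Proof.
move=> sf hB; set e : E := delta_mx ord0 i.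
have B0 : 0 <= B by rewrite (le_trans _ (hB 0 i _)) ?normr0.
have hst (s : R) : 0 <= s <= 1 -> `|s * t| <= `|t|.
  by move=> /andP[s0 s1]; rewrite normrM ger0_norm// ler_piMl.
have bnd s : 0 <= s <= 1 ->
    modulus (pderiv i f (x + (s * t) *: e) - pderiv i f x) <= 2 * B * `|t|.
  move=> s01; apply: (@le_trans _ _ (2 * B * `|s * t|)); last first.
    by rewrite ler_wpM2l ?mulr_ge0// hst.
  rewrite -(sum_coord_delta i) mvt_le// => [y|u j /andP[u0 u1]].
    by apply: smooth_cdiff; exact: smooth_pderiv.
  rewrite scalerA hB// normrM ger0_norm//.
  by rewrite (le_trans _ (hst s s01))// ler_piMl.
have key (h : E -> R) : (forall y, differentiable (h : E -> R^o) y) ->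
    (forall s, 0 <= s <= 1 -> `|'D_e (h : E -> R^o) (x + (s * t) *: e) -
      'D_e (h : E -> R^o) x| <= 2 * B * `|t|) ->
    `|h (x + t *: e) - h x - t * 'D_e (h : E -> R^o) x| <= 2 * B * t ^+ 2.
  move=> dh hh; have [s s01 ->] := mvt_line x (t *: e) dh.
  rewrite deriveE// linearZ /= -deriveE// scalerA -mulrBr normrM.
  by rewrite -(real_normK (num_real t)) expr2 mulrA mulrC ler_wpM2r// hh.
apply: (le_trans (modulus_le _)).
rewrite (_ : 4 * B * t ^+ 2 = 2 * B * t ^+ 2 + 2 * B * t ^+ 2); last by ring.
rewrite !ReD !ReN !ImD !ImN ReM ImM /= !mul0r subr0 addr0 lerD//.
- apply: (key (fun y => complex.Re (f y))) => [y|s s01].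
    by have [] := smooth_cdiff y sf.
  apply: le_trans (bnd s s01).
  by have := Re_le_modulus (pderiv i f (x + (s * t) *: e) - pderiv i f x); rewrite ReD ReN.
- apply: (key (fun y => complex.Im (f y))) => [y|s s01].
    by have [] := smooth_cdiff y sf.
  apply: le_trans (bnd s s01).
  by have := Im_le_modulus (pderiv i f (x + (s * t) *: e) - pderiv i f x); rewrite ImD ImN.
Qed.

Lemma cdiff_coord i y : cdiff (fun y : E => (y ord0 i)%:C%C) y.
Proof. by apply: cdiff_ofreal; exact: differentiable_coord. Qed.

Lemma derive_coord (j : 'I_n) (v y : E) :
  'D_v (fun y : E => (y ord0 j) : R^o) y = v ord0 j.
Proof.
rewrite deriveE; last exact: differentiable_coord.
have lin : linear (fun y : E => y ord0 j : R^o) by move=> a u w; rewrite !mxE.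
pose L : {linear E -> R^o} := HB.pack (fun y : E => y ord0 j : R^o)
  (GRing.isLinear.Build _ _ _ _ _ lin).
have -> : (fun y : E => (y ord0 j) : R^o) = L by [].
by rewrite (diff_lin (f := L)); last exact: coord_continuous.
Qed.

Lemma pderiv_coord i j (y : E) : pderiv i (fun y => (y ord0 j)%:C%C) y = (i == j)%:R.
Proof.
rewrite (pderiv_ofreal i (fun y : E => y ord0 j)) derive_coord mxE eqxx /=.
by rewrite eq_sym; case: eqP.
Qed.

Lemma slow_coord j : slow (fun y : E => (y ord0 j)%:C%C).
Proof.
apply: (@slow_coind _ _ (fun f => f = (fun y => (y ord0 j)%:C%C) \/ exists c, f = fun=> c));
  last by left.
move=> f [|[c]] -> ; split => [x|i|].
- exact: cdiff_coord.
- by right; exists (i == j)%:R; apply/funext => x; rewrite pderiv_coord.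
- exists 1, 1%N; split => // x; rewrite modulus_ofreal mul1r expr1.
  by rewrite (le_trans (coord_le_enorm _ _))// lerDr.
- exact: cdiff_cst.
- by right; exists 0; apply/funext => x; rewrite pderiv_cst.
- by exists (modulus c), 0%N; split => // x; rewrite expr0 mulr1.
Qed.

Lemma dotprod_differentiable (a x : E) : differentiable (fun y : E => dotprod a y : R^o) x.
Proof.
rewrite (_ : (fun _ => _) = \sum_i (fun y : E => a ord0 i *: (y ord0 i : R^o))); last first.
  by apply/funext => y; rewrite fct_sumE.
apply: differentiable_sum => i; apply: differentiableZ.
exact: differentiable_coord.
Qed.

Lemma derive_dotprod (a v x : E) : 'D_v (fun y : E => dotprod a y : R^o) x = dotprod a v.
Proof.
rewrite (_ : (fun _ => _) = \sum_i (fun y : E => a ord0 i *: (y ord0 i : R^o))); last first.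
  by apply/funext => y; rewrite fct_sumE.
have dc i : derivable (fun y : E => y ord0 i : R^o) x v.
  by apply: diff_derivable; exact: differentiable_coord.
rewrite derive_sum => [|i]; last exact: derivableZ.
by apply: eq_bigr => i _; rewrite deriveZ// derive_coord.
Qed.

Lemma cdiff_cis (a x : E) : cdiff (fun y => cis (dotprod a y)) x.
Proof.
split => /=.
- apply: (@differentiable_comp1 _ _ cos); first exact: dotprod_differentiable.
  exact: derivable_cos.
- apply: (@differentiable_comp1 _ _ sin); first exact: dotprod_differentiable.
  exact: derivable_sin.
Qed.

Lemma pderiv_cis (a x : E) i : pderiv i (fun y => cis (dotprod a y)) x =
  ('i * (a ord0 i)%:C * cis (dotprod a x))%C.
Proof.
apply: complex_eq; rewrite ?ReM ?ImM /= !(mul0r, mulr0, subr0, add0r, addr0, mul1r).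
- rewrite (derive_comp1 (h := cos)); [|exact: dotprod_differentiable|exact: derivable_cos].
  by rewrite derive_dotprod dotprod_delta derive1E derive_val; ring.
- rewrite (derive_comp1 (h := sin)); [|exact: dotprod_differentiable|exact: derivable_sin].
  by rewrite derive_dotprod dotprod_delta derive1E derive_val; ring.
Qed.

Lemma slow_cis (a : E) : slow (fun y => cis (dotprod a y)).
Proof.
apply: (@slow_coind _ _ (fun f => exists c : C, f = (fun y => c * cis (dotprod a y))));
  last by exists 1; apply/funext => y; rewrite mul1r.
move=> f [c ->]; split => [x|i|].
- by apply: cdiffZ; exact: cdiff_cis.
- exists (c * ('i * (a ord0 i)%:C)%C); apply/funext => x.
  by rewrite pderivZ ?pderiv_cis ?mulrA//; exact: cdiff_cis.
- by exists (modulus c), 0%N; split => // x; rewrite modulusM modulus_cis expr0.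
Qed.

Lemma Bw_cis (a : E) k M : (forall i, `|a ord0 i| <= M) -> 1 <= M ->
  Bw k (fun=> M ^+ k) (fun y => cis (dotprod a y)).
Proof.
move=> aM M1.
(* The induction needs a coefficient of modulus at most 1: a derivative multiplies the exponential
   by ['i * a_i], which is [M] times a number of modulus at most 1, and [M] is factored out. *)
suff H (c : C) : modulus c <= 1 -> Bw k (fun=> M ^+ k) (fun y => c * cis (dotprod a y)).
  have := H 1; rewrite modulus1 => /(_ (lexx _)).
  by rewrite (_ : (fun y => 1 * _) = (fun y => cis (dotprod a y)))//;
     apply/funext => y; rewrite mul1r.
elim: k c => [|k IH] c c1.
  by apply/Bw0 => x; rewrite modulusM modulus_cis mulr1 expr0.
apply/BwS; split => [x|i]; first by rewrite modulusM modulus_cis mulr1 (le_trans c1)// exprn_ege1.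
have M0 : 0 < M by rewrite (lt_le_trans ltr01).
rewrite (_ : pderiv i _ = fun x => M%:C%C * ((c * ('i * (a ord0 i / M)%:C)%C) * cis (dotprod a x))).
  have sc : slow (fun x => (c * ('i * (a ord0 i / M)%:C)%C) * cis (dotprod a x)).
    by apply: slowZ; exact: slow_cis.
  have := @BwZ _ _ k (fun=> M ^+ k) M%:C%C _ (slow_smooth sc) (IH _ _).
  rewrite modulus_ofreal (ger0_norm (ltW M0)) exprS; apply.
  rewrite !modulusM modulus_ofreal normrM normrV ?unitfE ?gt_eqF// (gtr0_norm M0).
  rewrite (_ : modulus 'i%C = 1) ?mul1r; last by rewrite modulusE /= expr0n add0r expr1n sqrtr1.
  by rewrite mulr_ile1// ?divr_ge0// ?(ltW M0)// ler_pdivrMr// mul1r.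
apply/funext => x; rewrite pderivZ ?pderiv_cis; last exact: cdiff_cis.
rewrite mulrA; apply: complex_eq; rewrite !(ReM, ImM) /=; field; exact: lt0r_neq0.
Qed.

(** The value is of order [e * enorm x] by the mean value theorem, and each derivative carries a
    factor [e] by itself. All orders are thus [O(e)] at the price of one factor [jb x], which is the
    source of the rates in [approx_id] and [dl_bound]. *)
Lemma Bw_dilate_sub k (g : E -> C) (M e : R) : smooth g ->
  Bw k.+1 (fun=> M) g -> 0 <= e <= 1 ->
  Bw k (fun x => e * ((2 * M * n%:R + M) * jb x)) (fun x => g (e *: x) - g 0).
Proof.
move=> sg bg /andP[e0 e1].
have M0 : 0 <= M by exact: (Bw_ge0 0 bg).
have sge : smooth (fun x => g (e *: x)).
  by have := smooth_affine e 0 sg; under eq_fun do rewrite addr0.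
have b0 x : modulus (g (e *: x) - g 0) <= e * ((2 * M * n%:R + M) * jb x).
  rewrite -{1}(add0r (e *: x)); apply: (le_trans (mvt_le (B := M) _ _)).
  - by move=> y; exact: smooth_cdiff.
  - by move=> t i _; have /BwS[_ /(_ i) /Bw_le0] := bg; exact.
  have h1 := sum_coord_le (e *: x).
  rewrite (@le_trans _ _ (2 * M * (n%:R * enorm (e *: x))))//.
    by rewrite ler_wpM2l ?mulr_ge0.
  rewrite enormZ (ger0_norm e0).
  have x0 := enorm_ge0 x; rewrite /jb.
  have n0 : 0 <= n%:R :> R by [].
  set a := enorm x in x0 *; set N : R := n%:R in n0 *.
  rewrite (_ : 2 * M * (N * (e * a)) = e * (2 * M * N * a)); last by ring.
  rewrite ler_wpM2l//; have : 0 <= M * N by rewrite mulr_ge0.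
  have : 0 <= M * a by rewrite mulr_ge0.
  by rewrite mulrDl !mulrDr !mulr1 => ? ?; lra.
have bi i k' : (k' <= k)%N -> Bw k' (fun x => e * ((2 * M * n%:R + M) * jb x))
    (pderiv i (fun x => g (e *: x) - g 0)).
  move=> kk; rewrite (_ : pderiv i _ = fun x => e%:C%C * pderiv i g (e *: x + 0)); last first.
    rewrite pderivDf//; last exact: smooth_cst.
    apply/funext => x; rewrite pderiv_cst addr0.
    rewrite -(pderiv_affine i (c := e) (a := 0)); last exact: smooth_cdiff.
    by under [in RHS]eq_fun do rewrite addr0.
  have si := smooth_pderiv i sg.
  have := BwZ e%:C%C (smooth_affine e 0 si) (Bw_affine e 0 si (Bw_pderiv i bg)).
  apply: Bw_mono => // x.
  rewrite modulus_ofreal ger0_norm// ler_wpM2l// max_l ?expr1n ?mul1r ?ger0_norm//.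
  have := jb_ge1 x; have n0 : 0 <= n%:R :> R by [].
  have : 0 <= M * n%:R by rewrite mulr_ge0.
  set N : R := n%:R; set j := jb x; nra.
case: k bg bi => [|k] bg bi; first exact/Bw0.
by apply/BwS; split => // i; exact: bi.
Qed.

Lemma slow_pderiv m i : slow m -> slow (pderiv i m).
Proof.
move=> [sm H]; split; first exact: smooth_pderiv.
by move=> k; have [M [N [M0 hM]]] := H k.+1; exists M, N; split => //; exact: Bw_pderiv.
Qed.

Lemma schwartz_coind (P : (E -> C) -> Prop) :
  (forall f, P f -> [/\ forall x, cdiff f x, forall i, P (pderiv i f) &
     forall N, exists M, forall x, modulus (f x) <= M * jb x ^- N]) ->
  forall f, P f -> schwartz f.
Proof.
move=> HP f Pf; have sf : smooth f by apply: (@smooth_coind _ _ P) Pf => {}f /HP[].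
apply/schwartzP; split => // k N.
have [||c c0 hc] := @Bw_ex _ _ k (fun x => jb x ^- N) f.
- by move=> x; rewrite ltW// jbV_gt0.
- move=> a; elim/last_ind: a f Pf {sf} => [|a i IH] f Pf.
    by have [_ _ /(_ N)] := HP f Pf.
  by have [_ Pi _] := HP f Pf; rewrite pderivs_rcons; exact: IH.
by exists c.
Qed.

Definition gaus (x : E) : R := expR (- (dotprod x x / 2)).

Lemma gaus_gt0 x : 0 < gaus x. Proof. exact: expR_gt0. Qed.

Lemma derive_sqr_norm (v x : E) :
  differentiable (fun y : E => dotprod y y : R^o) x /\
  'D_v (fun y : E => dotprod y y : R^o) x = 2 * dotprod x v.
Proof.
have dc i : differentiable (fun y : E => y ord0 i : R^o) x by exact: differentiable_coord.
have -> : (fun y : E => dotprod y y : R^o) =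
   \sum_i (fun y : E => (y ord0 i : R^o) * (y ord0 i : R^o)).
  by apply/funext => y; rewrite fct_sumE.
have dm i : differentiable (fun y : E => (y ord0 i : R^o) * (y ord0 i : R^o)) x.
  exact: differentiableM.
split; first exact: differentiable_sum.
rewrite derive_sum => [|i]; last exact: diff_derivable.
rewrite /dotprod mulr_sumr; apply: eq_bigr => i _.
rewrite deriveM; [|exact: diff_derivable|exact: diff_derivable].
by rewrite !derive_coord /GRing.scale /=; ring.
Qed.

Lemma gaus_derive (v x : E) : differentiable (gaus : E -> R^o) x /\
  'D_v (gaus : E -> R^o) x = - dotprod x v * gaus x.
Proof.
have [d1 d2] := derive_sqr_norm v x.
have -> : gaus = (fun t : R => expR (- 2^-1 * t)) \o (fun y : E => dotprod y y).
  by apply/funext => y; rewrite /gaus /= mulNr mulrC.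
have de : is_derive (dotprod x x) 1 (fun t : R => expR (- 2^-1 * t))
   (- 2^-1 * expR (- 2^-1 * dotprod x x)).
  have e1 : is_derive (dotprod x x) 1 (fun t : R => - 2^-1 * t) (- 2^-1).
    have := is_deriveZ (- 2^-1) (is_derive_id (dotprod x x) (1 : R)).
    by rewrite /GRing.scale /= mulr1.
  have := is_derive1_comp (is_derive_expR _) e1.
  by rewrite mulrC.
split; first exact: differentiable_comp1.
rewrite derive_comp1// d2 derive1E (@derive_val _ _ _ _ _ _ _ de) /=.
by field.
Qed.

Lemma gaus_decay N : exists M, forall x, gaus x <= M * jb x ^- N.
Proof.
have e12 : 0 < expR (2^-1 : R) by exact: expR_gt0.
pose K : R := (4 * N.+1%:R) ^+ N.+1.
exists (expR 2^-1 * K) => x.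
rewrite ler_pdivlMr ?jbX_gt0//.
apply: (@le_trans _ _ (gaus x * jb x ^+ (2 * N.+1))).
  rewrite ler_wpM2l ?ler_weXn2l ?(ltW (gaus_gt0 x))//.
  by rewrite (leq_trans (leqnSn N))// leq_pmull.
(* This [s] is at most [2^-1 + dotprod x x / 2], so [gaus x * expR s] is bounded by [expR 2^-1],
   while [expR s] beats every power of [s]. *)
pose s := jb x ^+ 2 / 4.
have hs : s <= 2^-1 + dotprod x x / 2.
  rewrite /s /jb -sqr_enorm; have := sqr_ge0 (1 - enorm x); nra.
have s0 : 0 <= s by rewrite divr_ge0// sqr_ge0.
have hK : s ^+ N.+1 <= N.+1%:R ^+ N.+1 * expR s.
  have -> : expR s = expR (s / N.+1%:R) ^+ N.+1.
    by rewrite -expRM_natl mulrC divfK// pnatr_eq0.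
  have e0 : 0 <= N.+1%:R * expR (s / N.+1%:R) by rewrite mulr_ge0 ?expR_ge0.
  rewrite -exprMn lerXn2r // ?nnegrE //.
  by rewrite [leRHS]mulrC -ler_pdivrMr ?ltr0n// (le_trans _ (expR_ge1Dx _))// lerDr.
have -> : jb x ^+ (2 * N.+1) = 4 ^+ N.+1 * s ^+ N.+1.
  by rewrite -exprMn /s mulrC divfK// exprM.
apply: (@le_trans _ _ (gaus x * (4 ^+ N.+1 * (N.+1%:R ^+ N.+1 * expR s)))).
  by rewrite ler_wpM2l ?(ltW (gaus_gt0 x))// ler_wpM2l ?exprn_ge0.
rewrite (_ : _ * _ = K * (gaus x * expR s)); last by rewrite /K exprMn; ring.
rewrite [leRHS]mulrC ler_wpM2l ?exprn_ge0 ?mulr_ge0// -expRD ler_expR.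
lra.
Qed.

Lemma cdiff_gaus x : cdiff (ofreal gaus) x.
Proof. by apply: cdiff_ofreal; have [] := gaus_derive 0 x. Qed.

Lemma pderiv_gaus i x : pderiv i (ofreal gaus) x = - (x ord0 i)%:C%C * ofreal gaus x.
Proof.
rewrite pderiv_ofreal; have [_ ->] := gaus_derive (delta_mx ord0 i) x.
by rewrite dotprod_delta rmorphM rmorphN.
Qed.

Lemma schwartz_gaus : schwartz (ofreal gaus).
Proof.
apply: (@schwartz_coind (fun f => exists2 p, slow p & f = fun x => p x * ofreal gaus x)).
  move=> f [p sp ->]; split => [x|i|N].
  - by apply: cdiffM; [apply: smooth_cdiff; exact: slow_smooth|exact: cdiff_gaus].
  - exists (fun x => pderiv i p x - p x * (x ord0 i)%:C%C).
      by apply: slowB; [exact: slow_pderiv|apply: slowM => //; exact: slow_coord].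
    apply/funext => x; rewrite pderivM ?pderiv_gaus; last 2 first.
    + by apply: smooth_cdiff; exact: slow_smooth.
    + exact: cdiff_gaus.
    ring.
  have [_ /(_ 0%N)[M [L [M0 /Bw0 hM]]]] := sp.
  have [K hK] := gaus_decay (N + L).
  exists (M * K) => x; rewrite modulusM modulus_ofreal (gtr0_norm (gaus_gt0 x)).
  apply: (le_trans (ler_pM _ (ltW (gaus_gt0 x)) (hM x) (hK x))) => //.
  rewrite exprD le_eqVlt; apply/orP; left; apply/eqP.
  by field; rewrite !gt_eqF ?jbX_gt0.
by exists (fun=> 1); [exact: slow_cst|apply/funext => x; rewrite mul1r].
Qed.

Definition logistic (t : R) : R := (1 + expR (- t))^-1.

Lemma logistic_gt0 t : 0 < logistic t.
Proof. by rewrite invr_gt0 addr_gt0// expR_gt0. Qed.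

Lemma logistic_lt1 t : logistic t < 1.
Proof. by rewrite invf_lt1 ?addr_gt0 ?expR_gt0// ltrDl expR_gt0. Qed.

Lemma is_derive_logistic (t : R) : is_derive t 1 logistic (logistic t * (1 - logistic t)).
Proof.
have p0 : 1 + expR (- t) != 0 by rewrite gt_eqF// addr_gt0 ?expR_gt0.
have eN : is_derive t 1 (fun t : R => expR (- t)) (- expR (- t)).
  have := is_derive1_comp (is_derive_expR (- t)) (is_deriveNid t (1 : R)).
  by rewrite mulrN1.
have e1 : is_derive t 1 (fun t : R => 1 + expR (- t)) (- expR (- t)).
  have := is_deriveD (is_derive_cst (1 : R) t (1 : R)) eN.
  by rewrite add0r.
have d1 : derivable (fun t : R => 1 + expR (- t)) t 1 by exact: ex_derive.
apply: DeriveDef; first exact: derivableV.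
rewrite deriveV// (@derive_val _ _ _ _ _ _ _ e1) /logistic /GRing.scale /=.
by field.
Qed.

Lemma is_derive_horner (p : {poly R}) (t : R) : is_derive t 1 (horner p) (p^`()).[t].
Proof.
apply: DeriveDef; first exact: derivable_horner.
by rewrite -derive1E -derivE.
Qed.

(* polynomials in the logistic function of a coordinate form a class closed
   under differentiation *)
Lemma slow_logistic i (a b : R) :
  slow (ofreal (fun x : E => logistic (a * x ord0 i + b))).
Proof.
pose L (x : E) := logistic (a * x ord0 i + b).
apply: (@slow_coind _ _ (fun f => exists p : {poly R}, f = ofreal (fun x => p.[L x]))); last first.
  by exists 'X; congr ofreal; apply/funext => x; rewrite hornerX.
move=> f [p ->].
pose h t := p.[logistic (a * t + b)].
have dh (t : R) : is_derive t 1 h ((p^`()).[logistic (a * t + b)] *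
    (logistic (a * t + b) * (1 - logistic (a * t + b)) * a)).
  have e0 : is_derive t 1 (fun t : R => a * t + b) a.
    have := is_deriveD (is_deriveZ a (is_derive_id t (1 : R))) (is_derive_cst b t (1 : R)).
    by rewrite addr0 /GRing.scale /= mulr1.
  have e1 := @is_derive1_comp R logistic (fun t => a * t + b) t _ _ (is_derive_logistic (a * t + b)) e0.
  exact: (@is_derive1_comp R (horner p) (logistic \o (fun t => a * t + b)) t _ _
    (is_derive_horner p (logistic (a * t + b))) e1).
have dc x : differentiable (fun y : E => y ord0 i : R^o) x by exact: differentiable_coord.
have fE : (fun x => p.[L x]) = h \o (fun x : E => x ord0 i) by [].
split => [x|j|].
- apply: cdiff_ofreal; rewrite fE; apply: differentiable_comp1 => //.
- exists (p^`() * ('X * (1%:P - 'X)) * (a * (i == j)%:R)%:P); apply/funext => x.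
  rewrite pderiv_ofreal fE derive_comp1//.
  rewrite derive1E (@derive_val _ _ _ _ _ _ _ (dh _)) derive_coord mxE eqxx /=.
  rewrite /ofreal; congr (_%:C)%C; rewrite !(hornerM, hornerX, hornerC, hornerD, hornerN) /L.
  by ring.
- exists (\sum_(k < size p) `|p`_k|), 0%N; split; first exact: sumr_ge0.
  move=> x; rewrite expr0 mulr1 modulus_ofreal horner_coef.
  rewrite (le_trans (ler_norm_sum _ _ _))//; apply: ler_sum => k _.
  rewrite normrM ler_piMr// ger0_norm ?exprn_ge0 ?(ltW (logistic_gt0 _))//.
  by rewrite exprn_ile1// ?(ltW (logistic_gt0 _)) ?(ltW (logistic_lt1 _)).
Qed.

(** Products of a smooth function and a real power of [g] form a class closed under differentiation:
    a derivative lowers the exponent by 1, and the term in which the power is not differentiated is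
    brought to the new exponent by a factor [g]. *)
Lemma smooth_powR (g : E -> R) (al : R) : smooth (ofreal g) ->
  (forall x, 0 < g x) -> smooth (ofreal (fun x => g x `^ al)).
Proof.
move=> sg g0.
have dg x : differentiable (g : E -> R^o) x by have [] := smooth_cdiff x sg.
have dpow be x : differentiable (fun x : E => g x `^ be : R^o) x.
  by apply: (@differentiable_comp1 _ _ (fun t : R => t `^ be)) => //; apply: ex_derive; exact: is_derive1_powR.
have cpow be x : cdiff (ofreal (fun x => g x `^ be)) x by exact: cdiff_ofreal.
have ppow i be x : pderiv i (ofreal (fun x => g x `^ be)) x =
    be%:C%C * ofreal (fun x => g x `^ (be - 1)) x * pderiv i (ofreal g) x.
  rewrite !pderiv_ofreal (derive_comp1 (h := fun t : R => t `^ be))//; last first.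
    by apply: ex_derive; exact: is_derive1_powR.
  rewrite derive1E (@derive_val _ _ _ _ _ _ _ (is_derive1_powR _ _))//.
  by rewrite /ofreal -!rmorphM.
apply: (@smooth_coind _ _ (fun f => exists (h : E -> C) (be : R), smooth h /\ f = fun x => h x * ofreal (fun x => g x `^ be) x)); last first.
  exists (fun=> 1), al; split; first exact: smooth_cst.
  by apply/funext => x; rewrite mul1r.
move=> f [h [be [sh ->]]]; split => [x|i].
  by apply: cdiffM => //; exact: smooth_cdiff.
exists (fun x => pderiv i h x * ofreal g x + be%:C%C * (h x * pderiv i (ofreal g) x)), (be - 1).
split.
  apply: smoothD; first by apply: smoothM => //; exact: smooth_pderiv.
  by apply: smoothZ; apply: smoothM => //; exact: smooth_pderiv.
apply/funext => x; rewrite pderivM ?ppow; [|exact: smooth_cdiff|exact: cpow].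
have -> : ofreal (fun x => g x `^ be) x = ofreal g x * ofreal (fun x => g x `^ (be - 1)) x.
  rewrite /ofreal -rmorphM; congr (_%:C)%C; rewrite -{2}(powRr1 (ltW (g0 x))).
  by rewrite -powRD ?(gt_eqF (g0 x)) ?implybT// addrC subrK.
by ring.
Qed.

Lemma near_eq_pderiv i f g x : (\forall y \near x, f y = g y) ->
  pderiv i f x = pderiv i g x.
Proof.
move=> fg.
apply: complex_eq => /=; apply: near_eq_derive => //.
- by near=> y; congr complex.Re; near: y.
- by near=> y; congr complex.Im; near: y.
Unshelve. all: by end_near. Qed.

Lemma pderivs_support (a : seq 'I_n) f x : ~ fsupport f x -> pderivs a f x = 0.
Proof.
move=> fx.
have : \forall y \near x, pderivs a f y = 0.
  elim: a => [|i a IH] /=.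
    have o : open (~` fsupport f) by exact/closed_openC/closed_closure.
    have : nbhs x (~` fsupport f) by move: o; rewrite openE; apply.
    apply: filterS => y fy; apply/eqP/negPn/negP => f0; apply: fy.
    exact: subset_closure.
  move/nbhs_interior : IH; apply: filterS => y /= h.
  by rewrite (@near_eq_pderiv i _ (fun=> 0))// pderiv_cst.
exact: nbhs_singleton.
Qed.

Lemma Cc_smooth_schwartz O f : Cc_smooth O f -> schwartz f.
Proof.
move=> [sf cf _]; apply/schwartzP; split => // k N.
have [||c c0 hc] := @Bw_ex _ _ k (fun x => jb x ^- N) f; last by exists c.
  by move=> x; rewrite ltW// jbV_gt0.
move=> a.
have ca : continuous (fun x => modulus (pderivs a f x) * jb x ^+ N).
  move=> x; apply: (@continuousM _ E (fun x => modulus (pderivs a f x)) (fun x => jb x ^+ N)).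
    by apply: modulus_continuous => y; exact: sf.
  apply: (@continuous_comp _ _ _ jb (fun t : R => t ^+ N)).
    by apply: continuousD; [exact: cst_continuous|exact: enorm_continuous].
  exact: exprn_continuous.
have [f0|/set0P f0] := eqVneq (fsupport f) set0.
  exists 0 => x; rewrite mul0r pderivs_support ?modulus0//.
  by rewrite f0.
have [x0 _ hx0] := compact_EVT_max f0 cf (continuous_subspaceT ca).
exists (modulus (pderivs a f x0) * jb x0 ^+ N) => x.
have [fx|nfx] := pselect (fsupport f x).
  by rewrite ler_pdivlMr ?jbX_gt0//; apply: hx0; rewrite inE.
rewrite pderivs_support// modulus0 !mulr_ge0// ?exprn_ge0 ?invr_ge0 ?exprn_ge0//.
- exact: ltW.
- exact: ltW.
Qed.

Lemma fsupport_sub f g : (forall x, f x != 0 -> g x != 0) -> fsupport f `<=` fsupport g.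
Proof. by move=> fg; apply: closure_subset => x /= /fg. Qed.

Lemma Cc_smoothM O m f : smooth m -> Cc_smooth O f -> Cc_smooth O (fun x => m x * f x).
Proof.
move=> sm [sf cf fO].
have sub : fsupport (fun x => m x * f x) `<=` fsupport f.
  by apply: fsupport_sub => x; apply: contra => /eqP ->; rewrite mulr0.
split; first exact: smoothM.
  by apply: subclosed_compact cf sub; exact: closed_closure.
exact: subset_trans sub fO.
Qed.

End differential.

(** * Differentiability from a quadratic remainder *)

Section quad.
Context {R : realType} {n : nat}.
Local Notation E := 'rV[R]_n.

(** A remainder bounded by the square of the norm is [o] of the increment, so it identifies the
    differential at once. For the Fourier transform this replaces differentiation under the integral
    sign. *)
Lemma quad_differentiable (h : E -> R) (x : E) (L : 'I_n -> R) (M : R) :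
  (forall v, `|h (x + v) - h x - \sum_i v ord0 i * L i| <= M * enorm v ^+ 2) ->
  differentiable (h : E -> R^o) x /\
  forall i, 'D_(delta_mx ord0 i) (h : E -> R^o) x = L i.
Proof.
move=> H.
pose l (v : E) : R^o := \sum_i v ord0 i * L i.
have linl : linear l.
  move=> a u w; rewrite /l scaler_sumr -big_split; apply: eq_bigr => i _.
  by rewrite !mxE mulrDl /GRing.scale /= mulrA.
pose LL : {linear E -> R^o} := HB.pack l (GRing.isLinear.Build _ _ _ _ _ linl).
have cl : continuous (LL : E -> R^o).
  rewrite (_ : (LL : E -> R^o) = \sum_i (fun v : E => L i *: (v ord0 i : R^o))); last first.
    apply/funext => v; rewrite fct_sumE /LL /= /l.
    by apply: eq_bigr => i _; rewrite mulrC.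
  move=> v; apply: differentiable_continuous; apply: differentiable_sum => i.
  by apply: differentiableZ; exact: differentiable_coord.
have key : (h : E -> R^o) \o shift x = cst (h x : R^o) + (LL : E -> R^o) +o_ (0 : E) id.
  apply/eqaddoP => e e0.
  pose K := `|M| * (n%:R : R) ^+ 2 + 1.
  have K0 : 0 < K by rewrite ltr_wpDl// mulr_ge0// exprn_ge0.
  have eK : 0 < e / K by rewrite divr_gt0.
  near=> v.
  rewrite /= fctE /shift /= opprD addrA (addrC v x).
  rewrite (le_trans (H v))//.
  rewrite (@le_trans _ _ (`|M| * (n%:R * `|v|) ^+ 2))//.
    apply: (@le_trans _ _ (`|M| * enorm v ^+ 2)).
      by rewrite ler_wpM2r ?sqr_ge0 ?ler_norm.
    apply: ler_wpM2l => //.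
    by rewrite lerXn2r ?nnegrE ?mulr_ge0// enorm_le_norm.
  have ve : `|v| <= e / K.
    by near: v; exact: (nbhs0_le (V := E) eK).
  rewrite exprMn mulrA (@le_trans _ _ (K * `|v| ^+ 2))//.
    by rewrite ler_wpM2r ?sqr_ge0// lerDl.
  rewrite expr2 mulrA ler_wpM2r//.
  by rewrite -ler_pdivlMl// mulrC.
have dE : 'd (h : E -> R^o) x = LL :> (E -> R^o) by exact: diff_unique.
have dh : differentiable (h : E -> R^o) x.
  by apply/diff_locallyP; rewrite dE; split.
split => // i; rewrite deriveE// dE /= /l (bigD1 i)//= mxE !eqxx mul1r.
by rewrite big1 ?addr0// => j ji; rewrite mxE (negbTE ji) mul0r.
Unshelve. all: by end_near. Qed.

Lemma cquad_differentiable (f : E -> R[i]) (x : E) (L : 'I_n -> R[i]) (M : R) :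
  (forall v, modulus (f (x + v) - f x - \sum_i (v ord0 i)%:C%C * L i) <= M * enorm v ^+ 2) ->
  cdiff f x /\ forall i, pderiv i f x = L i.
Proof.
move=> H.
have HR v : `|complex.Re (f (x + v)) - complex.Re (f x) -
    \sum_i v ord0 i * complex.Re (L i)| <= M * enorm v ^+ 2.
  apply: le_trans (H v); apply: le_trans (Re_le_modulus _).
  rewrite !ReD !ReN; have -> // : complex.Re (\sum_i (v ord0 i)%:C%C * L i) = \sum_i v ord0 i * complex.Re (L i).
  elim/big_ind2 : _ => // [a b c d <- <-|i _]; first by rewrite ReD.
  by rewrite ReM /= mul0r subr0.
have HI v : `|complex.Im (f (x + v)) - complex.Im (f x) -
    \sum_i v ord0 i * complex.Im (L i)| <= M * enorm v ^+ 2.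
  apply: le_trans (H v); apply: le_trans (Im_le_modulus _).
  rewrite !ImD !ImN; have -> // : complex.Im (\sum_i (v ord0 i)%:C%C * L i) = \sum_i v ord0 i * complex.Im (L i).
  elim/big_ind2 : _ => // [a b c d <- <-|i _]; first by rewrite ImD.
  by rewrite ImM /= mul0r addr0.
have [d1 e1] := @quad_differentiable (fun x => complex.Re (f x)) x (fun i => complex.Re (L i)) M HR.
have [d2 e2] := @quad_differentiable (fun x => complex.Im (f x)) x (fun i => complex.Im (L i)) M HI.
by split => // i; apply: complex_eq => /=.
Qed.

End quad.

(** * Fourier transform of Schwartz functions *)

Section fourier.
Context {R : realType} {n : nat}.
Local Notation E := 'rV[R]_n.
Local Notation C := R[i].
Local Notation leb := (lebesgue_rV n).
Implicit Types (f g m phi : E -> C) (x y v xi : E) (i : 'I_n).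

Lemma mvt1 (h h' : R -> R) (t : R) : (forall s : R, is_derive s 1 h (h' s)) ->
  exists2 c, `|c| <= `|t| & h t - h 0 = h' c * t.
Proof.
move=> dh.
have ch : continuous h.
  by move=> s; apply: differentiable_continuous; apply/derivable1_diffP; exact: ex_derive.
have [t0|t0] := leP 0 t.
  have [c] := @MVT_segment R h h' 0 t t0 (fun s _ => dh s) (continuous_subspaceT ch).
  rewrite in_itv /= subr0 => /andP[c0 ct] ->; exists c => //.
  by rewrite !ger0_norm// (le_trans c0).
have [c] := @MVT_segment R h h' t 0 (ltW t0) (fun s _ => dh s) (continuous_subspaceT ch).
rewrite in_itv /= sub0r => /andP[tc c0] hc.
exists c; first by rewrite !ler0_norm ?lerN2// ltW.
by rewrite -opprB hc mulrN opprK.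
Qed.

Lemma cis_taylor (t : R) : modulus (cis t - 1 - ('i * t%:C)%C) <= 2 * t ^+ 2.
Proof.
have sle s : `|sin s| <= `|s| :> R.
  have [c _] := @mvt1 sin cos s (fun s => is_derive_sin s).
  rewrite sin0 subr0 => ->; rewrite normrM ler_piMl//.
  by rewrite ler_norml cos_geN1 cos_le1.
have cle s : `|cos s - 1| <= `|s| ^+ 2 :> R.
  have [c cs] := @mvt1 cos (fun s => - sin s) s (fun s => is_derive_cos s).
  rewrite cos0 => ->; rewrite normrM normrN expr2 ler_wpM2r//.
  exact: le_trans (sle c) cs.
have cle1 s : `|cos s - 1| <= `|s| :> R.
  have [c _] := @mvt1 cos (fun s => - sin s) s (fun s => is_derive_cos s).
  rewrite cos0 => ->; rewrite normrM normrN ler_piMl//.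
  by rewrite ler_norml sin_geN1 sin_le1.
have dd (s : R) : is_derive s 1 (fun s => sin s - s) (cos s - 1).
  exact: is_deriveB.
have [c ct] := @mvt1 _ _ t dd; rewrite sin0 !subr0 => h.
apply: (le_trans (modulus_le _)).
rewrite !(ReD, ReN, ImD, ImN) /= !(mul0r, mul1r, mulr0, subr0, add0r, addr0, oppr0).
rewrite mulr2n mulrDl mul1r lerD//.
  by rewrite (le_trans (cle t))// real_normK ?num_real.
rewrite h normrM (le_trans (y := `|t| * `|t|))//.
  by rewrite ler_wpM2r// (le_trans (cle1 c)).
by rewrite -expr2 real_normK ?num_real.
Qed.

Lemma fourierE phi xi :
  fourier phi xi = cint leb (fun x => cis (dotprod (- xi) x) * phi x).
Proof. by apply: eq_cint => x; rewrite dotprodNl dotprodC. Qed.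

Lemma cis_cmeas (xi : E) : cmeas (fun x => cis (dotprod xi x)).
Proof. by apply: smooth_cmeas; apply: slow_smooth; exact: slow_cis. Qed.

Lemma cis_cintgr (xi : E) phi : cintgr leb phi ->
  cintgr leb (fun x => cis (dotprod xi x) * phi x).
Proof.
move=> ip; apply: (cintgr_le _ (cintgr_modulus ip)).
  by apply: cmeasM; [exact: cis_cmeas|exact: cintgr_cmeas ip].
by move=> x; rewrite modulusM modulus_cis mul1r.
Qed.

Lemma fourier_le phi xi : cintgr leb phi ->
  modulus (fourier phi xi) <= \int[leb]_x modulus (phi x).
Proof.
move=> ip; rewrite fourierE (le_trans (modulus_cint_le (cis_cintgr _ ip)))//.
by under eq_Rintegral do rewrite modulusM modulus_cis mul1r.
Qed.

Lemma fourierD f g : cintgr leb f -> cintgr leb g ->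
  fourier (fun x => f x + g x) = (fun xi => fourier f xi + fourier g xi).
Proof.
move=> iF ig; apply/funext => xi; rewrite !fourierE -cintD; try exact: cis_cintgr.
by apply: eq_cint => x; rewrite mulrDr.
Qed.

Lemma fourierZ (c : C) f : cintgr leb f ->
  fourier (fun x => c * f x) = (fun xi => c * fourier f xi).
Proof.
move=> iF; apply/funext => xi; rewrite !fourierE -cintZ; last exact: cis_cintgr.
by apply: eq_cint => x; rewrite mulrCA.
Qed.

(** The operator that becomes the [i]-th partial derivative after Fourier transformation. *)
Definition mulx i phi : E -> C := fun x => (- 'i%C) * (x ord0 i)%:C%C * phi x.

Lemma schwartz_mulx i phi : schwartz phi -> schwartz (mulx i phi).
Proof.
move=> sp; apply: schwartz_slowM => //; apply: slowZ; exact: slow_coord.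
Qed.

Lemma measurable_jb : measurable_fun setT (@jb R n).
Proof. by apply: measurable_funD => //; exact: measurable_enorm. Qed.

Lemma cintgr0 : cintgr leb (fun _ => 0 : C).
Proof.
by split; rewrite (_ : (fun _ => _) = cst 0%E)//; exact: integrable0.
Qed.

Lemma cint_sum (I : Type) (r : seq I) (F : I -> E -> C) :
  (forall j, cintgr leb (F j)) ->
  cintgr leb (fun x => \sum_(j <- r) F j x) /\
  cint leb (fun x => \sum_(j <- r) F j x) = \sum_(j <- r) cint leb (F j).
Proof.
move=> iF; elim: r => [|a r [IH1 IH2]].
  have -> : (fun x => \sum_(j <- [::]) F j x) = (fun _ => 0 : C).
    by apply/funext => x; rewrite big_nil.
  by rewrite big_nil cint0; split => //; exact: cintgr0.
have -> : (fun x => \sum_(j <- a :: r) F j x) = (fun x => F a x + \sum_(j <- r) F j x).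
  by apply/funext => x; rewrite big_cons.
by rewrite big_cons -IH2 -cintD//; split => //; exact: cintgrD.
Qed.

Lemma fourier_diff phi xi : schwartz phi ->
  cdiff (fourier phi) xi /\ forall i, pderiv i (fourier phi) xi = fourier (mulx i phi) xi.
Proof.
move=> sp; have ip := schwartz_cintgr sp.
have imx i : cintgr leb (mulx i phi) by apply: schwartz_cintgr; exact: schwartz_mulx.
(* By [cis_taylor] the first-order remainder of the exponential is at most twice the square of
   [dotprod v x], so [2 * enorm v ^+ 2 * G x] is an integrable majorant. *)
pose G x := modulus (phi x) * jb x ^+ 2.
have iG : leb.-integrable setT (fun x => (G x)%:E).
  have [M /Bw0 hM] := schwartz_Sle 0 (2 * n + 2)%N sp.
  apply: (le_integrable measurableT _ _ (integrableRZ M (@jb_integrable R n _ (leqnn _)))).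
    apply: measurable_EFin; apply: measurable_funM.
      by apply: cmeas_modulus; exact: cintgr_cmeas ip.
    by apply: measurable_funX; exact: measurable_jb.
  move=> x _ /=; rewrite lee_fin; apply: le_trans (ler_norm _).
  rewrite ger0_norm /G ?mulr_ge0 ?exprn_ge0 ?(ltW (jb_gt0 x))//.
  rewrite -ler_pdivlMr ?jbX_gt0// (le_trans (hM x))//.
  by rewrite exprD invfM mulrA.
apply: (@cquad_differentiable _ _ _ _ _ (2 * \int[leb]_x G x)) => v.
rewrite !fourierE; under eq_bigr do rewrite fourierE.
rewrite (eq_bigr (fun i => cint leb (fun x => (v ord0 i)%:C%C *
    (cis (dotprod (- xi) x) * mulx i phi x)))); last first.
  by move=> i _; rewrite cintZ//; exact: cis_cintgr.
have [s1 s2] := @cint_sum _ (index_enum 'I_n)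
  (fun i x => (v ord0 i)%:C%C * (cis (dotprod (- xi) x) * mulx i phi x))
  (fun j => cintgrZ _ (cis_cintgr _ (imx j))).
rewrite -s2 -!cintB//; try exact: cis_cintgr; last first.
  by apply: cintgrD; [|apply: cintgrN]; exact: cis_cintgr.
set F := fun x => _.
have FE x : F x = cis (dotprod (- xi) x) * phi x *
    (cis (- dotprod v x) - 1 - ('i * (- dotprod v x)%:C)%C).
  rewrite /F (opprD xi v) dotprodDl cisD (dotprodNl v x).
  set S := \sum_(j <- _) _.
  have -> : S =
      cis (dotprod (- xi) x) * phi x * (- 'i%C) * (dotprod v x)%:C%C.
    rewrite /S /dotprod rmorph_sum mulr_sumr; apply: eq_bigr => i _.
    by rewrite /mulx rmorphM; ring.
  rewrite rmorphN /= 2!mulrBr mulr1 mulrAC; congr (_ - _).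
  by rewrite !mulrN mulNr mulrA.
have bF x : modulus (F x) <= 2 * enorm v ^+ 2 * G x.
  rewrite FE modulusM (modulusM (cis _)) modulus_cis mul1r [leLHS]mulrC.
  apply: (@le_trans _ _ (2 * (- dotprod v x) ^+ 2 * modulus (phi x))).
    by rewrite ler_wpM2r// cis_taylor.
  rewrite sqrrN /G (_ : 2 * enorm v ^+ 2 * _ =
    2 * (enorm v * jb x) ^+ 2 * modulus (phi x)); last by ring.
  rewrite ler_wpM2r// ler_wpM2l//.
  rewrite -(real_normK (num_real (dotprod v x))) lerXn2r ?nnegrE ?mulr_ge0//.
  - by rewrite (ltW (jb_gt0 x)).
  - by rewrite (le_trans (dotprod_le _ _))// ler_wpM2l// lerDr.
have mF : cmeas F.
  rewrite (funext FE); apply: cmeasM.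
    by apply: cmeasM; [exact: cis_cmeas|exact: cintgr_cmeas ip].
  have md : measurable_fun setT (fun x => - dotprod v x : R).
    apply: measurableT_comp => //; apply: continuous_measurable_rV => x.
    by apply: differentiable_continuous; exact: dotprod_differentiable.
  apply: cmeasD.
    by apply: cmeasD; [exact: cmeas_cis|exact: cmeas_cst].
  by apply: cmeasN; apply: cmeasM; [exact: cmeas_cst|exact: cmeas_real].
have iF := cintgr_le mF (integrableRZ _ iG) bF.
apply: (le_trans (modulus_cint_le iF)).
rewrite mulrAC -RintegralZl//; apply: le_Rintegral => //.
- exact: cintgr_modulus.
- exact: integrableRZ.
Qed.

End fourier.

Section fourier2.
Context {R : realType} {n : nat}.
Local Notation E := 'rV[R]_n.
Local Notation C := R[i].
Local Notation leb := (lebesgue_rV n).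
Implicit Types (f g m phi : E -> C) (x y v xi : E) (i : 'I_n).

Lemma smooth_fourier phi : schwartz phi -> smooth (fourier phi).
Proof.
move=> sp; apply: (@smooth_coind _ _ (fun f => exists2 phi, schwartz phi & f = fourier phi)).
  move=> f [{}phi {}sp ->]; split => [x|i]; first by have [] := fourier_diff x sp.
  exists (mulx i phi); first exact: schwartz_mulx.
  by apply/funext => x; have [_ ->] := fourier_diff x sp.
by exists phi.
Qed.

Lemma pderiv_fourier phi i : schwartz phi -> pderiv i (fourier phi) = fourier (mulx i phi).
Proof. by move=> sp; apply/funext => x; have [_ ->] := fourier_diff x sp. Qed.

Lemma enorm_delta i : enorm (delta_mx ord0 i : E) = 1.
Proof. by rewrite /enorm dotprod_delta mxE !eqxx sqrtr1. Qed.

(** Translation invariance takes the place of integration by parts: a difference quotient has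
    integral 0, and by [taylor2_le] it differs from the derivative by [t] times an integrable
    function. *)
Lemma cint_pderiv0 phi i : schwartz phi -> cint leb (pderiv i phi) = 0.
Proof.
move=> sp; set e : E := delta_mx ord0 i.
pose N := (2 * n)%N; have [M hM] := schwartz_Sle 2 N sp.
have M0 := Sle_ge0 hM.
pose K := \int[leb]_x (M * 2 ^+ N * jb x ^- N).
have iK : leb.-integrable setT (fun x => (M * 2 ^+ N * jb x ^- N)%:E).
  by apply: integrableRZ; exact: jb_integrable.
have K0 : 0 <= K.
  by apply: Rintegral_ge0 => x _; rewrite !mulr_ge0 ?exprn_ge0 ?(ltW (jbV_gt0 _ _)).
have key t : 0 < t <= 1 -> modulus (cint leb (pderiv i phi)) <= t * (4 * K).
  move=> /andP[t0 t1].
  have iphi := schwartz_cintgr sp.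
  have it : cintgr leb (fun x => phi (x + t *: e)).
    have := cintgr_affine (t *: e) (oner_neq0 R) iphi.
    by under eq_fun do rewrite scale1r.
  have ip := schwartz_cintgr (schwartz_pderiv i sp).
  have tE : t%:C%C * cint leb (pderiv i phi) = - cint leb (fun x =>
      phi (x + t *: e) - phi x - t%:C%C * pderiv i phi x).
    rewrite !cintB//; [|by apply: cintgrD => //; exact: cintgrN|exact: cintgrZ].
    by rewrite cint_shift// subrr sub0r opprK cintZ.
  have ir : cintgr leb (fun x => phi (x + t *: e) - phi x - t%:C%C * pderiv i phi x).
    apply: cintgrD; last by apply: cintgrN; exact: cintgrZ.
    by apply: cintgrD => //; exact: cintgrN.
  have : t * modulus (cint leb (pderiv i phi)) <= t * (t * (4 * K)).
    rewrite -[X in X * modulus _](ger0_norm (ltW t0)) -modulus_ofreal -modulusM tE modulusN.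
    rewrite (le_trans (modulus_cint_le ir))//.
    rewrite (_ : t * (t * (4 * K)) = (4 * t ^+ 2) * K); last by ring.
    rewrite /K -RintegralZl//; apply: le_Rintegral => //.
    - exact: cintgr_modulus.
    - exact: integrableRZ.
    move=> x _; rewrite (le_trans (taylor2_le (B := M * 2 ^+ N * jb x ^- N) _ _))//.
    - exact: schwartz_smooth.
    - move=> s j; rewrite (ger0_norm (ltW t0)) => st.
      have /BwS[_ /(_ i) /BwS[_ /(_ j) /Bw0 h]] := hM.
      rewrite (le_trans (h _))// -mulrA ler_wpM2l//.
      rewrite ler_pdivlMr ?jbX_gt0// mulrC ler_pdivrMr ?jbX_gt0//.
      rewrite -exprMn lerXn2r ?nnegrE ?mulr_ge0 ?(ltW (jb_gt0 _))//.
      rewrite -{1}(addrK (s *: e) x) (le_trans (jbD _ _))// mulrC.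
      rewrite ler_wpM2r ?(ltW (jb_gt0 _))// /jb enormN enormZ enorm_delta mulr1.
      by rewrite -[leRHS]/(1 + 1) lerD2l (le_trans st).
    - by apply: le_of_eq; ring.
  by rewrite ler_pM2l.
apply: modulus_eq0; apply/eqP; rewrite eq_le modulus_ge0 andbT.
apply/ler_addgt0Pr => e0 e0p; rewrite add0r.
have K1 : 0 < 4 * K + 1 by rewrite ltr_wpDl// mulr_ge0.
pose t := Num.min 1 (e0 / (4 * K + 1)).
have t0 : 0 < t by rewrite lt_min ltr01 divr_gt0.
rewrite (le_trans (key t _))//; first by rewrite t0 ge_min lexx.
rewrite (@le_trans _ _ (t * (4 * K + 1)))//; first by rewrite ler_wpM2l ?(ltW t0)// lerDl.
by rewrite -ler_pdivlMr// ge_min lexx orbT.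
Qed.

Lemma fourier_pderiv phi i xi : schwartz phi ->
  fourier (pderiv i phi) xi = ('i * (xi ord0 i)%:C)%C * fourier phi xi.
Proof.
move=> sp.
have sc := @slow_cis R n (- xi).
have := cint_pderiv0 i (schwartz_slowM sc sp).
rewrite pderivMf; [|exact: slow_smooth|exact: schwartz_smooth].
have ip := schwartz_cintgr sp; have ipd := schwartz_cintgr (schwartz_pderiv i sp).
have -> : (fun x => pderiv i (fun y => cis (dotprod (- xi) y)) x * phi x +
    cis (dotprod (- xi) x) * pderiv i phi x) =
  (fun x => ('i * ((- xi) ord0 i)%:C)%C * (cis (dotprod (- xi) x) * phi x) +
    cis (dotprod (- xi) x) * pderiv i phi x).
  by apply/funext => x; rewrite pderiv_cis mulrA.
rewrite cintD; [|by apply: cintgrZ; exact: cis_cintgr|exact: cis_cintgr].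
rewrite cintZ; last exact: cis_cintgr.
rewrite -!fourierE mxE rmorphN /= mulrN mulNr => /eqP.
by rewrite addrC subr_eq0 => /eqP.
Qed.

Lemma Bw_sum (I : Type) (r : seq I) k w (F : I -> E -> C) :
  (forall j, smooth (F j)) -> (forall j, Bw k w (F j)) ->
  smooth (fun x => \sum_(j <- r) F j x) /\
  Bw k (fun x => (size r)%:R * w x) (fun x => \sum_(j <- r) F j x).
Proof.
move=> sF bF; elim: r => [|a r [IH1 IH2]].
  have -> : (fun x => \sum_(j <- [::]) F j x) = (fun _ => 0 : C).
    by apply/funext => x; rewrite big_nil.
  split; first exact: smooth_cst.
  move=> b x _; rewrite mul0r.
  have -> : pderivs b (fun=> 0) = (fun=> 0) :> (E -> C).
    elim: b => //= i b ->; apply/funext => y; exact: pderiv_cst.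
  by rewrite modulus0.
have -> : (fun x => \sum_(j <- a :: r) F j x) = (fun x => F a x + \sum_(j <- r) F j x).
  by apply/funext => x; rewrite big_cons.
split; first exact: smoothD.
apply: Bw_mono (BwD (sF a) IH1 (bF a) IH2) => // x.
by rewrite /= -natr1 mulrDl mul1r addrC.
Qed.

(** The operator [1 - Laplacian]. Its symbol [1 + dotprod xi xi] is bounded below by 1 and turns
    derivatives of [phi] into decay of the transform. *)
Definition bessel phi : E -> C := fun x => phi x - \sum_(i < n) pderiv i (pderiv i phi) x.

Lemma schwartz_bessel phi : schwartz phi -> schwartz (bessel phi).
Proof.
move=> sp; apply: schwartzB => //; apply: schwartz_sum => j.
by do 2 apply: schwartz_pderiv.
Qed.

Lemma Sle_bessel k N M phi : schwartz phi -> Sle k.+2 N M phi ->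
  Sle k N ((1 + n%:R) * M) (bessel phi).
Proof.
move=> sp hM; have M0 := Sle_ge0 hM.
have s2 j : smooth (pderiv j (pderiv j phi)).
  by do 2 apply: smooth_pderiv; exact: schwartz_smooth.
have b2 j : Bw k (fun x => M * jb x ^- N) (pderiv j (pderiv j phi)).
  by do 2 apply: Bw_pderiv.
have [S1 S2] := @Bw_sum _ (index_enum 'I_n) k _ _ s2 b2.
have bk : Bw k (fun x => M * jb x ^- N) phi.
  by apply: Bw_mono hM => //; rewrite leqW.
apply: Bw_mono (BwB (schwartz_smooth sp) S1 bk S2) => // x.
rewrite /index_enum -enumT size_enum_ord -mulrA mulrDl mul1r lerD2l.
by [].
Qed.

Lemma fourier_bessel phi xi : schwartz phi ->
  fourier (bessel phi) xi = (1 + dotprod xi xi)%:C%C * fourier phi xi.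
Proof.
move=> sp; have ip := schwartz_cintgr sp.
have i2 j : cintgr leb (pderiv j (pderiv j phi)).
  by apply: schwartz_cintgr; do 2 apply: schwartz_pderiv.
rewrite fourierE.
have -> : (fun x => cis (dotprod (- xi) x) * bessel phi x) =
  (fun x => cis (dotprod (- xi) x) * phi x -
    \sum_(j < n) cis (dotprod (- xi) x) * pderiv j (pderiv j phi) x).
  by apply/funext => x; rewrite mulrBr mulr_sumr.
have [s1 s2] := @cint_sum _ _ _ (index_enum 'I_n)
  (fun j x => cis (dotprod (- xi) x) * pderiv j (pderiv j phi) x) (fun j => cis_cintgr _ (i2 j)).
rewrite cintB//; last exact: cis_cintgr.
rewrite s2 -fourierE rmorphD rmorph1 mulrDl mul1r; congr (_ + _).
rewrite /dotprod rmorph_sum mulr_suml -sumrN; apply: eq_bigr => j _.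
rewrite -fourierE fourier_pderiv; last exact: schwartz_pderiv.
rewrite fourier_pderiv// rmorphM /= mulrA -mulNr; congr (_ * _).
have ii : 'i%C * 'i%C = -1 :> C by rewrite -expr2 sqr_i.
by rewrite mulrACA ii mulN1r opprK.
Qed.

End fourier2.

Section fourier3.
Context {R : realType} {n : nat}.
Local Notation E := 'rV[R]_n.
Local Notation C := R[i].
Local Notation leb := (lebesgue_rV n).
Implicit Types (f g m phi : E -> C) (x y v xi : E) (i : 'I_n).

Definition jbint : R := \int[leb]_x (jb x ^- (2 * n)).

Lemma jbint_ge0 : 0 <= jbint.
Proof. by apply: Rintegral_ge0 => x _; rewrite ltW// jbV_gt0. Qed.

Lemma Sle_int_le M phi : cmeas phi -> Sle 0 (2 * n) M phi ->
  \int[leb]_x modulus (phi x) <= M * jbint.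
Proof.
move=> mp hM; have /Bw0 bM := hM.
rewrite /jbint -RintegralZl//; last exact: jb_integrable.
apply: le_Rintegral => //.
- by apply: cintgr_modulus; exact: Sle_integrable hM.
- exact: (integrableRZ M (@jb_integrable R n (2 * n)%N (leqnn _))).
Qed.

(** Decay comes from [N] applications of [bessel], since [jb xi <= 2 * (1 + dotprod xi xi)]. They
    cost [2 * N] derivatives of [phi], and the decay of order [2 * n] makes the result
    integrable. *)
Lemma fourier_Sle0 N : exists (C0 : R) (k L : nat), 0 <= C0 /\
  forall phi M, schwartz phi -> Sle k L M phi -> Sle 0 N (C0 * M) (fourier phi).
Proof.
exists (2 ^+ N * ((1 + n%:R) ^+ N * jbint)), (2 * N)%N, (2 * n)%N; split.
  by rewrite !mulr_ge0 ?exprn_ge0 ?addr_ge0 ?jbint_ge0.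
move=> phi M sp hM.
have H j k : schwartz (iter j bessel phi) /\ (Sle (k + 2 * j) (2 * n) M phi ->
    Sle k (2 * n) ((1 + n%:R) ^+ j * M) (iter j bessel phi)).
  elim: j k => [|j IH] k; first by rewrite muln0 addn0 mul1r.
  have [s1 s2] := IH k.+2; split; first exact: schwartz_bessel.
  rewrite mulnS addnA addn2 => /s2 /(Sle_bessel s1).
  by rewrite exprS mulrA.
have FE j xi : fourier (iter j bessel phi) xi = ((1 + dotprod xi xi) ^+ j)%:C%C * fourier phi xi.
  elim: j => [|j IH]; first by rewrite expr0 mul1r.
  by rewrite /= fourier_bessel ?IH ?exprS ?rmorphM ?mulrA//; have [] := H j 0%N.
have [sN bN] := H N 0%N; have {}bN := bN hM.
apply/Bw0 => xi.
have p0 : 0 < 1 + dotprod xi xi by rewrite ltr_pwDl// dotprod_ge0.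
have : modulus (fourier (iter N bessel phi) xi) <= (1 + n%:R) ^+ N * M * jbint.
  rewrite (le_trans (fourier_le _ (schwartz_cintgr sN)))//.
  by apply: Sle_int_le => //; apply: smooth_cmeas; exact: schwartz_smooth.
rewrite FE modulusM modulus_ofreal ger0_norm ?exprn_ge0 ?(ltW p0)// => h.
rewrite -(ler_pM2l (exprn_gt0 N p0)) (le_trans h)//.
rewrite [leRHS]mulrA ler_pdivlMr ?jbX_gt0//.
set K := (1 + n%:R) ^+ N * M * jbint.
rewrite [leRHS](_ : _ = K * (2 ^+ N * (1 + dotprod xi xi) ^+ N)); last by rewrite /K; ring.
have K0 : 0 <= K by rewrite !mulr_ge0 ?exprn_ge0 ?addr_ge0 ?jbint_ge0// (Sle_ge0 hM).
rewrite ler_wpM2l// -exprMn lerXn2r ?nnegrE ?(ltW (jb_gt0 _))//.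
  by rewrite mulr_ge0// ltW.
rewrite /jb -sqr_enorm; have := sqr_ge0 (1 - enorm xi); have := enorm_ge0 xi; nra.
Qed.

Lemma Sle_mulx k N M phi i : schwartz phi -> Sle k N.+1 M phi ->
  Sle k N (2 ^+ k * M) (mulx i phi).
Proof.
move=> sp hM.
have b1 : Bw k (fun x : E => 1 * jb x ^+ 1) (fun x => - 'i%C * (x ord0 i)%:C%C).
  have sc := slow_smooth (@slow_coord R n i).
  have mi : modulus (- 'i%C : C) = 1.
    by rewrite modulusN modulusE /= expr0n add0r expr1n sqrtr1.
  have bc : Bw k (fun x : E => 1 * jb x ^+ 1) (fun x => (x ord0 i)%:C%C).
    case: k {hM} => [|k].
      apply/Bw0 => x; rewrite modulus_ofreal mul1r expr1.
      by rewrite (le_trans (coord_le_enorm _ _))// lerDr.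
    apply/BwS; split => [x|j].
      rewrite modulus_ofreal mul1r expr1.
      by rewrite (le_trans (coord_le_enorm _ _))// lerDr.
    have -> : pderiv j (fun x : E => (x ord0 i)%:C%C) = fun=> (j == i)%:R.
      by apply/funext => x; rewrite pderiv_coord.
    move=> a x _.
    have : modulus (pderivs a (fun _ : E => (j == i)%:R : C) x) <= 1.
      case/lastP: a => [|a l] /=; first by case: (j == i); rewrite ?modulus1 ?modulus0.
      rewrite pderivs_rcons.
      have -> : pderiv l (fun _ : E => (j == i)%:R : C) = fun=> 0.
        by apply/funext => y; rewrite pderiv_cst.
      have -> : pderivs a (fun _ : E => 0 : C) = fun=> 0.
        by elim: a => //= u a ->; apply/funext => y; rewrite pderiv_cst.
      by rewrite modulus0.
    by move/le_trans; apply; rewrite mul1r expr1.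
  apply: Bw_mono (BwZ (- 'i%C) sc bc) => // x.
  by rewrite mi mul1r.
have s1 : smooth (fun x : E => - 'i%C * (x ord0 i)%:C%C).
  by apply: smoothZ; apply: slow_smooth; exact: slow_coord.
have hM' : Sle k (N + 1) M phi by rewrite addn1.
by have := SleM s1 (schwartz_smooth sp) b1 hM'; rewrite mul1r.
Qed.

Lemma fourier_Sle k N : exists (C0 : R) (k' L : nat), 0 <= C0 /\
  forall phi M, schwartz phi -> Sle k' L M phi -> Sle k N (C0 * M) (fourier phi).
Proof.
elim: k => [|k [C1 [k1 [L1 [C10 IH]]]]]; first exact: fourier_Sle0.
have [C2 [k2 [L2 [C20 H0]]]] := fourier_Sle0 N.
exists (C2 + C1 * 2 ^+ k1), (maxn k1 k2), (maxn L1.+1 L2); split.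
  by rewrite addr_ge0// mulr_ge0 ?exprn_ge0.
move=> phi M sp hM; have M0 := Sle_ge0 hM.
have h1 : Sle k1 L1.+1 M phi by apply: Sle_mono hM; rewrite ?leq_maxl.
have h2 : Sle k2 L2 M phi by apply: Sle_mono hM; rewrite ?leq_maxr.
apply/BwS; split => [x|i].
  have /Bw0 h := H0 phi M sp h2; rewrite (le_trans (h x))// ler_wpM2r ?(ltW (jbV_gt0 _ _))//.
  by rewrite ler_wpM2r// lerDl mulr_ge0 ?exprn_ge0.
rewrite pderiv_fourier//.
apply: Bw_mono (IH _ _ (schwartz_mulx i sp) (Sle_mulx i sp h1)) => // x.
rewrite ler_wpM2r ?(ltW (jbV_gt0 _ _))// mulrA ler_wpM2r// lerDr//.
Qed.

Lemma schwartz_fourier phi : schwartz phi -> schwartz (fourier phi).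
Proof.
move=> sp; apply/schwartzP; split; first exact: smooth_fourier.
move=> k N; have [C0 [k' [L [C00 H]]]] := fourier_Sle k N.
have [M hM] := schwartz_Sle k' L sp.
by exists (C0 * M); exact: H.
Qed.

Lemma ifourierE phi x : ifourier phi x = ((2 * pi) ^- n)%:C%C * fourier phi (- x).
Proof.
rewrite /ifourier; congr (_ * _); apply: eq_cint => xi.
by rewrite dotprodNr opprK dotprodC.
Qed.

Lemma schwartz_opp phi : schwartz phi -> schwartz (fun x => phi (- x)).
Proof.
move=> sp; have N10 : -1 != 0 :> R by rewrite oppr_eq0 oner_neq0.
have := schwartz_affine 0 N10 sp.
by under eq_fun do rewrite scaleN1r addr0.
Qed.

Lemma schwartz_ifourier phi : schwartz phi -> schwartz (ifourier phi).
Proof.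
move=> sp; rewrite (funext (ifourierE phi)).
by apply: schwartzZ; apply: schwartz_opp; exact: schwartz_fourier.
Qed.

Lemma integral_gaus : \int[leb]_(x in setT) gaus (x : E) = Num.sqrt (2 * pi) ^+ n.
Proof.
have mg : measurable_fun setT (fun t : R => expR (- (t ^+ 2 / 2))).
  apply: measurableT_comp => //; apply: measurableT_comp => //.
  by apply: measurable_funM => //; exact: measurable_funX.
rewrite /Rintegral -[RHS]/(fine (_ %:E)).
rewrite -(ge0_integral_rV_prod n mg (fun t => expR_ge0 _) integral_gauss_half).
congr fine; apply: eq_integral => x _; congr (_ %:E).
rewrite -expR_sum /gaus; congr expR; rewrite sumrN /dotprod mulr_suml.
by congr (- _); apply: eq_bigr => i _; rewrite expr2.
Qed.

(** The transform and the Gaussian solve the same first-order system, so their quotient [h] has zero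
    gradient and is constant. Its value at 0 is the Gaussian integral. *)
Lemma fourier_gaus xi :
  fourier (ofreal (@gaus R n)) xi = (Num.sqrt (2 * pi) ^+ n)%:C%C * ofreal (@gaus R n) xi.
Proof.
have sg := @schwartz_gaus R n.
pose ig : E -> R := fun x => (gaus x)^-1.
have gn x : (gaus x : R^o) != 0 by rewrite gt_eqF// gaus_gt0.
have dig x : differentiable (ig : E -> R^o) x.
  by apply: differentiableV => //; have [] := gaus_derive 0 x.
have pig i x : pderiv i (ofreal ig) x = (x ord0 i)%:C%C * ofreal ig x.
  rewrite pderiv_ofreal /ofreal -rmorphM; congr (_%:C)%C.
  have [dg ->] : derivable (gaus : E -> R^o) x (delta_mx ord0 i) /\
     'D_(delta_mx ord0 i) (ig : E -> R^o) x = - gaus x ^- 2 * 'D_(delta_mx ord0 i) (gaus : E -> R^o) x.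
    have dg : derivable (gaus : E -> R^o) x (delta_mx ord0 i).
      by apply: diff_derivable; have [] := gaus_derive 0 x.
    by split => //; rewrite deriveV.
  have [_ ->] := gaus_derive (delta_mx ord0 i) x.
  by rewrite dotprod_delta /ig; field; exact: gn.
pose h x := fourier (ofreal gaus) x * ofreal ig x.
have dF x : cdiff (fourier (ofreal gaus)) x by have [] := fourier_diff x sg.
have pF i x : pderiv i (fourier (ofreal gaus)) x = - (x ord0 i)%:C%C * fourier (ofreal gaus) x.
  rewrite pderiv_fourier//.
  have -> : mulx i (ofreal gaus) = fun x => 'i%C * pderiv i (ofreal gaus) x.
    by apply/funext => y; rewrite pderiv_gaus /mulx; ring.
  rewrite fourierZ; last by apply: schwartz_cintgr; exact: schwartz_pderiv.
  rewrite fourier_pderiv// /= mulrA; congr (_ * _).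
  by rewrite mulrA -expr2 sqr_i mulN1r.
have hc : h xi = h 0.
  have dh x : cdiff h x by apply: cdiffM; [exact: dF|exact: cdiff_ofreal].
  have ph i x : pderiv i h x = 0.
    rewrite pderivM; [|exact: dF|exact: cdiff_ofreal].
    by rewrite pF pig; ring.
  have := @mvt_le _ _ h 0 xi 0 dh; rewrite add0r mulr0 mul0r.
  move=> /(_ _)/wrap[t i _|]; first by rewrite ph modulus0.
  move=> hle; apply/eqP; rewrite -subr_eq0; apply/eqP/modulus_eq0.
  by apply/eqP; rewrite eq_le hle modulus_ge0.
have h0 : h 0 = (Num.sqrt (2 * pi) ^+ n)%:C%C.
  rewrite /h /ofreal /ig /gaus dotprod0l mul0r oppr0 expR0 invr1 mulr1.
  rewrite fourierE oppr0 -integral_gaus.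
  under eq_cint do rewrite dotprod0l cis0 mul1r.
  by apply: complex_eq => //=; rewrite Rintegral_cst// mul0r.
have := hc; rewrite h0 /h => <-; rewrite -mulrA -rmorphM mulVf ?mulr1//.
Qed.

End fourier3.

(** * Fourier inversion *)

Section inversion.
Context {R : realType} {n : nat}.
Local Notation E := 'rV[R]_n.
Local Notation C := R[i].
Local Notation leb := (lebesgue_rV n).
Implicit Types (f g m phi : E -> C) (x y v xi : E) (i : 'I_n).

Lemma eps_le0 (r K : R) : (forall e, 0 < e <= 1 -> r <= e * K) -> r <= 0.
Proof.
move=> H; have [K0|K0] := leP K 0.
  by have := H 1; rewrite ltr01 lexx mul1r => /(_ isT) /le_trans; apply.
apply/ler_addgt0Pr => e e0; rewrite add0r.
pose t := Num.min 1 (e / K).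
have t0 : 0 < t by rewrite lt_min ltr01 divr_gt0.
rewrite (le_trans (H t _))//; first by rewrite t0 ge_min lexx.
by rewrite -ler_pdivlMr// ge_min lexx orbT.
Qed.

Lemma jbM_integrable (f : E -> C) M k : cmeas f -> Sle 0 (2 * n + k) M f ->
  leb.-integrable setT (fun x => (jb x ^+ k * modulus (f x))%:E).
Proof.
move=> mf /Bw0 hM.
apply: (le_integrable measurableT _ _ (integrableRZ M (@jb_integrable R n (2 * n)%N (leqnn _)))).
  apply: measurable_EFin; apply: measurable_funM; last exact: cmeas_modulus.
  by apply: measurable_funX; exact: measurable_jb.
move=> x _ /=; rewrite lee_fin; apply: le_trans (ler_norm _).
rewrite ger0_norm ?mulr_ge0 ?exprn_ge0 ?(ltW (jb_gt0 x))//.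
rewrite mulrC -ler_pdivlMr ?jbX_gt0// (le_trans (hM x))//.
by rewrite exprD invfM mulrA.
Qed.

Lemma cis_dotprodB (x y xi : E) :
  cis (dotprod x xi) * cis (dotprod (- xi) y) = cis (dotprod (- (y - x)) xi).
Proof.
by rewrite -cisD; congr cis; rewrite !(dotprodNl, dotprodDl) (dotprodC xi); ring.
Qed.

Lemma fourier_dilate phi (e : R) xi : 0 < e -> schwartz phi ->
  fourier (fun x => phi (e *: x)) xi = (e ^- n)%:C%C * fourier phi (e^-1 *: xi).
Proof.
move=> e0 sp; rewrite !fourierE.
have ip := cis_cintgr (- (e^-1 *: xi)) (schwartz_cintgr sp).
have := cint_affine 0 (lt0r_neq0 e0) ip; rewrite gtr0_norm// => <-.
apply: eq_cint => x; rewrite !addr0; congr (cis _ * _).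
by rewrite !dotprodNl dotprodZl dotprodZr mulrA mulVf ?mul1r// gt_eqF.
Qed.

(** The double integral is not absolutely convergent, so a Gaussian factor of width [1 / e] is
    inserted. Fubini and rescaling then turn the integral into a Gaussian average of [phi] around
    [x]. Both errors, of the inserted factor and of the average, are linear in [e], so [eps_le0]
    concludes. *)
Lemma ifourierK phi x : schwartz phi -> ifourier (fourier phi) x = phi x.
Proof.
move=> sp; have sF := schwartz_fourier sp.
have ip := schwartz_cintgr sp; have iF := schwartz_cintgr sF.
pose c : R := Num.sqrt (2 * pi) ^+ n.
have c0 : 0 < c by rewrite exprn_gt0// sqrtr_gt0 mulr_gt0// pi_gt0.
have cc : (2 * pi) ^+ n = c * c :> R.
  by rewrite -exprMn -expr2 sqr_sqrtr// mulr_ge0// pi_ge0.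
pose A := cint leb (fun xi => cis (dotprod x xi) * fourier phi xi).
suff HA : A = (c * c)%:C%C * phi x.
  rewrite /ifourier cc; have -> : cintegral (fun xi => cis (dotprod x xi) * fourier phi xi) = A by [].
  rewrite HA mulrA -rmorphM mulVf ?mul1r//.
  by rewrite mulf_neq0// gt_eqF.
have sg := @schwartz_gaus R n.
have mF := smooth_cmeas (schwartz_smooth sF).
have [M1 hM1] := schwartz_Sle 0 (2 * n + 2)%N sF.
have iK1 := jbM_integrable mF hM1.
have [M2 hM2] := schwartz_Sle 0 (2 * n + 1)%N sg.
have iK2 := jbM_integrable (smooth_cmeas (schwartz_smooth sg)) hM2.
have [M3 hM3] := schwartz_Sle 1 0%N sp.
have {}hM3 y i : modulus (pderiv i phi y) <= M3.
  by have /BwS[_ /(_ i) /Bw0 /(_ y)] := hM3; rewrite expr0 invr1 mulr1.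
set K1 := \int[leb]_x (jb x ^+ 2 * modulus (fourier phi x)) in iK1.
apply/eqP; rewrite -subr_eq0; apply/eqP/modulus_eq0/eqP.
rewrite eq_le modulus_ge0 andbT.
pose K2 := \int[leb]_x (jb x ^+ 1 * modulus (ofreal (@gaus R n) x)).
apply: (@eps_le0 _ (K1 + c * (2 * `|M3| * n%:R * K2))) => e /andP[e0 e1].
have ne := lt0r_neq0 e0.
pose ge : E -> C := fun xi => ofreal gaus (e *: xi).
have sge : schwartz ge.
  by have := schwartz_affine 0 ne sg; under eq_fun do rewrite addr0.
have ige := schwartz_cintgr sge.
pose Ae := cint leb (fun xi => cis (dotprod x xi) * (fourier phi xi * ge xi)).
have iAe : cintgr leb (fun xi => cis (dotprod x xi) * (fourier phi xi * ge xi)).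
  by apply: cis_cintgr; apply: schwartz_cintgr; exact: schwartzM.
have step1 : modulus (A - Ae) <= e * K1.
  rewrite /A /Ae -cintB//; last exact: cis_cintgr.
  rewrite (le_trans (modulus_cint_le _))//.
    by apply: cintgrD; [exact: cis_cintgr|exact: cintgrN].
  rewrite /K1 -RintegralZl//; apply: le_Rintegral => //.
  - by apply: cintgr_modulus; apply: cintgrD; [exact: cis_cintgr|exact: cintgrN].
  - exact: (integrableRZ e iK1).
  move=> xi _; rewrite -mulrBr modulusM modulus_cis mul1r -{1}(mulr1 (fourier phi xi)) -mulrBr.
  rewrite modulusM mulrC mulrA ler_wpM2r//.
  rewrite /ge /ofreal -(rmorph1 (real_complex R)) -rmorphB modulus_ofreal.
  have g1 := expR_ge1Dx (- (dotprod (e *: xi) (e *: xi) / 2)).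
  have g2 : gaus (e *: xi) <= 1.
    by rewrite /gaus -expR0 ler_expR lerNl oppr0 divr_ge0// dotprod_ge0.
  rewrite ger0_norm ?subr_ge0// lerBlDl -lerBlDr (le_trans _ g1)//.
  rewrite lerD2l lerN2 dotprodZl dotprodZr -sqr_enorm mulrA -expr2.
  have e2 : e ^+ 2 <= e by rewrite expr2 ler_piMr// ltW.
  have x0 := enorm_ge0 xi.
  rewrite -mulrA (@le_trans _ _ (e * (enorm xi ^+ 2 / 2)))//.
    by rewrite ler_wpM2r// divr_ge0// sqr_ge0.
  by rewrite ler_wpM2l ?(ltW e0)// /jb; have := sqr_ge0 (enorm xi); nra.
have step2 : Ae = c%:C%C * cint leb (fun z => phi (e *: z + x) * ofreal gaus z).
  have -> : Ae = cint leb (fun xi => cint leb (fun y =>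
      (cis (dotprod x xi) * ge xi) * (cis (dotprod (- xi) y) * phi y))).
    apply: eq_cint => xi; rewrite cintZ; last exact: cis_cintgr.
    by rewrite fourierE; ring.
  rewrite (@cfubini _ _ _ _ _ leb leb (fun z =>
      cis (dotprod x z.1) * ge z.1 * (cis (dotprod (- z.1) z.2) * phi z.2))
      (fun xi => modulus (ge xi)) (fun y => modulus (phi y))); last first.
  - by move=> xi y /=; rewrite !modulusM !modulus_cis !mul1r.
  - exact: cintgr_modulus.
  - exact: cintgr_modulus.
  - have m1 (f : E -> C) : cmeas f -> cmeas (fun z : E * E => f z.1).
      by move=> [f1 f2]; split; [apply: (measurableT_comp f1)|apply: (measurableT_comp f2)].
    have m2 (f : E -> C) : cmeas f -> cmeas (fun z : E * E => f z.2).
      by move=> [f1 f2]; split; [apply: (measurableT_comp f1)|apply: (measurableT_comp f2)].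
    apply: cmeasM; first by apply: (m1 (fun xi => cis (dotprod x xi) * ge xi)); apply: cmeasM; [exact: cis_cmeas|exact: cintgr_cmeas ige].
    apply: cmeasM; last by apply: (m2 phi); exact: cintgr_cmeas ip.
    apply: cmeas_cis; under eq_fun do rewrite /dotprod.
    apply: measurable_sum => i; apply: measurable_funM.
      under eq_fun do rewrite mxE; apply: measurableT_comp => //.
      by apply: (measurableT_comp (measurable_rV_coor i)).
    by apply: (measurableT_comp (measurable_rV_coor i)).
  have -> : (fun y => cint leb (fun xi =>
      cis (dotprod x xi) * ge xi * (cis (dotprod (- xi) y) * phi y))) =
      (fun y => phi y * fourier ge (y - x)).
    apply/funext => y; rewrite fourierE -cintZ; last exact: cis_cintgr.
    apply: eq_cint => xi; rewrite -cis_dotprodB; ring.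
  have ig : cintgr leb (fun y => phi y * fourier ge (y - x)).
    apply: schwartz_cintgr; apply: schwartzM => //.
    have := schwartz_affine (- x) (oner_neq0 R) (schwartz_fourier sge).
    by under eq_fun do rewrite scale1r.
  have := cint_affine x ne ig; rewrite (gtr0_norm e0) => h.
  have {}h : cint leb (fun y => phi y * fourier ge (y - x)) = (e ^+ n)%:C%C *
     cint leb (fun x0 => phi (e *: x0 + x) * fourier ge (e *: x0 + x - x)).
    rewrite h mulrA -rmorphM divff ?mul1r//; exact: expf_neq0.
  rewrite h -!cintZ; last 2 first.
  - apply: schwartz_cintgr; apply: schwartzM => //; exact: schwartz_affine.
  - exact: (cintgr_affine x ne ig).
  apply: eq_cint => z; rewrite addrK fourier_dilate// scalerA mulVf// scale1r.
  rewrite fourier_gaus -/c.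
  have -> : (e ^+ n)%:C%C * (phi (e *: z + x) * ((e ^- n)%:C%C * (c%:C%C * ofreal gaus z))) =
     ((e ^+ n)%:C * (e ^- n)%:C)%C * (c%:C%C * (phi (e *: z + x) * ofreal gaus z)) by ring.
  by rewrite -rmorphM divff ?mul1r//; exact: expf_neq0.
have sphe : schwartz (fun z => phi (e *: z + x)) by exact: schwartz_affine.
have step3 : modulus (Ae - (c * c)%:C%C * phi x) <= e * (c * (2 * `|M3| * n%:R * K2)).
  rewrite step2 rmorphM /= -(mulrA c%:C%C) -mulrBr modulusM modulus_ofreal (gtr0_norm c0) mulrCA.
  rewrite ler_wpM2l ?(ltW c0)//.
  have -> : c%:C%C * phi x = cint leb (fun z => phi x * ofreal gaus z).
    rewrite cintZ; last exact: schwartz_cintgr.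
    rewrite mulrC; congr (_ * _); apply: complex_eq => /=; first by rewrite integral_gaus.
    by rewrite Rintegral_cst// mul0r.
  rewrite -cintB; last 2 first.
  - by apply: schwartz_cintgr; exact: schwartzM.
  - by apply: schwartz_cintgr; exact: schwartzZ.
  have id : cintgr leb (fun z => phi (e *: z + x) * ofreal gaus z - phi x * ofreal gaus z).
    by apply: schwartz_cintgr; apply: schwartzB; [exact: schwartzM|exact: schwartzZ].
  rewrite (le_trans (modulus_cint_le id))// mulrA /K2 -RintegralZl//.
  apply: le_Rintegral => //.
  - exact: cintgr_modulus.
  - exact: (integrableRZ _ iK2).
  move=> z _; rewrite -mulrBl modulusM expr1 mulrA ler_wpM2r// (addrC _ x).
  have := @mvt_le _ _ phi x (e *: z) `|M3| (fun y => smooth_cdiff y (schwartz_smooth sp)).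
  move=> /(_ (fun t i _ => le_trans (hM3 _ i) (ler_norm _))) h.
  rewrite (le_trans h)//; have := sum_coord_le (e *: z).
  rewrite enormZ (gtr0_norm e0) => h2.
  rewrite (@le_trans _ _ (2 * `|M3| * (n%:R * (e * enorm z))))//.
    by rewrite ler_wpM2l// mulr_ge0.
  rewrite (_ : _ * (n%:R * _) = e * (2 * `|M3| * n%:R) * enorm z); last by ring.
  by rewrite ler_wpM2l ?lerDr// !mulr_ge0// ltW.
rewrite -(subrK Ae A) -addrA (le_trans (modulusD _ _))//.
by rewrite mulrDr lerD.
Qed.

End inversion.

(** * Fourier multipliers on test functions and distributions *)

Section multop.
Context {R : realType} {n : nat}.
Local Notation E := 'rV[R]_n.
Local Notation C := R[i].
Local Notation leb := (lebesgue_rV n).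
Implicit Types (f g m phi psi : E -> C) (x y v xi : E) (i : 'I_n).

Lemma cmeas_fst f : cmeas f -> cmeas (fun z : E * E => f z.1).
Proof. by move=> [f1 f2]; split; [apply: (measurableT_comp f1)|apply: (measurableT_comp f2)]. Qed.

Lemma cmeas_snd f : cmeas f -> cmeas (fun z : E * E => f z.2).
Proof. by move=> [f1 f2]; split; [apply: (measurableT_comp f1)|apply: (measurableT_comp f2)]. Qed.

Lemma measurable_sub : measurable_fun setT (fun z : E * E => z.1 - z.2).
Proof.
apply: measurable_fun_rV => i; under eq_fun do rewrite !mxE.
apply: measurable_funB.
  by apply: (measurableT_comp (measurable_rV_coor i)).
by apply: (measurableT_comp (measurable_rV_coor i)).
Qed.

Lemma measurable_dotprod2 : measurable_fun setT (fun z : E * E => dotprod z.1 z.2).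
Proof.
apply: measurable_sum => i; apply: measurable_funM.
  by apply: (measurableT_comp (measurable_rV_coor i)).
by apply: (measurableT_comp (measurable_rV_coor i)).
Qed.

Lemma cmeas_sub f : cmeas f -> cmeas (fun z : E * E => f (z.1 - z.2)).
Proof.
by move=> [f1 f2]; split; [apply: (measurableT_comp f1)|apply: (measurableT_comp f2)];
  exact: measurable_sub.
Qed.

Lemma cmeas_cis2 : cmeas (fun z : E * E => cis (dotprod (- z.1) z.2)).
Proof.
apply: cmeas_cis; under eq_fun do rewrite dotprodNl.
by apply: measurableT_comp => //; exact: measurable_dotprod2.
Qed.

Lemma fourierK phi x : schwartz phi -> fourier (ifourier phi) x = phi x.
Proof.
move=> sp; have sF := schwartz_fourier sp.
rewrite -[RHS](ifourierK x sp) ifourierE.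
have N10 : -1 != 0 :> R by rewrite oppr_eq0 oner_neq0.
have so := schwartz_opp sF.
rewrite (funext (ifourierE phi)) fourierZ; last exact: schwartz_cintgr.
congr (_ * _); rewrite !fourierE opprK.
rewrite -cint_opp; last by apply: cis_cintgr; exact: schwartz_cintgr.
by apply: eq_cint => xi; rewrite opprK dotprodNl dotprodNr opprK.
Qed.

(** The transpose of the multiplier operator: [multiplier m u f] is [u (T m f)]. As the inverse
    transform comes first, [T m] has the symbol [m (- xi)] in the usual convention; hence the
    reflections in [cint_T] and [multiplier_toD]. *)
Definition T m phi : E -> C := fourier (fun xi => m xi * ifourier phi xi).

Lemma schwartz_T m phi : slow m -> schwartz phi -> schwartz (T m phi).
Proof.
by move=> sm sp; apply: schwartz_fourier; apply: schwartz_slowM => //; exact: schwartz_ifourier.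
Qed.

Lemma ifourier_T m phi : slow m -> schwartz phi ->
  ifourier (T m phi) = (fun xi => m xi * ifourier phi xi).
Proof.
move=> sm sp; apply/funext => xi; rewrite ifourierK//.
by apply: schwartz_slowM => //; exact: schwartz_ifourier.
Qed.

Lemma T_comp m m' phi : slow m' -> schwartz phi ->
  T m (T m' phi) = T (fun xi => m xi * m' xi) phi.
Proof.
move=> sm sp; rewrite {1}/T ifourier_T//; congr fourier.
by apply/funext => xi; rewrite mulrA.
Qed.

Lemma T_compC m m' phi : slow m -> slow m' -> schwartz phi ->
  T m (T m' phi) = T m' (T m phi).
Proof.
move=> sm sm' sp; rewrite !T_comp//; congr (T _ _).
by apply/funext => xi; rewrite mulrC.
Qed.

Lemma T1 phi : schwartz phi -> T (fun=> 1) phi = phi.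
Proof.
move=> sp; rewrite /T; under eq_fun do rewrite mul1r.
by apply/funext => x; rewrite fourierK.
Qed.

Lemma ifourierD f g : schwartz f -> schwartz g ->
  ifourier (fun x => f x + g x) = (fun xi => ifourier f xi + ifourier g xi).
Proof.
move=> sf sg; apply/funext => xi; rewrite !ifourierE fourierD; try exact: schwartz_cintgr.
by rewrite mulrDr.
Qed.

Lemma ifourierZ (c : C) f : schwartz f ->
  ifourier (fun x => c * f x) = (fun xi => c * ifourier f xi).
Proof.
move=> sf; apply/funext => xi; rewrite !ifourierE fourierZ; last exact: schwartz_cintgr.
by rewrite mulrCA.
Qed.

Lemma TD m f g : slow m -> schwartz f -> schwartz g ->
  T m (fun x => f x + g x) = (fun x => T m f x + T m g x).
Proof.
move=> sm sf sg; rewrite /T ifourierD// -fourierD; first last.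
- by apply: schwartz_cintgr; apply: schwartz_slowM => //; exact: schwartz_ifourier.
- by apply: schwartz_cintgr; apply: schwartz_slowM => //; exact: schwartz_ifourier.
by congr fourier; apply/funext => xi; rewrite mulrDr.
Qed.

Lemma TZ m (c : C) f : slow m -> schwartz f ->
  T m (fun x => c * f x) = (fun x => c * T m f x).
Proof.
move=> sm sf; rewrite /T ifourierZ// -fourierZ; last first.
  by apply: schwartz_cintgr; apply: schwartz_slowM => //; exact: schwartz_ifourier.
by congr fourier; apply/funext => xi; rewrite mulrCA.
Qed.

Lemma TDm m m' f : slow m -> slow m' -> schwartz f ->
  T (fun xi => m xi + m' xi) f = (fun x => T m f x + T m' f x).
Proof.
move=> sm sm' sf; rewrite /T -fourierD; first last.
- by apply: schwartz_cintgr; apply: schwartz_slowM => //; exact: schwartz_ifourier.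
- by apply: schwartz_cintgr; apply: schwartz_slowM => //; exact: schwartz_ifourier.
by congr fourier; apply/funext => xi; rewrite mulrDl.
Qed.

Lemma TZm m (c : C) f : slow m -> schwartz f ->
  T (fun xi => c * m xi) f = (fun x => c * T m f x).
Proof.
move=> sm sf; rewrite /T -fourierZ; last first.
  by apply: schwartz_cintgr; apply: schwartz_slowM => //; exact: schwartz_ifourier.
by congr fourier; apply/funext => xi; rewrite mulrA.
Qed.

Lemma TBm m m' f : slow m -> slow m' -> schwartz f ->
  T (fun xi => m xi - m' xi) f = (fun x => T m f x - T m' f x).
Proof.
move=> sm sm' sf; rewrite TDm//; last exact: slowN.
apply/funext => x; congr (_ + _).
under [X in T X]eq_fun do rewrite -mulN1r.
by rewrite TZm// mulN1r.
Qed.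

Lemma T_cis (a : E) phi x : schwartz phi ->
  T (fun xi => cis (dotprod a xi)) phi x = phi (x - a).
Proof.
move=> sp; rewrite -[RHS](fourierK _ sp) /T !fourierE; apply: eq_cint => xi.
rewrite mulrA -cisD; congr (cis _ * _).
by rewrite !(dotprodNl, dotprodDl); ring.
Qed.

Lemma cint_fourier phi psi : schwartz phi -> schwartz psi ->
  cint leb (fun x => fourier phi x * psi x) = cint leb (fun x => phi x * fourier psi x).
Proof.
move=> sp sq; have ip := schwartz_cintgr sp; have iq := schwartz_cintgr sq.
transitivity (cint leb (fun x => cint leb (fun y => cis (dotprod (- x) y) * phi y * psi x))).
  apply: eq_cint => x; rewrite fourierE mulrC -cintZ; last exact: cis_cintgr.
  by apply: eq_cint => y; rewrite mulrC.
rewrite (@cfubini _ _ _ _ _ leb leb (fun z => cis (dotprod (- z.1) z.2) * phi z.2 * psi z.1)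
  (fun x => modulus (psi x)) (fun y => modulus (phi y))); last first.
- by move=> x y /=; rewrite !modulusM modulus_cis mul1r mulrC.
- exact: cintgr_modulus.
- exact: cintgr_modulus.
- apply: cmeasM; last by apply: cmeas_fst; exact: cintgr_cmeas iq.
  by apply: cmeasM; [exact: cmeas_cis2|apply: cmeas_snd; exact: cintgr_cmeas ip].
apply: eq_cint => y; rewrite fourierE -cintZ; last exact: cis_cintgr.
apply: eq_cint => x /=.
by rewrite !dotprodNl (dotprodC x); ring.
Qed.

Lemma slow_opp m : slow m -> slow (fun x => m (- x)).
Proof.
move=> sm; have := slow_affine (- 1) 0 sm.
by under eq_fun do rewrite scaleN1r addr0.
Qed.

Lemma cint_T m phi psi : slow m -> schwartz phi -> schwartz psi ->
  cint leb (fun x => T m phi x * psi x) =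
  cint leb (fun x => phi x * T (fun xi => m (- xi)) psi x).
Proof.
move=> sm sp sq.
have sip := schwartz_ifourier sp; have siq := schwartz_ifourier sq.
have sFp := schwartz_fourier sp; have sFq := schwartz_fourier sq.
rewrite cint_fourier//; last exact: schwartz_slowM.
rewrite -(@cint_fourier phi (fun xi => m (- xi) * ifourier psi xi))//; last first.
  by apply: schwartz_slowM => //; exact: slow_opp.
rewrite -cint_opp; last first.
  by apply: schwartz_cintgr; apply: schwartzM => //; exact: schwartz_slowM.
apply: eq_cint => xi; rewrite !ifourierE opprK; ring.
Qed.

Definition kern m : E -> C := fun x => ((2 * pi) ^- n)%:C%C * fourier m x.

Lemma T_kern m phi x : schwartz m -> schwartz phi ->
  T m phi x = cint leb (fun y => kern m (x - y) * phi y).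
Proof.
move=> sm sp; have im := schwartz_cintgr sm; have ip := schwartz_cintgr sp.
set c : C := ((2 * pi) ^- n)%:C%C.
transitivity (cint leb (fun xi => cint leb (fun y => c * (cis (dotprod (- x) xi) * m xi) *
    (cis (dotprod (- (- xi)) y) * phi y)))).
  rewrite /T fourierE; apply: eq_cint => xi; rewrite cintZ; last exact: cis_cintgr.
  by rewrite -fourierE ifourierE -/c; ring.
rewrite (@cfubini _ _ _ _ _ leb leb (fun z => c * (cis (dotprod (- x) z.1) * m z.1) *
    (cis (dotprod (- (- z.1)) z.2) * phi z.2))
  (fun xi => modulus c * modulus (m xi)) (fun y => modulus (phi y))); last first.
- by move=> xi y /=; rewrite !modulusM !modulus_cis !mul1r.
- exact: cintgr_modulus.
- by apply: integrableRZ; exact: cintgr_modulus.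
- apply: cmeasM.
    apply: cmeasM; first exact: cmeas_cst.
    apply: (cmeas_fst (f := fun xi => cis (dotprod (- x) xi) * m xi)).
    by apply: cmeasM; [exact: cis_cmeas|exact: cintgr_cmeas im].
  apply: cmeasM; last by apply: cmeas_snd; exact: cintgr_cmeas ip.
  apply: cmeas_cis; under eq_fun do rewrite opprK.
  exact: measurable_dotprod2.
apply: eq_cint => y; rewrite /kern fourierE -cintZ; last exact: cis_cintgr.
rewrite mulrC -cintZ; last by apply: cintgrZ; exact: cis_cintgr.
apply: eq_cint => xi; rewrite -/c opprK.
have -> : cis (dotprod (- (x - y)) xi) = cis (dotprod (- x) xi) * cis (dotprod xi y).
  by rewrite -cisD; congr cis; rewrite !(dotprodNl, dotprodDl) (dotprodC y); ring.
ring.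
Qed.

Lemma schwartz_kern m : schwartz m -> schwartz (kern m).
Proof. by move=> sm; apply: schwartzZ; exact: schwartz_fourier. Qed.

Lemma kern_dilate m (e : R) x : 0 < e -> schwartz m ->
  kern (fun xi => m (e *: xi)) x = (e ^- n)%:C%C * kern m (e^-1 *: x).
Proof. by move=> e0 sm; rewrite /kern fourier_dilate// mulrCA. Qed.

Lemma multiplierE m (u : dist) f : slow m -> schwartz f -> multiplier m u f = u (T m f).
Proof.
move=> sm sf; rewrite /multiplier /difourier /dmul /dfourier /ext0 /patch.
rewrite mem_set// mem_set; last exact: schwartz_ifourier.
by rewrite mem_set//; apply: schwartz_slowM => //; exact: schwartz_ifourier.
Qed.

Lemma multiplier_out m (u : dist) f : ~ schwartz f -> multiplier m u f = 0.
Proof. by move=> sf; rewrite /multiplier /difourier /ext0 /patch memNset. Qed.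

End multop.

(** * Dominated convergence and L^p functions *)

Section Rdct.
Context {R : realType} {d : measure_display} {T : measurableType d}.
Variable mu : {measure set T -> \bar R}.

Lemma integrable_le (f g : T -> R) : measurable_fun setT f ->
  mu.-integrable setT (fun x => (g x)%:E) -> (forall x, `|f x| <= g x) ->
  mu.-integrable setT (fun x => (f x)%:E).
Proof.
move=> mf ig fg; apply: (le_integrable measurableT _ _ ig); first exact: measurable_EFin.
by move=> x _ /=; rewrite lee_fin (le_trans (fg x))// ler_norm.
Qed.

Lemma Rdct (f_ : nat -> T -> R) (f g : T -> R) :
  (forall k, measurable_fun setT (f_ k)) -> measurable_fun setT f ->
  mu.-integrable setT (fun x => (g x)%:E) ->
  (forall k x, `|f_ k x| <= g x) -> (forall x, f_ ^~ x @ \oo --> f x) ->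
  mu.-integrable setT (fun x => (f x)%:E) /\
  (fun k => \int[mu]_x f_ k x) @ \oo --> \int[mu]_x f x.
Proof.
move=> mf_ mf ig fg cf.
have [h1 _ h3] : [/\ mu.-integrable setT (fun x => (f x)%:E),
   (fun k => \int[mu]_x `|(f_ k x)%:E - (f x)%:E|)%E @ \oo --> 0%E &
   (fun k => \int[mu]_x (f_ k x)%:E)%E @ \oo --> (\int[mu]_x (f x)%:E)%E].
  apply: (@dominated_convergence _ T R mu setT measurableT
    (fun k x => (f_ k x)%:E) (fun x => (f x)%:E) (fun x => (g x)%:E)) => //.
  - by move=> k; exact: measurable_EFin.
  - exact: measurable_EFin.
  - by apply/aeW => x _; apply: cvg_EFin; [exact: nearW|exact: cf].
  - by apply/aeW => x k _; rewrite lee_fin.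
split=> //; rewrite /Rintegral.
apply: fine_cvg; rewrite fineK//; exact: integrable_fin_num.
Qed.

Lemma ae_Rintegral0 (f : T -> R) : measurable_fun setT f -> (forall x, 0 <= f x) ->
  mu.-integrable setT (fun x => (f x)%:E) -> \int[mu]_x f x <= 0 ->
  {ae mu, forall x, f x = 0}.
Proof.
move=> mf f0 ifx le0.
have h : (\int[mu]_x (f x)%:E = 0)%E.
  have := integrable_fin_num measurableT ifx.
  move: le0; rewrite /Rintegral.
  have : (0 <= \int[mu]_x (f x)%:E)%E by apply: integral_ge0 => x _; rewrite lee_fin.
  by case: (\int[mu]_x (f x)%:E)%E => //= r r0 r1 _; congr EFin; apply/eqP; rewrite eq_le r1.
have h2 : (\int[mu]_x `|(f x)%:E| = 0)%E.
  by rewrite -h; apply: eq_integral => x _; rewrite gee0_abs ?lee_fin.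
have := (ae_eq_integral_abs mu measurableT (measurable_EFin mf)).1 h2.
by apply: filterS => x /(_ I) /= [].
Qed.

Lemma ae_eq_Rint (f g : T -> R) : measurable_fun setT f -> measurable_fun setT g ->
  {ae mu, forall x, f x = g x} -> \int[mu]_x f x = \int[mu]_x g x.
Proof.
move=> mf mg fg; rewrite /Rintegral; congr fine.
apply: ae_eq_integral => //; [exact: measurable_EFin|exact: measurable_EFin|].
by apply: filterS fg => x /= -> _.
Qed.

End Rdct.

Section Lp.
Context {R : realType} {d : measure_display} {T : measurableType d}.
Variable mu : {measure set T -> \bar R}.
Local Notation C := R[i].
Implicit Types (f g : T -> C) (p q : R).

(** The values are real: an infinite integral is sent to 0 by [fine], so a bound on [Ip] or [Np] is
    informative only together with [Lp]. The variational arguments work with the power [Ip] rather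
    than with the norm. *)
Definition Ip p f : R := \int[mu]_x (modulus (f x) `^ p).
Definition Np p f : R := Ip p f `^ p^-1.
Definition Lp p f := cmeas f /\ mu.-integrable setT (fun x => (modulus (f x) `^ p)%:E).

Lemma Ip_ge0 p f : 0 <= Ip p f.
Proof. by apply: Rintegral_ge0 => x _; exact: powR_ge0. Qed.
Lemma Np_ge0 p f : 0 <= Np p f. Proof. exact: powR_ge0. Qed.

Lemma NpX p f : p != 0 -> Np p f `^ p = Ip p f.
Proof. by move=> p0; rewrite /Np -powRrM mulVf// powRr1// Ip_ge0. Qed.

Lemma ger0_powR_le p (a b : R) : 0 <= p -> 0 <= a -> a <= b -> a `^ p <= b `^ p.
Proof. by move=> p0 a0 ab; apply: ge0_ler_powR; rewrite ?nnegrE// (le_trans a0). Qed.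

Lemma measurable_pow p (h : T -> R) : measurable_fun setT h ->
  measurable_fun setT (fun x => h x `^ p).
Proof. by move=> mh; apply: (measurableT_comp (measurable_powR _)). Qed.

Lemma measurable_modp p f : cmeas f -> measurable_fun setT (fun x => modulus (f x) `^ p).
Proof. by move=> mf; apply: measurable_pow; exact: cmeas_modulus. Qed.

Lemma Lp_le p f (h : T -> R) : 0 <= p -> cmeas f ->
  mu.-integrable setT (fun x => (h x `^ p)%:E) -> (forall x, modulus (f x) <= h x) ->
  Lp p f.
Proof.
move=> p0 mf ih fh; split=> //; apply: (integrable_le _ ih).
  exact: measurable_modp.
by move=> x; rewrite ger0_norm ?powR_ge0//; apply: ger0_powR_le.
Qed.

Lemma Ip_le p f g : 0 <= p -> Lp p f -> Lp p g ->
  (forall x, modulus (f x) <= modulus (g x)) -> Ip p f <= Ip p g.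
Proof.
move=> p0 [_ lf] [_ lg] fg; apply: le_Rintegral => // x _; exact: ger0_powR_le.
Qed.

Lemma Lp0 p : p != 0 -> Lp p (fun=> 0).
Proof.
move=> p0; split; first exact: cmeas_cst.
have -> : (fun x : T => (modulus (0 : C) `^ p)%:E) = (fun=> 0%E).
  by apply/funext => x; rewrite modulus0 powR0.
exact: integrable0.
Qed.

Lemma LpZ p (c : C) f : Lp p f -> Lp p (fun x => c * f x).
Proof.
move=> [mf lf]; split; first by apply: cmeasM => //; exact: cmeas_cst.
have -> : (fun x => (modulus (c * f x) `^ p)%:E) =
    (fun x => (modulus c `^ p * modulus (f x) `^ p)%:E).
  by apply/funext => x; rewrite modulusM powRM.
exact: integrableRZ.
Qed.

Lemma powRD_le p (a b : R) : 0 <= p -> 0 <= a -> 0 <= b ->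
  (a + b) `^ p <= 2 `^ p * (a `^ p + b `^ p).
Proof.
move=> p0; wlog ab : a b / a <= b => [hw a0 b0|a0 b0].
  have [ab|/ltW ba] := leP a b; first exact: hw.
  by rewrite (addrC a) (addrC (a `^ p)); exact: hw.
apply: (@le_trans _ _ ((2 * b) `^ p)).
  by apply: ger0_powR_le => //; [exact: addr_ge0|rewrite mulr_natl mulr2n lerD].
by rewrite powRM// ler_wpM2l ?powR_ge0// lerDr powR_ge0.
Qed.

Lemma LpD p f g : 0 <= p -> Lp p f -> Lp p g -> Lp p (fun x => f x + g x).
Proof.
move=> p0 [mf lf] [mg lg]; have mfg := cmeasD mf mg; split=> //.
have ii : mu.-integrable setT
    (fun x => (2 `^ p * (modulus (f x) `^ p + modulus (g x) `^ p))%:E).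
  by apply: integrableRZ; under eq_fun do rewrite EFinD; exact: integrableD.
apply: (integrable_le _ ii); first exact: measurable_modp.
move=> x; rewrite ger0_norm ?powR_ge0//; apply: le_trans (powRD_le p0 _ _) => //.
by apply: ger0_powR_le => //; exact: modulusD.
Qed.

Lemma LpN p f : Lp p f -> Lp p (fun x => - f x).
Proof.
move=> lf; have -> : (fun x => - f x) = (fun x => (-1) * f x).
  by apply/funext => x; rewrite mulN1r.
exact: LpZ.
Qed.

Lemma LpB p f g : 0 <= p -> Lp p f -> Lp p g -> Lp p (fun x => f x - g x).
Proof. by move=> p0 lf lg; apply: LpD => //; exact: LpN. Qed.

Lemma Lnorm_Np p f : 0 < p -> Lp p f ->
  Lnorm mu p%:E (fun x => (modulus (f x))%:E) = (Np p f)%:E.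
Proof.
move=> p0 [mf lf]; rewrite unlock /Np /Ip /Rintegral.
have -> : (\int[mu]_x `|(modulus (f x))%:E| `^ p = \int[mu]_x (modulus (f x) `^ p)%:E)%E.
  by apply: eq_integral => x _; rewrite gee0_abs ?lee_fin// poweR_EFin.
have := integrable_fin_num measurableT lf.
by case: (\int[mu]_x _)%E => // r _; rewrite poweR_EFin.
Qed.

Lemma Lnorm_Lp p f : 0 < p -> cmeas f ->
  (Lnorm mu p%:E (fun x => (modulus (f x))%:E) < +oo)%E -> Lp p f.
Proof.
move=> p0 mf; rewrite unlock => h; split=> //.
apply/integrableP; split; first by apply: measurable_EFin; exact: measurable_modp.
have h2 := lty_poweRy (lt0r_neq0 _) h; apply: le_lt_trans (h2 _); last by rewrite invr_gt0.
apply: le_of_eq; apply: eq_integral => x _.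
by rewrite !gee0_abs ?lee_fin ?powR_ge0// poweR_EFin.
Qed.

Lemma NpZ p (c : C) f : 0 < p -> Lp p f -> Np p (fun x => c * f x) = modulus c * Np p f.
Proof.
move=> p0 [mf lf]; rewrite /Np.
have -> : Ip p (fun x => c * f x) = modulus c `^ p * Ip p f.
  rewrite /Ip -RintegralZl//; apply: eq_Rintegral => x _.
  by rewrite modulusM powRM.
by rewrite powRM ?powR_ge0 ?Ip_ge0// -powRrM divff ?gt_eqF// powRr1.
Qed.

Lemma NpN p f : Np p (fun x => - f x) = Np p f.
Proof.
suff e : Ip p (fun x => - f x) = Ip p f by rewrite /Np e.
by apply: eq_Rintegral => x _; rewrite modulusN.
Qed.

Lemma Np_le p f g : 0 < p -> Lp p f -> Lp p g ->
  (forall x, modulus (f x) <= modulus (g x)) -> Np p f <= Np p g.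
Proof.
move=> p0 lf lg fg; apply: ger0_powR_le => //; first by rewrite invr_ge0 ltW.
  exact: Ip_ge0.
by apply: Ip_le => //; exact: ltW.
Qed.

Lemma NpD p f g : 1 <= p -> Lp p f -> Lp p g ->
  Np p (fun x => f x + g x) <= Np p f + Np p g.
Proof.
move=> p1 lf lg; have p0 : 0 < p by apply: lt_le_trans p1.
have lfg := LpD (ltW p0) lf lg.
pose h x : C := (modulus (f x) + modulus (g x))%:C%C.
have mh x : modulus (h x) = modulus (f x) + modulus (g x).
  by rewrite modulus_ofreal ger0_norm// addr_ge0.
have rf (k : T -> C) : Lp p k -> Lp p (fun x => (modulus (k x))%:C%C).
  move=> [mk lk]; apply: (Lp_le (ltW p0) _ lk) => [|x].
    by apply: cmeas_real; exact: cmeas_modulus.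
  by rewrite modulus_ofreal ger0_norm.
have lh : Lp p h.
  have := LpD (ltW p0) (rf _ lf) (rf _ lg); congr (Lp p _); apply/funext => x.
  by rewrite /h rmorphD.
apply: (@le_trans _ _ (Np p h)).
  by apply: Np_le => // x; rewrite mh; exact: modulusD.
have := minkowski_EFin mu (cmeas_modulus lf.1) (cmeas_modulus lg.1) p1.
have -> : (EFin \o ((fun x => modulus (f x)) \+ (fun x => modulus (g x))))
    = (fun x => (modulus (h x))%:E) by apply/funext => x; exact: (congr1 EFin (esym (mh x))).
by rewrite /comp !Lnorm_Np// -EFinD lee_fin.
Qed.

Lemma NpB p f g : 1 <= p -> Lp p f -> Lp p g ->
  Np p (fun x => f x - g x) <= Np p f + Np p g.
Proof.
move=> p1 lf lg; have := NpD p1 lf (LpN lg); by rewrite NpN.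
Qed.

Lemma hoelder_int p q f g : 0 < p -> 0 < q -> p^-1 + q^-1 = 1 -> Lp p f -> Lp q g ->
  cintgr mu (fun x => f x * g x) /\
  \int[mu]_x modulus (f x * g x) <= Np p f * Np q g.
Proof.
move=> p0 q0 pq lf lg.
have ii : mu.-integrable setT
    (fun x => (p^-1 * modulus (f x) `^ p + q^-1 * modulus (g x) `^ q)%:E).
  under eq_fun do rewrite EFinD.
  by apply: integrableD => //; apply: integrableRZ; [apply: lf.2|apply: lg.2].
have ci : cintgr mu (fun x => f x * g x).
  apply: (cintgr_le _ ii) => [|x]; first exact: cmeasM lf.1 lg.1.
  rewrite modulusM [p^-1 * _]mulrC [q^-1 * _]mulrC.
  exact: conjugate_powR.
split=> //.
have := hoelder mu (cmeas_modulus lf.1) (cmeas_modulus lg.1) p0 q0 pq.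
rewrite !Lnorm_Np// unlock invr1 poweRe1; last by apply: integral_ge0 => x _; rewrite poweR_ge0.
rewrite -EFinM => h.
have /fineK e : (\int[mu]_x (modulus (f x * g x))%:E)%E \is a fin_num.
  by apply: integrable_fin_num => //; exact: cintgr_modulus.
rewrite /Rintegral -lee_fin e; apply: le_trans h.
apply: le_of_eq; apply: eq_integral => x _.
by rewrite poweRe1//= ger0_norm ?mulr_ge0// modulusM.
Qed.

Lemma hoelder_cint p q f g : 0 < p -> 0 < q -> p^-1 + q^-1 = 1 -> Lp p f -> Lp q g ->
  modulus (cint mu (fun x => f x * g x)) <= Np p f * Np q g.
Proof.
move=> p0 q0 pq lf lg; have [ci le] := hoelder_int p0 q0 pq lf lg.
by apply: le_trans le; exact: modulus_cint_le.
Qed.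

Lemma hoelder_cintgr p q f g : 0 < p -> 0 < q -> p^-1 + q^-1 = 1 -> Lp p f -> Lp q g ->
  cintgr mu (fun x => f x * g x).
Proof. by move=> p0 q0 pq lf lg; have [] := hoelder_int p0 q0 pq lf lg. Qed.

Lemma ae_eq_Np p f g : cmeas f -> cmeas g -> {ae mu, forall x, f x = g x} ->
  Np p f = Np p g.
Proof.
move=> mf mg fg; suff e : Ip p f = Ip p g by rewrite /Np e.
apply: ae_eq_Rint.
- exact: measurable_modp.
- exact: measurable_modp.
- by apply: filterS fg => x /= ->.
Qed.

Lemma ae_eq_cint f g : cmeas f -> cmeas g -> {ae mu, forall x, f x = g x} ->
  cint mu f = cint mu g.
Proof.
move=> [f1 f2] [g1 g2] fg; apply: complex_eq => /=; apply: ae_eq_Rint => //;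
  by apply: filterS fg => x /= ->.
Qed.

End Lp.

(** * Uniform convexity of the p-th power *)

Section uniform_convexity.
Context {R : realType}.
Local Notation C := R[i].
Implicit Types (a b : C) (p q x d : R).

(** Young's inequality for the product [x * 1], multiplied by [p]. *)
Lemma bernoulli p x : 1 < p -> 0 <= x -> 1 + p * (x - 1) <= x `^ p.
Proof.
move=> p1 x0; have p0 : 0 < p by apply: lt_trans p1.
have q0 : 0 < p / (p - 1) by apply: divr_gt0; lra.
have pq : p^-1 + (p / (p - 1))^-1 = 1 by field; apply/andP; split; apply/eqP; lra.
have := conjugate_powR x0 ler01 p0 q0 pq.
rewrite powR1 mulr1 invf_div => h.
have e : p * (x `^ p / p + 1 * ((p - 1) / p)) = x `^ p + (p - 1).
  by field; apply/eqP; lra.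
have : p * x <= p * (x `^ p / p + 1 * ((p - 1) / p)) by rewrite ler_wpM2l// ltW.
by rewrite e; lra.
Qed.

(** A second-order gain without second derivatives: [bernoulli] is applied to the square root [y] of
    [1 + d] and squared, and the square of [1 + p * (y - 1)] is [1 + p * (y ^+ 2 - 1)] plus the
    positive term [(p ^+ 2 - p) * (y - 1) ^+ 2]. *)
Lemma bernoulli_gap p d : 1 < p -> 0 <= d <= 1 ->
  1 + p * d + (p ^+ 2 - p) * (d / 3) ^+ 2 <= (1 + d) `^ p.
Proof.
move=> p1 /andP[d0 d1]; pose y := Num.sqrt (1 + d).
have y0 : 0 <= y by exact: sqrtr_ge0.
have yy : y ^+ 2 = 1 + d by rewrite sqr_sqrtr// addr_ge0.
have yd : 1 + d / 3 <= y.
  rewrite -(@ler_pXn2r _ 2)// ?nnegrE//; last by apply: addr_ge0 => //; apply: divr_ge0.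
  by rewrite yy; nra.
have b := bernoulli p1 y0.
have -> : (1 + d) `^ p = (y `^ p) ^+ 2.
  by rewrite -yy !expr2 powRM.
have b1 : 1 <= 1 + p * (y - 1) by rewrite lerDl mulr_ge0; lra.
have b2 : (1 + p * (y - 1)) ^+ 2 <= (y `^ p) ^+ 2.
  by rewrite ler_pXn2r// nnegrE ?powR_ge0//; lra.
apply: le_trans b2.
have e : (1 + p * (y - 1)) ^+ 2 = 1 + p * (y ^+ 2 - 1) + (p ^+ 2 - p) * (y - 1) ^+ 2.
  by ring.
rewrite e yy; have -> : 1 + d - 1 = d by ring.
have pp : 0 <= p ^+ 2 - p by nra.
rewrite lerD2l ler_wpM2l// ler_pXn2r// ?nnegrE; lra.
Qed.

Lemma powR_mid p d : 1 < p -> 0 <= d <= 1 ->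
  1 + (p ^+ 2 - p) / 18 * d ^+ 2 <= ((1 + d) `^ p + (1 - d) `^ p) / 2.
Proof.
move=> p1 d01; have h1 := bernoulli_gap p1 d01.
have /(bernoulli p1) h2 : 0 <= 1 - d by lra.
have e : (p ^+ 2 - p) * (d / 3) ^+ 2 = 2 * ((p ^+ 2 - p) / 18 * d ^+ 2) by field.
rewrite e in h1; set z := _ / 18 * _ in h1 *; lra.
Qed.

(** The defect of midpoint convexity of the [p]-th power of the modulus. *)
Definition pgap p a b : R :=
  (modulus a `^ p + modulus b `^ p) / 2 - modulus ((2^-1)%:C%C * (a + b)) `^ p.

Lemma modulus_half a b : modulus ((2^-1)%:C%C * (a + b)) = modulus (a + b) / 2.
Proof. by rewrite modulusM modulus_ofreal ger0_norm// mulrC. Qed.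

Lemma parallelogram a b :
  modulus (a + b) ^+ 2 + modulus (a - b) ^+ 2 = 2 * (modulus a ^+ 2 + modulus b ^+ 2).
Proof. by rewrite !sqr_modulus !(ReD, ImD, ReN, ImN); ring. Qed.

(** Apart from [modulus (a + b)], only the two moduli enter [pgap]. Their mean [m] and relative gap
    [d] reduce estimates to [powR_mid]. *)
Lemma polar a b : (a = 0 /\ b = 0) \/ exists m d : R, [/\ 0 < m, 0 <= d <= 1 &
  (modulus a = m * (1 + d) /\ modulus b = m * (1 - d)) \/
  (modulus b = m * (1 + d) /\ modulus a = m * (1 - d))].
Proof.
wlog ab : a b / modulus b <= modulus a => [hw|].
  have [ba|/ltW ab] := leP (modulus b) (modulus a); first exact: hw.
  have [[]|[m [d [m0 d01 h]]]] := hw b a ab; first by left.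
  by right; exists m, d; split => //; case: h; [right|left].
have [b0 a0] := (modulus_ge0 b, modulus_ge0 a).
have [m0|] := eqVneq (modulus a + modulus b) 0.
  by left; split; apply: modulus_eq0; lra.
rewrite neq_lt ltNge addr_ge0//= => mgt; right.
pose m := (modulus a + modulus b) / 2; have m0 : 0 < m by rewrite divr_gt0.
pose d := (modulus a - modulus b) / (2 * m).
have md : m * d = (modulus a - modulus b) / 2 by rewrite /d; field; apply/eqP; lra.
have md2 : 2 * m = modulus a + modulus b by rewrite /m; field.
exists m, d; split => //; last by left; rewrite mulrDr mulrBr md; lra.
apply/andP; split; first by rewrite divr_ge0 ?subr_ge0// mulr_ge0// ltW.
by rewrite ler_pdivrMr ?mulr_gt0//; lra.
Qed.

Lemma pgap_ge0 p a b : 1 < p -> 0 <= pgap p a b.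
Proof.
move=> p1; have p0 : 0 < p by apply: lt_trans p1.
rewrite /pgap subr_ge0 modulus_half.
have [[-> ->]|[m [d [m0 d01 h]]]] := polar a b.
  rewrite addr0 modulus0 mul0r powR0 ?gt_eqF// divr_ge0// addr_ge0//.
have -> : modulus a `^ p + modulus b `^ p = m `^ p * ((1 + d) `^ p + (1 - d) `^ p).
  rewrite mulrDr -!powRM ?(ltW m0)//; try lra.
  by case: h => -[-> ->]//; rewrite addrC.
have le : modulus (a + b) / 2 <= m.
  by have := modulusD a b; case: h => -[-> ->]; lra.
apply: (@le_trans _ _ (m `^ p)).
  by apply: ger0_powR_le => //; [exact: ltW|rewrite divr_ge0].
have mp : 0 <= m `^ p by exact: powR_ge0.

have pp : 0 <= (p ^+ 2 - p) / 18 * d ^+ 2.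
  by rewrite mulr_ge0 ?sqr_ge0// divr_ge0//; nra.
have := powR_mid p1 d01; move: ((1 + d) `^ p + _) => w h1.
by rewrite -mulrA ler_peMr//; lra.
Qed.

(** Strict convexity has two sources. If the moduli differ, that is [eta / 2 <= d], then [powR_mid]
    provides the gap [c1]. Otherwise the parallelogram identity shortens [a + b]: half its modulus
    is at most [m * ka], where [ka ^+ 2] is [1 + eta ^+ 2 / 4 - eta ^+ 2], and the gap is [c2]. *)
Lemma pgap_far p (eta : R) : 1 < p -> 0 < eta < 1 -> exists2 c, 0 < c &
  forall a b, eta * (modulus a + modulus b) <= modulus (a - b) ->
    c * (modulus a + modulus b) `^ p <= pgap p a b.
Proof.
move=> p1 /andP[e0 e1]; have p0 : 0 < p by apply: lt_trans p1.
pose ka := Num.sqrt (1 - 3 / 4 * eta ^+ 2).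
have k0 : 0 <= ka by exact: sqrtr_ge0.
have kk : ka ^+ 2 = 1 - 3 / 4 * eta ^+ 2 by rewrite sqr_sqrtr//; nra.
have k1 : ka < 1 by nra.
have kp1 : ka `^ p < 1.
  have [->|kn0] := eqVneq ka 0; first by rewrite powR0 ?gt_eqF.
  have := gt0_ltr_powR p0 (x := ka) (y := 1); rewrite powR1; apply=> //; by rewrite nnegrE.
have pp : 0 < p ^+ 2 - p by nra.
pose c1 := (p ^+ 2 - p) / 18 * (eta / 2) ^+ 2.
have c10 : 0 < c1 by rewrite mulr_gt0 ?divr_gt0// exprn_gt0// divr_gt0.
pose c2 := 1 - ka `^ p.
have c20 : 0 < c2 by rewrite subr_gt0.
exists (Num.min c1 c2 / 2 `^ p); first by rewrite divr_gt0 ?powR_gt0// lt_min c10.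
move=> a b far; rewrite /pgap modulus_half.
have [[-> ->]|[m [d [m0 d01 h]]]] := polar a b.
  by rewrite addr0 modulus0 mul0r !addr0 powR0 ?gt_eqF//; lra.
have sm : modulus a + modulus b = 2 * m by case: h => -[-> ->]; ring.
have -> : modulus a `^ p + modulus b `^ p = m `^ p * ((1 + d) `^ p + (1 - d) `^ p).
  rewrite mulrDr -!powRM ?(ltW m0)//; try lra.
  by case: h => -[-> ->]//; rewrite addrC.
have -> : Num.min c1 c2 / 2 `^ p * (modulus a + modulus b) `^ p = m `^ p * Num.min c1 c2.
  by rewrite sm powRM ?(ltW m0)// mulrA divfK ?gt_eqF ?powR_gt0// mulrC.
have mid := powR_mid p1 d01.
have mp : 0 < m `^ p by exact: powR_gt0.
have le : modulus (a + b) / 2 <= m.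
  by have := modulusD a b; rewrite sm; lra.
rewrite lerBrDr; set w := (1 + d) `^ p + _ in mid *.
rewrite -mulrA.
have [dbig|dsmall] := leP (eta / 2) d.
  have h1 : (modulus (a + b) / 2) `^ p <= m `^ p.
    by apply: ger0_powR_le => //; [exact: ltW|rewrite divr_ge0].
  have h2 : Num.min c1 c2 <= (p ^+ 2 - p) / 18 * d ^+ 2.
    rewrite ge_min; apply/orP; left; rewrite /c1 ler_wpM2l ?divr_ge0 ?(ltW pp)//.
    by rewrite ler_pXn2r// nnegrE; lra.
  nra.
have h1 : (modulus (a + b) / 2) `^ p <= m `^ p * ka `^ p.
  rewrite -powRM ?(ltW m0)//; apply: ger0_powR_le => //; [exact: ltW|by rewrite divr_ge0|].
  rewrite -(@ler_pXn2r _ 2)// ?nnegrE ?divr_ge0 ?mulr_ge0 ?(ltW m0)//.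
  have := parallelogram a b.
  have f2 : (2 * m * eta) ^+ 2 <= modulus (a - b) ^+ 2.
    rewrite ler_pXn2r ?nnegrE ?mulr_ge0 ?(ltW m0) ?(ltW e0)//.
    by apply: le_trans far; rewrite sm mulrC.
  have -> : modulus a ^+ 2 + modulus b ^+ 2 = 2 * m ^+ 2 * (1 + d ^+ 2).
    by case: h => -[-> ->]; ring.
  have d2 : m ^+ 2 * d ^+ 2 <= m ^+ 2 * (eta ^+ 2 / 4) by rewrite ler_wpM2l ?sqr_ge0//; nra.
  by rewrite !exprMn kk exprVn; lra.
have h2 : Num.min c1 c2 <= 1 - ka `^ p by rewrite ge_min lexx orbT.
have h3 : 1 <= w / 2.
  by apply: (le_trans _ mid); rewrite lerDl mulr_ge0 ?sqr_ge0// divr_ge0// ltW.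
nra.
Qed.

(** The form is chosen for integration: the bound holds for all [a], [b]. Pairs whose difference is
    small relative to their size go into the term with [e], all others into the term with [K] by
    [pgap_far]. *)
Lemma unif_convex p (e : R) : 1 < p -> 0 < e -> exists2 K, 0 <= K & forall a b,
  modulus (a - b) `^ p <= e * (modulus a `^ p + modulus b `^ p) + K * pgap p a b.
Proof.
move=> p1 e0; have p0 : 0 < p by apply: lt_trans p1.
pose t := (e / 2 `^ p) `^ p^-1.
have t0 : 0 < t by rewrite powR_gt0// divr_gt0// powR_gt0.
pose eta := Num.min (1 / 2) t.
have e01 : 0 < eta < 1.
  by rewrite lt_min t0 andbT gt_min; apply/andP; split; last (apply/orP; left); lra.
have ep : eta `^ p * 2 `^ p <= e.
  apply: (@le_trans _ _ (t `^ p * 2 `^ p)).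
    rewrite ler_wpM2r ?powR_ge0// ger0_powR_le ?(ltW p0)//; first by case/andP: e01 => /ltW.
    by rewrite ge_min lexx orbT.
  rewrite -powRrM mulVf ?gt_eqF// powRr1 ?divfK ?gt_eqF ?powR_gt0//.
  by rewrite divr_ge0 ?powR_ge0// ltW.
have [c c0 hc] := pgap_far p1 e01.
exists c^-1 => [|a b]; first by rewrite invr_ge0 ltW.
have g0 := pgap_ge0 a b p1.
have [far|near] := leP (eta * (modulus a + modulus b)) (modulus (a - b)).
  apply: ler_wpDl; first by rewrite mulr_ge0 ?(ltW e0)// addr_ge0 ?powR_ge0.
  rewrite ler_pdivlMl//; apply: le_trans (hc _ _ far).
  rewrite ler_wpM2l ?(ltW c0)// ger0_powR_le ?(ltW p0)//; exact: modulusB.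
apply: ler_wpDr; first by rewrite mulr_ge0// invr_ge0 ltW.
apply: (@le_trans _ _ ((eta * (modulus a + modulus b)) `^ p)).
  by apply: ger0_powR_le => //; exact: ltW.
rewrite powRM ?addr_ge0//; last by case/andP: e01 => /ltW.
apply: le_trans (ler_wpM2l (powR_ge0 _ _) (powRD_le (ltW p0) _ _)) _ => //.
by rewrite mulrA ler_wpM2r// addr_ge0 ?powR_ge0.
Qed.

(** The duality map, that is the gradient of the [p]-th power of the modulus divided by [p]. The
    factor conjugate to [a] makes the value at 0 equal to 0 whatever the power gives there. *)
Definition dualv p a : C := (modulus a `^ (p - 2))%:C%C * (a^*)%C.

Lemma modulus_dualv p a : 1 < p -> modulus (dualv p a) = modulus a `^ (p - 1).
Proof.
move=> p1; rewrite modulusM modulus_ofreal modulus_conj ger0_norm ?powR_ge0//.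
have [->|/modulus_gt0 a0] := eqVneq a 0.
  by rewrite modulus0 mulr0 powR0// gt_eqF// subr_gt0.
rewrite -[X in _ * X]powRr1// -powRD; first by congr (_ `^ _); lra.
by rewrite (gt_eqF a0) implybT.
Qed.

Lemma mul_conj a : a * (a^*)%C = (modulus a ^+ 2)%:C%C.
Proof.
by apply: complex_eq; rewrite ?(ReM, ImM) sqr_modulus; case: a => x y /=; ring.
Qed.

Lemma dualv_mul p a : 1 < p -> dualv p a * a = (modulus a `^ p)%:C%C.
Proof.
move=> p1; rewrite /dualv -mulrA [_ * a]mulrC mul_conj -rmorphM /=; congr (_%:C)%C.
have [->|/modulus_gt0 a0] := eqVneq a 0.
  by rewrite modulus0 expr0n mulr0 powR0// gt_eqF// (lt_trans _ p1).
rewrite -powR_mulrn// -powRD; first by congr (_ `^ _); rewrite subrK.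
by rewrite (gt_eqF a0) implybT.
Qed.

(** The supporting-line inequality of the convex function [modulus b] to the power [p], obtained
    from Young's inequality for [modulus b] and the power [p - 1] of [modulus a]. *)
Lemma dualv_grad p q a b : 1 < p -> p^-1 + q^-1 = 1 -> 0 < q ->
  modulus a `^ p + p * complex.Re (dualv p a * (b - a)) <= modulus b `^ p.
Proof.
move=> p1 pq q0; have p0 : 0 < p by apply: lt_trans p1.
rewrite mulrBr dualv_mul// ReD ReN /=.
have h1 : complex.Re (dualv p a * b) <= modulus b * modulus a `^ (p - 1).
  apply: le_trans (ler_norm _) _; apply: le_trans (Re_le_modulus _) _.
  by rewrite modulusM modulus_dualv// mulrC.
have h2 := conjugate_powR (modulus_ge0 b) (powR_ge0 (modulus a) (p - 1)) p0 q0 pq.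
have e1 : (p - 1) * q = p.
  have -> : q = (1 - p^-1)^-1 by rewrite -pq addrAC subrr add0r invrK.
  by field; apply/andP; split; apply/eqP; lra.
rewrite -powRrM e1 in h2.
have e2 : q^-1 = 1 - p^-1 by rewrite -pq addrAC subrr add0r.
rewrite e2 in h2.
have h3 : p * (modulus b `^ p / p + modulus a `^ p * (1 - p^-1)) =
   modulus b `^ p + (p - 1) * modulus a `^ p by field; apply/eqP; lra.
have : p * complex.Re (dualv p a * b) <= modulus b `^ p + (p - 1) * modulus a `^ p.
  by rewrite -h3 ler_wpM2l ?(ltW p0)//; exact: le_trans h2.
by move: (modulus a `^ p) (modulus b `^ p) (complex.Re _) => x y z; lra.
Qed.

End uniform_convexity.

(** * Completeness of L^p *)

Section completeness.
Context {R : realType} {d : measure_display} {T : measurableType d}.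
Variable mu : {measure set T -> \bar R}.
Local Notation C := R[i].

Lemma sum_half_le n : \sum_(0 <= k < n) (2 ^- k : R) <= 2.
Proof.
have -> : \sum_(0 <= k < n) (2 ^- k : R) = 2 - 2 * 2 ^- n.
  elim: n => [|n IHn]; first by rewrite big_geq// expr0 invr1; ring.
  by rewrite big_nat_recr//= IHn exprS invfM; move: (_ ^- n) => t; field.
by rewrite lerBlDr lerDl mulr_ge0// invr_ge0 exprn_ge0.
Qed.

(** The series of the [a k] has integral at most 2, hence is finite almost everywhere, and its sum
    dominates each term. *)
Lemma series_dom (a : nat -> T -> R) :
  (forall k, measurable_fun setT (a k)) -> (forall k x, 0 <= a k x) ->
  (forall k, mu.-integrable setT (fun x => (a k x)%:E)) ->
  (forall k, \int[mu]_x a k x <= 2 ^- k) ->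
  exists (A : set T) (s : T -> R), [/\ measurable A, {ae mu, forall x, A x},
    measurable_fun setT s, mu.-integrable setT (fun x => (s x)%:E) &
    forall k x, A x -> a k x <= s x].
Proof.
move=> ma a0 ia ba; pose S x := (\sum_(0 <= k <oo) (a k x)%:E)%E.
have mS : measurable_fun setT S.
  by apply: ge0_emeasurable_sum => [k x _ _|k _]; [rewrite lee_fin|exact: measurable_EFin].
have S0 x : (0 <= S x)%E by apply: nneseries_ge0 => k _ _; rewrite lee_fin.
have iS : mu.-integrable setT S.
  apply/integrableP; split => //.
  have -> : (\int[mu]_x `|S x| = \sum_(0 <= k <oo) \int[mu]_x (a k x)%:E)%E.
    rewrite -integral_nneseries//.
    - by apply: eq_integral => x _; rewrite gee0_abs.
    - by move=> k; exact: measurable_EFin.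
    - by move=> k x _; rewrite lee_fin.
  apply: (@le_lt_trans _ _ 2%:E); last exact: ltry.
  apply: lime_le.
    by apply: is_cvg_nneseries => k _ _; apply: integral_ge0 => x _; rewrite lee_fin.
  apply: nearW => n; apply: (@le_trans _ _ (\sum_(0 <= k < n) (2 ^- k : R)%:E)%E).
    apply: lee_sum => k _; have /fineK <- := integrable_fin_num measurableT (ia k).
    by rewrite lee_fin; exact: ba.
  by rewrite sumEFin lee_fin sum_half_le.
exists [set x | (S x < +oo)%E], (fun x => fine (S x)); split.
- have -> : [set x | (S x < +oo)%E] = setT `&` [set x | (S x < +oo)%E] by rewrite setTI.
  exact: emeasurable_fun_infty_o.
- have := integrable_ae measurableT iS; apply: filterS => x /(_ I).
  by rewrite ge0_fin_numE.
- exact: (measurableT_comp (fine_measurable measurableT)).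
- apply: (le_integrable measurableT _ _ iS).
    by apply: measurable_EFin; exact: (measurableT_comp (fine_measurable measurableT)).
  move=> x _ /=; have := S0 x; case: (S x) => [r| |]//= _.
  by rewrite normr0 leey.
- move=> k x /= Sx.
  have /fineK e : S x \is a fin_num by rewrite ge0_fin_numE.
  rewrite -lee_fin e /S (@nneseriesD1 _ _ k)//; last by move=> i _; rewrite lee_fin.
  by rewrite leeDl// nneseries_ge0// => i _ _; rewrite lee_fin.
Qed.

(** The correction [2 * M * 2 ^- k] absorbs the increments, so both [a] and [- a] become
    nonincreasing after adding it. The two limits are opposite, which gives convergence and rate
    together. *)
Lemma geo_cauchy (a : nat -> R) (M : R) :
  (forall k, `|a k.+1 - a k| <= M * 2 ^- k) ->
  exists l, a @ \oo --> l /\ forall k, `|a k - l| <= 2 * M * 2 ^- k.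
Proof.
move=> h; have M0 : 0 <= M.
  by have := h 0%N; rewrite expr0 invr1 mulr1; apply: le_trans.
have e k : (2 : R) ^- k.+1 = 2 ^- k / 2 by rewrite exprS invfM mulrC.
have step k : 0 < (2 : R) ^- k by rewrite invr_gt0 exprn_gt0.
pose u k := a k + 2 * M * 2 ^- k; pose v k := - a k + 2 * M * 2 ^- k.
have du : nonincreasing_seq u.
  apply/nonincreasing_seqP => k; rewrite /u e.
  by have := h k; rewrite ler_norml => /andP[_]; lra.
have dv : nonincreasing_seq v.
  apply/nonincreasing_seqP => k; rewrite /v e.
  by have := h k; rewrite ler_norml => /andP[]; lra.
have uv k : u k + v k >= 0.
  by rewrite /u /v; have := mulr_ge0 M0 (ltW (step k)); lra.
have bnd (f g : nat -> R) : nonincreasing_seq f -> nonincreasing_seq g ->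
    (forall k, f k + g k >= 0) -> has_lbound (range f).
  move=> df dg fg; exists (- g 0%N) => _ [k _ <-].
  by have := fg k; have := dg 0%N k (leq0n k); lra.
have cu : cvgn u by apply: nonincreasing_is_cvgn => //; exact: (bnd _ v).
have cv : cvgn v.
  by apply: nonincreasing_is_cvgn => //; apply: (bnd _ u) => // k; rewrite addrC.
have g0 : (fun k => 2 * M * (2 : R) ^- k) @ \oo --> 2 * M * 0.
  apply: cvgM; first exact: cvg_cst.
  have -> : (fun k => (2 : R) ^- k) = (fun k => (2^-1) ^+ k).
    by apply/funext => k; rewrite exprVn.
  by apply: cvg_expr; rewrite ger0_norm//; lra.
rewrite mulr0 in g0.
have ca : a @ \oo --> limn u.
  have -> : a = (fun k => u k - 2 * M * (2 : R) ^- k).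
    by apply/funext => k; rewrite /u addrK.
  by rewrite -[limn u]subr0; apply: cvgB.
have ev : limn v = - limn u.
  apply/cvg_lim => //; have -> : v = (fun k => - a k + 2 * M * (2 : R) ^- k) by [].
  by rewrite -[- _]addr0; apply: cvgD => //; exact: cvgN.
exists (limn u); split => // k.
have := nonincreasing_cvgn_ge du cu k; have := nonincreasing_cvgn_ge dv cv k.
rewrite ev /u /v ler_norml => h1 h2; apply/andP; split; lra.
Qed.

(** The increments are weighted by [w k] so that [series_dom] applies to their [p]-th powers. Almost
    everywhere the [k]-th increment is then at most [S x * 2 ^- k] with [S] in [L^p], and the limit
    inherits this rate in norm. The indicator of [A] in [h] makes the pointwise bounds hold
    everywhere. *)
Lemma Lp_cauchy (p : R) (g : nat -> T -> C) : 0 < p -> (forall k, Lp mu p (g k)) ->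
  (forall k, Ip mu p (fun x => g k.+1 x - g k x) <= (2 ^- k * (2 ^- k) `^ p)) ->
  exists f, Lp mu p f /\
    exists M, forall k, Np mu p (fun x => g k x - f x) <= M * 2 ^- k.
Proof.
move=> p0 lg ig.
have tk k : 0 < (2 : R) ^- k by rewrite invr_gt0 exprn_gt0.
pose w k : R := ((2 ^- k) `^ p)^-1.
have w0 k : 0 < w k by rewrite invr_gt0 powR_gt0.
have ld k : Lp mu p (fun x => g k.+1 x - g k x) by apply: LpB => //; exact: ltW.
have [A [s [mA aA ms is_ As]]] : exists (A : set T) (s : T -> R), [/\ measurable A,
    {ae mu, forall x, A x}, measurable_fun setT s, mu.-integrable setT (fun x => (s x)%:E) &
    forall k x, A x -> w k * modulus (g k.+1 x - g k x) `^ p <= s x].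
  apply: series_dom => [k|k x|k|k].
  - by apply: measurable_funM => //; apply: measurable_modp; exact: (ld k).1.
  - by rewrite mulr_ge0 ?powR_ge0// ltW.
  - by apply: integrableRZ; exact: (ld k).2.
  - rewrite RintegralZl//; last exact: (ld k).2.
    rewrite /w ler_pdivrMl ?powR_gt0// mulrC; exact: ig.
pose S x := (Num.max 0 (s x)) `^ p^-1.
pose h k x : C := g k x * (\1_A x : R)%:C%C.
have hg x : A x -> forall k, h k x = g k x.
  by move=> Ax k; rewrite /h indicE mem_set// mulr1.
have hg0 x : ~ A x -> forall k, h k x = 0.
  by move=> Ax k; rewrite /h indicE memNset// mulr0.
have mh k : cmeas (h k).
  apply: cmeasM; first exact: (lg k).1.
  by apply: cmeas_real; exact: measurable_indic.
have bnd k x : modulus (h k.+1 x - h k x) <= S x * 2 ^- k.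
  have [Ax|nAx] := pselect (A x); last first.
    by rewrite !hg0// subr0 modulus0 mulr_ge0 ?powR_ge0// ltW.
  rewrite !hg//.
  have := As k x Ax; rewrite ler_pdivrMl ?powR_gt0// => b.
  have b2 : modulus (g k.+1 x - g k x) `^ p <= (2 ^- k) `^ p * Num.max 0 (s x).
    by apply: le_trans b _; rewrite ler_wpM2l ?powR_ge0// le_max lexx orbT.
  have p1 : 0 <= p^-1 by rewrite invr_ge0 ltW.
  have := ger0_powR_le p1 (powR_ge0 _ _) b2.
  by rewrite powRM ?powR_ge0 ?le_max ?lexx// -!powRrM divff ?gt_eqF// !powRr1// ?(ltW (tk k))// mulrC.
have [f hf] : exists f : T -> C, forall x,
    [/\ (fun k => complex.Re (h k x)) @ \oo --> complex.Re (f x),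
        (fun k => complex.Im (h k x)) @ \oo --> complex.Im (f x) &
        forall k, modulus (h k x - f x) <= 4 * S x * 2 ^- k].
  suff /choice : forall x, exists c : C,
      [/\ (fun k => complex.Re (h k x)) @ \oo --> complex.Re c,
        (fun k => complex.Im (h k x)) @ \oo --> complex.Im c &
        forall k, modulus (h k x - c) <= 4 * S x * 2 ^- k] by case=> f hf; exists f.
  move=> x.
  have [l1 [c1 b1]] : exists l, (fun k => complex.Re (h k x)) @ \oo --> l /\
      forall k, `|complex.Re (h k x) - l| <= 2 * S x * 2 ^- k.
    apply: geo_cauchy => k; apply: le_trans (bnd k x).
    by apply: le_trans (Re_le_modulus _); rewrite ReD ReN.
  have [l2 [c2 b2]] : exists l, (fun k => complex.Im (h k x)) @ \oo --> l /\
      forall k, `|complex.Im (h k x) - l| <= 2 * S x * 2 ^- k.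
    apply: geo_cauchy => k; apply: le_trans (bnd k x).
    by apply: le_trans (Im_le_modulus _); rewrite ImD ImN.
  exists (l1 +i* l2)%C; split => // k; apply: le_trans (modulus_le _) _.
  rewrite ReD ReN ImD ImN /=; have := b1 k; have := b2 k.
  by move: (_ ^- k) => t; lra.
have mf : cmeas f.
  split.
  - apply: (@measurable_fun_cvg _ _ _ _ (fun k x => complex.Re (h k x))) => [k|x _].
      exact: (mh k).1.
    by have [] := hf x.
  - apply: (@measurable_fun_cvg _ _ _ _ (fun k x => complex.Im (h k x))) => [k|x _].
      exact: (mh k).2.
    by have [] := hf x.
have iS : mu.-integrable setT (fun x => (S x `^ p)%:E).
  apply: (integrable_le _ (integrable_abse is_)).
    apply: measurable_pow; apply: measurable_pow.
    by apply: measurable_maxr => //; exact: measurable_cst.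
  move=> x; rewrite (@ger0_norm _ (S x `^ p)) ?powR_ge0// /S -powRrM mulVf ?gt_eqF// powRr1 ?le_max ?lexx//.
  by rewrite ge_max normr_ge0 ler_norm.
have mS : cmeas (fun x => (S x)%:C%C).
  apply: cmeas_real; apply: measurable_pow.
  by apply: measurable_maxr => //; exact: measurable_cst.
have lS : Lp mu p (fun x => (S x)%:C%C).
  apply: (Lp_le (ltW p0) mS iS) => x.
  by rewrite modulus_ofreal ger0_norm ?powR_ge0.
have lhf k : Lp mu p (fun x => h k x - f x).
  have := LpZ ((4 * 2 ^- k)%:C)%C lS => -[m l].
  apply: (Lp_le (ltW p0) (cmeasD (mh k) (cmeasN mf)) l) => x.
  have [_ _ /(_ k)] := hf x; rewrite modulusM !modulus_ofreal !ger0_norm ?powR_ge0//.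
  by rewrite mulrAC.
have lh0 k : Lp mu p (h k).
  apply: (Lp_le (ltW p0) (mh k) (lg k).2) => x.
  by rewrite modulusM modulus_ofreal ger0_norm// ler_piMr// indicE; case: (x \in A).
exists f; split.
  have := LpB (ltW p0) (lh0 0%N) (lhf 0%N); congr (Lp mu p _).
  by apply/funext => x; rewrite subKr.
exists (4 * Np mu p (fun x => (S x)%:C%C)) => k.
have -> : Np mu p (fun x => g k x - f x) = Np mu p (fun x => h k x - f x).
  apply: ae_eq_Np.
  - by apply: cmeasD; [exact: (lg k).1|exact: cmeasN].
  - by apply: cmeasD; [exact: mh|exact: cmeasN].
  - by apply: filterS aA => x /= Ax; rewrite hg.
have -> : 4 * Np mu p (fun x => (S x)%:C%C) * 2 ^- k =
    Np mu p (fun x => (4 * 2 ^- k)%:C%C * (S x)%:C%C).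
  rewrite NpZ// modulus_ofreal ger0_norm; first by rewrite mulrAC.
  by rewrite mulr_ge0// ltW.
apply: Np_le => //; first exact: LpZ.
move=> x; have [_ _ /(_ k)] := hf x; rewrite modulusM !modulus_ofreal !ger0_norm ?powR_ge0//.
by rewrite mulrAC.
Qed.

End completeness.

(** The arithmetic of the Cauchy estimate in [Lp_represent]: [a] and [b] are the powers of two
    near-minimal norms, [mp] is the minimal power and [h] that of the midpoint. The arguments of
    [Num.min] control the two terms of [unif_convex] respectively. *)
Lemma cauchy_bound (R : realType) (mp e M a b h : R) : 0 < mp -> 0 < e -> 0 <= M ->
  a < mp + Num.min 1 (e / (2 * (M + 1))) -> b < mp + Num.min 1 (e / (2 * (M + 1))) ->
  mp <= h -> e / (4 * (mp + 1)) * (a + b) + M * ((a + b) / 2 - h) <= e.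
Proof.
move=> mp0 e0 M0; set e' := Num.min _ _ => ha hb hh.
have e1 : e' <= 1 by rewrite ge_min lexx.
have M1 : 0 < M + 1 by lra.
have q1 : 0 < mp + 1 by lra.
have e2 : M * e' <= e / 2.
  apply: (@le_trans _ _ (M * (e / (2 * (M + 1))))).
    by rewrite ler_wpM2l// ge_min lexx orbT.
  have -> : M * (e / (2 * (M + 1))) = e / 2 * (M / (M + 1)) by field; lra.
  by rewrite ler_piMr ?divr_ge0 ?(ltW e0)// ler_pdivrMr// mul1r lerDl.
have h1 : e / (4 * (mp + 1)) * (a + b) <= e / 2.
  apply: (@le_trans _ _ (e / (4 * (mp + 1)) * (2 * (mp + 1)))).
    by rewrite ler_wpM2l ?divr_ge0 ?(ltW e0)//; lra.
  by apply: le_of_eq; field; lra.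
have h2 : M * ((a + b) / 2 - h) <= M * e' by rewrite ler_wpM2l//; lra.
lra.
Qed.

Lemma lt_addmin3 (R : realType) (x m a b c : R) :
  x < m + Num.min (Num.min a b) c -> [/\ x < m + a, x < m + b & x < m + c].
Proof. by rewrite !addr_minr !lt_min => /andP[/andP[? ?] ?]. Qed.

Lemma le_lim0 (R : realType) (a b : R) (v : nat -> R) : v @ \oo --> (0 : R) ->
  (forall k, a <= b + v k) -> a <= b.
Proof.
move=> v0 ab; have h : (fun k => b + v k) @ \oo --> b.
  by rewrite -[X in _ --> X]addr0; apply: cvgD => //; exact: cvg_cst.
by apply: (cvgr_to_ge h); exact: nearW.
Qed.

Lemma cvg_half_pow (R : realType) (M : R) : (fun k => M * (2 : R) ^- k) @ \oo --> (0 : R).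
Proof.
rewrite -(mulr0 M); apply: cvgM; first exact: cvg_cst.
have -> : (fun k => (2 : R) ^- k) = (fun k => (2^-1) ^+ k).
  by apply/funext => k; rewrite exprVn.
by apply: cvg_expr; rewrite ger0_norm//; lra.
Qed.

(** * First variation at a point of least norm *)

Section variation.
Context {R : realType} {d : measure_display} {T : measurableType d}.
Variable mu : {measure set T -> \bar R}.
Local Notation C := R[i].
Variables (p q : R) (p1 : 1 < p) (q0 : 0 < q) (pq : p^-1 + q^-1 = 1).

Let p0 : 0 < p. Proof. exact: lt_trans ltr01 p1. Qed.
Let p0' : 0 <= p. Proof. exact: ltW. Qed.

Lemma conj_exponent : (p - 1) * q = p.
Proof.
have -> : q = (1 - p^-1)^-1 by rewrite -pq addrAC subrr add0r invrK.
have := p1; have := p0 => *.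
by field; apply/andP; split; apply/eqP; lra.
Qed.

Lemma powR_dualv (a : C) : modulus (dualv p a) `^ q = modulus a `^ p.
Proof. by rewrite modulus_dualv// -powRrM conj_exponent. Qed.

Lemma cmeas_dualv (f : T -> C) : cmeas f -> cmeas (fun x => dualv p (f x)).
Proof.
move=> mf; apply: cmeasM; last exact: cmeas_conj.
by apply: cmeas_real; apply: measurable_pow; exact: cmeas_modulus.
Qed.

Lemma Lp_dualv (f : T -> C) : Lp mu p f -> Lp mu q (fun x => dualv p (f x)).
Proof.
move=> [mf lf]; split; first exact: cmeas_dualv.
by under eq_fun do rewrite powR_dualv.
Qed.

Lemma Ip_dualv (f : T -> C) : Ip mu q (fun x => dualv p (f x)) = Ip mu p f.
Proof. by apply: eq_Rintegral => x _; exact: powR_dualv. Qed.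

Lemma cvg_harmonic_pow (r c : R) : 0 < r -> (fun k => (harmonic k) `^ r * c) @ \oo --> 0.
Proof.
move=> r0; rewrite -(mul0r c); apply: cvgM; last exact: cvg_cst.
apply: (@cvg_comp _ _ _ (@harmonic R) (fun a => a `^ r) \oo 0^'+); last exact: powR_cvg0.
move=> A [e /= e0 h]; have := @cvg_harmonic R => /cvgrPdist_lt /(_ _ e0).
apply: filterS => k; rewrite sub0r normrN => hk; apply: h; first by rewrite /= sub0r normrN.
by rewrite /harmonic invr_gt0.
Qed.

(** Continuity of the duality map along a line. At [a = 0] the exponent [p - 2] may be negative, and
    the positive exponent [p - 1] of the modulus is used instead. *)
Lemma dualv_cvg (a b c : C) :
  (fun k => complex.Re (dualv p (a + (harmonic k)%:C%C * b) * c)) @ \oo -->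
  complex.Re (dualv p a * c).
Proof.
have cre (u : nat -> C) (v : C) : (fun k => modulus (u k - v)) @ \oo --> 0 ->
    (fun k => complex.Re (u k)) @ \oo --> complex.Re v.
  move=> h; apply/cvgrPdist_lt => e e0; have /cvgrPdist_lt /(_ _ e0) := h.
  apply: filterS => k; rewrite sub0r normrN ger0_norm//; apply: le_lt_trans.
  by rewrite distrC; apply: le_trans (Re_le_modulus _); rewrite ReD ReN.
apply: cre; have [->|a0] := eqVneq a 0.
  have -> : (fun k => modulus (dualv p (0 + (harmonic k)%:C%C * b) * c - dualv p 0 * c)) =
      (fun k => (harmonic k) `^ (p - 1) * (modulus b `^ (p - 1) * modulus c)).
    apply/funext => k; rewrite add0r -mulrBl modulusM.
    have -> : dualv p (0 : C) = 0.
      by apply: modulus_eq0; rewrite modulus_dualv// modulus0 powR0// gt_eqF// subr_gt0.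
    rewrite subr0 modulus_dualv// modulusM modulus_ofreal ger0_norm ?harmonic_ge0//.
    by rewrite powRM ?harmonic_ge0// mulrA.
  by apply: cvg_harmonic_pow; rewrite subr_gt0.
have ma : 0 < modulus a by exact: modulus_gt0.
have h0 : (fun k => @harmonic R k) @ \oo --> 0 by exact: cvg_harmonic.
have mz : (fun k => modulus (a + (harmonic k)%:C%C * b)) @ \oo --> modulus a.
  apply/cvgrPdist_le => e e0.
  have : (fun k => harmonic k * modulus b) @ \oo --> 0 * modulus b.
    by apply: cvgM => //; exact: cvg_cst.
  rewrite mul0r => /cvgrPdist_le /(_ _ e0); apply: filterS => k.
  rewrite sub0r normrN ger0_norm ?mulr_ge0 ?harmonic_ge0// => hk.
  rewrite distrC ler_norml; apply/andP; split.
    have := modulusB (a + (harmonic k)%:C%C * b) ((harmonic k)%:C%C * b).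
    rewrite addrK modulusM modulus_ofreal (ger0_norm (harmonic_ge0 k)) => h.
    by rewrite lerBrDr addrC lerBlDr; apply: le_trans h _; rewrite lerD2l.
  rewrite lerBlDl; apply: le_trans (modulusD _ _) _.
  by rewrite lerD2l modulusM modulus_ofreal (ger0_norm (harmonic_ge0 k)).
have pw : (fun k => modulus (a + (harmonic k)%:C%C * b) `^ (p - 2)) @ \oo --> modulus a `^ (p - 2).
  have d1 : derivable ((@powR R) ^~ (p - 2)) (modulus a) 1.
    by apply: derivable_powR; rewrite in_itv/= andbT.
  have /differentiable_continuous c1 := (derivable1_diffP _ _).1 d1.
  apply: (@cvg_comp _ _ _ (fun k => modulus (a + (@harmonic R k)%:C%C * b)) (@powR R ^~ (p - 2)) _ _ _ mz). exact: c1.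
have -> : (fun k => modulus (dualv p (a + (harmonic k)%:C%C * b) * c - dualv p a * c)) =
   (fun k => modulus (((modulus (a + (harmonic k)%:C%C * b) `^ (p - 2) - modulus a `^ (p - 2))%:C%C
      * (a^*)%C) + (modulus (a + (harmonic k)%:C%C * b) `^ (p - 2) * harmonic k)%:C%C * (b^*)%C)
      * modulus c).
  apply/funext => k; rewrite -mulrBl modulusM; congr (modulus _ * _).
  rewrite /dualv; set h := harmonic k; set u := modulus (a + h%:C%C * b) `^ _; set v := modulus a `^ _; clearbody u v; clearbody h.
  by apply: complex_eq; case: a {ma a0 mz pw} => ? ?; case: b => ? ?; rewrite ?(ReD, ImD, ReN, ImN, ReM, ImM) /=; ring.
rewrite -(mul0r (modulus c)); apply: cvgM; last exact: cvg_cst.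
pose B k := `|modulus (a + (harmonic k)%:C%C * b) `^ (p - 2) - modulus a `^ (p - 2)| * modulus a
   + `|modulus (a + (harmonic k)%:C%C * b) `^ (p - 2) * harmonic k| * modulus b.
have Bc : B @ \oo --> 0.
  have -> : (0 : R) = `|modulus a `^ (p - 2) - modulus a `^ (p - 2)| * modulus a
     + `|modulus a `^ (p - 2) * 0| * modulus b by rewrite subrr mulr0 !normr0 !mul0r addr0.
  by apply: cvgD; apply: cvgM => //; try exact: cvg_cst; apply: cvg_norm;
    [apply: cvgB => //; exact: cvg_cst|apply: cvgM].
apply: (@squeeze_cvgr _ _ _ _ (fun=> 0) B) => //; last exact: cvg_cst.
apply: nearW => k; rewrite modulus_ge0 /=; apply: le_trans (modulusD _ _) _.
by rewrite !modulusM !modulus_conj !modulus_ofreal.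
Qed.

(** The gradient inequality is applied at [f + t * h] rather than at [f]. Integrated and combined
    with minimality it gives the sign of the pairing with [dualv p (f + t * h)] for each [t > 0],
    and [t] tends to 0 by dominated convergence. The norm itself is never differentiated. *)
Lemma dualv_variation (f h : T -> C) : Lp mu p f -> Lp mu p h ->
  (forall t : R, Ip mu p f <= Ip mu p (fun x => f x + t%:C%C * h x)) ->
  0 <= complex.Re (cint mu (fun x => dualv p (f x) * h x)).
Proof.
move=> Lf Lh le.
pose G x := 2 `^ p * (modulus (f x) `^ p + modulus (h x) `^ p).
have iG : mu.-integrable setT (fun x => (G x)%:E).
  apply: integrableRZ; under eq_fun do rewrite EFinD.
  by apply: integrableD => //; [exact: Lf.2|exact: Lh.2].
pose g k x := f x + (@harmonic R k)%:C%C * h x.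
have Lg k : Lp mu p (g k) by apply: LpD => //; exact: LpZ.
pose F k x := complex.Re (dualv p (g k x) * h x).
have mF k : cmeas (fun x => dualv p (g k x) * h x).
  by apply: cmeasM; [apply: cmeas_dualv; exact: (Lg k).1|exact: Lh.1].
have FG k x : `|F k x| <= G x.
  apply: le_trans (Re_le_modulus _) _; rewrite modulusM modulus_dualv//.
  apply: le_trans (powRD_le p0' (modulus_ge0 (f x)) (modulus_ge0 (h x))).
  rewrite -[in leRHS](mulr_powRB1 _ p0) ?addr_ge0// mulrC.
  apply: ler_pM => //; [exact: powR_ge0|by rewrite lerDr|].
  apply: ger0_powR_le => //; first by rewrite subr_ge0 ltW.
  apply: le_trans (modulusD _ _) _; rewrite lerD2l modulusM modulus_ofreal.
  rewrite ger0_norm ?harmonic_ge0// ler_piMl// /harmonic invf_le1//.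
  by rewrite ler1n.
have [_ lim] := Rdct (fun k => (mF k).1) (cmeasM (cmeas_dualv Lf.1) Lh.1).1 iG FG
  (fun x => @dualv_cvg (f x) (h x) (h x)).
apply: (cvgr_to_ge lim); apply: nearW => k.
have iF : mu.-integrable setT (fun x => (F k x)%:E).
  by apply: (integrable_le (mF k).1 iG) => x; exact: FG.
have t0 : 0 < @harmonic R k by rewrite /harmonic invr_gt0.
have grad x : modulus (g k x) `^ p - p * harmonic k * F k x <= modulus (f x) `^ p.
  have := dualv_grad (g k x) (f x) p1 pq q0.
  have -> : f x - g k x = (- harmonic k)%:C%C * h x.
    by rewrite /g opprD addrA subrr add0r rmorphN mulNr.
  rewrite mulrCA ReM /= mul0r subr0 -/(F k x) mulNr mulrN mulrA.
  exact.
have : Ip mu p (g k) - p * harmonic k * \int[mu]_x F k x <= Ip mu p (g k).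
  apply: le_trans (le _).
  rewrite -RintegralZl// -RintegralB//; [|exact: (Lg k).2|exact: integrableRZ].
  apply: le_Rintegral => //; [|exact: Lf.2]. 
  have := integrableB measurableT (Lg k).2 (integrableRZ (p * harmonic k) iF).
  by congr (integrable mu setT _).
by rewrite gerBl -mulrA pmulr_rge0// pmulr_rge0.
Qed.

End variation.

(** * Representation of bounded functionals on subspaces of L^p *)

Section representation.
Context {R : realType} {d : measure_display} {T : measurableType d}.
Variable mu : {measure set T -> \bar R}.
Local Notation C := R[i].
Variables (p q : R) (p1 : 1 < p) (q0 : 0 < q) (pq : p^-1 + q^-1 = 1).
Variables (X : set (T -> C)) (ell : (T -> C) -> C) (K : R).
Hypothesis XL : forall f, X f -> Lp mu p f.
Hypothesis X0 : X (fun=> 0).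
Hypothesis XP : forall c f g, X f -> X g -> X (fun x => c * f x + g x).
Hypothesis ellP : forall c f g, X f -> X g ->
  ell (fun x => c * f x + g x) = c * ell f + ell g.
Hypothesis ellB : forall f, X f -> modulus (ell f) <= K * Np mu p f.

Let p0 : 0 < p. Proof. exact: lt_trans ltr01 p1. Qed.
Let p0' : 0 <= p. Proof. exact: ltW. Qed.
Let p1' : 1 <= p. Proof. exact: ltW. Qed.

Let NpE f : Np mu p f `^ p = Ip mu p f.
Proof. by apply: NpX; rewrite gt_eqF. Qed.

Let Ip_lt f r : Np mu p f `^ p < r -> Ip mu p f < r. Proof. by rewrite NpE. Qed.
Let le_Ip f r : r <= Np mu p f `^ p -> r <= Ip mu p f. Proof. by rewrite NpE. Qed.
Let Ip_le f r : Np mu p f `^ p <= r -> Ip mu p f <= r. Proof. by rewrite NpE. Qed.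

Let ell0 : ell (fun=> 0) = 0.
Proof.
have := ellP 1 X0 X0; have -> : (fun x : T => 1 * 0 + 0 : C) = fun=> 0.
  by apply/funext => x; rewrite mul1r addr0.
by rewrite mul1r => /esym/(congr1 (fun z => z - ell (fun=> 0))); rewrite addrK subrr.
Qed.

Let ZE (c : C) (f : T -> C) : (fun x => c * f x) = (fun x => c * f x + (fun=> 0) x).
Proof. by apply/funext => x; rewrite addr0. Qed.

Let XZ c f : X f -> X (fun x => c * f x).
Proof. by move=> Xf; rewrite ZE; exact: XP. Qed.

Let ellZ c f : X f -> ell (fun x => c * f x) = c * ell f.
Proof. by move=> Xf; rewrite ZE ellP// ell0 addr0. Qed.

Let half (x y : T -> C) t : C := (2^-1)%:C%C * (x t + y t).

Let halfE x y : half x y = fun t => (2^-1)%:C%C * x t + (fun t => (2^-1)%:C%C * y t) t.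
Proof. by apply/funext => t; rewrite /half mulrDr. Qed.

Let Xhalf x y : X x -> X y -> X (half x y).
Proof. by move=> Xx Xy; rewrite halfE; apply: XP => //; exact: XZ. Qed.

Let ellhalf x y : X x -> X y -> ell x = 1 -> ell y = 1 -> ell (half x y) = 1.
Proof.
move=> Xx Xy x1 y1; rewrite halfE ellP//; last exact: XZ.
rewrite ellZ// x1 y1 !mulr1; apply: complex_eq; rewrite ?(ReD, ImD) /=; first by field.
by rewrite addr0.
Qed.

Let Ip_unif e : 0 < e -> exists2 M, 0 <= M & forall x y, X x -> X y ->
  Ip mu p (fun t => x t - y t) <=
    e * (Ip mu p x + Ip mu p y) + M * ((Ip mu p x + Ip mu p y) / 2 - Ip mu p (half x y)).
Proof.
move=> e0; have [M M0 h] := unif_convex p1 e0; exists M => // x y Xx Xy.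
have ix := (XL Xx).2; have iy := (XL Xy).2; have ih := (XL (Xhalf Xx Xy)).2.
have ixy : mu.-integrable setT (fun t => (modulus (x t) `^ p + modulus (y t) `^ p)%:E).
  by under eq_fun do rewrite EFinD; exact: integrableD.
pose a t := modulus (x t) `^ p + modulus (y t) `^ p; pose b t := modulus (half x y t) `^ p.
have ii : mu.-integrable setT (fun t => ((e + M / 2) * a t + (- M) * b t)%:E).
  by under eq_fun do rewrite EFinD; apply: integrableD => //; exact: integrableRZ.
have -> : e * (Ip mu p x + Ip mu p y) + M * ((Ip mu p x + Ip mu p y) / 2 - Ip mu p (half x y)) =
    \int[mu]_t ((e + M / 2) * a t + (- M) * b t).
  rewrite RintegralD//; [|exact: integrableRZ|exact: integrableRZ].
  rewrite !RintegralZl// /a RintegralD// -/(Ip mu p x) -/(Ip mu p y) -/(Ip mu p (half x y)).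
  by move: (Ip mu p x) (Ip mu p y) (Ip _ _ _) => u v w; ring.
apply: le_Rintegral => //; first by apply: (LpB p0' (XL Xx) (XL Xy)).2.
move=> t _; apply: le_trans (h _ _) _; rewrite /pgap /a /b /half.
by move: (modulus (x t) `^ p) (modulus (y t) `^ p) (_ `^ p) => u v w; lra.
Qed.

(** Near-minimal elements of the hyperplane [ell = 1] are close to each other by uniform convexity.
    Their limit [f] may lie outside [X], but its norm [m] is still minimal among perturbations by
    the kernel of [ell], so [dualv p (f x)] annihilates that kernel. Dividing by the [p]-th power of
    [m] normalises the functional and leaves the norm [m^-1], which is at most [K]. *)
Lemma Lp_represent : 0 <= K -> exists f, [/\ Lp mu q f, Np mu q f <= K &
  forall g, X g -> cint mu (fun x => f x * g x) = ell g].
Proof.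
move=> K0.
have [h0|] := pselect (forall g, X g -> ell g = 0).
  exists (fun=> 0); split; first by apply: Lp0; rewrite gt_eqF.
    have -> : Np mu q (fun=> 0) = 0; last by [].
    rewrite /Np /Ip; have -> : (fun x : T => modulus (0 : C) `^ q) = fun=> 0.
      by apply/funext => x; rewrite modulus0 powR0// gt_eqF.
    by rewrite /Rintegral integral0_eq// powR0// invr_eq0 gt_eqF.
  move=> g Xg; rewrite h0//; have -> : (fun x => 0 * g x) = (fun=> 0).
    by apply/funext => x; rewrite mul0r.
  exact: cint0.
move=> /existsNP[y0 /not_implyP[Xy0 ly0]].
pose X1 : set (T -> C) := [set x | X x /\ ell x = 1].
have [x0 X1x0] : exists x, X1 x.
  exists (fun t => (ell y0)^-1 * y0 t); split; first exact: XZ.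
  by rewrite ellZ// mulVf//; apply/eqP.
have [m [mle mK near_inf]] : exists m : R, [/\ forall x, X1 x -> m <= Np mu p x,
    1 <= K * m & forall e, 0 < e -> exists2 x, X1 x & Np mu p x < m + e].
  pose D : set R := [set Np mu p x | x in X1].
  have Dlb : has_lbound D by exists 0 => _ [x _ <-]; exact: Np_ge0.
  have Dinf : has_inf D by split => //; exists (Np mu p x0); exists x0.
  exists (inf D); split => [x hx||e e0].
  - by apply: ge_inf => //; exists x.
  - have Kp : 0 < K.
      rewrite lt_neqAle K0 andbT; apply/eqP => Ke.
      by case: X1x0 => Xx lx; have := ellB Xx; rewrite lx -Ke mul0r modulus1 ler10.
    rewrite -ler_pdivrMl// mulr1; apply: lb_le_inf; first by case: Dinf.
    move=> _ [x [Xx lx] <-]; rewrite -[_^-1]mulr1 ler_pdivrMl//.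
    by have := ellB Xx; rewrite lx modulus1.
  - by have [_ [x hx <-] lt] := inf_adherent e0 Dinf; exists x.
have m0 : 0 < m by rewrite ltNge; apply/negP => mn; nra.
have Ipm x : X1 x -> m `^ p <= Ip mu p x.
  by move=> h; apply: le_Ip; apply: ger0_powR_le => //; [exact: ltW|exact: mle].
have pow_cont e : 0 < e -> exists2 z, 0 < z & forall t, 0 <= t -> t < m + z -> t `^ p < m `^ p + e.
  move=> e0; pose w := (m `^ p + e) `^ p^-1.
  have we : w `^ p = m `^ p + e.
    by rewrite -powRrM mulVf ?gt_eqF// powRr1// addr_ge0 ?powR_ge0// ltW.
  have mw : m < w.
    rewrite ltNge; apply/negP => wm.
    have := ger0_powR_le p0' (powR_ge0 _ _) wm; rewrite -/w we.
    by rewrite gerDl leNgt e0.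
  exists (w - m); first by rewrite subr_gt0.
  by move=> t t0; rewrite addrC subrK -we => tw; apply: gt0_ltr_powR; rewrite ?nnegrE// powR_ge0.
have cauchy e : 0 < e -> exists2 z, 0 < z & forall x y, X1 x -> X1 y ->
    Np mu p x < m + z -> Np mu p y < m + z -> Ip mu p (fun t => x t - y t) <= e.
  move=> e0.
  have mp : 0 < m `^ p by exact: powR_gt0.
  have [M M0 hM] := @Ip_unif (e / (4 * (m `^ p + 1))) (divr_gt0 e0 (mulr_gt0 (ltr0Sn _ 3) (addr_gt0 mp ltr01))).
  pose e' := Num.min 1 (e / (2 * (M + 1))).
  have e'0 : 0 < e' by rewrite lt_min ltr01 divr_gt0// mulr_gt0//; lra.
  have [z z0 hz] := pow_cont _ e'0; exists z => // x y [Xx lx] [Xy ly] nx ny.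
  have ix : Ip mu p x < m `^ p + e' by exact: (Ip_lt (hz _ (Np_ge0 _ _ _) nx)).
  have iy : Ip mu p y < m `^ p + e' by exact: (Ip_lt (hz _ (Np_ge0 _ _ _) ny)).
  apply: le_trans (hM _ _ Xx Xy) _.
  have ih : m `^ p <= Ip mu p (half x y).
    by apply: Ipm; split; [exact: Xhalf|exact: ellhalf].
  exact: (cauchy_bound mp e0 M0 ix iy ih).
pose eps k : R := 2 ^- k * (2 ^- k) `^ p.
have eps0 k : 0 < eps k by rewrite mulr_gt0 ?powR_gt0// invr_gt0 exprn_gt0.
have /choice[z hz] : forall k, exists z, 0 < z /\ forall x y, X1 x -> X1 y ->
    Np mu p x < m + z -> Np mu p y < m + z -> Ip mu p (fun t => x t - y t) <= eps k.
  by move=> k; have [z z0 h] := cauchy _ (eps0 k); exists z.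
(* Being near-minimal for the tolerances of both [k] and [k.-1], the consecutive terms [g k] and
   [g k.+1] share the tolerance [z k]. The last condition makes the norms tend to [m]. *)
have /choice[g hg] : forall k, exists x, [/\ X1 x, Np mu p x < m + z k,
    Np mu p x < m + z k.-1 & Np mu p x < m + k.+1%:R^-1].
  move=> k; have := near_inf (Num.min (Num.min (z k) (z k.-1)) (k.+1%:R^-1)).
  rewrite !lt_min !(hz _).1 invr_gt0 ltr0n => /(_ isT)[x Xx].
  by move=> /lt_addmin3[? ? ?]; exists x.
have [f [Lf [M hM]]] : exists f, Lp mu p f /\
    exists M, forall k, Np mu p (fun x => g k x - f x) <= M * 2 ^- k.
  apply: Lp_cauchy => // [k|k]; first by have [[/XL]] := hg k.
  have [X1k lk _ _] := hg k; have [X1k' _ lk' _] := hg k.+1.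
  exact: (hz k).2.
have Lg k : Lp mu p (g k) by have [[/XL]] := hg k.
have Mlim := cvg_half_pow M.
have Nf : Np mu p f <= m.
  apply: (@le_lim0 _ _ _ (fun k => harmonic k + M * (2 : R) ^- k)) => [|k].
    by rewrite -[0]addr0; apply: cvgD => //; exact: cvg_harmonic.
  have [_ _ _ hk] := hg k.
  have -> : f = (fun x => g k x - (g k x - f x)) by apply/funext => x; rewrite subKr.
  apply: le_trans (NpB p1' (Lg k) (LpB p0' (Lg k) Lf)) _.
  by rewrite [leRHS]addrA; apply: lerD; [exact: ltW hk|exact: hM].
have If : Ip mu p f <= m `^ p.
  by apply: Ip_le; apply: ger0_powR_le => //; exact: Np_ge0.
have var h (t : R) : X h -> ell h = 0 -> m `^ p <= Ip mu p (fun x => f x + t%:C%C * h x).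
  move=> Xh lh; have Lh := LpZ t%:C%C (XL Xh); have Lfh := LpD p0' Lf Lh.
  apply: le_Ip; apply: ger0_powR_le => //; first exact: ltW.
  apply: (@le_lim0 _ _ _ (fun k => M * (2 : R) ^- k)) => // k.
  have [[Xk lk] _ _ _] := hg k.
  have e : (fun x => t%:C%C * h x + g k x) =
      (fun x => (f x + t%:C%C * h x) + (g k x - f x)).
    by apply/funext => x; rewrite addrCA addrC addrA subrKC addrC || ring.
  have X1t : X1 (fun x => t%:C%C * h x + g k x).
    by split; [exact: XP|rewrite ellP// lh mulr0 add0r].
  apply: le_trans (mle _ X1t) _; rewrite e.
  apply: le_trans (NpD p1' Lfh (LpB p0' (Lg k) Lf)) _.
  by rewrite lerD2l.
have mp0 : 0 < m `^ p by exact: powR_gt0.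
have Ipf : Ip mu p f = m `^ p.
  apply/eqP; rewrite eq_le If /=; have := var _ 0 X0 ell0.
  by have -> : (fun x => f x + 0%:C%C * 0) = f by apply/funext => x; rewrite mulr0 addr0.
have LJ : Lp mu q (fun x => dualv p (f x)) by exact: Lp_dualv.
have NJ : Np mu q (fun x => dualv p (f x)) = (m `^ p) `^ q^-1.
  by rewrite /Np Ip_dualv// Ipf.
have orth h : X h -> ell h = 0 -> cint mu (fun x => dualv p (f x) * h x) = 0.
  move=> Xh lh; have Lh := XL Xh.
  have re c : 0 <= complex.Re (c * cint mu (fun x => dualv p (f x) * h x)).
    have Xc := XZ c Xh; have lc : ell (fun x => c * h x) = 0 by rewrite ellZ// lh mulr0.
    have := dualv_variation p1 q0 pq Lf (XL Xc) (fun t => le_trans If (var _ t Xc lc)).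
    have -> : (fun x => dualv p (f x) * (c * h x)) = (fun x => c * (dualv p (f x) * h x)).
      by apply/funext => x; rewrite mulrCA.
    by rewrite cintZ//; apply: (hoelder_cintgr q0 p0 _ LJ Lh); rewrite addrC.
  (* Nonnegative real parts after multiplication by 1, -1, i and -i leave only the value 0. *)
  have := re 1; have := re (-1); have := re (0 +i* 1)%C; have := re (0 +i* (-1))%C.
  rewrite mul1r mulN1r !ReM ReN /= !mul0r !sub0r mul1r mulN1r opprK => h1 h2 h3 h4.
  by apply: complex_eq; apply/eqP; rewrite eq_le /= ?h1 ?h4 ?andbT -oppr_ge0.
have pq' : q^-1 + p^-1 = 1 by rewrite addrC.
have ci g' : Lp mu p g' -> cintgr mu (fun x => dualv p (f x) * g' x).
  by move=> Lg'; exact: (hoelder_cintgr q0 p0 pq' LJ Lg').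
have Jff : cint mu (fun x => dualv p (f x) * f x) = (m `^ p)%:C%C.
  rewrite -Ipf; have -> : (fun x => dualv p (f x) * f x) =
      (fun x => (modulus (f x) `^ p)%:C%C) by apply/funext => x; rewrite dualv_mul.
  apply: complex_eq => //=; by rewrite /Rintegral integral0_eq.
(* The combination [h - ell h * g k] lies in the kernel, and [g k] tends to [f] in norm. *)
have main h : X h -> cint mu (fun x => dualv p (f x) * h x) = ell h * (m `^ p)%:C%C.
  move=> Xh; apply/eqP; rewrite -subr_eq0; apply/eqP/modulus_eq0/eqP.
  rewrite eq_le modulus_ge0 andbT.
  pose B := modulus (ell h) * (Np mu q (fun x => dualv p (f x)) * M).
  apply: (@le_lim0 _ _ _ (fun k => B * (2 : R) ^- k)); first exact: cvg_half_pow.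
  move=> k; rewrite add0r; have [[Xk lk] _ _ _] := hg k.
  have Xc := XP (- ell h) Xk Xh.
  have lc : ell (fun x => - ell h * g k x + h x) = 0.
    by rewrite ellP// lk mulr1 addNr.
  have := orth _ Xc lc.
  have -> : (fun x => dualv p (f x) * (- ell h * g k x + h x)) =
      (fun x => - ell h * (dualv p (f x) * g k x) + dualv p (f x) * h x).
    by apply/funext => x; rewrite mulrDr mulrCA.
  rewrite cintD; [|by apply: cintgrZ; exact: ci|exact: (ci _ (XL Xh))].
  rewrite cintZ; last exact: ci.
  rewrite mulNr addrC => /eqP; rewrite subr_eq0 => /eqP ->.
  rewrite -Jff -mulrBr -cintB; [|exact: ci|exact: ci].
  have -> : (fun x => dualv p (f x) * g k x - dualv p (f x) * f x) =
     (fun x => dualv p (f x) * (g k x - f x)) by apply/funext => x; rewrite mulrBr.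
  rewrite modulusM /B -[leRHS]mulrA ler_wpM2l// -[leRHS]mulrA.
  have := hoelder_cint q0 p0 pq' LJ (LpB p0' (Lg k) Lf).
  move/le_trans; apply; rewrite ler_wpM2l ?Np_ge0//; exact: hM.
exists (fun x => ((m `^ p)^-1)%:C%C * dualv p (f x)); split.
- exact: LpZ.
- rewrite NpZ// NJ modulus_ofreal ger0_norm ?invr_ge0 ?(ltW mp0)//.
  have -> : (m `^ p)^-1 * (m `^ p) `^ q^-1 = m^-1.
    have -> : q^-1 = 1 - p^-1 by rewrite -pq addrAC subrr add0r.
    rewrite powRD ?powRr1 ?(ltW mp0)//; last by rewrite (gt_eqF mp0) implybT.
    rewrite mulrA mulVf ?gt_eqF// mul1r -powRrM mulrN divff ?gt_eqF// powR_inv1//.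
    exact: ltW.
  by rewrite -[_^-1]mulr1 ler_pdivrMl// mulrC.
- move=> h Xh; have -> : (fun x => ((m `^ p)^-1)%:C%C * dualv p (f x) * h x) =
      (fun x => ((m `^ p)^-1)%:C%C * (dualv p (f x) * h x)).
    by apply/funext => x; rewrite mulrA.
  rewrite cintZ; last exact: (ci _ (XL Xh)).
  rewrite main// mulrCA -rmorphM /= mulVf ?gt_eqF// rmorph1 mulr1//.
Qed.

End representation.

(** * Approximation of indicators by smooth functions *)

Section approximation.
Context {R : realType} {n : nat}.
Local Notation E := 'rV[R]_n.
Local Notation leb := (lebesgue_rV n).
Variable w : E -> R.
Hypothesis w0 : forall x, 0 <= w x.
Hypothesis mw : measurable_fun setT w.
Hypothesis iw : leb.-integrable setT (fun x => (w x)%:E).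

(** The sets whose indicator is approximated in weighted [L^1] by smooth functions with values
    between 0 and 1. They form a sigma-algebra that contains the half-spaces bounded by coordinate
    hyperplanes, hence all measurable sets; this takes the place of mollification. *)
Definition apx (A : set E) := measurable A /\ forall e, 0 < e ->
  exists phi : E -> R, [/\ slow (ofreal phi), forall x, 0 <= phi x <= 1 &
    \int[leb]_x (`|\1_A x - phi x| * w x) <= e].

Lemma ofreal_measurable (f : E -> R) : slow (ofreal f) -> measurable_fun setT f.
Proof. by move=> /slow_smooth/smooth_cmeas[]. Qed.

Lemma abs_sub01 (a b : R) : 0 <= a <= 1 -> 0 <= b <= 1 -> `|a - b| <= 1.
Proof. by move=> /andP[? ?] /andP[? ?]; rewrite ler_norml; apply/andP; split; lra. Qed.

Lemma indic01 (A : set E) x : 0 <= (\1_A x : R) <= 1.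
Proof. by rewrite indicE; case: (x \in A); rewrite ?lexx ?ler01. Qed.

Lemma integrable_gap (f g : E -> R) : measurable_fun setT f -> measurable_fun setT g ->
  (forall x, 0 <= f x <= 1) -> (forall x, 0 <= g x <= 1) ->
  leb.-integrable setT (fun x => (`|f x - g x| * w x)%:E).
Proof.
move=> mf mg f01 g01; apply: (integrable_le _ iw).
  apply: measurable_funM => //; apply: measurableT_comp => //.
  exact: measurable_funB.
move=> x; rewrite ger0_norm ?mulr_ge0// ler_piMl//; exact: abs_sub01.
Qed.

Lemma apx0 : apx set0.
Proof.
split => // e e0; exists (fun=> 0); split.
- exact: (slow_cst 0).
- by move=> x; rewrite lexx ler01.
- have -> : (fun x => `|\1_set0 x - 0| * w x) = (fun=> 0).
    by apply/funext => x; rewrite indicE in_set0 subr0 normr0 mul0r.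
  by rewrite /Rintegral integral0_eq// ltW.
Qed.

Lemma apxC A : apx A -> apx (~` A).
Proof.
move=> [mA hA]; split; first exact: measurableC.
move=> e e0; have [f [sf f01 le]] := hA e e0.
exists (fun x => 1 - f x); split.
- have -> : ofreal (fun x => 1 - f x) = (fun x => 1 - ofreal f x).
    by apply/funext => x; rewrite /ofreal rmorphB.
  by apply: slowB => //; exact: slow_cst.
- by move=> x; have := f01 x; lra.
- apply: le_trans le; apply: le_of_eq.
  apply: eq_Rintegral => x _; congr (_ * _); rewrite -normrN; congr `|_|.
  rewrite !indicE in_setC; case: (x \in A) => /=; ring.
Qed.

Lemma apxU A B : apx A -> apx B -> apx (A `|` B).
Proof.
move=> [mA hA] [mB hB]; have mAB : measurable (A `|` B) by exact: measurableU.
split=> // e e0.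
have [f [sf f01 lef]] := hA (e / 2) (divr_gt0 e0 (ltr0Sn _ 1)).
have [g [sg g01 leg]] := hB (e / 2) (divr_gt0 e0 (ltr0Sn _ 1)).
pose h x := 1 - (1 - f x) * (1 - g x).
have sh : slow (ofreal h).
  have -> : ofreal h = (fun x => 1 - (1 - ofreal f x) * (1 - ofreal g x)).
    by apply/funext => x; rewrite /ofreal /h rmorphB rmorphM !rmorphB.
  apply: slowB; first exact: slow_cst.
  by apply: slowM; apply: slowB => //; exact: slow_cst.
have h01 x : 0 <= h x <= 1.
  by have /andP[? ?] := f01 x; have /andP[? ?] := g01 x; rewrite /h; apply/andP; split; nra.
exists h; split => //.
have if_ := integrable_gap (@measurable_indic _ _ R setT A mA) (ofreal_measurable sf) (@indic01 A) f01.
have ig_ := integrable_gap (@measurable_indic _ _ R setT B mB) (ofreal_measurable sg) (@indic01 B) g01.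
have -> : e = e / 2 + e / 2 by field.
apply: le_trans (lerD lef leg); rewrite -RintegralD//; apply: le_Rintegral => //.
- by apply: integrable_gap => //; [exact: ofreal_measurable|exact: indic01].
- by under [X in integrable _ _ X]eq_fun do rewrite /= EFinD; exact: integrableD.
- move=> x _; rewrite -mulrDl ler_wpM2r//.
  have -> : (\1_(A `|` B) x : R) = 1 - (1 - \1_A x) * (1 - \1_B x).
    by rewrite !indicE in_setU; case: (x \in A); case: (x \in B) => /=; ring.
  have := f01 x; have := g01 x; have := indic01 A x; have := indic01 B x; rewrite /h.
  move: (\1_A x : R) (\1_B x : R) (f x) (g x) => a b u v /andP[? ?] /andP[? ?] /andP[? ?] /andP[? ?].
  have -> : 1 - (1 - a) * (1 - b) - (1 - (1 - u) * (1 - v)) =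
     (a - u) * (1 - b) + (b - v) * (1 - u) by ring.
  apply: le_trans (ler_normD _ _) _; rewrite !normrM; apply: lerD.
    by rewrite ler_piMr// ger0_norm; lra.
  by rewrite ler_piMr// ger0_norm; lra.
Qed.

Lemma apx_limit (A : set E) (h : nat -> E -> R) : measurable A ->
  (forall k, exists2 B : set E, measurable B & h k = \1_B \/ slow (ofreal (h k))) ->
  (forall k x, 0 <= h k x <= 1) -> (forall x, h ^~ x @ \oo --> (\1_A x : R)) ->
  forall e, 0 < e -> exists k, \int[leb]_x (`|\1_A x - h k x| * w x) <= e.
Proof.
move=> mA mh h01 lim e e0.
have mA' := @measurable_indic _ _ R setT A mA.
have mh' k : measurable_fun setT (h k).
  have [B mB [->|]] := mh k; [exact: measurable_indic|exact: ofreal_measurable].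
have cv : (fun k => \int[leb]_x (`|\1_A x - h k x| * w x)) @ \oo --> \int[leb]_x (0 : R).
  apply: (@Rdct _ _ _ leb (fun k x => `|\1_A x - h k x| * w x) (fun=> 0) w _ _ iw _ _).2.
  - move=> k; apply: measurable_funM => //; apply: measurableT_comp.
      exact: normr_measurable.
    exact: measurable_funB.
  - exact: measurable_cst.
  - move=> k x; rewrite ger0_norm ?mulr_ge0// ler_piMl//.
    by apply: abs_sub01 => //; exact: indic01.
  - move=> x; rewrite -(mul0r (w x)); apply: cvgM; last exact: cvg_cst.
    rewrite -(normr0 R) -(subrr (\1_A x : R)); apply: cvg_norm.
    by apply: cvgB => //; exact: cvg_cst.
rewrite {2}/Rintegral integral0_eq//= in cv.
have /cvgrPdist_le /(_ _ e0) [N _ /(_ N (leqnn N))] := cv.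
by rewrite sub0r normrN => h'; exists N; apply: le_trans h'; exact: ler_norm.
Qed.

Lemma gap_trans (A : set E) (g f : E -> R) (e1 e2 : R) : measurable A ->
  measurable_fun setT g -> measurable_fun setT f ->
  (forall x, 0 <= g x <= 1) -> (forall x, 0 <= f x <= 1) ->
  \int[leb]_x (`|\1_A x - g x| * w x) <= e1 -> \int[leb]_x (`|g x - f x| * w x) <= e2 ->
  \int[leb]_x (`|\1_A x - f x| * w x) <= e1 + e2.
Proof.
move=> mA mg mf g01 f01 h1 h2; apply: le_trans (lerD h1 h2).
have mA' := @measurable_indic _ _ R setT A mA.
have i1 := integrable_gap mA' mg (@indic01 A) g01.
have i2 := integrable_gap mg mf g01 f01.
rewrite -RintegralD//; apply: le_Rintegral => //.
- by apply: integrable_gap => //; exact: indic01.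
- by under [X in integrable _ _ X]eq_fun do rewrite /= EFinD; exact: integrableD.
- move=> x _; rewrite -mulrDl ler_wpM2r//.
  have -> : \1_A x - f x = (\1_A x - g x) + (g x - f x) by ring.
  exact: ler_normD.
Qed.

Lemma apx_bigcup (F : (set E)^nat) : (forall k, apx (F k)) -> apx (\bigcup_k F k).
Proof.
move=> hF; have mU : measurable (\bigcup_k F k) by apply: bigcupT_measurable => k; have [] := hF k.
split=> // e e0.
pose G N := \big[setU/set0]_(i < N) F i.
have hG N : apx (G N).
  rewrite /G; elim: N => [|N IH]; first by rewrite big_ord0; exact: apx0.
  by rewrite big_ord_recr; exact: apxU.
have e2 : 0 < e / 2 by exact: divr_gt0.
have [N hN] : exists k, \int[leb]_x (`|\1_(\bigcup_k F k) x - \1_(G k) x| * w x) <= e / 2.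
  apply: (@apx_limit _ (fun k => \1_(G k) : E -> R)) => // [k|k x|x].
  - by exists (G k); [have [] := hG k|left].
  - exact: indic01.
  - have [[i _ Fix]|nU] := pselect ((\bigcup_k F k) x).
      have Ux : (\bigcup_k F k) x by exists i.
      apply: cvg_near_cst; near=> k; rewrite !indicE (mem_set Ux) mem_set//.
      rewrite /G -bigcup_mkord; exists i => //=; near: k; exact: nbhs_infty_gt.
    apply: cvg_near_cst; apply: nearW => k; rewrite !indicE !memNset//.
    by rewrite /G -bigcup_mkord => -[i _ Fi]; apply: nU; exists i.
have [mG /(_ _ e2)[f [sf f01 hf]]] := hG N; exists f; split => //.
have -> : e = e / 2 + e / 2 by field.
apply: (gap_trans (g := \1_(G N))) => //; [exact: ofreal_measurable|exact: indic01].
Unshelve. all: by end_near. Qed.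

Lemma apx_ray (i : 'I_n) (a : R) : apx [set x | a < x ord0 i].
Proof.
have mA : measurable [set x : E | a < x ord0 i].
  have -> : [set x : E | a < x ord0 i] = setT `&` (rV_coor i @^-1` `]a, +oo[).
    by rewrite setTI; apply/seteqP; split => x /=; rewrite in_itv/= andbT.
  by apply: measurable_rV_coor => //; exact: measurable_itv.
split=> // e e0.
(* This is [k ^+ 2 * (x_i - a) - k]. The shift by [k] makes the limit 0 on the hyperplane [x_i = a]
   itself, as the open half-space requires, while for [x_i > a] the slope [k ^+ 2] wins. *)
pose t k (x : E) := k%:R ^+ 2 * x ord0 i + (- (k%:R ^+ 2 * a) - k%:R).
have lb (z c : R) : 0 <= c -> c <= z -> expR (- z) <= (1 + c)^-1.
  move=> c0 cz; rewrite expRN lef_pV2 ?posrE ?expR_gt0//; last by rewrite ltr_wpDr.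
  by apply: le_trans (expR_ge1Dx _); rewrite lerD2l.
have lg_le (z : R) : logistic z <= expR z.
  have ep : 0 < expR (- z) by exact: expR_gt0.
  have -> : expR z = (expR (- z))^-1 by rewrite expRN invrK.
  by rewrite /logistic lef_pV2 ?posrE// ?addr_gt0// lerDr.
have lg_ge (z : R) : 1 - expR (- z) <= logistic z.
  have ep : 0 < expR (- z) by exact: expR_gt0.
  rewrite /logistic.
  have p1 : 0 < 1 + expR (- z) by rewrite addr_gt0.
  by rewrite -[leRHS]mul1r ler_pdivlMr//; nra.
suff lim x : (fun k => logistic (t k x)) @ \oo --> (\1_[set x : E | a < x ord0 i] x : R).
  have [k|k x|k hk] := @apx_limit _ (fun k x => logistic (t k x)) mA _ _ lim e e0.
  - by exists set0 => //; right; exact: slow_logistic.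
  - by rewrite (ltW (logistic_gt0 _)) (ltW (logistic_lt1 _)).
  exists (fun x => logistic (t k x)); split; [exact: slow_logistic| |exact: hk].
  by move=> x; rewrite (ltW (logistic_gt0 _)) (ltW (logistic_lt1 _)).
have [ax|xa] := ltP a (x ord0 i).
  rewrite indicE mem_set// mulr1n; apply/cvgrPdist_le => d d0.
  have dx : 0 < x ord0 i - a by rewrite subr_gt0.
  near=> k.
  have k0 : 0 <= k%:R :> R by exact: ler0n.
  have k1 : 2 / (x ord0 i - a) <= k%:R by near: k; exact: nbhs_infty_ger.
  have k2 : k.+1%:R^-1 <= d by apply: ltW; near: k; exact: (near_infty_natSinv_lt (PosNum d0)).
  have tk : k%:R <= t k x.
    rewrite ler_pdivrMr// in k1.
    have -> : t k x = k%:R * (k%:R * (x ord0 i - a)) - k%:R by rewrite /t; ring.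
    by have := ler_wpM2l k0 k1; lra.
  rewrite ger0_norm ?subr_ge0 ?(ltW (logistic_lt1 _))//.
  have := lg_ge (t k x); have := lb _ _ k0 tk; move: k2; rewrite -natr1 addrC; lra.
rewrite indicE memNset ?mulr0n; last by rewrite /= ltNge xa.
apply/cvgrPdist_le => d d0; near=> k.
  have k0 : 0 <= k%:R :> R by exact: ler0n.
have k2 : k.+1%:R^-1 <= d by apply: ltW; near: k; exact: (near_infty_natSinv_lt (PosNum d0)).
have tk : k%:R <= - t k x.
  have : k%:R ^+ 2 * (x ord0 i - a) <= 0 by rewrite mulr_ge0_le0 ?sqr_ge0// subr_le0.
  rewrite /t; lra.
rewrite sub0r normrN ger0_norm ?(ltW (logistic_gt0 _))//.
have := lg_le (t k x); have := lb _ _ k0 tk; rewrite opprK; move: k2; rewrite -natr1 addrC; lra.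
Unshelve. all: by end_near. Qed.

Lemma apx_sigma : sigma_algebra setT apx.
Proof.
by split; [exact: apx0|move=> A; rewrite setTD; exact: apxC|exact: apx_bigcup].
Qed.

Lemma apx_measurable (A : set E) : measurable A -> apx A.
Proof.
move: A; apply: smallest_sub; first exact: apx_sigma.
suff H (i : 'I_n) (Y : set R) : measurable Y -> apx (rV_coor i @^-1` Y).
  rewrite -bigcup_seq => B [i _ [Y mY <-]]; rewrite setTI; exact: H.
move=> mY; have : <<s @RGenOInfty.G R >> Y 
  by exact: (eq_rect _ (fun S : set (set R) => S Y) mY _ (RGenOInfty.measurableE R)).
move: Y {mY}; apply: smallest_sub; last first.
  move=> _ [a ->]; have := apx_ray i a; congr apx.
  by apply/seteqP; split => x /=; rewrite in_itv/= andbT.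
split.
- by rewrite preimage_set0; exact: apx0.
- by move=> Y hY; rewrite setTD preimage_setC; exact: apxC.
- by move=> F hF; rewrite preimage_bigcup; exact: apx_bigcup.
Qed.

End approximation.

(** * Pointwise bounds by testing against Schwartz functions *)

Section ae_bound.
Context {R : realType} {n : nat}.
Local Notation E := 'rV[R]_n.
Local Notation C := R[i].
Local Notation leb := (lebesgue_rV n).

(** The indicator of the set where the real part exceeds [M] is replaced by a smooth [phi] with
    small error for the weight [w], and the hypothesis is tested on [phi] times the Gaussian, which
    is a Schwartz function. *)
Lemma Re_le_ae (f : E -> C) (M : R) : 0 <= M -> cmeas f ->
  (forall phi, schwartz phi -> cintgr leb (fun x => f x * phi x)) ->
  (forall phi, schwartz phi ->
     modulus (cint leb (fun x => f x * phi x)) <= M * \int[leb]_x modulus (phi x)) ->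
  {ae leb, forall x, complex.Re (f x) <= M}.
Proof.
move=> M0 mf ci le.
have ig := cintgr_modulus (ci _ (@schwartz_gaus R n)).
have gpos (x : E) : 0 < gaus x by exact: gaus_gt0.
have eg x : modulus (f x * ofreal (@gaus R n) x) = modulus (f x) * gaus x.
  by rewrite modulusM modulus_ofreal ger0_norm ?(ltW (gpos x)).
have cgs := schwartz_cintgr (@schwartz_gaus R n).
have msg : measurable_fun setT (@gaus R n) by exact: cgs.1.1 || exact: (cintgr_cmeas cgs).1.
have igs : leb.-integrable setT (fun x => (@gaus R n x)%:E) by exact: cgs.1.
pose w (x : E) := (modulus (f x) + M) * gaus x.
have w0 x : 0 <= w x by rewrite mulr_ge0 ?addr_ge0 ?(ltW (gpos x)).
have mw : measurable_fun setT w.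
  by apply: measurable_funM => //; apply: measurable_funD => //; exact: cmeas_modulus.
have iw : leb.-integrable setT (fun x => (w x)%:E).
  have h := integrableD measurableT ig (integrableRZ M igs).
  by move: h; congr (integrable leb setT _); apply/funext => x; rewrite -EFinD eg /w mulrDl.
pose A := [set x : E | M < complex.Re (f x)].
have mA : measurable A.
  have -> : A = setT `&` ((fun x => complex.Re (f x)) @^-1` `]M, +oo[).
    by rewrite setTI; apply/seteqP; split => x /=; rewrite in_itv/= andbT.
  by apply: mf.1 => //; exact: measurable_itv.
pose h x := (complex.Re (f x) - M) * gaus x.
have ih : leb.-integrable setT (fun x => (h x)%:E).
  apply: (integrable_le _ iw) => [|x].
    by apply: measurable_funM => //; apply: measurable_funB => //; exact: mf.1.
  rewrite normrM (ger0_norm (ltW (gpos x))) ler_wpM2r ?(ltW (gpos x))//.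
  apply: le_trans (ler_normB _ _) _; rewrite (ger0_norm M0) lerD2r; exact: Re_le_modulus.
have mA' := @measurable_indic _ _ R setT A mA.
have mulh (f1 : E -> R) : measurable_fun setT f1 -> (forall x, 0 <= f1 x <= 1) ->
    leb.-integrable setT (fun x => (f1 x * h x)%:E).
  move=> mf1 f01; apply: (integrable_le _ (integrable_abse ih)).
    apply: measurable_funM => //; apply: measurable_funM => //.
    by apply: measurable_funB => //; exact: mf.1.
  move=> x; rewrite normrM ler_piMl//; have /andP[? ?] := f01 x.
  by rewrite ger0_norm.
have main : \int[leb]_x (\1_A x * h x) <= 0.
  apply/ler_addgt0Pr => e e0; rewrite add0r.
  have [_ /(_ e e0)[phi [sphi phi01 lphi]]] := apx_measurable w0 mw iw mA.
  have mphi := ofreal_measurable sphi.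
  have sps : schwartz (fun x => ofreal phi x * ofreal (@gaus R n) x).
    by apply: schwartz_slowM => //; exact: schwartz_gaus.
  have := le _ sps; have ic := ci _ sps.
  have -> : \int[leb]_x modulus (ofreal phi x * ofreal (@gaus R n) x) = \int[leb]_x (phi x * gaus x).
    apply: eq_Rintegral => x _; have /andP[p0 _] := phi01 x.
    by rewrite modulusM !modulus_ofreal !ger0_norm ?(ltW (gpos x)).
  move=> /(le_trans (le_trans (ler_norm _) (Re_le_modulus _))) /=.
  have -> : \int[leb]_x complex.Re (f x * (ofreal phi x * ofreal (@gaus R n) x)) =
      \int[leb]_x (phi x * complex.Re (f x) * gaus x).
    by apply: eq_Rintegral => x _; rewrite ReM ReM ImM /=; ring.
  move=> hle.
  have i1 : leb.-integrable setT (fun x => (phi x * complex.Re (f x) * gaus x)%:E).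
    have := ic.1; congr (integrable leb setT _); apply/funext => x; congr EFin.
    by rewrite ReM ReM ImM /=; ring.
  have i2 : leb.-integrable setT (fun x => (phi x * gaus x)%:E).
    apply: (integrable_le _ igs) => [|x]; first exact: measurable_funM.
    have /andP[? ?] := phi01 x.
    by rewrite ger0_norm ?mulr_ge0 ?(ltW (gpos x))// ler_piMl// ltW.
  have hle2 : \int[leb]_x (phi x * h x) <= 0.
    have -> : \int[leb]_x (phi x * h x) =
       \int[leb]_x (phi x * complex.Re (f x) * gaus x) - M * \int[leb]_x (phi x * gaus x).
      rewrite -RintegralZl// -RintegralB//; last exact: integrableRZ.
      by apply: eq_Rintegral => x _; rewrite /h; ring.
    by rewrite subr_le0.
  have i3 := mulh _ mphi phi01; have i4 := mulh _ mA' (@indic01 R n A).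
  apply: le_trans lphi; rewrite -[leLHS]subr0.
  apply: (@le_trans _ _ (\int[leb]_x (\1_A x * h x) - \int[leb]_x (phi x * h x))).
    by rewrite lerD2l lerN2.
  rewrite -RintegralB//; apply: le_Rintegral => //.
  - by have := integrableB measurableT i4 i3; congr (integrable leb setT _).
  - by apply: integrable_gap => //; exact: indic01.
  - move=> x _; rewrite -mulrBl; apply: le_trans (ler_norm _) _.
    rewrite normrM ler_wpM2l// /h /w normrM (ger0_norm (ltW (gpos x))).
    rewrite ler_wpM2r ?(ltW (gpos x))//; apply: le_trans (ler_normB _ _) _.
    by rewrite (ger0_norm M0) lerD2r; exact: Re_le_modulus.
have pos x : 0 <= \1_A x * h x.
  rewrite indicE; have [Ax|nA] := pselect (A x); last by rewrite memNset// mul0r.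
  by rewrite mem_set// mul1r mulr_ge0 ?(ltW (gpos x))// subr_ge0 ltW.
have i4 := mulh _ mA' (@indic01 R n A).
have mAh : measurable_fun setT (fun x => \1_A x * h x).
  apply: measurable_funM => //; apply: measurable_funM => //.
  by apply: measurable_funB => //; exact: mf.1.
have := ae_Rintegral0 mAh pos i4 main; apply: filterS => x h0.
rewrite leNgt; apply/negP => Mx.
move: h0; rewrite indicE mem_set// mul1r /h => /eqP.
by rewrite mulf_eq0 (gt_eqF (gpos x)) orbF subr_eq0 => /eqP e; rewrite e ltxx in Mx.
Qed.

(** Rotations by 1, -1, i, -i bound the real and the imaginary part separately. The resulting factor
    2 is harmless, since the lemma serves with [M = 0] and for norms that tend to 0. *)
Lemma modulus_le_ae (f : E -> C) (M : R) : 0 <= M -> cmeas f ->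
  (forall phi, schwartz phi -> cintgr leb (fun x => f x * phi x)) ->
  (forall phi, schwartz phi ->
     modulus (cint leb (fun x => f x * phi x)) <= M * \int[leb]_x modulus (phi x)) ->
  {ae leb, forall x, modulus (f x) <= 2 * M}.
Proof.
move=> M0 mf ci le.
have H (c : C) : modulus c = 1 -> {ae leb, forall x, complex.Re (c * f x) <= M}.
  move=> c1; have cE phi : (fun x => c * f x * phi x) = (fun x => c * (f x * phi x)).
    by apply/funext => x; rewrite mulrA.
  apply: Re_le_ae => // [|phi sphi|phi sphi].
  - by apply: cmeasM => //; exact: cmeas_cst.
  - by rewrite cE; apply: cintgrZ; exact: ci.
  - by rewrite cE cintZ ?modulusM ?c1 ?mul1r; [exact: le|exact: ci].
have m1 (z : C) : modulus (- z) = modulus z by exact: modulusN.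
have mi : modulus (0 +i* 1 : C)%C = 1 by rewrite modulusE /= expr0n add0r expr1n sqrtr1.
have h1 := H 1 (@modulus1 R); have h2 := H (-1) (etrans (m1 _) (@modulus1 R)).
have h3 := H _ mi; have h4 := H (- (0 +i* 1)%C) (etrans (m1 _) mi).
have h12 : {ae leb, forall x, complex.Re (1 * f x) <= M /\ complex.Re (-1 * f x) <= M}.
  by move: h1 h2; apply: filterS2 => x.
move: h12 h3 h4; apply: filterS3 => x [] + +.
rewrite !mul1r !mulNr !ReN mul1r ReM /= mul0r mul1r sub0r opprK => {h1 h2} h1 h2 h3 h4.
apply: le_trans (modulus_le _) _; rewrite mulr_natl mulr2n lerD// ler_norml.
  by apply/andP; split => //; lra.
by apply/andP; split => //; lra.
Qed.

Lemma ae_unique (f g : E -> C) : cmeas f -> cmeas g ->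
  (forall phi, schwartz phi -> cintgr leb (fun x => f x * phi x)) ->
  (forall phi, schwartz phi -> cintgr leb (fun x => g x * phi x)) ->
  (forall phi, schwartz phi ->
     cint leb (fun x => f x * phi x) = cint leb (fun x => g x * phi x)) ->
  {ae leb, forall x, f x = g x}.
Proof.
move=> mf mg cf cg fg.
have e phi : (fun x => (f x - g x) * phi x) = (fun x => f x * phi x - g x * phi x).
  by apply/funext => x; rewrite mulrBl.
have : {ae leb, forall x, modulus (f x - g x) <= 2 * 0}.
  apply: modulus_le_ae => // [|phi sp|phi sp].
  - by apply: cmeasD => //; exact: cmeasN.
  - by rewrite e; apply: cintgrD; [exact: cf|apply: cintgrN; exact: cg].
  - rewrite e cintB; [|exact: cf|exact: cg].
    by rewrite fg// subrr modulus0 mul0r.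
apply: filterS => x; rewrite mulr0 => h; apply/eqP; rewrite -subr_eq0; apply/eqP.
by apply: modulus_eq0; apply/eqP; rewrite eq_le h modulus_ge0.
Qed.

End ae_bound.

Definition hpair (R : realType) (p q : R) := [/\ 1 < p, 1 < q & p^-1 + q^-1 = 1].

Lemma hpairC (R : realType) (p q : R) : hpair p q -> hpair q p.
Proof. by move=> [? ? ?]; split => //; rewrite addrC. Qed.

(** * Density of Schwartz functions in L^p *)

Section schwartzLp.
Context {R : realType} {n : nat}.
Local Notation E := 'rV[R]_n.
Local Notation C := R[i].
Local Notation leb := (lebesgue_rV n).
Implicit Types (phi psi f g : E -> C) (p q : R).

Lemma schwartz_cmeas phi : schwartz phi -> cmeas phi.
Proof. by move=> /schwartz_smooth/smooth_cmeas. Qed.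

Lemma Sle_Lp p M phi : 1 <= p -> cmeas phi -> Sle 0 (2 * n) M phi ->
  Lp leb p phi /\ Np leb p phi <= M * (@jbint R n) `^ p^-1.
Proof.
move=> p1 mp hM; have M0 := Sle_ge0 hM; move/Bw0 : hM => hM.
have p0 : 0 < p by apply: lt_le_trans p1.
have b x : modulus (phi x) `^ p <= M `^ p * jb x ^- (2 * n).
  apply: (@le_trans _ _ ((M * jb x ^- (2 * n)) `^ p)).
    by apply: ger0_powR_le => //; exact: ltW.
  rewrite powRM// ?(ltW (jbV_gt0 _ _))// ler_wpM2l ?powR_ge0//.
  by apply: ge1r_powR => //; rewrite jbV_gt0 jbV_le1.
have ij := @jb_integrable R n (2 * n)%N (leqnn _).
have iM := integrableRZ (M `^ p) ij.
have lp : Lp leb p phi.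
  split => //; apply: (integrable_le _ iM); first exact: measurable_modp.
  by move=> x; rewrite ger0_norm ?powR_ge0//; exact: b.
split => //; have -> : M = (M `^ p) `^ p^-1 by rewrite -powRrM divff ?gt_eqF// powRr1.
rewrite -powRM ?powR_ge0 ?jbint_ge0//; apply: ger0_powR_le; [by rewrite invr_ge0 ltW|exact: Ip_ge0|].
by rewrite /jbint -RintegralZl//; apply: le_Rintegral => //; exact: lp.2.
Qed.

Lemma schwartz_Lp p phi : 1 <= p -> schwartz phi -> Lp leb p phi.
Proof.
move=> p1 sp; have [M hM] := schwartz_Sle 0 (2 * n) sp.
by have [] := Sle_Lp p1 (schwartz_cmeas sp) hM.
Qed.

Lemma Lp_schwartz_cintgr p q f phi : hpair p q -> Lp leb p f -> schwartz phi ->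
  cintgr leb (fun x => f x * phi x).
Proof.
move=> [p1 q1 pq] lf sp; apply: (hoelder_cintgr _ _ pq lf); rewrite ?(lt_trans ltr01)//.
by apply: schwartz_Lp => //; exact: ltW.
Qed.

Lemma Np0 p : 0 < p -> Np leb p (fun=> 0) = 0.
Proof.
move=> p0; rewrite /Np; have -> : Ip leb p (fun=> 0) = 0.
  rewrite /Ip; have -> : (fun x : E => modulus (0 : C) `^ p) = fun=> 0.
    by apply/funext => x; rewrite modulus0 powR0// gt_eqF.
  by rewrite /Rintegral integral0_eq.
by rewrite powR0// invr_eq0 gt_eqF.
Qed.

Lemma Lp_ae_unique p q f g : hpair p q -> Lp leb p f -> Lp leb p g ->
  (forall phi, schwartz phi ->
     cint leb (fun x => f x * phi x) = cint leb (fun x => g x * phi x)) ->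
  {ae leb, forall x, f x = g x}.
Proof.
move=> pq lf lg; apply: ae_unique; [exact: lf.1|exact: lg.1| |].
  by move=> phi; exact: Lp_schwartz_cintgr pq lf.
by move=> phi; exact: Lp_schwartz_cintgr pq lg.
Qed.

(** If [g] stays at distance [e] from the Schwartz functions, then the coefficient of [g] in
    [c * g + phi] is a functional of norm at most [e^-1]. Its representative pairs to 0 with every
    Schwartz function, hence vanishes almost everywhere, yet it pairs to 1 with [g]. *)
Lemma schwartz_dense p q g : hpair p q -> Lp leb p g -> forall e, 0 < e ->
  exists2 phi, schwartz phi & Np leb p (fun x => g x - phi x) <= e.
Proof.
move=> pq lg e e0; apply: contrapT => /forall2NP H.
have [p1 q1 pqe] := pq; have p0 : 0 < p by apply: lt_trans p1.
have q0 : 0 < q by apply: lt_trans q1.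
have far phi : schwartz phi -> e < Np leb p (fun x => g x - phi x).
  by move=> sp; have [//|/negP] := H phi; rewrite -ltNge.
pose X : set (E -> C) := [set h | exists c phi, schwartz phi /\ h = fun x => c * g x + phi x].
have uniq c phi c' phi' : schwartz phi -> schwartz phi' ->
    (fun x => c * g x + phi x) = (fun x => c' * g x + phi' x) -> c = c'.
  move=> sp sp' ee; apply: contrapT => cc.
  have d0 : c - c' != 0 by rewrite subr_eq0; apply/eqP.
  have := far (fun x => (c - c')^-1 * (phi' x - phi x)) (schwartzZ _ (schwartzB sp' sp)).
  have -> : (fun x => g x - (c - c')^-1 * (phi' x - phi x)) = fun=> 0.
    apply/funext => x; apply/eqP; rewrite subr_eq0; apply/eqP.
    apply: (mulfI d0); rewrite mulrA mulfV// mul1r.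
    have := congr1 (fun h => h x) ee => /= hx.
    by rewrite mulrBl; apply/eqP; rewrite subr_eq addrAC eq_sym subr_eq addrC hx addrC.
  by rewrite Np0// ltNge ltW.
pose ell (h : E -> C) : C := xget 0 [set c | exists2 phi, schwartz phi & h = fun x => c * g x + phi x].
have ellE c phi : schwartz phi -> ell (fun x => c * g x + phi x) = c.
  move=> sp; rewrite /ell; case: xgetP => [c' _ [phi' sp' ee]|/(_ c) []]; last by exists phi.
  exact/esym/(uniq _ _ _ _ sp sp' ee).
have lX h : X h -> Lp leb p h.
  move=> [c [phi [sp ->]]]; apply: LpD; [exact: ltW|exact: LpZ|].
  by apply: schwartz_Lp => //; exact: ltW.
have cX c f h : X f -> X h -> X (fun x => c * f x + h x).
  move=> [a [phi [sp ->]]] [b [psi [sps ->]]]; exists (c * a + b), (fun x => c * phi x + psi x).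
  split; first by apply: schwartzD => //; exact: schwartzZ.
  by apply/funext => x; ring.
have X0 : X (fun=> 0).
  by exists 0, (fun=> 0); split; [exact: schwartz0|apply/funext => x; rewrite mul0r addr0].
have [f [lf _ fX]] : exists f, [/\ Lp leb q f, Np leb q f <= e^-1 &
    forall h, X h -> cint leb (fun x => f x * h x) = ell h].
  apply: (@Lp_represent _ _ _ leb p q p1 q0 pqe X ell e^-1 lX X0 cX _ _ _).
  - move=> c _ _ [a [phi [sp ->]]] [b [psi [sps ->]]].
    have -> : (fun x => c * (a * g x + phi x) + (b * g x + psi x)) =
       (fun x => (c * a + b) * g x + (c * phi x + psi x)) by apply/funext => x; ring.
    by rewrite !ellE//; apply: schwartzD => //; exact: schwartzZ.
  - move=> _ [c [phi [sp ->]]]; rewrite ellE//.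
    have [->|c0] := eqVneq c 0; first by rewrite modulus0 mulr_ge0 ?Np_ge0// invr_ge0 ltW.
    have -> : (fun x => c * g x + phi x) = (fun x => c * (g x - (- c^-1) * phi x)).
      by apply/funext => x; rewrite mulNr opprK mulrDr mulrA mulfV// mul1r.
    have lh : Lp leb p (fun x => g x - - c^-1 * phi x).
      apply: LpB => //; first exact: ltW.
      by apply: LpZ; apply: schwartz_Lp => //; exact: ltW.
    rewrite NpZ// mulrCA ler_peMr// ler_pdivlMl// mulr1 ltW//; apply: far; exact: schwartzZ.
  - by rewrite invr_ge0 ltW.
have f0 : {ae leb, forall x, f x = 0}.
  have l0 : Lp leb q (fun _ : E => (0 : C)) by apply: Lp0; rewrite gt_eqF.
  apply: (Lp_ae_unique (hpairC pq) lf l0) => phi sp.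
  have -> : (fun x => 0 * phi x) = fun=> 0 by apply/funext => x; rewrite mul0r.
  have e0p : (fun x => 0 * g x + phi x) = phi by apply/funext => x; rewrite mul0r add0r.
  have Xp : X phi by exists 0, phi; rewrite e0p.
  by rewrite (fX _ Xp) cint0 -[phi]e0p ellE.
have Xg : X g by exists 1, (fun=> 0); split; [exact: schwartz0|apply/funext => x; rewrite mul1r addr0].
have := fX _ Xg; have -> : ell g = 1.
  have := ellE 1 (fun=> 0) (@schwartz0 _ _).
  by have -> : (fun x => 1 * g x + 0) = g by apply/funext => x; rewrite mul1r addr0.
have -> : cint leb (fun x => f x * g x) = cint leb (fun=> 0).
  apply: ae_eq_cint; [exact: (cmeasM lf.1 lg.1)|exact: cmeas_cst|].
  by apply: filterS f0 => x ->; rewrite mul0r.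
by rewrite cint0 => /eqP; rewrite eq_sym oner_eq0.
Qed.

End schwartzLp.

(** * Distributions given by L^p and bounded functions *)

Section distLp.
Context {R : realType} {n : nat}.
Local Notation E := 'rV[R]_n.
Local Notation C := R[i].
Local Notation leb := (lebesgue_rV n).
Local Notation dist := (@dist R n).
Implicit Types (phi psi f g : E -> C) (u v w : dist).

(** Linear on Schwartz functions and 0 elsewhere: with the encoding by zero extension, equality of
    two such functionals is equality on Schwartz functions. *)
Definition lin0 w := (forall f, ~ schwartz f -> w f = 0) /\
  forall (c : C) f g, schwartz f -> schwartz g ->
    w (fun x => c * f x + g x) = c * w f + w g.

(** Norm bounds in dual form. For [p] conjugate to [q], [Lb q K] on a linear functional says that it
    is a function of [L^p] norm at most [K] ([Lb_represents]); [Lb1] is the counterpart for bounded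
    functions. *)
Definition Lb (q K : R) w := forall phi, schwartz phi -> modulus (w phi) <= K * Np leb q phi.
Definition Lb1 (K : R) w := forall phi, schwartz phi ->
  modulus (w phi) <= K * \int[leb]_x modulus (phi x).

Lemma tempered_lin0 w : tempered w -> lin0 w. Proof. by case. Qed.

Lemma dist_eq u v : lin0 u -> lin0 v -> (forall phi, schwartz phi -> u phi = v phi) -> u = v.
Proof.
move=> [u0 _] [v0 _] h; apply/funext => f.
by have [/h//|nf] := pselect (schwartz f); rewrite u0// v0.
Qed.

Lemma lin0Z w (c : C) f : lin0 w -> schwartz f -> w (fun x => c * f x) = c * w f.
Proof.
move=> [w0 wl] sf; have s0 := @schwartz0 R n.
have w00 : w (fun=> 0) = 0.
  have := wl 1 _ _ s0 s0; have -> : (fun x : E => 1 * 0 + 0 : C) = fun=> 0.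
    by apply/funext => x; rewrite mul1r addr0.
  by rewrite mul1r => /esym/(congr1 (fun z => z - w (fun=> 0))); rewrite addrK subrr.
have := wl c _ _ sf s0; rewrite w00 addr0 => <-; congr w; apply/funext => x.
by rewrite addr0.
Qed.

Lemma lin0D w f g : lin0 w -> schwartz f -> schwartz g ->
  w (fun x => f x + g x) = w f + w g.
Proof.
move=> [w0 wl] sf sg; rewrite -[w f]mul1r -wl//; congr w; apply/funext => x.
by rewrite mul1r.
Qed.

Lemma lin0B w f g : lin0 w -> schwartz f -> schwartz g ->
  w (fun x => f x - g x) = w f - w g.
Proof.
move=> lw sf sg; rewrite -[- w g]mulN1r -lin0Z// -lin0D//; last exact: schwartzZ.
by congr w; apply/funext => x; rewrite mulN1r.
Qed.

Lemma lin0P w (c : C) v : lin0 v -> lin0 w -> lin0 (fun f => c * v f + w f).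
Proof.
move=> [v0 vl] [w0 wl]; split=> [f nf|d f g sf sg]; first by rewrite v0// w0// mulr0 addr0.
by rewrite vl// wl//; ring.
Qed.

Lemma tempered_Lb q K w : 1 <= q -> 0 <= K -> lin0 w -> Lb q K w -> tempered w.
Proof.
move=> q1 K0 [w0 wl] bw; split => //; exists (2 * n)%N, (K * (@jbint R n) `^ q^-1) => f M sf.
move=> /schwartz_leE h; have M0 := Sle_ge0 h.
have h0 : Sle 0 (2 * n) M f by apply: Sle_mono h.
have [_ b] := Sle_Lp q1 (schwartz_cmeas sf) h0.
apply: le_trans (bw _ sf) _; rewrite -mulrA ler_wpM2l// mulrC; exact: b.
Qed.

Lemma tempered_Lb1 K w : 0 <= K -> lin0 w -> Lb1 K w -> tempered w.
Proof.
move=> K0 [w0 wl] bw; split => //; exists (2 * n)%N, (K * @jbint R n) => f M sf.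
move=> /schwartz_leE h; have M0 := Sle_ge0 h.
have h0 : Sle 0 (2 * n) M f by apply: Sle_mono h.
have b := Sle_int_le (schwartz_cmeas sf) h0.
apply: le_trans (bw _ sf) _; rewrite -mulrA ler_wpM2l// mulrC; exact: b.
Qed.

Section pq.
Variables (p q : R) (H : hpair p q).
Let p1 : 1 < p. Proof. by case: H. Qed.
Let q1 : 1 < q. Proof. by case: H. Qed.
Let p0 : 0 < p. Proof. exact: lt_trans p1. Qed.
Let q0 : 0 < q. Proof. exact: lt_trans q1. Qed.
Let pq : p^-1 + q^-1 = 1. Proof. by case: H. Qed.

Lemma represents_ae f g w : Lp leb p f -> represents f w -> represents g w ->
  [/\ Lp leb p g, Np leb p g = Np leb p f & {ae leb, forall x, f x = g x}].
Proof.
move=> lf [tw mf hf] [_ mg hg].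
have fg : {ae leb, forall x, f x = g x}.
  apply: ae_unique => // phi sp; first by have [] := hf _ sp.
    by have [] := hg _ sp.
  by have [_ e1] := hf _ sp; have [_ e2] := hg _ sp; exact: (etrans (esym e1) e2).
have NN := @ae_eq_Np _ _ _ leb p f g mf mg fg.
split; [|exact: (esym NN)|exact: fg].
split; first exact: mg.
have eI : (\int[leb]_x `|(modulus (g x) `^ p)%:E| = \int[leb]_x `|(modulus (f x) `^ p)%:E|)%E.
  have mm (h : E -> C) : cmeas h -> measurable_fun setT (fun x => `|(modulus (h x) `^ p)%:E|%E).
    move=> mh; apply: (@measurableT_comp _ _ _ _ _ _ (@abse R)).
      exact: abse_measurable.
    by apply: measurable_EFin; exact: measurable_modp.
  have fg2 : ae_eq leb setT (fun x => `|(modulus (g x) `^ p)%:E|%E)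
      (fun x => `|(modulus (f x) `^ p)%:E|%E) by apply: filterS fg => x /= -> _.
  exact: (ae_eq_integral _ _ measurableT (mm _ mg) (mm _ mf) fg2).
apply/integrableP; split; first by apply: measurable_EFin; exact: measurable_modp.
by rewrite eI; have /integrableP[_] := lf.2.
Qed.

Lemma Lb_represents K w : 0 <= K -> lin0 w -> Lb q K w ->
  exists f, [/\ represents f w, Lp leb p f & Np leb p f <= K].
Proof.
move=> K0 lw bw; have [w0 wl] := lw.
have [f [lf nf fX]] := @Lp_represent _ _ _ leb q p q1 p0 (etrans (addrC _ _) pq)
  (@schwartz R n) w K (fun f sf => schwartz_Lp (ltW q1) sf) (@schwartz0 R n)
  (fun c f g sf sg => schwartzD (schwartzZ c sf) sg) wl bw K0.
exists f; split => //; split; [exact: (tempered_Lb (ltW q1) K0 lw bw)|exact: lf.1|].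
move=> phi sp; split; last exact: (esym (fX _ sp)).
exact: (Lp_schwartz_cintgr H lf sp).
Qed.

Lemma fun_of_spec K w : 0 <= K -> lin0 w -> Lb q K w ->
  [/\ represents (fun_of w) w, Lp leb p (fun_of w) & Np leb p (fun_of w) <= K].
Proof.
move=> K0 lw bw; have [f [rf lf nf]] := Lb_represents K0 lw bw.
have rw : represents (fun_of w) w by rewrite /fun_of; case: xgetP => [//|/(_ f)].
have [l2 n2 _] := represents_ae lf rf rw.
split; [exact: rw|exact: l2|exact: (eq_ind_r (fun t => t <= K) nf n2)].
Qed.

Lemma dLnorm_le K w : 0 <= K -> lin0 w -> Lb q K w -> (dLnorm p%:E w <= K%:E)%E.
Proof.
move=> K0 lw bw; have [f [rf lf nf]] := Lb_represents K0 lw bw.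
apply: le_trans (ereal_inf_lbound _) _; first by exists f; [exact: rf|reflexivity].
by rewrite Lnorm_Np// lee_fin.
Qed.

Lemma Lb_eps K w : (forall e, 0 < e -> Lb q (K + e) w) -> Lb q K w.
Proof.
move=> h phi sp; apply/ler_addgt0Pr => e e0.
have N0 := Np_ge0 leb q phi; have N1 : 0 < Np leb q phi + 1 by rewrite ltr_wpDl.
have := h (e / (Np leb q phi + 1)) (divr_gt0 e0 N1) phi sp.
move/le_trans; apply; rewrite mulrDl lerD2l mulrAC ler_pdivrMr// ler_wpM2l ?(ltW e0)//.
by rewrite lerDl.
Qed.

Lemma dLnorm_Lb K w : (dLnorm p%:E w <= K%:E)%E -> tempered w /\ Lb q K w.
Proof.
move=> le.
have Hf e : 0 < e -> exists2 f, represents f w & (Lnorm leb p%:E (fun x => (modulus (f x))%:E) < (K + e)%:E)%E.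
  move=> e0; have : (dLnorm p%:E w < (K + e)%:E)%E.
    by apply: le_lt_trans le _; rewrite lte_fin ltrDl.
  by move=> /ereal_inf_lt[_ [f rf <-] lt]; exists f.
split; first by have [f [tw _ _] _] := Hf 1 ltr01.
apply: Lb_eps => e e0 phi sp; have [f [tw mf hf] lt] := Hf e e0.
have lf : Lp leb p f by apply: Lnorm_Lp => //; apply: lt_trans lt _; exact: ltry.
move: lt; rewrite Lnorm_Np// lte_fin => /ltW le2.
have [_ ->] := hf _ sp.
apply: le_trans (hoelder_cint p0 q0 pq lf (schwartz_Lp (ltW q1) sp)) _.
by rewrite ler_wpM2r// Np_ge0.
Qed.

Lemma dLnorm_ge0 w : (0 <= dLnorm p%:E w)%E.
Proof. by apply: le_ereal_inf_tmp => _ [f _ <-]; exact: Lnorm_ge0. Qed.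

Lemma dLnorm_fin w : (dLnorm p%:E w < +oo)%E ->
  exists K : R, [/\ 0 <= K, dLnorm p%:E w = K%:E, tempered w & Lb q K w].
Proof.
move=> h; have h0 := dLnorm_ge0 w; exists (fine (dLnorm p%:E w)).
have e : dLnorm p%:E w = (fine (dLnorm p%:E w))%:E by rewrite fineK// ge0_fin_numE.
have [tw lw] := @dLnorm_Lb (fine (dLnorm p%:E w)) w (eq_ind _ (fun t => (_ <= t)%E) (le_refl _) _ e).
by split; [exact: fine_ge0|exact: e|exact: tw|exact: lw].
Qed.

End pq.

Lemma dLnormy_Lb1 K w : 0 <= K -> (dLnorm +oo w <= K%:E)%E -> tempered w /\ Lb1 K w.
Proof.
move=> K0 le.
have Hf e : 0 < e -> exists2 f, represents f w & (Lnorm leb +oo (fun x => (modulus (f x))%:E) < (K + e)%:E)%E.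
  move=> e0; have : (dLnorm +oo w < (K + e)%:E)%E.
    by apply: le_lt_trans le _; rewrite lte_fin ltrDl.
  by move=> /ereal_inf_lt[_ [f rf <-] lt]; exists f.
split; first by have [f [tw _ _] _] := Hf 1 ltr01.
move=> phi sp; have ip := cintgr_modulus (schwartz_cintgr sp).
have i0 : 0 <= \int[leb]_x modulus (phi x) by apply: Rintegral_ge0 => x _.
apply/ler_addgt0Pr => e e0.
have N1 : 0 < \int[leb]_x modulus (phi x) + 1 by rewrite ltr_wpDl.
pose d := e / (\int[leb]_x modulus (phi x) + 1).
have d0 : 0 < d by exact: divr_gt0.
have [f [tw mf hf] lt] := Hf d d0.
have ub : {ae leb, forall x, modulus (f x) <= K + d}.
  (* The norm at [+oo] is an essential supremum if the space has positive measure and 0 by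
     convention otherwise; in the latter case every property holds almost everywhere. *)
  move: lt; rewrite unlock; case: ifPn => mu0 lt.
    have := ess_sup_ge leb (abse \o (fun x => (modulus (f x))%:E)).
    apply: filterS => x /le_trans /(_ (ltW lt)) /=; rewrite lee_fin ger0_norm//.
  exists setT; split; [exact: measurableT| |by move=> x _].
  by apply/eqP; rewrite eq_le measure_ge0 andbT leNgt.
have [ci ->] := hf _ sp.
apply: le_trans (modulus_cint_le ci) _.
apply: (@le_trans _ _ ((K + d) * \int[leb]_x modulus (phi x))).
  rewrite -RintegralZl//.
  have mfp : measurable_fun setT (fun x => modulus (f x * phi x)).
    by apply: cmeas_modulus; apply: cmeasM => //; exact: schwartz_cmeas.
  pose h x := Num.min (modulus (f x * phi x)) ((K + d) * modulus (phi x)).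
  have mKp : measurable_fun setT (fun x => (K + d) * modulus (phi x)).
    by apply: measurable_funM => //; apply: cmeas_modulus; exact: schwartz_cmeas.
  have mh : measurable_fun setT h by exact: measurable_minr.
  have -> : \int[leb]_x modulus (f x * phi x) = \int[leb]_x h x.
    apply: ae_eq_Rint => //; apply: filterS ub => x hx; apply/esym/min_idPl.
    by rewrite modulusM ler_wpM2r.
  have Kd0 : 0 <= K + d by rewrite addr_ge0// ltW.
  apply: le_Rintegral => //; last by move=> x _; rewrite /h ge_min lexx orbT.
    apply: (integrable_le mh (integrableRZ (K + d) ip)) => x.
    rewrite ger0_norm; first by rewrite /h ge_min lexx orbT.
    by rewrite le_min modulus_ge0 mulr_ge0.
  exact: integrableRZ.
rewrite mulrDl lerD2l /d mulrAC ler_pdivrMr// ler_wpM2l ?(ltW e0)// lerDl//.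
Qed.

(** Bounded functions are reached through [L^2]: after multiplying test functions by the weight [G],
    the [L^1] bound becomes an [L^2] bound, because [G^-1] is square integrable. The representative
    found in [L^2] is then bounded pointwise by [modulus_le_ae], whence the factor 2. *)
Lemma dLnormy_le K w : 0 <= K -> lin0 w -> Lb1 K w -> (dLnorm +oo w <= (2 * K)%:E)%E.
Proof.
move=> K0 lw bw; have tw := tempered_Lb1 K0 lw bw.
have hh : 2^-1 + 2^-1 = 1 :> R by field.
pose G (x : E) : R := jb x ^+ (2 * n).
have G0 x : 0 < G x by exact: jbX_gt0.
have mG : measurable_fun setT G by apply: measurable_funX; exact: measurable_jb.
pose X : set (E -> C) := [set h | exists2 phi, schwartz phi & h = fun x => (G x)%:C%C * phi x].
pose ell (h : E -> C) : C := w (fun x => ((G x)^-1)%:C%C * h x).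
have GKx x (z : C) : ((G x)^-1)%:C%C * ((G x)%:C%C * z) = z.
  by rewrite mulrA -rmorphM /= mulVf ?gt_eqF// rmorph1 mul1r.
have GK phi : (fun x => ((G x)^-1)%:C%C * ((G x)%:C%C * phi x)) = phi.
  by apply/funext => x; rewrite mulrA -rmorphM /= mulVf ?gt_eqF// rmorph1 mul1r.
have [f [lf _ fX]] : exists f, [/\ Lp leb 2 f, Np leb 2 f <= K * (@jbint R n) `^ 2^-1 &
    forall h, X h -> cint leb (fun x => f x * h x) = ell h].
  have lX h : X h -> Lp leb 2 h.
    move=> [phi sp ->]; have [M hM] := schwartz_Sle 0 (2 * n + 2 * n) sp.
    have mph : cmeas (fun x => (G x)%:C%C * phi x).
      by apply: cmeasM; [exact: cmeas_real|exact: schwartz_cmeas].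
    have [] // := @Sle_Lp R n 2 M _ (ler1n _ 2) mph; apply/Bw0 => x.
    rewrite modulusM modulus_ofreal ger0_norm ?(ltW (G0 x))//.
    move/Bw0 : hM => /(_ x) h'; apply: le_trans (ler_wpM2l (ltW (G0 x)) h') _.
    rewrite /G exprD invfM mulrCA mulrA [_ * jb x ^+ _]mulrC mulrA.
    by apply: le_of_eq; field; rewrite gt_eqF// jbX_gt0.
  apply: (@Lp_represent _ _ _ leb 2 2 (ltr1n _ 2) (ltr0n _ 2) _ X ell _ lX).
  - by field.
  - by exists (fun=> 0); [exact: schwartz0|apply/funext => x; rewrite mulr0].
  - move=> c _ _ [phi sp ->] [psi sps ->]; exists (fun x => c * phi x + psi x).
      by apply: schwartzD => //; exact: schwartzZ.
    by apply/funext => x; ring.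
  - move=> c _ _ [phi sp ->] [psi sps ->]; rewrite /ell !GK -(lw.2 c _ _ sp sps); congr w.
    by apply/funext => x; rewrite mulrDr mulrCA !GKx.
  - move=> _ [phi sp ->]; rewrite /ell GK; apply: le_trans (bw _ sp) _.
    rewrite -mulrA ler_wpM2l//.
    have ij := @jb_integrable R n (2 * n)%N (leqnn _).
    pose k (x : E) : C := ((jb x ^- (2 * n)))%:C%C.
    have mk : cmeas k by apply: cmeas_real; apply: measurable_funX || exact: (@measurable_int _ _ _ _ _ _ ij) || (apply/measurable_EFinP; exact: (measurable_int _ ij)).
    have lk : Lp leb 2 k.
      have [] // := @Sle_Lp R n 2 1 k (ler1n _ 2) mk; apply/Bw0 => x.
      by rewrite mul1r modulus_ofreal ger0_norm// ltW// jbV_gt0.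
    have lh : Lp leb 2 (fun x => (G x)%:C%C * phi x) by apply: lX; exists phi.
    have [_] := hoelder_int (ltr0n R 2) (ltr0n R 2) hh lk lh.
    have -> : \int[leb]_x modulus (k x * ((G x)%:C%C * phi x)) = \int[leb]_x modulus (phi x).
      apply: eq_Rintegral => x _; congr modulus; rewrite mulrA -rmorphM /=.
      by rewrite mulVf ?gt_eqF ?jbX_gt0// rmorph1 mul1r.
    move=> h; apply: le_trans h _.
    rewrite ler_wpM2r ?Np_ge0//.
    have [] // := @Sle_Lp R n 2 1 k (ler1n _ 2) mk; last by rewrite mul1r.
    by apply/Bw0 => x; rewrite mul1r modulus_ofreal ger0_norm// ltW// jbV_gt0.
  - by rewrite mulr_ge0// powR_ge0.
pose g x : C := f x * (G x)%:C%C.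
have mg : cmeas g by apply: cmeasM; [exact: lf.1|exact: cmeas_real].
have gE phi : (fun x => g x * phi x) = (fun x => f x * ((G x)%:C%C * phi x)).
  by apply/funext => x; rewrite /g mulrA.
have lX2 phi : schwartz phi -> Lp leb 2 (fun x => (G x)%:C%C * phi x).
  move=> sp; have [M hM] := schwartz_Sle 0 (2 * n + 2 * n) sp.
  have mph : cmeas (fun x => (G x)%:C%C * phi x).
    by apply: cmeasM; [exact: cmeas_real|exact: schwartz_cmeas].
  have [] // := @Sle_Lp R n 2 M _ (ler1n _ 2) mph; apply/Bw0 => x.
  rewrite modulusM modulus_ofreal ger0_norm ?(ltW (G0 x))//.
  move/Bw0 : hM => /(_ x) h'; apply: le_trans (ler_wpM2l (ltW (G0 x)) h') _.
  rewrite /G exprD invfM mulrCA mulrA [_ * jb x ^+ _]mulrC mulrA.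
  by apply: le_of_eq; field; rewrite gt_eqF// jbX_gt0.
have ci phi : schwartz phi -> cintgr leb (fun x => g x * phi x).
  move=> sp; rewrite gE; apply: (hoelder_cintgr (ltr0n R 2) (ltr0n R 2) _ lf (lX2 _ sp)).
  by field.
have wE phi : schwartz phi -> w phi = cint leb (fun x => g x * phi x).
  by move=> sp; rewrite gE fX; [rewrite /ell GK|exists phi].
apply: le_trans (ereal_inf_lbound _) _.
  by exists g; last reflexivity; split => // phi sp; split; [exact: ci|exact: wE].
have ub : {ae leb, forall x, modulus (g x) <= 2 * K}.
  by apply: modulus_le_ae => // phi sp; rewrite -wE//; exact: bw.
rewrite unlock; case: ifPn => _; last by rewrite lee_fin mulr_ge0.
apply/ess_supP; apply: filterS ub => x h; rewrite /= lee_fin ger0_norm//.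
Qed.

End distLp.

(** * Pairing of conjugate Lebesgue spaces and density arguments *)

Section pairing.
Context {R : realType} {n : nat}.
Local Notation E := 'rV[R]_n.
Local Notation C := R[i].
Local Notation leb := (lebesgue_rV n).
Local Notation dist := (@dist R n).
Implicit Types (phi psi f g : E -> C) (u v w : dist).

(** The index is the exponent of the test functions: for [p] conjugate to [q], [Qd q w] means that
    [w] is a function in [L^p]. *)
Definition Qd (q : R) w := lin0 w /\ exists2 K, 0 <= K & Lb q K w.
Definition pair w1 w2 : C := cint leb (fun x => fun_of w1 x * fun_of w2 x).
Definition toD phi : dist := ext0 schwartz (fun psi => cint leb (fun x => phi x * psi x)).

Lemma pairC w1 w2 : pair w1 w2 = pair w2 w1.
Proof. by apply: eq_cint => x; rewrite mulrC. Qed.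

Lemma toDE phi psi : schwartz psi -> toD phi psi = cint leb (fun x => phi x * psi x).
Proof. by move=> sp; rewrite /toD /ext0 /patch mem_set. Qed.

Lemma lin0_toD phi : schwartz phi -> lin0 (toD phi).
Proof.
move=> sp; split=> [f nf|c f g sf sg]; first by rewrite /toD /ext0 /patch memNset.
rewrite !toDE//; last by apply: schwartzD => //; exact: schwartzZ.
rewrite -cintZ -?cintD; try by apply: schwartz_cintgr; apply: schwartzM.
  by apply: eq_cint => x; ring.
by apply: cintgrZ; apply: schwartz_cintgr; apply: schwartzM.
Qed.

Lemma Lb_lin q K K' (c : C) u v : Lb q K u -> Lb q K' v ->
  Lb q (modulus c * K + K') (fun f => c * u f + v f).
Proof.
move=> bu bv phi sp; apply: le_trans (modulusD _ _) _.
rewrite modulusM mulrDl lerD ?bv// -mulrA ler_wpM2l//; exact: bu.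
Qed.

Lemma Qd_lin q (c : C) u v : Qd q u -> Qd q v -> Qd q (fun f => c * u f + v f).
Proof.
move=> [lu [K K0 bu]] [lv [K' K0' bv]]; split; first exact: lin0P.
by exists (modulus c * K + K'); [rewrite addr_ge0// mulr_ge0|exact: Lb_lin].
Qed.

Section pq.
Variables (p q : R) (H : hpair p q).
Let p1 : 1 < p. Proof. by case: H. Qed.
Let q1 : 1 < q. Proof. by case: H. Qed.
Let p0 : 0 < p. Proof. exact: lt_trans p1. Qed.
Let q0 : 0 < q. Proof. exact: lt_trans q1. Qed.
Let pq : p^-1 + q^-1 = 1. Proof. by case: H. Qed.
Let H' := hpairC H.

Lemma fun_of_Qd w : Qd q w -> represents (fun_of w) w /\ Lp leb p (fun_of w).
Proof. by move=> [lw [K K0 bw]]; have [] := fun_of_spec H K0 lw bw. Qed.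

Lemma Qd_represents f w : Lp leb p f -> represents f w -> Qd q w.
Proof.
move=> lf [tw mf hf]; split; first exact: tempered_lin0.
exists (Np leb p f); first exact: Np_ge0.
move=> phi sp; have [_ ->] := hf _ sp.
exact: (hoelder_cint p0 q0 pq lf (schwartz_Lp (ltW q1) sp)).
Qed.

Lemma represents_toD phi : schwartz phi -> represents phi (toD phi).
Proof.
move=> sp; have lp := schwartz_Lp (ltW p1) sp.
split; [|exact: schwartz_cmeas|move=> psi sps; split; last by rewrite toDE].
  apply: (@tempered_Lb _ _ q (Np leb p phi)); rewrite ?Np_ge0 ?(ltW q1)//; first exact: lin0_toD.
  by move=> psi sps; rewrite toDE//; exact: (hoelder_cint p0 q0 pq lp (schwartz_Lp (ltW q1) sps)).
by apply: schwartz_cintgr; exact: schwartzM.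
Qed.

Lemma Lb_toD phi : schwartz phi -> Lb q (Np leb p phi) (toD phi).
Proof.
move=> sp psi sps; rewrite toDE//.
exact: (hoelder_cint p0 q0 pq (schwartz_Lp (ltW p1) sp) (schwartz_Lp (ltW q1) sps)).
Qed.

Lemma Qd_toD phi : schwartz phi -> Qd q (toD phi).
Proof.
by move=> sp; split; [exact: lin0_toD|exists (Np leb p phi); [exact: Np_ge0|exact: Lb_toD]].
Qed.

Lemma represents_fun_of f w : Lp leb p f -> represents f w ->
  {ae leb, forall x, fun_of w x = f x}.
Proof.
move=> lf rf; have [rw lw] := fun_of_Qd (Qd_represents lf rf).
by have [_ _] := represents_ae lw rw rf.
Qed.

End pq.

Section pq2.
Variables (p q : R) (H : hpair p q).
Let p1 : 1 < p. Proof. by case: H. Qed.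
Let q1 : 1 < q. Proof. by case: H. Qed.
Let p0 : 0 < p. Proof. exact: lt_trans p1. Qed.
Let q0 : 0 < q. Proof. exact: lt_trans q1. Qed.
Let pq : p^-1 + q^-1 = 1. Proof. by case: H. Qed.
Let H' := hpairC H.
Let qp : q^-1 + p^-1 = 1. Proof. by rewrite addrC. Qed.

Lemma pair_rep f1 f2 w1 w2 : Lp leb q f1 -> represents f1 w1 ->
  Lp leb p f2 -> represents f2 w2 -> pair w1 w2 = cint leb (fun x => f1 x * f2 x).
Proof.
move=> l1 r1 l2 r2.
have a1 := represents_fun_of H' l1 r1; have a2 := represents_fun_of H l2 r2.
have [_ m1] := fun_of_Qd H' (Qd_represents H' l1 r1).
have [_ m2] := fun_of_Qd H (Qd_represents H l2 r2).
apply: ae_eq_cint; [exact: (cmeasM m1.1 m2.1)|exact: (cmeasM l1.1 l2.1)|].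
by move: a1 a2; apply: filterS2 => x -> ->.
Qed.

Lemma pair_le K1 K2 w1 w2 : 0 <= K1 -> 0 <= K2 -> lin0 w1 -> lin0 w2 ->
  Lb p K1 w1 -> Lb q K2 w2 -> modulus (pair w1 w2) <= K1 * K2.
Proof.
move=> K10 K20 l1 l2 b1 b2.
have [_ m1 n1] := fun_of_spec H' K10 l1 b1; have [_ m2 n2] := fun_of_spec H K20 l2 b2.
apply: le_trans (hoelder_cint q0 p0 qp m1 m2) _.
by apply: ler_pM => //; exact: Np_ge0.
Qed.

Lemma represents_lin (c : C) f g u v : Lp leb p f -> Lp leb p g ->
  represents f u -> represents g v ->
  represents (fun x => c * f x + g x) (fun h => c * u h + v h).
Proof.
move=> lf lg rf rg; have [lu [K K0 bK]] := Qd_lin c (Qd_represents H lf rf) (Qd_represents H lg rg).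
have [tu mf hf] := rf; have [tv mg hg] := rg.
split; [exact: (tempered_Lb (ltW q1) K0 lu bK)|by apply: cmeasD => //; apply: cmeasM => //; exact: cmeas_cst|].
move=> phi sp; have [c1 e1] := hf _ sp; have [c2 e2] := hg _ sp.
have e : (fun x => (c * f x + g x) * phi x) = (fun x => c * (f x * phi x) + g x * phi x).
  by apply/funext => x; ring.
rewrite e; split; first by apply: cintgrD => //; exact: cintgrZ.
have h := cintD (cintgrZ c c1) c2; rewrite (cintZ c c1) in h.
by rewrite e1 e2; exact: (esym h).
Qed.

Lemma pair_linr (c : C) w1 u v : Qd p w1 -> Qd q u -> Qd q v ->
  pair w1 (fun f => c * u f + v f) = c * pair w1 u + pair w1 v.
Proof.
move=> Q1 Qu Qv; have [r1 l1] := fun_of_Qd H' Q1.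
have [ru lu] := fun_of_Qd H Qu; have [rv lv] := fun_of_Qd H Qv.
have lc : Lp leb p (fun x => c * fun_of u x + fun_of v x).
  by apply: LpD; [exact: ltW|exact: LpZ|].
rewrite (pair_rep l1 r1 lc (represents_lin c lu lv ru rv)).
have cu := hoelder_cintgr q0 p0 qp l1 lu; have cv := hoelder_cintgr q0 p0 qp l1 lv.
rewrite /pair -cintZ// -cintD//; last exact: cintgrZ.
by apply: eq_cint => x; ring.
Qed.

Lemma pair_toD w phi : Qd p w -> schwartz phi -> pair w (toD phi) = w phi.
Proof.
move=> Qw sp; have [rw lw] := fun_of_Qd H' Qw.
rewrite (pair_rep lw rw (schwartz_Lp (ltW p1) sp) (represents_toD H sp)).
by have [_ _ /(_ _ sp) [_ ->]] := rw.
Qed.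

Lemma toD_dense w e : Qd q w -> 0 < e ->
  exists2 phi, schwartz phi & Lb q e (fun f => (-1) * toD phi f + w f).
Proof.
move=> Qw e0; have [rw lw] := fun_of_Qd H Qw.
have [phi sp le] := schwartz_dense H lw e0; exists phi => // psi sps.
have [_ _ /(_ _ sps) [ci ->]] := rw.
have cp : cintgr leb (fun x => phi x * psi x) by apply: schwartz_cintgr; exact: schwartzM.
rewrite toDE// mulN1r addrC -/(cint leb _) -cintB//.
have -> : (fun x => fun_of w x * psi x - phi x * psi x) = (fun x => (fun_of w x - phi x) * psi x).
  by apply/funext => x; ring.
have ld : Lp leb p (fun x => fun_of w x - phi x).
  by apply: LpB => //; [exact: ltW|apply: schwartz_Lp => //; exact: ltW].
apply: le_trans (hoelder_cint p0 q0 pq ld (schwartz_Lp (ltW q1) sps)) _.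
by rewrite ler_wpM2r// Np_ge0.
Qed.

(** Functionals bounded on [L^p] uniformly in [i] tend to 0 everywhere once they do so on Schwartz
    functions. The filter is arbitrary because the lemma serves for pairs of summation bounds, for
    steps tending to infinity and for sequences. *)
Lemma lim_by_density {I : Type} (D : set_system I) {FD : Filter D} (F : I -> dist -> C) (KF : R) :
  0 <= KF ->
  (forall i (c : C) u v, Qd q u -> Qd q v -> F i (fun f => c * u f + v f) = c * F i u + F i v) ->
  (forall i u K, lin0 u -> 0 <= K -> Lb q K u -> modulus (F i u) <= KF * K) ->
  (forall phi, schwartz phi -> forall e, 0 < e -> \forall i \near D, modulus (F i (toD phi)) <= e) ->
  forall w, Qd q w -> forall e, 0 < e -> \forall i \near D, modulus (F i w) <= e.
Proof.
move=> KF0 lF bF sF w Qw e e0.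
have d0 : 0 < e / (2 * (KF + 1)) by rewrite divr_gt0// mulr_gt0// ltr_wpDl.
have [phi sp le] := toD_dense Qw d0.
have e2 : 0 < e / 2 by exact: divr_gt0.
apply: filterS (sF _ sp _ e2) => i hi.
have QD := Qd_toD H sp; have Qdiff := Qd_lin (-1) QD Qw.
have := bF i _ _ Qdiff.1 (ltW d0) le; rewrite lF// => h.
have -> : F i w = (-1 * F i (toD phi) + F i w) + F i (toD phi) by ring.
apply: le_trans (modulusD _ _) _; apply: (@le_trans _ _ (e / 2 + e / 2)); last by rewrite -splitr.
apply: lerD hi; apply: le_trans h _.
have K1 : 0 < KF + 1 by rewrite ltr_wpDl.
have -> : KF * (e / (2 * (KF + 1))) = e / 2 * (KF / (KF + 1)) by field; rewrite gt_eqF.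
by rewrite ler_piMr ?(ltW e2)// ler_pdivrMr// mul1r lerDl.
Qed.

Lemma eq_by_density (F : dist -> C) (KF : R) : 0 <= KF ->
  (forall (c : C) u v, Qd q u -> Qd q v -> F (fun f => c * u f + v f) = c * F u + F v) ->
  (forall u K, lin0 u -> 0 <= K -> Lb q K u -> modulus (F u) <= KF * K) ->
  (forall phi, schwartz phi -> F (toD phi) = 0) -> forall w, Qd q w -> F w = 0.
Proof.
move=> KF0 lF bF sF w Qw; apply/modulus_eq0/eqP; rewrite eq_le modulus_ge0 andbT.
apply/ler_addgt0Pr => e e0; rewrite add0r.
have [_ /(_ e e0)] : True /\ forall e, 0 < e -> \forall i \near \oo, modulus ((fun _ : nat => F) i w) <= e.
  split=> //; apply: (@lim_by_density _ \oo _ (fun _ : nat => F) KF) => //.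
  by move=> phi sp d d0; apply: nearW => i; rewrite sF// modulus0 ltW.
by move=> [N _ /(_ N (leqnn N))].
Qed.

(** The converse of Hoelder's inequality: the bound represents [toD phi] by a function of norm at
    most [K], and representatives agree almost everywhere. *)
Lemma Np_dual K phi : 0 <= K -> schwartz phi ->
  (forall psi, schwartz psi -> modulus (cint leb (fun x => phi x * psi x)) <= K * Np leb q psi) ->
  Np leb p phi <= K.
Proof.
move=> K0 sp le; have bw : Lb q K (toD phi) by move=> psi sps; rewrite toDE//; exact: le.
have [rw lw nw] := fun_of_spec H K0 (lin0_toD sp) bw.
by have [_ <- _] := represents_ae (schwartz_Lp (ltW p1) sp) (represents_toD H sp) rw.
Qed.

End pq2.

End pairing.

(** * Multiplier bounds, Young's inequality and dilations *)

Section multbound.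
Context {R : realType} {n : nat}.
Local Notation E := 'rV[R]_n.
Local Notation C := R[i].
Local Notation leb := (lebesgue_rV n).
Local Notation dist := (@dist R n).
Implicit Types (phi psi f g m : E -> C) (u v w : dist).

Definition Mb (q K : R) m := forall phi, schwartz phi -> Np leb q (T m phi) <= K * Np leb q phi.

Lemma lin0_multiplier m w : slow m -> lin0 w -> lin0 (multiplier m w).
Proof.
move=> sm lw; split=> [f nf|c f g sf sg]; first exact: multiplier_out.
rewrite !multiplierE//; last by apply: schwartzD => //; exact: schwartzZ.
rewrite TD//; last exact: schwartzZ.
by rewrite TZ// lw.2//; exact: schwartz_T.
Qed.

Lemma Lb_multiplier q K K' m w : slow m -> 0 <= K -> Lb q K w -> Mb q K' m ->
  Lb q (K * K') (multiplier m w).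
Proof.
move=> sm K0 bw bm phi sp; rewrite multiplierE//.
apply: le_trans (bw _ (schwartz_T sm sp)) _; rewrite -mulrA ler_wpM2l//; exact: bm.
Qed.

Lemma Qd_multiplier q K m w : slow m -> 0 <= K -> Mb q K m -> Qd q w -> Qd q (multiplier m w).
Proof.
move=> sm K0 bm [lw [K1 K10 bw]]; split; first exact: lin0_multiplier.
by exists (K1 * K); [exact: mulr_ge0|exact: Lb_multiplier].
Qed.

Lemma multiplier_comp m m' w : slow m -> slow m' -> 
  multiplier m (multiplier m' w) = multiplier (fun xi => m' xi * m xi) w.
Proof.
move=> sm sm'; apply/funext => f; have [sf|nf] := pselect (schwartz f); last by rewrite !multiplier_out.
by rewrite (multiplierE _ sm sf) (multiplierE _ sm' (schwartz_T sm sf))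
  (multiplierE _ (slowM sm' sm) sf) T_comp.
Qed.

Lemma multiplier_toD m phi : slow m -> schwartz phi ->
  multiplier (fun xi => m (- xi)) (toD phi) = toD (T m phi).
Proof.
move=> sm sp; have smo := slow_opp sm.
apply: dist_eq; [exact: lin0_multiplier (lin0_toD sp)|by apply: lin0_toD; exact: schwartz_T|].
move=> psi sps; rewrite multiplierE// !toDE//; last exact: schwartz_T.
by rewrite cint_T.
Qed.

Lemma multiplier_lin m (c : C) u v : slow m ->
  multiplier m (fun f => c * u f + v f) = (fun f => c * multiplier m u f + multiplier m v f).
Proof.
move=> sm; apply/funext => f; have [sf|nf] := pselect (schwartz f).
  by rewrite !multiplierE.
by rewrite !multiplier_out// mulr0 addr0.
Qed.

(** Both sides are linear and bounded in [w2], so [w2] may be taken Schwartz; then [multiplier_toD]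
    reduces both to the same value of [w1]. *)
Lemma pair_multiplier p q K K' m w1 w2 : hpair p q -> slow m -> 0 <= K -> 0 <= K' ->
  Mb p K m -> Mb q K' (fun xi => m (- xi)) -> Qd p w1 -> Qd q w2 ->
  pair (multiplier m w1) w2 = pair w1 (multiplier (fun xi => m (- xi)) w2).
Proof.
move=> H sm K0 K0' bm bm' Q1 Q2; have [l1 [K1 K10 b1]] := Q1; have smo := slow_opp sm.
have Qm1 := Qd_multiplier sm K0 bm Q1.
apply/eqP; rewrite -subr_eq0; apply/eqP.
apply: (@eq_by_density _ _ p q H (fun w => pair (multiplier m w1) w -
   pair w1 (multiplier (fun xi => m (- xi)) w)) (K1 * K + K1 * K') _ _ _ _ w2 Q2).
- by rewrite addr_ge0// mulr_ge0.
- move=> c u v Qu Qv; rewrite multiplier_lin//.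
  have Qmo z := Qd_multiplier smo K0' bm' (w := z).
  rewrite (pair_linr H c Qm1 Qu Qv) (pair_linr H c Q1 (Qmo _ Qu) (Qmo _ Qv)).
  by move: (pair _ _) (pair _ _) (pair _ _) (pair _ _) => *; ring.
- move=> u K2 lu K20 bu; apply: le_trans (modulusB _ _) _; rewrite mulrDl; apply: lerD.
    exact: (pair_le H (mulr_ge0 K10 K0) K20 (lin0_multiplier sm l1) lu (Lb_multiplier sm K10 b1 bm) bu).
  rewrite -mulrA [K' * _]mulrC.
  exact: (pair_le H K10 (mulr_ge0 K20 K0') l1 (lin0_multiplier smo lu) b1 (Lb_multiplier smo K20 bu bm')).
- move=> phi sp; rewrite multiplier_toD// !(pair_toD H)//; last exact: schwartz_T.
  by rewrite multiplierE// subrr.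
Qed.

Lemma schwartz_reflect (x : E) phi : schwartz phi -> schwartz (fun z => phi (x - z)).
Proof.
move=> sp; have -> : (fun z => phi (x - z)) = (fun z => phi ((-1) *: z + x)).
  by apply/funext => z; rewrite scaleN1r addrC.
by apply: schwartz_affine => //; rewrite oppr_eq0 oner_neq0.
Qed.

Lemma cint_reflect (x : E) f : cintgr leb f -> cint leb (fun z => f (x - z)) = cint leb f.
Proof.
move=> fi; have N10 : -1 != 0 :> R by rewrite oppr_eq0 oner_neq0.
have := cint_affine x N10 fi; rewrite normrN1 expr1n invr1 mul1r => <-.
by apply: eq_cint => z; rewrite scaleN1r addrC.
Qed.

Lemma Rint_reflect (x : E) (f : E -> R) : leb.-integrable setT (fun z => (f z)%:E) ->
  \int[leb]_z f (x - z) = \int[leb]_z f z.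
Proof.
move=> fi; have N10 : -1 != 0 :> R by rewrite oppr_eq0 oner_neq0.
have := Rintegral_rV_affine x N10 fi; rewrite normrN1 expr1n invr1 mul1r => <-.
by apply: eq_Rintegral => z _; rewrite scaleN1r addrC.
Qed.

Lemma Np_reflect p (x : E) phi : 1 <= p -> schwartz phi -> Np leb p (fun z => phi (x - z)) = Np leb p phi.
Proof.
move=> p1 sp; suff e : Ip leb p (fun z => phi (x - z)) = Ip leb p phi by rewrite /Np e.
exact: (Rint_reflect x (schwartz_Lp p1 sp).2).
Qed.

Lemma Np_shift p (x : E) phi : 1 <= p -> schwartz phi -> Np leb p (fun z => phi (z - x)) = Np leb p phi.
Proof.
move=> p1 sp; have sr := schwartz_reflect 0 sp.
have -> : (fun z => phi (z - x)) = (fun z => (fun y => phi (0 - y)) (x - z)).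
  by apply/funext => z; rewrite sub0r opprB.
exact: (etrans (Np_reflect x p1 sr) (Np_reflect 0 p1 sp)).
Qed.

Lemma T_kernC m phi x : schwartz m -> schwartz phi ->
  T m phi x = cint leb (fun z => kern m z * phi (x - z)).
Proof.
move=> sm sp; rewrite (T_kern _ sm sp).
have ci : cintgr leb (fun z => kern m z * phi (x - z)).
  by apply: schwartz_cintgr; apply: schwartzM; [exact: schwartz_kern|exact: schwartz_reflect].
by rewrite -(cint_reflect x ci); apply: eq_cint => y; rewrite subKr.
Qed.

Definition kern1 m : R := \int[leb]_x modulus (kern m x).

Lemma kern1_ge0 m : 0 <= kern1 m. Proof. by apply: Rintegral_ge0 => x _. Qed.

Lemma schwartz_bounded phi : schwartz phi -> exists2 M, 0 <= M & forall x, modulus (phi x) <= M.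
Proof.
move=> sp; have [M hM] := schwartz_Sle 0 0 sp; exists M; first exact: Sle_ge0 hM.
by move=> x; move/Bw0 : hM => /(_ x); rewrite expr0 invr1 mulr1.
Qed.

(** By [Np_dual] it is enough to test against [psi]. After Fubini the inner integral, for a fixed
    shift [z], is bounded by Hoelder and translation invariance independently of [z], and the kernel
    is left to be integrated. *)
Lemma young p q m : hpair p q -> schwartz m -> Mb p (kern1 m) m.
Proof.
move=> H sm phi sp; have [p1 q1 pq] := H.
have p0 : 0 < p by apply: lt_trans p1.
have q0 : 0 < q by apply: lt_trans q1.
have sT : schwartz (T m phi) by apply: schwartz_T => //; exact: slow_schwartz.
apply: (Np_dual H) => //; first by rewrite mulr_ge0 ?Np_ge0// kern1_ge0.
move=> psi sps; have sk := schwartz_kern sm.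
have [M M0 bM] := schwartz_bounded sp.
pose F (z : E * E) := kern m z.2 * phi (z.1 - z.2) * psi z.1.
have e1 : cint leb (fun x => T m phi x * psi x) = cint leb (fun x => cint leb (fun z => F (x, z))).
  apply: eq_cint => x; rewrite T_kernC// mulrC -cintZ.
    by apply: eq_cint => z; rewrite /F mulrC.
  by apply: schwartz_cintgr; apply: schwartzM => //; exact: schwartz_reflect.
rewrite e1 (@cfubini _ _ _ _ _ leb leb F (fun x => M * modulus (psi x)) (fun z => modulus (kern m z))); last first.
- by move=> x z; rewrite /F !modulusM /= mulrAC [leRHS]mulrC -mulrA ler_wpM2l// mulrC ler_wpM2r.
- exact: cintgr_modulus (schwartz_cintgr sk).
- by apply: integrableRZ; exact: cintgr_modulus (schwartz_cintgr sps).
- apply: cmeasM; last by apply: cmeas_fst; exact: schwartz_cmeas.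
  by apply: cmeasM; [apply: cmeas_snd; exact: schwartz_cmeas|apply: cmeas_sub; exact: schwartz_cmeas].
pose G z := cint leb (fun x => phi (x - z) * psi x).
have e2 z : cint leb (fun x => F (x, z)) = kern m z * G z.
  rewrite -cintZ; first by apply: eq_cint => x; rewrite /F mulrA.
  apply: schwartz_cintgr; apply: schwartzM => //.
  have := schwartz_affine (- z) (oner_neq0 R) sp.
  by congr schwartz; apply/funext => x; rewrite scale1r.
have bG z : modulus (G z) <= Np leb p phi * Np leb q psi.
  have ss : schwartz (fun x => phi (x - z)).
    have := schwartz_affine (- z) (oner_neq0 R) sp.
    by congr schwartz; apply/funext => x; rewrite scale1r.
  have := hoelder_cint p0 q0 pq (schwartz_Lp (ltW p1) ss) (schwartz_Lp (ltW q1) sps).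
  by rewrite Np_shift// ltW.
have ciF : cintgr leb (fun z => cint leb (fun x => F (x, z))).
  have mF : cmeas (fun z : E * E => F (z.2, z.1)).
    apply: cmeasM; last by apply: cmeas_snd; exact: schwartz_cmeas.
    apply: cmeasM; first by apply: cmeas_fst; exact: schwartz_cmeas.
    have -> : (fun z : E * E => phi ((z.2, z.1).1 - (z.2, z.1).2)) = (fun z => (fun x => phi (0 - x)) (z.1 - z.2)).
      by apply/funext => z; rewrite /= sub0r opprB.
    by apply: (cmeas_sub (f := fun x => phi (0 - x))); apply: schwartz_cmeas; exact: schwartz_reflect.
  apply: (@cfubini_cintgr1 _ _ _ _ _ leb leb (fun z => F (z.2, z.1)) (fun z => modulus (kern m z)) (fun x => M * modulus (psi x))) => //.
  - exact: cintgr_modulus (schwartz_cintgr sk).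
  - by apply: integrableRZ; exact: cintgr_modulus (schwartz_cintgr sps).
  - by move=> z x; rewrite /F !modulusM /= -mulrA ler_wpM2l// ler_wpM2r.
apply: le_trans (modulus_cint_le ciF) _.
rewrite -mulrA mulrC /kern1 -RintegralZl; [|exact: measurableT|exact: cintgr_modulus (schwartz_cintgr sk)].
apply: le_Rintegral => //; [exact: cintgr_modulus ciF|
  by apply: integrableRZ; exact: cintgr_modulus (schwartz_cintgr sk)|].
by move=> z _; rewrite e2 modulusM mulrC ler_wpM2r.
Qed.

Lemma T_sup p q m phi x : hpair p q -> schwartz m -> schwartz phi ->
  modulus (T m phi x) <= Np leb p (kern m) * Np leb q phi.
Proof.
move=> H sm sp; have [p1 q1 pq] := H.
have p0 : 0 < p by apply: lt_trans p1.
have q0 : 0 < q by apply: lt_trans q1.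
rewrite T_kernC//; have sr := schwartz_reflect x sp.
apply: le_trans (hoelder_cint p0 q0 pq (schwartz_Lp (ltW p1) (schwartz_kern sm)) (schwartz_Lp (ltW q1) sr)) _.
by rewrite Np_reflect// ltW.
Qed.

(** The transpose of [T_sup]. Together with [Np_kern_dilate] it acts as a Bernstein inequality on
    dyadic pieces. *)
Lemma L1_Lp p q m phi : hpair p q -> schwartz m -> schwartz phi ->
  Np leb p (T m phi) <= Np leb p (kern (fun xi => m (- xi))) * \int[leb]_x modulus (phi x).
Proof.
move=> H sm sp; have smo : schwartz (fun xi => m (- xi)) by exact: schwartz_opp.
have ip := cintgr_modulus (schwartz_cintgr sp).
have i0 : 0 <= \int[leb]_x modulus (phi x) by apply: Rintegral_ge0 => x _.
apply: (Np_dual H); [by rewrite mulr_ge0 ?Np_ge0|by apply: schwartz_T => //; exact: slow_schwartz|].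
move=> psi sps; rewrite cint_T//; last exact: slow_schwartz.
have sT : schwartz (T (fun xi => m (- xi)) psi) by apply: schwartz_T => //; exact: slow_schwartz.
have ci : cintgr leb (fun x => phi x * T (fun xi => m (- xi)) psi x).
  by apply: schwartz_cintgr; exact: schwartzM.
apply: le_trans (modulus_cint_le ci) _.
rewrite mulrAC -RintegralZl//; apply: le_Rintegral => //.
- exact: cintgr_modulus ci.
- exact: integrableRZ.
- by move=> x _; rewrite modulusM mulrC ler_wpM2r//; exact: (T_sup _ H).
Qed.

Lemma Rint_dilate (e : R) (f : E -> R) : 0 < e -> leb.-integrable setT (fun z => (f z)%:E) ->
  \int[leb]_z f (e *: z) = e ^- n * \int[leb]_z f z.
Proof.
move=> e0 fi; have := Rintegral_rV_affine 0 (lt0r_neq0 e0) fi.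
rewrite gtr0_norm// => <-.
by apply: eq_Rintegral => z _; rewrite addr0.
Qed.

Lemma Ip_kern_dilate p m (e : R) : 1 <= p -> 0 < e -> schwartz m ->
  Ip leb p (kern (fun xi => m (e *: xi))) = (e ^- n) `^ p * e ^+ n * Ip leb p (kern m).
Proof.
move=> p1 e0 sm; have sk := schwartz_kern sm; have [_ ik] := schwartz_Lp p1 sk.
have ei0 : 0 < e^-1 by rewrite invr_gt0.
have en : 0 <= e ^- n by rewrite invr_ge0 exprn_ge0// ltW.
have := Rint_dilate ei0 ik; rewrite exprVn invrK => h.
rewrite -mulrA; have -> : e ^+ n * Ip leb p (kern m) = \int[leb]_x (modulus (kern m (e^-1 *: x)) `^ p) := esym h.
have iF : leb.-integrable setT (fun x => (modulus (kern m (e^-1 *: x)) `^ p)%:E).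
  have h0 : leb.-integrable setT (fun x => (modulus (kern m (e^-1 *: x + 0)) `^ p)%:E) :=
    @integrable_rV_affine R n _ 0 (fun x => modulus (kern m x) `^ p) (lt0r_neq0 ei0) ik.
  have E0 : (fun x => (modulus (kern m (e^-1 *: x + 0)) `^ p)%:E) =
      (fun x => (modulus (kern m (e^-1 *: x)) `^ p)%:E).
    by apply/funext => x; rewrite addr0.
  exact: (eq_ind _ (fun F => leb.-integrable setT F) h0 _ E0).
have Z : \int[leb]_x ((e ^- n) `^ p * modulus (kern m (e^-1 *: x)) `^ p) =
   (e ^- n) `^ p * \int[leb]_x (modulus (kern m (e^-1 *: x)) `^ p).
  exact: (RintegralZl ((e ^- n) `^ p) measurableT iF).
apply: (etrans _ Z); apply: eq_Rintegral => x _.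
by rewrite kern_dilate// modulusM modulus_ofreal ger0_norm// powRM.
Qed.

(** By this scale invariance one constant bounds the dilates of a fixed symbol at all dyadic
    scales. *)
Lemma kern1_dilate m (e : R) : 0 < e -> schwartz m -> kern1 (fun xi => m (e *: xi)) = kern1 m.
Proof.
move=> e0 sm; have := Ip_kern_dilate (lexx 1) e0 sm.
have E1 (k : E -> C) : Ip leb 1 k = \int[leb]_x modulus (k x).
  by apply: eq_Rintegral => x _; rewrite powRr1.
rewrite !E1 powRr1; last by rewrite invr_ge0 exprn_ge0// ltW.
by rewrite mulVf ?mul1r// expf_neq0// gt_eqF.
Qed.

(** The exponent [n / q] found here is the one in the condition on [s]; it gets there through
    [L1_sym]. *)
Lemma Np_kern_dilate p q m (e : R) : hpair p q -> 0 < e -> schwartz m ->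
  Np leb p (kern (fun xi => m (e *: xi))) = e `^ (- (n%:R / q)) * Np leb p (kern m).
Proof.
move=> [p1 q1 pq] e0 sm; have p0 : 0 < p by apply: lt_trans p1.
rewrite /Np Ip_kern_dilate ?(ltW p1)// powRM ?Ip_ge0//; last first.
  by rewrite mulr_ge0 ?powR_ge0// exprn_ge0// ltW.
congr (_ * _); rewrite -powR_invn ?(ltW e0)// -powR_mulrn ?(ltW e0)// -powRrM -powRD; last first.
  by rewrite (gt_eqF e0) implybT.
rewrite -powRrM; congr (_ `^ _); have -> : q^-1 = 1 - p^-1 by rewrite -pq addrAC subrr add0r.
by field; rewrite gt_eqF.
Qed.

(** Finitely many seminorms of the symbol control the kernel. This is for symbols that depend on the
    scale in another way than by dilation, as in [Qd_diff]. *)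
Lemma kern1_Sle : exists (C0 : R) (k L : nat), 0 <= C0 /\
  forall m M, schwartz m -> Sle k L M m -> kern1 m <= C0 * M.
Proof.
have [C0 [k [L [C00 h]]]] := @fourier_Sle R n 0 (2 * n)%N.
have c0 : 0 <= ((2 * pi) ^- n : R) by rewrite invr_ge0 exprn_ge0// mulr_ge0// pi_ge0.
exists ((2 * pi) ^- n * C0 * @jbint R n), k, L; split; first by rewrite !mulr_ge0// jbint_ge0.
move=> m M sm hM; have sf := schwartz_fourier sm.
have := Sle_int_le (schwartz_cmeas sf) (h _ _ sm hM) => le.
have -> : kern1 m = (2 * pi) ^- n * \int[leb]_x modulus (fourier m x).
  rewrite -RintegralZl//; last exact: cintgr_modulus (schwartz_cintgr sf).
  by apply: eq_Rintegral => x _; rewrite /kern modulusM modulus_ofreal ger0_norm.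
by rewrite -!mulrA ler_wpM2l//; apply: le_trans le _; rewrite -mulrA [M * _]mulrC.
Qed.

(** The factor [jb] lost in [Bw_dilate_sub] is paid by one more order of decay of the transform of
    [phi], hence [L + 1]; everything else is uniform in [e]. *)
Lemma approx_id (g : E -> C) phi k N : slow g -> (forall l, exists M, Bw l (fun=> M) g) ->
  schwartz phi -> exists2 K, 0 <= K & forall e, 0 < e <= 1 ->
    Sle k N (K * e) (T (fun xi => g (e *: xi) - g 0) phi).
Proof.
move=> sg bg sp; have [C0 [k' [L [C00 h]]]] := @fourier_Sle R n k N.
have [M hM] := bg k'.+1; have M0 : 0 <= M by exact: (Bw_ge0 0 hM).
have sif := schwartz_ifourier sp.
have [M' hM'] := schwartz_Sle k' (L + 1)%N sif; have M0' := Sle_ge0 hM'.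
have c0 : 0 <= 2 * M * n%:R + M by rewrite addr_ge0// mulr_ge0// mulr_ge0.
exists (C0 * (2 ^+ k' * ((2 * M * n%:R + M) * M'))).
  by rewrite !mulr_ge0// exprn_ge0.
move=> e /andP[e0 e1]; have e01 : 0 <= e <= 1 by rewrite e1 ltW.
have sge : slow (fun xi => g (e *: xi) - g 0).
  apply: slowB; last exact: slow_cst.
  have := slow_affine e 0 sg; by congr slow; apply/funext => x; rewrite addr0.
have := h (fun xi => (g (e *: xi) - g 0) * ifourier phi xi) (2 ^+ k' * (e * (2 * M * n%:R + M) * M')) _ _.
have -> : C0 * (2 ^+ k' * (e * (2 * M * n%:R + M) * M')) =
   C0 * (2 ^+ k' * ((2 * M * n%:R + M) * M')) * e by ring.
apply; first exact: schwartz_slowM.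
apply: (SleM (L := 1)) => //; [exact: slow_smooth|exact: schwartz_smooth|].
apply: Bw_mono (Bw_dilate_sub (slow_smooth sg) hM e01) => // x.
by rewrite expr1 mulrA.
Qed.

End multbound.

(** * Sums over the integers *)

Section zsums.
Context {R : realType}.
Local Notation C := R[i].
Implicit Types (a b : int -> C) (z : C).

Definition psum a (MN : nat * nat) : C :=
  \sum_(k < (MN.1 + MN.2)%N) a ((k : nat)%:Z - MN.1%:Z).

Lemma zsumE a z : zsum a z <-> forall e, 0 < e ->
  \forall MN \near (\oo, \oo), modulus (psum a MN - z) <= e.
Proof.
split=> [/cvgrPdist_le h e e0|h].
  by apply: filterS (h e e0) => MN; rewrite sub0r normrN ger0_norm.
apply/cvgrPdist_le => e e0; apply: filterS (h e e0) => MN.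
by rewrite sub0r normrN ger0_norm.
Qed.

Lemma near_prod (P Q : nat -> Prop) (S : nat * nat -> Prop) :
  (\forall k \near \oo, P k) -> (\forall k \near \oo, Q k) ->
  (forall M N, P M -> Q N -> S (M, N)) -> \forall MN \near (\oo, \oo), S MN.
Proof.
move=> hP hQ hS; exists ([set k | P k], [set k | Q k]); first by split.
by move=> [M N] [/= PM QN]; exact: hS.
Qed.

Lemma zsum_unique a z z' : zsum a z -> zsum a z' -> z = z'.
Proof.
move=> /zsumE h /zsumE h'; apply/eqP; rewrite -subr_eq0; apply/eqP/modulus_eq0/eqP.
rewrite eq_le modulus_ge0 andbT; apply/ler_addgt0Pr => e e0; rewrite add0r.
have e2 : 0 < e / 2 by exact: divr_gt0.
have [MN [h1 h2]] := filter_ex (filterI (h _ e2) (h' _ e2)).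
have -> : z - z' = (psum a MN - z') - (psum a MN - z) by ring.
by apply: le_trans (modulusB _ _) _; rewrite [leRHS]splitr lerD.
Qed.

Lemma psum_lin a b (c : C) MN : psum (fun j => c * a j + b j) MN = c * psum a MN + psum b MN.
Proof. by rewrite /psum big_split mulr_sumr. Qed.

Lemma zsum_lin a b (c : C) z z' : zsum a z -> zsum b z' ->
  zsum (fun j => c * a j + b j) (c * z + z').
Proof.
move=> /zsumE h /zsumE h'; apply/zsumE => e e0.
have c1 : 0 < 2 * (modulus c + 1) by rewrite mulr_gt0// ltr_wpDl.
apply: filterS (filterI (h _ (divr_gt0 e0 c1)) (h' _ (divr_gt0 e0 (ltr0n R 2)))) => MN [h1 h2].
rewrite psum_lin; have -> : c * psum a MN + psum b MN - (c * z + z') =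
  c * (psum a MN - z) + (psum b MN - z') by ring.
apply: le_trans (modulusD _ _) _; rewrite modulusM [leRHS]splitr; apply: lerD h2.
have h3 := ler_wpM2l (modulus_ge0 c) h1; apply: le_trans h3 _.
have c2 : 0 < modulus c + 1 by rewrite ltr_wpDl.
have -> : modulus c * (e / (2 * (modulus c + 1))) = e / 2 * (modulus c / (modulus c + 1)).
  by field; rewrite gt_eqF.
by rewrite ler_piMr ?divr_ge0 ?(ltW e0)// ler_pdivrMr// mul1r lerDl.
Qed.

Lemma psum_split a M N : psum a (M, N) =
  \sum_(i < M) a (- (i.+1%:Z)) + \sum_(i < N) a i%:Z.
Proof.
rewrite /psum big_split_ord /=; congr (_ + _).
  rewrite (reindex_inj rev_ord_inj) /=; apply: eq_bigr => i _; congr a.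
  by rewrite subzn ?leq_subr// -opprB subzn ?leq_subr// subKn// || (rewrite -opprB; congr (- _); rewrite subzn ?leq_subr// subKn).
by apply: eq_bigr => i _; rewrite PoszD addrAC subrr add0r.
Qed.

Lemma psum_telescope (f : int -> C) M N :
  psum (fun j => f (j + 1) - f j) (M, N) = f N%:Z - f (- M%:Z).
Proof.
rewrite psum_split.
have -> : \sum_(i < M) (f (- i.+1%:Z + 1) - f (- i.+1%:Z)) = f 0 - f (- M%:Z).
  elim: M => [|M IH]; first by rewrite big_ord0 oppr0 subrr.
  rewrite big_ord_recr /= IH; have -> : - M.+1%:Z + 1 = - M%:Z by rewrite -addn1 PoszD; ring.
  by ring.
have -> : \sum_(i < N) (f (i%:Z + 1) - f i%:Z) = f N%:Z - f 0.
  elim: N => [|N IH]; first by rewrite big_ord0 subrr.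
  rewrite big_ord_recr /= IH; have -> : N%:Z + 1 = N.+1%:Z by rewrite -addn1 PoszD.
  by ring.
by ring.
Qed.

Lemma near_ge (N0 : nat) : \forall k \near \oo, (N0 <= k)%N.
Proof. by exists N0. Qed.

(** Dyadic pieces meet only their two neighbours. The partial sums are constant as soon as both ends
    of the range have passed [j0]. *)
Lemma zsum_finite a (j0 : int) :
  (forall j, j != j0 - 1 -> j != j0 -> j != j0 + 1 -> a j = 0) ->
  zsum a (\sum_(k <- [:: j0 - 1; j0; j0 + 1]) a k).
Proof.
move=> h; apply/zsumE => e e0.
apply: (near_prod (near_ge (absz j0 + 2)) (near_ge (absz j0 + 2))) => M N hM hN.
have -> : psum a (M, N) = \sum_(k <- [:: j0 - 1; j0; j0 + 1]) a k; last first.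
  by rewrite subrr modulus0 ltW.
pose F k := a ((k : nat)%:Z - M%:Z).
have P0 : exists p : nat, [/\ (p.+2 < M + N)%N & p%:Z - M%:Z = j0 - 1].
  exists (absz (j0 - 1 + M%:Z)); split; first by lia.
  by rewrite gez0_abs; lia.
have [p [pMN ep]] := P0.
rewrite /psum /= -(big_mkord xpredT (fun k => a (k%:Z - M%:Z))).
have -> : \sum_(0 <= i < M + N) a (i%:Z - M%:Z) = \sum_(p <= i < p + 3) a (i%:Z - M%:Z).
  rewrite (big_cat_nat (n := p)) /=; [|by []|by lia].
  rewrite [X in _ + X](big_cat_nat (n := (p + 3)%N)) /=; [|by lia|by lia].
  have z1 : \sum_(0 <= i < p) a (i%:Z - M%:Z) = 0.
    rewrite big_nat_cond big1// => i /andP[/andP[_ ip] _]; apply: h; apply/eqP; lia.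
  have z2 : \sum_(p + 3 <= i < M + N) a (i%:Z - M%:Z) = 0.
    rewrite big_nat_cond big1// => i /andP[/andP[ip _] _]; apply: h; apply/eqP; lia.
  by rewrite z1 z2 add0r addr0.
rewrite addn3 big_ltn; last by lia.
rewrite big_ltn; last by lia.
rewrite big_ltn; last by lia.
rewrite big_geq// !big_cons big_nil ep; congr (_ + (_ + (_ + _))); congr a; lia.
Qed.

Lemma csum_cvg (c : nat -> C) (b : nat -> R) (B : R) :
  (forall i, modulus (c i) <= b i) -> (forall N, \sum_(i < N) b i <= B) ->
  exists z, (forall e, 0 < e -> \forall N \near \oo, modulus (\sum_(i < N) c i - z) <= e) /\
    modulus z <= B.
Proof.
move=> cb bB; have b0 i : 0 <= b i by apply: le_trans (cb i).
have real (r : nat -> R) : (forall i, `|r i| <= b i) -> exists l : R, (fun N => \sum_(i < N) r i) @ \oo --> l.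
  move=> rb; have : cvgn (series r).
    apply: normed_cvg.
    have -> : [normed series r] = (fun k => \sum_(0 <= i < k) `|r i|).
      by [].
    apply: nondecreasing_is_cvgn.
      by apply/nondecreasing_seqP => k; rewrite big_nat_recr//= lerDl.
    exists B => _ [k _ <-]; rewrite big_mkord; apply: le_trans (bB k).
    by apply: ler_sum => i _; exact: rb.
  by move=> /cvg_ex[l hl]; exists l; move: hl; rewrite seriesEord.
have [l1 h1] := real (fun i => complex.Re (c i)) (fun i => le_trans (Re_le_modulus _) (cb i)).
have [l2 h2] := real (fun i => complex.Im (c i)) (fun i => le_trans (Im_le_modulus _) (cb i)).
have ReS (F : nat -> C) N : complex.Re (\sum_(i < N) F i) = \sum_(i < N) complex.Re (F i).
  by elim: N => [|N IH]; rewrite ?big_ord0// !big_ord_recr /= ReD IH.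
have ImS (F : nat -> C) N : complex.Im (\sum_(i < N) F i) = \sum_(i < N) complex.Im (F i).
  by elim: N => [|N IH]; rewrite ?big_ord0// !big_ord_recr /= ImD IH.
have H e : 0 < e -> \forall N \near \oo, modulus (\sum_(i < N) c i - (l1 +i* l2)%C) <= e.
  move=> e0; have e2 : 0 < e / 2 by exact: divr_gt0.
  have /cvgrPdist_le /(_ _ e2) g1 := h1; have /cvgrPdist_le /(_ _ e2) g2 := h2.
  apply: filterS (filterI g1 g2) => N [k1 k2]; apply: le_trans (modulus_le _) _.
  rewrite ReD ImD ReN ImN ReS ImS /= [leRHS]splitr; apply: lerD.
    by rewrite distrC. by rewrite distrC.
exists (l1 +i* l2)%C; split => //; apply/ler_addgt0Pr => e e0.
have [N hN] := filter_ex (H e e0).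
set S := \sum_(i < N) c i in hN.
have -> : (l1 +i* l2)%C = S - (S - (l1 +i* l2)%C) by rewrite subKr.
apply: le_trans (modulusB _ _) _; apply: lerD => //.
by apply: le_trans (modulus_sum _ _ _) _; apply: le_trans (bB N); apply: ler_sum => i _.
Qed.

Lemma zsum_exists a (b1 b2 : nat -> R) (B1 B2 : R) :
  (forall i : nat, modulus (a (- i.+1%:Z)) <= b1 i) -> (forall i : nat, modulus (a i%:Z) <= b2 i) ->
  (forall N, \sum_(i < N) b1 i <= B1) -> (forall N, \sum_(i < N) b2 i <= B2) ->
  exists2 z, zsum a z & modulus z <= B1 + B2.
Proof.
move=> h1 h2 s1 s2; have [z1 [c1 n1]] := csum_cvg h1 s1; have [z2 [c2 n2]] := csum_cvg h2 s2.
exists (z1 + z2); last by apply: le_trans (modulusD _ _) _; exact: lerD.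
apply/zsumE => e e0; have e2 : 0 < e / 2 by exact: divr_gt0.
apply: (near_prod (c1 _ e2) (c2 _ e2)) => M N k1 k2; rewrite psum_split.
move: (\sum_(i < M) _) (\sum_(i < N) _) k1 k2 => S1 S2 k1 k2.
have -> : S1 + S2 - (z1 + z2) = (S1 - z1) + (S2 - z2) by ring.
by apply: le_trans (modulusD _ _) _; rewrite [leRHS]splitr lerD.
Qed.

Lemma geo_sum_le (x : R) N : 0 <= x < 1 -> \sum_(i < N) x ^+ i <= (1 - x)^-1.
Proof.
move=> /andP[x0 x1]; have d : 0 < 1 - x by rewrite subr_gt0.
rewrite -[leRHS]mul1r ler_pdivlMr//.
have -> : (\sum_(i < N) x ^+ i) * (1 - x) = 1 - x ^+ N.
  elim: N => [|N IH]; first by rewrite big_ord0 mul0r expr0 subrr.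
  by rewrite big_ord_recr /= mulrDl IH exprSr; ring.
by rewrite lerBlDr lerDl exprn_ge0.
Qed.

End zsums.

(** * Littlewood-Paley symbols *)

Section symbols.
Context {R : realType} {n : nat}.
Local Notation E := 'rV[R]_n.
Local Notation C := R[i].
Variable chi : E -> R.
Hypothesis hchi : LP_cutoff chi.
Implicit Types (s t : R) (j k : int) (x xi : E).

Let r j : R := 2 ^ j.

Lemma pow2_gt0 j : 0 < (2 : R) ^ j. Proof. exact: exprz_gt0. Qed.

Lemma chi_out xi : 4 / 3 <= enorm xi -> chi xi = 0.
Proof.
have [[_ _ sub] _ _ _] := hchi; move=> h; apply/eqP; apply: contraT => nz.
have : eball (4 / 3) xi.
  apply: sub; apply: subset_closure => /=; rewrite /ofreal.
  by apply: contra nz => /eqP/(congr1 (@complex.Re R)) /= ->.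
by rewrite /eball /= ltNge h.
Qed.

Lemma chi_in xi : enorm xi < 3 / 4 -> chi xi = 1.
Proof. by have [_ _ _] := hchi; apply. Qed.

Lemma chi_radial x y : enorm x = enorm y -> chi x = chi y.
Proof. by have [_ h _ _] := hchi; exact: h. Qed.

Lemma chi_ge0 x : 0 <= chi x. Proof. by have [_ _ h _] := hchi. Qed.

Lemma schwartz_chi : schwartz (ofreal chi).
Proof. by have [h _ _ _] := hchi; exact: Cc_smooth_schwartz h. Qed.

Definition psi0 xi : R := chi (2^-1 *: xi) - chi xi.
Definition sym0 s xi : R := enorm xi `^ s * psi0 xi.
(** The symbol of the order-[s] lift of the [j]-th dyadic piece; by [symE] it is a power of [2 ^ j]
    times a dilate of the fixed function [sym0 s]. *)
Definition sym s j : E -> C := ofreal (fun xi => enorm xi `^ s * LP_psi chi j xi).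
(** The cut-off to frequencies up to about [2 ^ j]. The symbol [sym 0 j] is the difference of two
    consecutive ones, so partial sums telescope. *)
Definition chis j : E -> C := fun xi => ofreal chi ((2 : R) ^ (- j) *: xi).

Lemma enormZ_pos (c : R) xi : 0 <= c -> enorm (c *: xi) = c * enorm xi.
Proof. by move=> c0; rewrite enormZ ger0_norm. Qed.

Lemma pow2N j : (2 : R) ^ (- j) = (2 ^ j)^-1.
Proof. by rewrite exprzN || rewrite -invr_expz. Qed.

Lemma LP_psiE j xi : LP_psi chi j xi = psi0 ((2 ^ j)^-1 *: xi).
Proof.
by rewrite /LP_psi /LP_phi /psi0 pow2N !scalerA [_ * 2^-1]mulrC.
Qed.

Lemma psi0_supp xi : psi0 xi != 0 -> 3 / 4 <= enorm xi /\ enorm xi < 8 / 3.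
Proof.
move=> h; have e2 : enorm (2^-1 *: xi) = 2^-1 * enorm xi by rewrite enormZ_pos.
have e0 := enorm_ge0 xi.
split; rewrite leNgt || rewrite ltNge; apply/negP => l; case/negP: h; apply/eqP; rewrite /psi0.
  by rewrite !chi_in ?subrr// e2; lra.
by rewrite !chi_out ?subrr// ?e2; lra.
Qed.

Lemma LP_psi_supp j xi : LP_psi chi j xi != 0 ->
  3 / 4 * 2 ^ j <= enorm xi /\ enorm xi < 8 / 3 * 2 ^ j.
Proof.
have r0 := pow2_gt0 j; rewrite LP_psiE => /psi0_supp; rewrite enormZ_pos ?invr_ge0 ?(ltW r0)//.
by rewrite ler_pdivlMl// ltr_pdivrMl// [2 ^ j * (3 / 4)]mulrC [2 ^ j * (8 / 3)]mulrC.
Qed.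

Lemma chis_psi j xi : LP_psi chi j xi = chi ((2 : R) ^ (- (j + 1)) *: xi) - chi ((2 : R) ^ (- j) *: xi).
Proof.
rewrite /LP_psi /LP_phi scalerA; congr (chi (_ *: _) - _).
by rewrite opprD expfzDr ?pnatr_eq0// exprN1.
Qed.

(** The sum of three neighbouring pieces telescopes to a difference of two cut-offs, which on the
    support of the middle piece take the values 1 and 0. *)
Lemma LP_psi_tri j xi : LP_psi chi j xi *
  (LP_psi chi (j - 1) xi + (LP_psi chi j xi + LP_psi chi (j + 1) xi)) = LP_psi chi j xi.
Proof.
have [->|h] := eqVneq (LP_psi chi j xi) 0; first by rewrite mul0r.
have [h1 h2] := LP_psi_supp h; have r0 := pow2_gt0 j.
suff -> : LP_psi chi (j - 1) xi + (LP_psi chi j xi + LP_psi chi (j + 1) xi) = 1 by rewrite mulr1.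
rewrite !chis_psi subrK.
have -> : chi ((2 : R) ^ (- (j - 1)) *: xi) = 0.
  apply: chi_out; rewrite enormZ_pos; last by rewrite ltW// pow2_gt0.
  have -> : (2 : R) ^ (- (j - 1)) = 2 / 2 ^ j.
    by rewrite opprB addrC expfzDr ?pnatr_eq0// pow2N expr1z mulrC.
  by rewrite -mulrA [_^-1 * _]mulrC mulrA ler_pdivlMr//; lra.
have -> : chi ((2 : R) ^ (- (j + 1 + 1)) *: xi) = 1.
  apply: chi_in; rewrite enormZ_pos; last by rewrite ltW// pow2_gt0.
  have -> : (2 : R) ^ (- (j + 1 + 1)) = 4^-1 / 2 ^ j.
    by rewrite !opprD !expfzDr ?pnatr_eq0// pow2N exprN1; field; rewrite gt_eqF.
  by rewrite -mulrA [_^-1 * enorm _]mulrC mulrA ltr_pdivrMr//; lra.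
by ring.
Qed.

Lemma LP_psi_disj j k xi : (j + 2 <= k)%R -> LP_psi chi j xi * LP_psi chi k xi = 0.
Proof.
move=> jk; have [->|h] := eqVneq (LP_psi chi j xi) 0; first by rewrite mul0r.
have [->|h'] := eqVneq (LP_psi chi k xi) 0; first by rewrite mulr0.
have [_ h2] := LP_psi_supp h; have [h3 _] := LP_psi_supp h'; have r0 := pow2_gt0 j.
have le : 4 * 2 ^ j <= (2 : R) ^ k.
  have -> : (4 : R) * 2 ^ j = 2 ^ (j + 2) by rewrite expfzDr ?pnatr_eq0// mulrC; congr (_ * _); rewrite -exprnP expr2 -natrM.
  by apply: ler_weXz2l => //; rewrite ler1n.
exfalso; move: ((2 : R) ^ j) ((2 : R) ^ k) (enorm xi) h2 h3 r0 le => a b c *.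
suff : a < a by rewrite ltxx.
lra.
Qed.

Lemma symE s j xi : sym s j xi = ((2 ^ j) `^ s)%:C%C * ofreal (sym0 s) ((2 ^ j)^-1 *: xi).
Proof.
have r0 := pow2_gt0 j; rewrite /sym /ofreal -rmorphM /=; congr (_%:C)%C.
rewrite LP_psiE /sym0 mulrA -powRM ?(ltW r0)//; congr (_ `^ _ * _).
by rewrite enormZ_pos ?invr_ge0 ?(ltW r0)// mulVKf// gt_eqF.
Qed.

Lemma schwartz_sym0 s : schwartz (ofreal (sym0 s)).
Proof.
(* A power of [enorm xi] is not smooth at the origin in general. This [g] is positive everywhere,
   smooth, and equal to the squared norm where [enorm xi >= 3 / 4], which contains the support of
   [psi0]: the factor [16 / 9] is [4 / 3] divided by [3 / 4]. *)
pose g xi : R := dotprod xi xi + chi ((16 / 9) *: xi).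
have sch := schwartz_chi; have [hC _ _ _] := hchi.
have sg : smooth (ofreal g).
  have -> : ofreal g = (fun xi => \sum_(i < n) (xi ord0 i)%:C%C * (xi ord0 i)%:C%C + ofreal chi ((16/9) *: xi + 0)).
    apply/funext => xi; rewrite /ofreal /g addr0 rmorphD /= /dotprod rmorph_sum /=.
    by congr (_ + _); apply: eq_bigr => i _; rewrite rmorphM.
  apply: smoothD; last by apply: smooth_affine; exact: schwartz_smooth.
  by apply: slow_smooth; apply: slow_sum => i; apply: slowM; exact: slow_coord.
have g0 xi : 0 < g xi.
  have d0 := dotprod_ge0 xi; rewrite /g.
  have [x0|x0] := eqVneq (enorm xi) 0.
    by rewrite chi_in ?ltr_wpDl// enormZ_pos// x0 mulr0.
  by rewrite ltr_wpDr ?chi_ge0// -sqr_enorm exprn_gt0// lt_neqAle eq_sym x0 enorm_ge0.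
pose G := ofreal (fun xi => g xi `^ (s / 2)).
have sG : smooth G by exact: smooth_powR.
have GE xi : psi0 xi != 0 -> enorm xi `^ s = g xi `^ (s / 2).
  move=> /psi0_supp[h _]; rewrite /g chi_out ?addr0; last by rewrite enormZ_pos//; lra.
  rewrite -sqr_enorm -powR_mulrn ?enorm_ge0// -powRrM; congr (_ `^ _).
  by rewrite mulrC divfK ?pnatr_eq0.
have -> : ofreal (sym0 s) = (fun xi => (fun et => G (2 *: et + 0) * ofreal chi et) (2^-1 *: xi + 0) - G xi * ofreal chi xi).
  apply/funext => xi; rewrite !addr0 scalerA mulfV ?pnatr_eq0// scale1r -mulrBr.
  rewrite /ofreal /sym0 -rmorphB -rmorphM /= -/(psi0 xi); congr (_%:C)%C.
  have [->|h] := eqVneq (psi0 xi) 0; first by rewrite !mulr0.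
  by rewrite GE.
apply: schwartzB; last by apply: Cc_smooth_schwartz; exact: Cc_smoothM hC.
apply: (schwartz_affine 0 (f := fun et => G (2 *: et + 0) * ofreal chi et)).
  by rewrite invr_eq0 pnatr_eq0.
by apply: Cc_smooth_schwartz; apply: Cc_smoothM hC; exact: smooth_affine.
Qed.

Lemma schwartz_dil (c : R) f : 0 < c -> schwartz f -> schwartz (fun xi : E => f (c *: xi)).
Proof.
move=> c0 sf; have := schwartz_affine 0 (lt0r_neq0 c0) sf.
by congr schwartz; apply/funext => x; rewrite addr0.
Qed.

Lemma slow_dil (c : R) f : slow f -> slow (fun xi : E => f (c *: xi)).
Proof.
by move=> sf; have := slow_affine c 0 sf; congr slow; apply/funext => x; rewrite addr0.
Qed.

Lemma schwartz_sym s j : schwartz (sym s j).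
Proof.
rewrite (funext (symE s j)); apply: schwartzZ.
by apply: (schwartz_dil _ (schwartz_sym0 s)); rewrite invr_gt0 pow2_gt0.
Qed.

Lemma slow_sym s j : slow (sym s j). Proof. exact/slow_schwartz/schwartz_sym. Qed.

Lemma schwartz_chis j : schwartz (chis j).
Proof. by apply: (schwartz_dil _ schwartz_chi); exact: pow2_gt0. Qed.

Lemma slow_chis j : slow (chis j). Proof. exact/slow_schwartz/schwartz_chis. Qed.

Lemma sym_even s j xi : sym s j (- xi) = sym s j xi.
Proof.
rewrite /sym /ofreal !chis_psi enormN; congr ((_ * (_ - _))%:C)%C;
  by apply: chi_radial; rewrite scalerN enormN.
Qed.

Lemma sym_chis j : sym 0 j = (fun xi => chis (j + 1) xi - chis j xi).
Proof.
by apply/funext => xi; rewrite /sym /chis /ofreal -rmorphB /= powRr0 mul1r chis_psi.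
Qed.

Lemma sym_Delta j : ofreal (LP_psi chi j) = sym 0 j.
Proof. by apply/funext => xi; rewrite /sym /ofreal powRr0 mul1r. Qed.

Lemma sym_mul s t j k xi : sym s j xi * sym t k xi =
  ofreal (fun xi => enorm xi `^ (s + t) * (LP_psi chi j xi * LP_psi chi k xi)) xi.
Proof.
rewrite /sym /ofreal -rmorphM /=; congr (_%:C)%C.
have [->|h] := eqVneq (LP_psi chi j xi) 0; first by rewrite !(mul0r, mulr0).
have [h1 _] := LP_psi_supp h; have r0 := pow2_gt0 j.
have x0 : 0 < enorm xi by apply: lt_le_trans h1; rewrite mulr_gt0.
by rewrite powRD; [ring|rewrite (gt_eqF x0) implybT].
Qed.

Lemma sym_disj s t j k : j != k - 1 -> j != k -> j != k + 1 ->
  (fun xi => sym s j xi * sym t k xi) = (fun=> 0).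
Proof.
move=> h1 h2 h3; apply/funext => xi; rewrite sym_mul /ofreal.
have [le|le] : (j + 2 <= k)%R \/ (k + 2 <= j)%R by lia.
  by rewrite LP_psi_disj// mulr0.
by rewrite [X in _ * X]mulrC LP_psi_disj// mulr0.
Qed.

Lemma sym_tri s t k xi :
  \sum_(j <- [:: k - 1; k; k + 1]) (sym s j xi * sym t k xi) = sym (s + t) k xi.
Proof.
rewrite !big_cons big_nil addr0 !sym_mul /ofreal -!rmorphD /= /sym /ofreal; congr (_%:C)%C.
by rewrite -!mulrDr -!mulrDl [X in _ * X]mulrC LP_psi_tri.
Qed.

(** Powers of the frequency are traded for derivatives of the test function: the polynomial factor
    preserves Schwartz functions, and the remaining exponent can be made as negative as desired. *)
Lemma sym_lap s (K : nat) j xi :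
  sym s j xi = sym (s - (2 * K)%:R) j xi * (ofreal (fun xi => dotprod xi xi) xi) ^+ K.
Proof.
rewrite /sym /ofreal -rmorphXn -rmorphM /=; congr (_%:C)%C.
have [->|h] := eqVneq (LP_psi chi j xi) 0; first by rewrite !(mul0r, mulr0).
have [h1 _] := LP_psi_supp h; have r0 := pow2_gt0 j.
have x0 : 0 < enorm xi by apply: lt_le_trans h1; rewrite mulr_gt0.
rewrite -sqr_enorm -exprM mulrAC; congr (_ * _).
by rewrite -powR_mulrn ?enorm_ge0// -powRD ?subrK// (gt_eqF x0) implybT.
Qed.

End symbols.

(** * Tempered functionals composed with multipliers *)

Section functional.
Context {R : realType} {n : nat}.
Local Notation E := 'rV[R]_n.
Local Notation C := R[i].
Local Notation leb := (lebesgue_rV n).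
Local Notation dist := (@dist R n).
Implicit Types (phi psi : E -> C) (u v w : dist) (m : E -> C).

Lemma T0 phi : T (fun=> 0) phi = fun=> 0.
Proof.
apply/funext => x; rewrite /T fourierE -[RHS](cint0 leb); apply: eq_cint => xi.
by rewrite mul0r mulr0.
Qed.

Lemma lin00 u : lin0 u -> u (fun=> 0) = 0.
Proof.
move=> lu; have h := lin0Z 0 lu (@schwartz0 R n).
have e : (fun x : E => 0 * 0 : C) = (fun=> 0) by apply/funext => x; rewrite mulr0.
by rewrite e mul0r in h.
Qed.

Lemma uTB u m m' phi : lin0 u -> slow m -> slow m' -> schwartz phi ->
  u (T (fun xi => m xi - m' xi) phi) = u (T m phi) - u (T m' phi).
Proof. by move=> lu sm sm' sp; rewrite TBm// lin0B//; exact: schwartz_T. Qed.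

Lemma uT3 u (m : int -> E -> C) a b c phi : lin0 u -> (forall j, slow (m j)) -> schwartz phi ->
  \sum_(j <- [:: a; b; c]) u (T (m j) phi) =
  u (T (fun xi => \sum_(j <- [:: a; b; c]) m j xi) phi).
Proof.
move=> lu sm sp; have sT j : schwartz (T (m j) phi) by exact: schwartz_T.
have -> : (fun xi => \sum_(j <- [:: a; b; c]) m j xi) = (fun xi => m a xi + (m b xi + m c xi)).
  by apply/funext => xi; rewrite !big_cons big_nil addr0.
rewrite !big_cons big_nil addr0 TDm//; last exact: slowD.
rewrite TDm// lin0D//; last exact: schwartzD.
by rewrite lin0D.
Qed.

Lemma T_Sle m k N : slow m -> exists (C0 : R) (k' L : nat), 0 <= C0 /\
  forall phi M, schwartz phi -> Sle k' L M phi -> Sle k N (C0 * M) (T m phi).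
Proof.
move=> sm; have [C1 [k1 [L1 [C10 h1]]]] := @fourier_Sle R n k N.
have [Mm [Nm [Mm0 hm]]] := sm.2 k1.
have [C2 [k2 [L2 [C20 h2]]]] := @fourier_Sle R n k1 (L1 + Nm)%N.
have c0 : 0 <= ((2 * pi) ^- n : R) by rewrite invr_ge0 exprn_ge0// mulr_ge0// pi_ge0.
exists (C1 * (2 ^+ k1 * (Mm * ((2 * pi) ^- n * C2)))), k2, L2; split.
  by rewrite !mulr_ge0// exprn_ge0.
move=> phi M sp hM; have sif := schwartz_ifourier sp.
have hif : Sle k1 (L1 + Nm) ((2 * pi) ^- n * C2 * M) (ifourier phi).
  rewrite (funext (ifourierE phi)).
  have sf := schwartz_fourier sp.
  have b := Bw_affine (-1) 0 (schwartz_smooth sf) (h2 _ _ sp hM).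
  have so : smooth (fun x => fourier phi (- x)) by apply: schwartz_smooth; exact: schwartz_opp.
  have b' : Bw k1 (fun x => C2 * M * jb x ^- (L1 + Nm)) (fun x => fourier phi (- x)).
    move: b; have -> : (fun x : E => fourier phi (-1 *: x + 0)) = (fun x => fourier phi (- x)).
      by apply/funext => x; rewrite scaleN1r addr0.
    apply: Bw_mono => // x; rewrite normrN1 maxxx expr1n mul1r scaleN1r addr0.
    by rewrite /jb enormN.
  have := BwZ (((2 * pi) ^- n)%:C)%C so b'.
  apply: Bw_mono => // x; rewrite modulus_ofreal ger0_norm// !mulrA //.
have := h1 _ _ (schwartz_slowM sm sif) (SleM (slow_smooth sm) (schwartz_smooth sif) hm hif).
by congr (Sle k N _ _); ring.
Qed.

Lemma tempered_bound u : tempered u -> exists (k N : nat) (K : R), 0 <= K /\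
  forall phi M, schwartz phi -> Sle k N M phi -> modulus (u phi) <= K * M.
Proof.
move=> [_ _ [N [K h]]]; exists N, N, `|K|; split => // phi M sp hM.
have M0 := Sle_ge0 hM; apply: le_trans (h _ _ sp ((schwartz_leE N M phi).2 hM)) _.
by rewrite ler_wpM2r// ler_norm.
Qed.

End functional.

(** * Littlewood-Paley decomposition of distributions *)

Section LP.
Context {R : realType} {m : nat}.
Local Notation n := m.+1.
Local Notation E := 'rV[R]_n.
Local Notation C := R[i].
Local Notation leb := (lebesgue_rV n).
Local Notation dist := (@dist R n).
Variable chi : E -> R.
Hypothesis hchi : LP_cutoff chi.
Implicit Types (s t : R) (j k : int) (phi psi : E -> C) (u v w : dist).
Local Notation sy := (sym chi).
Local Notation ch := (chis chi).
Let ssy s j : slow (sy s j) := slow_sym hchi s j.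
Let sch j : slow (ch j) := slow_chis hchi j.

(** The distribution [w] is the lift of order [s] of [u]; the operators of [dzsum] are moved onto
    test functions. *)
Definition As s u w := tempered w /\ forall phi, schwartz phi ->
  zsum (fun j => u (T (sy s j) phi)) (w phi).

Lemma dzsumE s u w : dzsum (fun j => fracDelta chi s j u) w <-> As s u w.
Proof.
split=> -[tw h]; split => // phi sp; have := h phi sp;
  by congr zsum; apply/funext => j; rewrite /fracDelta multiplierE//; exact: ssy.
Qed.

Lemma tempered_psum u phi M N : lin0 u -> schwartz phi ->
  psum (fun j => u (T (sy 0 j) phi)) (M, N) = u (T (ch N%:Z) phi) - u (T (ch (- M%:Z)) phi).
Proof.
move=> lu sp; rewrite -(psum_telescope (fun j => u (T (ch j) phi))); congr psum.
by apply/funext => j; rewrite sym_chis// uTB.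
Qed.

(** This is the high-frequency end of the decomposition. It converges for every tempered
    distribution, because [approx_id] gives convergence in each Schwartz seminorm; a further
    condition is only needed at the low-frequency end. *)
Lemma chi_low u phi : tempered u -> schwartz phi -> forall e, 0 < e ->
  \forall N \near \oo, modulus (u (T (ch (N : nat)%:Z) phi) - u phi) <= e.
Proof.
move=> tu sp e e0; have lu := tempered_lin0 tu.
have [k [N' [K [K0 hK]]]] := tempered_bound tu.
have schs := schwartz_chi hchi.
have bg l : exists M, Bw l (fun=> M) (ofreal chi).
  have [M hM] := schwartz_Sle l 0 schs; exists M; apply: Bw_mono hM => // x.
  by rewrite expr0 invr1 mulr1.
have [K1 K10 h1] := approx_id k N' (slow_schwartz schs) bg sp.
have chi0 : ofreal chi (0 : E) = 1.
  by rewrite /ofreal (chi_in hchi)// enorm0.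
have lim := cvg_half_pow (K * K1).
have /cvgrPdist_le /(_ _ e0) := lim; apply: filterS => N.
rewrite sub0r normrN => hN.
have p2 : 0 < (2 : R) ^- N by rewrite invr_gt0 exprn_gt0.
have eN : (2 : R) ^ (- N%:Z) = 2 ^- N by rewrite exprnN.
have -> : u (T (ch N%:Z) phi) - u phi = u (T (fun xi => ofreal chi (2 ^- N *: xi) - ofreal chi 0) phi).
  rewrite chi0 -{2}(T1 sp) -uTB//; last exact: slow_cst.
  by rewrite /chis eN.
have e01 : 0 < (2 : R) ^- N <= 1 by rewrite p2 invf_le1 ?exprn_gt0// exprn_ege1// ler1n.
apply: le_trans (hK _ _ _ (h1 _ e01)) _.
  apply: schwartz_T => //; apply: slowB; last exact: slow_cst.
  by apply: slow_dil; exact: slow_schwartz.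
by rewrite mulrA; apply: le_trans hN; exact: ler_norm.
Qed.

Lemma zsum_id u phi : tempered u -> schwartz phi ->
  (forall e, 0 < e -> \forall M \near \oo, modulus (u (T (ch (- (M : nat)%:Z)) phi)) <= e) ->
  zsum (fun j => u (T (sy 0 j) phi)) (u phi).
Proof.
move=> tu sp hM; apply/zsumE => e e0; have e2 : 0 < e / 2 by exact: divr_gt0.
apply: (near_prod (hM _ e2) (chi_low tu sp e2)) => M N k1 k2.
rewrite tempered_psum//; last exact: tempered_lin0.
rewrite addrAC; apply: le_trans (modulusB _ _) _; rewrite [leRHS]splitr; exact: lerD.
Qed.

(** The condition [Sh'] with the norm of bounded functions replaced by its dual form. The factor 2
    in [dLnormy_le] does not affect a limit equal to 0, whence the equivalence [Sh'E]. *)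
Definition Shb u := tempered u /\ forall Theta, Cc_smooth setT Theta -> forall e, 0 < e ->
  \forall la \near (+oo : set_system R), Lb1 e (multiplier (fun xi => Theta (la *: xi)) u).

Lemma Sh'E u : Sh' u <-> Shb u.
Proof.
split=> -[tu h]; split => // Th cT.
  move=> e e0; have /fine_cvgP[h1 h2] := h Th cT.
  have /cvgrPdist_le /(_ _ e0) h3 := h2; apply: filterS (filterI h1 h3) => la [f1 f2].
  have d0 : (0 <= dLnorm +oo (multiplier (fun xi => Th (la *: xi)) u))%E.
    by apply: le_ereal_inf_tmp => _ [f _ <-]; exact: Lnorm_ge0.
  have le : (dLnorm +oo (multiplier (fun xi => Th (la *: xi)) u) <= e%:E)%E.
    rewrite -(fineK f1) lee_fin.
    by move: f2; rewrite sub0r normrN /=; apply: le_trans; exact: ler_norm.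
  by have [] := dLnormy_Lb1 (ltW e0) le.
have H e : 0 < e -> \forall la \near (+oo : set_system R),
    (0 <= dLnorm +oo (multiplier (fun xi => Th (la *: xi)) u) <= e%:E)%E.
  move=> e0; have e2 : 0 < e / 2 by exact: divr_gt0.
  apply: filterS (h Th cT _ e2) => la hla; apply/andP; split.
    by apply: le_ereal_inf_tmp => _ [f _ <-]; exact: Lnorm_ge0.
  have := dLnormy_le (ltW e2) (lin0_multiplier (slow_dil la (slow_schwartz (Cc_smooth_schwartz cT))) (tempered_lin0 tu)) hla.
  by have -> : 2 * (e / 2) = e by field.
apply/fine_cvgP; split.
  apply: filterS (H 1 ltr01) => la /andP[l1 l2].
  by rewrite ge0_fin_numE//; apply: le_lt_trans l2 _; exact: ltry.
apply/cvgrPdist_le => e e0; apply: filterS (H e e0) => la /andP[l1 l2] /=.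
have f1 : dLnorm +oo (multiplier (fun xi => Th (la *: xi)) u) \is a fin_num.
  by rewrite ge0_fin_numE//; apply: le_lt_trans l2 _; exact: ltry.
by rewrite sub0r normrN ger0_norm ?fine_ge0// -lee_fin fineK.
Qed.

Lemma cvg_pow2_y : (fun M : nat => (2 : R) ^+ M) @ \oo --> (+oo : set_system R).
Proof.
apply/cvgryPge => A; have [N hN] : exists N : nat, A <= N%:R.
  by exists (Num.bound `|A|); apply: le_trans (ler_norm _) _; exact/ltW/archi_boundP.
exists N => // M /= NM; apply: le_trans hN _; apply: (@le_trans _ _ M%:R); first by rewrite ler_nat.
by rewrite -natrX ler_nat ltnW// ltn_expl.
Qed.

Lemma Shb_zsum u phi : Shb u -> schwartz phi -> zsum (fun j => u (T (sy 0 j) phi)) (u phi).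
Proof.
move=> [tu h] sp; apply: zsum_id => // e e0.
have [hC _ _ _] := hchi; have cT : Cc_smooth setT (ofreal chi) by case: hC.
have i0 : 0 <= \int[leb]_x modulus (phi x) by apply: Rintegral_ge0 => x _.
have i1 : 0 < \int[leb]_x modulus (phi x) + 1 by rewrite ltr_wpDl.
have hP : \forall M \near \oo, Lb1 (e / (\int[leb]_x modulus (phi x) + 1))
    (multiplier (fun xi => ofreal chi ((2 : R) ^+ M *: xi)) u) :=
  cvg_pow2_y (h _ cT _ (divr_gt0 e0 i1)).
apply: filterS hP => M /(_ _ sp).
rewrite multiplierE//; last by apply: slow_dil; exact/slow_schwartz/schwartz_chi.
have -> : (fun xi => ofreal chi (2 ^+ M *: xi)) = ch (- M%:Z).
  by apply/funext => xi; rewrite /chis opprK.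
move/le_trans; apply; rewrite mulrAC ler_pdivrMr// ler_wpM2l ?(ltW e0)//.
by rewrite lerDl.
Qed.

(** Localised to one dyadic piece, the series defining [w] has only three nonzero terms, so lifts
    compose piece by piece and no convergence is at stake. With [t = - s] the pieces of [u] are
    recovered from those of [w]. *)
Lemma As_comm s t u w j phi : lin0 u -> As s u w -> schwartz phi ->
  w (T (sy t j) phi) = u (T (sy (s + t) j) phi).
Proof.
move=> lu [tw h] sp; have sT := schwartz_T (ssy t j) sp.
apply: zsum_unique (h _ sT) _.
have e k : u (T (sy s k) (T (sy t j) phi)) = u (T (fun xi => sy s k xi * sy t j xi) phi).
  by rewrite T_comp.
have := @zsum_finite R (fun k => u (T (sy s k) (T (sy t j) phi))) j _.
have -> : \sum_(k <- [:: j - 1; j; j + 1]) u (T (sy s k) (T (sy t j) phi)) = u (T (sy (s + t) j) phi).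
  rewrite (eq_bigr (fun k => u (T (fun xi => sy s k xi * sy t j xi) phi))); last by move=> k _; exact: e.
  rewrite (uT3 (m := fun k xi => sy s k xi * sy t j xi))//; last by move=> k; exact: slowM.
  by congr (u (T _ phi)); apply/funext => xi; rewrite sym_tri.
apply => k h1 h2 h3; rewrite e sym_disj// T0; exact: lin00.
Qed.

Definition C1 s : R := kern1 (ofreal (sym0 chi s)).

Lemma scale_le (M N c k : R) : 0 <= c -> M <= k * N -> modulus (c%:C)%C * M <= k * c * N.
Proof.
move=> c0 h; rewrite modulus_ofreal ger0_norm// [k * c]mulrC -mulrA; exact: ler_wpM2l.
Qed.

Lemma Mb_sym p q s j : hpair p q -> Mb p (C1 s * (2 ^ j) `^ s) (sy s j).
Proof.
move=> H phi sp; have [p1 q1 pq] := H; have p0 : 0 < p by apply: lt_trans p1.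
have r0 := @pow2_gt0 R j; have ri : 0 < ((2 : R) ^ j)^-1 by rewrite invr_gt0.
have s0 := schwartz_sym0 hchi s; have sd := schwartz_dil ri s0.
rewrite (funext (symE chi s j)) TZm//; last exact: slow_schwartz.
have sT : schwartz (T (fun xi => ofreal (sym0 chi s) ((2 ^ j)^-1 *: xi)) phi).
  by apply: schwartz_T => //; exact: slow_schwartz.
have e := NpZ ((2 ^ j) `^ s)%:C%C p0 (schwartz_Lp (ltW p1) sT).
apply: (eq_ind_r (fun t => t <= _) _ e).
have hy := young H sd sp; rewrite (kern1_dilate ri s0) in hy.
exact: (scale_le (powR_ge0 _ _) hy).
Qed.

Lemma Mb_chis p q j : hpair p q -> Mb p (kern1 (ofreal chi)) (ch j).
Proof.
move=> H phi sp; have sc := schwartz_chi hchi; have r0 := @pow2_gt0 R (- j).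
by have := young H (schwartz_dil r0 sc) sp; rewrite kern1_dilate.
Qed.

Definition C2 p s : R := Np leb p (kern (ofreal (sym0 chi s))).

Lemma sym0_even s : (fun xi => ofreal (sym0 chi s) (- xi)) = ofreal (sym0 chi s).
Proof.
apply/funext => xi; have := sym_even hchi s 0 xi; rewrite !symE expr0z invr1 powR1 !scale1r.
by rewrite !mul1r.
Qed.

(** The low-frequency estimate. The [L^p] norm of the dilated kernel contributes [n / q] to the
    exponent, and [s + n / q] is positive under the condition on [s]. *)
Lemma L1_sym p q s j phi : hpair p q -> schwartz phi ->
  Np leb p (T (sy s j) phi) <= C2 p s * (2 ^ j) `^ (s + n%:R / q) * \int[leb]_x modulus (phi x).
Proof.
move=> H sp; have [p1 q1 pq] := H; have p0 : 0 < p by apply: lt_trans p1.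
have r0 := @pow2_gt0 R j; have ri : 0 < ((2 : R) ^ j)^-1 by rewrite invr_gt0.
have s0 := schwartz_sym0 hchi s; have sd := schwartz_dil ri s0.
rewrite (funext (symE chi s j)) TZm//; last exact: slow_schwartz.
have sT : schwartz (T (fun xi => ofreal (sym0 chi s) ((2 ^ j)^-1 *: xi)) phi).
  by apply: schwartz_T => //; exact: slow_schwartz.
rewrite (NpZ _ p0 (schwartz_Lp (ltW p1) sT)) modulus_ofreal ger0_norm ?powR_ge0//.
have := L1_Lp H sd sp.
have -> : (fun xi => ofreal (sym0 chi s) ((2 ^ j)^-1 *: - xi)) = (fun xi => ofreal (sym0 chi s) ((2 ^ j)^-1 *: xi)).
  apply/funext => xi; rewrite scalerN.
  exact: (congr1 (fun f => f ((2 ^ j)^-1 *: xi)) (sym0_even s)).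
rewrite (Np_kern_dilate H ri s0) => h.
apply: le_trans (ler_wpM2l (powR_ge0 _ _) h) _.
apply: le_of_eq; rewrite /C2.
have -> : ((2 ^ j)^-1 : R) `^ (- (n%:R / q)) = (2 ^ j) `^ (n%:R / q).
  by rewrite -powR_inv1 ?(ltW r0)// -powRrM mulrNN mul1r.
rewrite powRD; last by rewrite (gt_eqF r0) implybT.
by move: (_ `^ _) (_ `^ _) (Np _ _ _) (Rintegral _ _ _) => *; ring.
Qed.

Lemma pow2_pos (i : nat) (a : R) : ((2 : R) ^ i%:Z) `^ a = (2 `^ a) ^+ i.
Proof. by rewrite -exprnP -powR_mulrn// -powRrM mulrC powRrM powR_mulrn// powR_ge0. Qed.

Lemma pow2_neg (i : nat) (a : R) : ((2 : R) ^ (- i%:Z)) `^ a = (2 `^ (- a)) ^+ i.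
Proof.
rewrite pow2N -powR_inv1; last by rewrite ltW// pow2_gt0.
by rewrite -powRrM mulN1r pow2_pos.
Qed.

Lemma pow2_lt1 (a : R) : a < 0 -> 0 <= (2 : R) `^ a < 1.
Proof.
move=> a0; rewrite powR_ge0 /=.
have := gt0_ltr_powR; rewrite -[a]opprK powRN invf_lt1 ?powR_gt0// => h.
by rewrite -(powRr0 2); apply: gt1_ltr_powR || (rewrite powRr0 /powR pnatr_eq0 /= expR_gt1 mulr_gt0 ?oppr_gt0// ln_gt0 ?ltr1n).
Qed.

Lemma geo_neg (A a : R) (N : nat) : 0 <= A -> 0 < a ->
  \sum_(i < N) A * (2 `^ (- a)) ^+ i.+1 <= A * (1 - 2 `^ (- a))^-1.
Proof.
move=> A0 a0; have /andP[x0 x1] : 0 <= (2 : R) `^ (- a) < 1 by apply: pow2_lt1; rewrite oppr_lt0.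
rewrite -mulr_sumr ler_wpM2l//; apply: le_trans (geo_sum_le N _); last by rewrite x0.
by apply: ler_sum => i _; rewrite exprS ler_piMl ?exprn_ge0// ltW.
Qed.

Lemma zsum_bound p q s : hpair p q -> - (n%:R / q) < s ->
  exists K0 (D : E -> C), [/\ 0 <= K0, slow D &
  forall w K phi, lin0 w -> 0 <= K -> Lb p K w -> schwartz phi ->
  exists2 z, zsum (fun j => w (T (sy s j) phi)) z &
    modulus z <= K0 * K * (\int[leb]_x modulus (phi x) + Np leb p (T D phi))].
Proof.
move=> H hs; have [p1 q1 pq] := H.
have al0 : 0 < s + n%:R / q by rewrite -ltrBlDr sub0r.
set al := s + n%:R / q in al0.
pose k := Num.bound `|s|; have sk : s - (2 * k)%:R < 0.
  have : s < k%:R by apply: le_lt_trans (ler_norm _) _; exact: archi_boundP.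
  by rewrite natrM; have : 0 <= (k%:R : R) by []; lra.
set be := s - (2 * k)%:R in sk.
have /andP[x0 x1] := pow2_lt1 sk.
have /andP[y0 y1] : 0 <= (2 : R) `^ (- al) < 1 by apply: pow2_lt1; rewrite oppr_lt0.
pose D : E -> C := fun xi => (ofreal (fun xi => dotprod xi xi) xi) ^+ k.
have sD : slow D.
  apply: slowX; have -> : ofreal (fun xi : E => dotprod xi xi) = (fun xi => \sum_(i < n) (xi ord0 i)%:C%C * (xi ord0 i)%:C%C).
    by apply/funext => xi; rewrite /ofreal /dotprod rmorph_sum /=; apply: eq_bigr => i _; rewrite rmorphM.
  by apply: slow_sum => i; apply: slowM; exact: slow_coord.
pose G1 := (1 - (2 : R) `^ (- al))^-1; pose G2 := (1 - (2 : R) `^ be)^-1.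
have G10 : 0 <= G1 by rewrite invr_ge0 subr_ge0 ltW.
have G20 : 0 <= G2 by rewrite invr_ge0 subr_ge0 ltW.
have C10 : 0 <= C1 be by exact: kern1_ge0.
have C20 : 0 <= C2 p s by exact: Np_ge0.
exists (C2 p s * G1 + C1 be * G2), D; split => //.
  by rewrite addr_ge0// mulr_ge0.
move=> w K phi lw K0 bw sp.
set I1 := \int[leb]_x _; set N1 := Np _ _ _.
have I10 : 0 <= I1 by apply: Rintegral_ge0 => x _.
have N10 : 0 <= N1 by exact: Np_ge0.
have sDp := schwartz_T sD sp.
have TD j : T (sy s j) phi = T (sy be j) (T D phi).
  by rewrite T_comp//; congr (T _ phi); apply/funext => xi; rewrite (sym_lap hchi s k).
have [i|i|N|N|z hz nz] := @zsum_exists R (fun j => w (T (sy s j) phi))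
  (fun i => K * C2 p s * I1 * ((2 `^ (- al)) ^+ i.+1)) (fun i => K * C1 be * N1 * ((2 `^ be) ^+ i))
  (K * C2 p s * I1 * G1) (K * C1 be * N1 * G2) _ _ _ _.
- apply: le_trans (bw _ (schwartz_T (ssy _ _) sp)) _.
  rewrite -!mulrA ler_wpM2l//; apply: le_trans (L1_sym s (- i.+1%:Z) H sp) _.
  by rewrite -/al pow2_neg -mulrA [_ * I1]mulrC.
- apply: le_trans (bw _ (schwartz_T (ssy _ _) sp)) _.
  rewrite -!mulrA ler_wpM2l// TD; apply: le_trans (Mb_sym be i%:Z H sDp) _.
  by rewrite pow2_pos -mulrA [_ * N1]mulrC.
- exact: (geo_neg N (mulr_ge0 (mulr_ge0 K0 C20) I10) al0).
- rewrite -mulr_sumr; apply: ler_wpM2l; first exact: (mulr_ge0 (mulr_ge0 K0 C10) N10).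
  by apply: geo_sum_le; rewrite x0.
exists z => //; apply: le_trans nz _.
have a1 := mulr_ge0 (mulr_ge0 (mulr_ge0 K0 C20) G10) N10.
have a2 := mulr_ge0 (mulr_ge0 (mulr_ge0 K0 C10) G20) I10.
by clearbody I1 N1 G1 G2; move: (C1 be) (C2 p s) a1 a2 => c1 c2 a1 a2; lra.
Qed.

Lemma Qd_tempered p q w : hpair p q -> Qd p w -> tempered w.
Proof. by move=> [p1 _ _] [lw [K K0 bw]]; exact: (tempered_Lb (ltW p1) K0 lw bw). Qed.

(** A function in [L^q] has no mass at frequency 0: by [L1_Lp] and dilation the cut-off applied to
    [phi] has [L^p] norm of order [2^(- M n / q)]. *)
Lemma chis_small p q w phi : hpair p q -> Qd p w -> schwartz phi -> forall e, 0 < e ->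
  \forall M \near \oo, modulus (w (T (ch (- (M : nat)%:Z)) phi)) <= e.
Proof.
move=> H [lw [K K0 bw]] sp e e0; have [p1 q1 pq] := H.
have q0 : 0 < q by apply: lt_trans q1.
have a0 : 0 < n%:R / q by apply: divr_gt0.
have /andP[x0 x1] : 0 <= (2 : R) `^ (- (n%:R / q)) < 1 by apply: pow2_lt1; rewrite oppr_lt0.
pose c := Np leb p (kern (ofreal chi)) * \int[leb]_x modulus (phi x).
have lim : (fun M : nat => K * c * (2 `^ (- (n%:R / q))) ^+ M) @ \oo --> (0 : R).
  rewrite -(mulr0 (K * c)); apply: cvgM; first exact: cvg_cst.
  by apply: cvg_expr; rewrite ger0_norm.
have /cvgrPdist_le /(_ _ e0) := lim; apply: filterS => M.
rewrite sub0r normrN => hM.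
have sc := schwartz_chi hchi; have r0 := @pow2_gt0 R M%:Z.
have chE : ch (- M%:Z) = (fun xi => ofreal chi ((2 : R) ^ M%:Z *: xi)).
  by apply/funext => xi; rewrite /chis opprK.
apply: le_trans (bw _ (schwartz_T (sch _) sp)) _; apply: le_trans hM.
apply: le_trans (ler_norm _) => //; rewrite -mulrA ler_wpM2l//.
have := L1_Lp H (schwartz_dil r0 sc) sp.
have -> : (fun xi => ofreal chi (2 ^ M%:Z *: - xi)) = (fun xi => ofreal chi (2 ^ M%:Z *: xi)).
  by apply/funext => xi; rewrite /ofreal; congr (_%:C)%C; apply: (chi_radial hchi); rewrite scalerN enormN.
rewrite (Np_kern_dilate H r0 sc) pow2_pos -chE => h; apply: le_trans h _.
by rewrite /c; move: (Np _ _ (kern _)) (Rintegral _ _ _) (_ ^+ M) => *; apply: le_of_eq; ring.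
Qed.

Lemma Qd_zsum p q w phi : hpair p q -> Qd p w -> schwartz phi ->
  zsum (fun j => w (T (sy 0 j) phi)) (w phi).
Proof.
move=> H Qw sp; apply: zsum_id => //; first exact: (Qd_tempered H Qw).
exact: (chis_small H Qw sp).
Qed.

End LP.

(** * The bracket as a pairing of lifts, and the homogeneous spaces *)

Section LP2.
Context {R : realType} {m : nat}.
Local Notation n := m.+1.
Local Notation E := 'rV[R]_n.
Local Notation C := R[i].
Local Notation leb := (lebesgue_rV n).
Local Notation dist := (@dist R n).
Variable chi : E -> R.
Hypothesis hchi : LP_cutoff chi.
Implicit Types (s t : R) (j k : int) (phi psi : E -> C) (u v w : dist).
Local Notation sy := (sym chi).
Local Notation ch := (chis chi).
Let ssy s j : slow (sy s j) := slow_sym hchi s j.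
Let sch j : slow (ch j) := slow_chis hchi j.

Let sy_even s j : (fun xi => sy s j (- xi)) = sy s j.
Proof. by apply/funext => xi; rewrite sym_even. Qed.

Lemma multiplierD mm mm' w : lin0 w -> slow mm -> slow mm' ->
  multiplier (fun xi => mm xi + mm' xi) w = (fun f => 1 * multiplier mm w f + multiplier mm' w f).
Proof.
move=> lw s1 s2; apply/funext => f; have [sf|nf] := pselect (schwartz f).
  rewrite (multiplierE _ (slowD s1 s2) sf) (multiplierE _ s1 sf) (multiplierE _ s2 sf).
  by rewrite TDm// lin0D ?mul1r//; exact: schwartz_T.
by rewrite !multiplier_out// mulr0 addr0.
Qed.

Lemma multiplierB mm mm' w : lin0 w -> slow mm -> slow mm' ->
  multiplier (fun xi => mm xi - mm' xi) w = (fun f => (-1) * multiplier mm' w f + multiplier mm w f).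
Proof.
move=> lw s1 s2; apply/funext => f; have [sf|nf] := pselect (schwartz f).
  rewrite (multiplierE _ (slowB s1 s2) sf) (multiplierE _ s1 sf) (multiplierE _ s2 sf).
  by rewrite uTB// mulN1r addrC.
by rewrite !multiplier_out// mulr0 addr0.
Qed.

Lemma big3 (F : int -> C) a b c : \sum_(k <- [:: a; b; c]) F k = F a + (F b + F c).
Proof. by rewrite !big_cons big_nil addr0. Qed.

Section pq.
Variables (p q : R) (H : hpair p q).
Let p1 : 1 < p. Proof. by case: H. Qed.
Let q1 : 1 < q. Proof. by case: H. Qed.
Let H' := hpairC H.
Let C1p s j : 0 <= C1 chi s * (2 ^ j) `^ s.
Proof. by rewrite mulr_ge0 ?powR_ge0// kern1_ge0. Qed.

Lemma Qd_sym s j w : Qd q w -> Qd q (multiplier (sy s j) w).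
Proof. exact: (Qd_multiplier (ssy s j) (C1p s j) (Mb_sym hchi s j H')). Qed.

Lemma Qd_chis j w : Qd q w -> Qd q (multiplier (ch j) w).
Proof. exact: (Qd_multiplier (sch j) (kern1_ge0 _) (Mb_chis hchi j H')). Qed.

(** Partial sums telescope to two cut-offs, and every cut-off has the multiplier bound
    [kern1 (ofreal chi)]. This uniform bound reduces the limit to Schwartz [w2], where it is
    [Qd_zsum] for [w1]. *)
Lemma pair_zsum w1 w2 : Qd p w1 -> Qd q w2 ->
  zsum (fun j => pair w1 (multiplier (sy 0 j) w2)) (pair w1 w2).
Proof.
move=> Q1 Q2; have [l1 [K1 K10 b1]] := Q1.
pose A := kern1 (ofreal chi); have A0 : 0 <= A by exact: kern1_ge0.
pose F (MN : nat * nat) w := psum (fun j => pair w1 (multiplier (sy 0 j) w)) MN - pair w1 w.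
apply/zsumE.
apply: (@lim_by_density R n p q H (nat * nat)%type (filter_prod \oo \oo) _ F (K1 * A + K1 * A + K1) _ _ _ _ w2 Q2).
- by rewrite !addr_ge0// mulr_ge0.
- move=> MN c u v Qu Qv; rewrite /F (pair_linr H c Q1 Qu Qv).
  have -> : (fun j => pair w1 (multiplier (sy 0 j) (fun f => c * u f + v f))) =
      (fun j => c * pair w1 (multiplier (sy 0 j) u) + pair w1 (multiplier (sy 0 j) v)).
    apply/funext => j; rewrite (multiplier_lin c u v (ssy 0 j)).
    exact: (pair_linr H c Q1 (Qd_sym 0 j Qu) (Qd_sym 0 j Qv)).
  by rewrite psum_lin; move: (psum _ _) (psum _ _) (pair _ _) (pair _ _) => *; ring.
- move=> [M N] u K lu K0 bu; rewrite /F.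
  have Qu : Qd q u by split => //; exists K.
  have -> : psum (fun j => pair w1 (multiplier (sy 0 j) u)) (M, N) =
     pair w1 (multiplier (ch N%:Z) u) - pair w1 (multiplier (ch (- M%:Z)) u).
    rewrite -(psum_telescope (fun j => pair w1 (multiplier (ch j) u))); congr psum.
    apply/funext => j; rewrite sym_chis (multiplierB lu (sch _) (sch _)).
    by rewrite (pair_linr H (-1) Q1 (Qd_chis _ Qu) (Qd_chis _ Qu)) mulN1r addrC.
  have bc j : modulus (pair w1 (multiplier (ch j) u)) <= K1 * A * K.
    rewrite -mulrA [A * K]mulrC.
    exact: (pair_le H K10 (mulr_ge0 K0 A0) l1 (lin0_multiplier (sch j) lu) b1 (Lb_multiplier (sch j) K0 bu (Mb_chis hchi j H'))).
  apply: le_trans (modulusB _ _) _; rewrite mulrDl; apply: lerD; last exact: (pair_le H K10 K0 l1 lu b1 bu).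
  by apply: le_trans (modulusB _ _) _; rewrite mulrDl; apply: lerD; exact: bc.
- move=> phi sp e e0; have /zsumE /(_ e e0) := Qd_zsum hchi H Q1 sp.
  apply: filterS => MN; rewrite /F (pair_toD H Q1 sp).
  have -> // : (fun j => pair w1 (multiplier (sy 0 j) (toD phi))) = (fun j => w1 (T (sy 0 j) phi)).
  apply/funext => j; rewrite -(sy_even 0 j) (multiplier_toD (ssy 0 j) sp) sy_even.
  exact: (pair_toD H Q1 (schwartz_T (ssy 0 j) sp)).
Qed.

Lemma pair_mD w1 w2 m1 m2 : Qd p w1 -> lin0 w2 -> slow m1 -> slow m2 ->
  Qd q (multiplier m1 w2) -> Qd q (multiplier m2 w2) ->
  Qd q (multiplier (fun xi => m1 xi + m2 xi) w2) /\
  pair w1 (multiplier (fun xi => m1 xi + m2 xi) w2) =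
    pair w1 (multiplier m1 w2) + pair w1 (multiplier m2 w2).
Proof.
move=> Q1 l2 s1 s2 Qa Qb; rewrite (multiplierD l2 s1 s2); split; first exact: Qd_lin.
by rewrite (pair_linr H 1 Q1 Qa Qb) mul1r.
Qed.

(** The dyadic pieces of [u] and [v] are those of the lifts with symbols of order [s] and [- s].
    Moved to one side by [pair_multiplier] these orders cancel, and the sum over three neighbours
    collapses by [sym_tri] to a single piece of order 0. *)
Lemma bracketE s u v w1 w2 : lin0 u -> lin0 v -> As chi (- s) u w1 -> Qd p w1 ->
  As chi s v w2 -> Qd q w2 -> bracket chi u v = pair w1 w2.
Proof.
move=> lu lv A1 Q1 A2 Q2; have l1 := Q1.1; have l2 := Q2.1.
have D1 j : Delta chi j u = multiplier (sy s j) w1.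
  rewrite /Delta sym_Delta; apply: dist_eq; [exact: lin0_multiplier|exact: lin0_multiplier|].
  move=> phi sp; rewrite (multiplierE _ (ssy 0 j) sp) (multiplierE _ (ssy s j) sp).
  by rewrite (As_comm hchi s j lu A1 sp) addNr.
have D2 k : Delta chi k v = multiplier (sy (- s) k) w2.
  rewrite /Delta sym_Delta; apply: dist_eq; [exact: lin0_multiplier|exact: lin0_multiplier|].
  move=> phi sp; rewrite (multiplierE _ (ssy 0 k) sp) (multiplierE _ (ssy (- s) k) sp).
  by rewrite (As_comm hchi (- s) k lv A2 sp) subrr.
pose mm j k : E -> C := fun xi => sy (- s) k xi * sy s j xi.
have smm j k : slow (mm j k) by exact: slowM.
have Qmm j k : Qd q (multiplier (mm j k) w2).
  by rewrite /mm -(multiplier_comp w2 (ssy s j) (ssy (- s) k)); do 2!apply: Qd_sym.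
have e j k : cintegral (fun x => fun_of (Delta chi j u) x * fun_of (Delta chi k v) x) =
    pair w1 (multiplier (mm j k) w2).
  have := pair_multiplier H (ssy s j) (C1p s j) (C1p s j) (Mb_sym hchi s j H) _ Q1 (Qd_sym (- s) k Q2).
  rewrite sy_even => /(_ (Mb_sym hchi s j H')) eqn.
  rewrite (multiplier_comp w2 (ssy s j) (ssy (- s) k)) in eqn.
  transitivity (pair (Delta chi j u) (Delta chi k v)); first reflexivity.
  by rewrite D1 D2; exact: eqn.
have sumE j : \sum_(k <- [:: j - 1; j; j + 1])
    cintegral (fun x => fun_of (Delta chi j u) x * fun_of (Delta chi k v) x) =
    pair w1 (multiplier (sy 0 j) w2).
  rewrite (eq_bigr (fun k => pair w1 (multiplier (mm j k) w2)) (fun k _ => e j k)).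
  rewrite (big3 (fun k => pair w1 (multiplier (mm j k) w2))).
  have -> : sy 0 j = (fun xi => mm j (j - 1) xi + (mm j j xi + mm j (j + 1) xi)).
    apply/funext => xi; rewrite -(addNr s) -(sym_tri hchi (- s) s j xi).
    by rewrite !big_cons big_nil addr0.
  have [Q3 e3] := pair_mD Q1 l2 (smm j j) (smm j (j + 1)) (Qmm _ _) (Qmm _ _).
  have [_ e4] := pair_mD Q1 l2 (smm j (j - 1)) (slowD (smm j j) (smm j (j + 1))) (Qmm _ _) Q3.
  exact: (esym (etrans e4 (congr1 _ e3))).
rewrite /bracket (funext sumE).
have z := pair_zsum Q1 Q2; case: xgetP => [y _ hy|/(_ _) h]; first exact: zsum_unique hy z.
by case: (h (pair w1 w2)).
Qed.

End pq.

(** The values are chosen by [xget], and uniqueness of sums makes the choice linear. *)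
Lemma mk_sum s w : lin0 w ->
  (forall phi, schwartz phi -> exists z, zsum (fun j => w (T (sy s j) phi)) z) ->
  exists u, lin0 u /\ forall phi, schwartz phi -> zsum (fun j => w (T (sy s j) phi)) (u phi).
Proof.
move=> lw h; pose u : dist := ext0 schwartz (fun phi => xget 0 (zsum (fun j => w (T (sy s j) phi)))).
have hu phi : schwartz phi -> zsum (fun j => w (T (sy s j) phi)) (u phi).
  move=> sp; rewrite /u /ext0 /patch mem_set//; case: xgetP => [//|hn].
  by have [z hz] := h _ sp; case: (hn z).
exists u; split => //; split=> [f nf|c f g sf sg]; first by rewrite /u /ext0 /patch memNset.
have sc := schwartzD (schwartzZ c sf) sg.
apply: zsum_unique (hu _ sc) _; have := zsum_lin c (hu _ sf) (hu _ sg).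
congr zsum; apply/funext => j; rewrite TD//; last exact: schwartzZ.
by rewrite TZ// lw.2//; exact: schwartz_T.
Qed.

Lemma Cc_bounded (Theta : E -> C) : Cc_smooth setT Theta ->
  exists2 rho : R, 0 < rho & forall xi, rho <= enorm xi -> Theta xi = 0.
Proof.
move=> [_ cT _]; have [M [Mr hM]] := compact_bounded cT.
pose M1 := `|M| + 1; have MM : M < M1 by rewrite (le_lt_trans (ler_norm M))// ltrDl.
have M10 : 0 < M1 by rewrite ltr_wpDl.
exists (n%:R * M1 + 1); first by rewrite ltr_wpDl// mulr_ge0// ltW.
move=> xi h; apply: contrapT => /eqP nz.
have : `|xi| <= M1 by apply: (hM _ MM); apply: subset_closure.
move=> le; have := enorm_le_norm xi; have : n%:R * `|xi| <= n%:R * M1 by rewrite ler_wpM2l.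
move: h; move: (enorm xi) (n%:R * `|xi|) (n%:R * M1) => a b c h1 h2 h3.
suff : a < a by rewrite ltxx.
lra.
Qed.

(** Summability of the pieces gives a tempered sum. It lies in [S'_h] because a dilated cut-off
    [Theta] keeps only the pieces of very low frequency, whose total is small: half of the exponent
    [al] supplies the smallness and the other half the geometric series. *)
Lemma lift (p q : R) s w : hpair p q -> - (n%:R / q) < s -> Qd p w ->
  exists u, Shb u /\ As chi s w u.
Proof.
move=> H hs Qw; have [p1 q1 pq] := H; have [lw [K K0 bw]] := Qw.
have [K1 [D [K10 sD hb]]] := zsum_bound hchi H hs.
have [u [lu hu]] := mk_sum (s := s) lw (fun phi sp =>
  let: ex_intro2 z hz _ := hb w K phi lw K0 bw sp in ex_intro _ z hz).
have tu : tempered u.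
  split; [exact: lu.1|exact: lu.2|].
  have [C0 [k' [L [C00 hT]]]] := T_Sle 0 (2 * n)%N sD.
  pose N := maxn (maxn k' L) (2 * n); pose J := (@jbint R n) `^ p^-1.
  exists N, (K1 * K * (@jbint R n + C0 * J)) => f M sf /schwartz_leE hf.
  have M0 := Sle_ge0 hf.
  have f1 : Sle 0 (2 * n) M f by apply: Sle_mono hf => //; rewrite /N leq_maxr.
  have f2 : Sle k' L M f.
    by apply: Sle_mono hf => //; rewrite /N; [rewrite !leq_max leqnn|rewrite !leq_max leqnn orbT].
  have [z hz nz] := hb w K f lw K0 bw sf.
  rewrite (zsum_unique (hu _ sf) hz); apply: le_trans nz _.
  rewrite -[leRHS]mulrA ler_wpM2l ?mulr_ge0//.
  have [_ g2] := Sle_Lp (ltW p1) (schwartz_cmeas (schwartz_T sD sf)) (hT _ _ sf f2).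
  have g1 := Sle_int_le (schwartz_cmeas sf) f1.
  apply: le_trans (lerD g1 g2) _; rewrite -/J.
  by move: (jbint) => b; apply: le_of_eq; ring.
exists u; split; last by split.
split => // Th cT e e0.
have [rho rho0 hrho] := Cc_bounded cT; have sTh := Cc_smooth_schwartz cT.
have al0 : 0 < s + n%:R / q by rewrite -ltrBlDr sub0r.
set al := s + n%:R / q in al0; have a2 : 0 < al / 2 by exact: divr_gt0.
have /andP[y0 y1] : 0 <= (2 : R) `^ (- (al / 2)) < 1 by apply: pow2_lt1; rewrite oppr_lt0.
pose G := (1 - (2 : R) `^ (- (al / 2)))^-1; have G0 : 0 <= G by rewrite invr_ge0 subr_ge0 ltW.
pose A := kern1 Th; have A0 : 0 <= A by exact: kern1_ge0.
pose B := C2 chi p s; have B0 : 0 <= B by exact: Np_ge0.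
pose c := K * A * B * G; have c0 : 0 <= c by rewrite !mulr_ge0.
have c10 : 0 < c + 1 by rewrite ltr_wpDl.
(* For frequencies below [d0] the power [al / 2] is at most [e / (c + 1)]; the bound by 1 makes all
   pieces with [j >= 0] vanish, and [c + 1] avoids a division by 0. *)
pose d0 := Num.min 1 ((e / (c + 1)) `^ (al / 2)^-1).
have d00 : 0 < d0 by rewrite lt_min ltr01 powR_gt0// divr_gt0.
near=> la.
have la0 : 0 < la by near: la; exact: nbhs_pinfty_gt.
have lad : 4 * rho / (3 * d0) <= la by near: la; exact: (nbhs_pinfty_ge (num_real _)).
(* The [j]-th piece lives where [enorm xi >= 3 / 4 * 2 ^ j], and the dilate of [Th] vanishes where
   [enorm xi >= rho / la]; so only pieces with [2 ^ j < de] survive. *)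
pose de := 4 * rho / (3 * la).
have de0 : 0 < de by rewrite divr_gt0// mulr_gt0.
have dd : de <= d0.
  by move: lad; rewrite /de !ler_pdivrMr ?mulr_gt0//; lra.
have de1 : de <= 1 by apply: le_trans dd _; rewrite ge_min lexx.
have dec : de `^ (al / 2) <= e / (c + 1).
  apply: (@le_trans _ _ (((e / (c + 1)) `^ (al / 2)^-1) `^ (al / 2))).
    by apply: ger0_powR_le; [exact: ltW|exact: ltW|apply: le_trans dd _; rewrite ge_min lexx orbT].
  by rewrite -powRrM mulVf ?gt_eqF// powRr1// divr_ge0// ltW.
have sla := schwartz_dil la0 sTh; have slla := slow_schwartz sla.
move=> phi sp; rewrite (multiplierE _ slla sp).
set I1 := \int[leb]_x _; have I10 : 0 <= I1 by apply: Rintegral_ge0 => x _.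
have sTp := schwartz_T slla sp.
have zero j : de <= 2 ^ j -> w (T (sy s j) (T (fun xi => Th (la *: xi)) phi)) = 0.
  move=> dej; rewrite (T_comp _ slla sp).
  have -> : (fun xi => sy s j xi * Th (la *: xi)) = fun=> 0.
    apply/funext => xi; have [z|nz] := eqVneq (LP_psi chi j xi) 0.
      by rewrite /sym /ofreal z mulr0 rmorph0 mul0r.
    have [h1 _] := LP_psi_supp hchi nz; rewrite hrho ?mulr0// enormZ_pos ?(ltW la0)//.
    have : 3 / 4 * de <= enorm xi by apply: le_trans h1; rewrite ler_wpM2l.
    move=> h; have := ler_wpM2l (ltW la0) h.
    by have -> : la * (3 / 4 * de) = rho by rewrite /de; field; rewrite gt_eqF.
  by rewrite T0; exact: lin00.
have term j : 2 ^ j < de -> modulus (w (T (sy s j) (T (fun xi => Th (la *: xi)) phi))) <=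
    K * A * B * I1 * de `^ (al / 2) * (2 ^ j) `^ (al / 2).
  move=> jde; apply: le_trans (bw _ (schwartz_T (ssy s j) sTp)) _.
  rewrite (T_compC (ssy s j) slla sp) -!mulrA ler_wpM2l//.
  have y := young H sla (schwartz_T (ssy s j) sp); rewrite (kern1_dilate la0 sTh) -/A in y.
  apply: le_trans y _; rewrite ler_wpM2l//.
  apply: le_trans (L1_sym hchi s j H sp) _; rewrite -/B -/al -/I1 -mulrA ler_wpM2l// mulrC ler_wpM2l//.
  have {1}-> : al = al / 2 + al / 2 by field.
  have r0 := @pow2_gt0 R j; rewrite powRD; last by rewrite (gt_eqF r0) implybT.
  by rewrite ler_wpM2r ?powR_ge0//; apply: ger0_powR_le; [exact: ltW|exact: ltW|exact: ltW].
have [i|i|N|N|z hz nz] := @zsum_exists R (fun j => w (T (sy s j) (T (fun xi => Th (la *: xi)) phi)))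
  (fun i => K * A * B * I1 * de `^ (al / 2) * ((2 `^ (- (al / 2))) ^+ i.+1)) (fun=> 0)
  (K * A * B * I1 * de `^ (al / 2) * G) 0 _ _ _ _.
- have [h|h] := leP de (2 ^ (- i.+1%:Z)).
    rewrite zero// modulus0; do 2?apply: mulr_ge0; rewrite ?exprn_ge0 ?powR_ge0//.
    by rewrite !mulr_ge0.
  by apply: le_trans (term _ h) _; rewrite pow2_neg.
- by rewrite zero ?modulus0//; apply: le_trans de1 _; rewrite -exprnP exprn_ege1// ler1n.
- have Z : 0 <= K * A * B * I1 * de `^ (al / 2) by apply: mulr_ge0; [rewrite !mulr_ge0|exact: powR_ge0].
  exact: (geo_neg N Z a2).
- by rewrite big1.
rewrite (zsum_unique (hu _ sTp) hz); apply: le_trans nz _; rewrite addr0.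
have -> : K * A * B * I1 * de `^ (al / 2) * G = c * de `^ (al / 2) * I1.
  by rewrite /c; move: (de `^ _) => X; ring.
apply: ler_wpM2r => //; apply: le_trans (ler_wpM2l c0 dec) _.
by rewrite mulrA ler_pdivrMr// mulrC ler_wpM2l ?(ltW e0)// lerDl.
Unshelve. all: by end_near. Qed.

Lemma As_inv s u w : lin0 w -> As chi s w u -> (forall phi, schwartz phi ->
  zsum (fun j => w (T (sy 0 j) phi)) (w phi)) -> tempered w -> As chi (- s) u w.
Proof.
move=> lw A hz tw; split => // phi sp; have := hz _ sp; congr zsum; apply/funext => j.
by rewrite (As_comm hchi (- s) j lw A sp) subrr.
Qed.

Lemma Shb_toD (p q : R) phi : hpair p q -> schwartz phi -> Shb (toD phi).
Proof.
move=> H sp; have [p1 q1 pq] := H; have q0 : 0 < q by apply: lt_trans q1.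
split; first exact: (Qd_tempered (hpairC H) (Qd_toD H sp)).
move=> Th cT e e0; have sTh := Cc_smooth_schwartz cT; have sTo := schwartz_opp sTh.
pose c := Np leb p (kern (fun xi => Th (- xi))) * Np leb q phi.
have c0 : 0 <= c by rewrite mulr_ge0 ?Np_ge0.
have c1 : 0 < c + 1 by rewrite ltr_wpDl.
have a0 : 0 < n%:R / q by exact: divr_gt0.
near=> la.
have la0 : 0 < la by near: la; exact: nbhs_pinfty_gt.
have lad : ((c + 1) / e) `^ (n%:R / q)^-1 <= la by near: la; exact: (nbhs_pinfty_ge (num_real _)).
have hl : la `^ (- (n%:R / q)) * c <= e.
  have h := ger0_powR_le (ltW a0) (powR_ge0 _ _) lad.
  rewrite -powRrM mulVf ?gt_eqF// powRr1 ?divr_ge0 ?(ltW e0) ?(ltW c1)// in h.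
  have lp : 0 < la `^ (n%:R / q) by exact: powR_gt0.
  rewrite powRN mulrC ler_pdivrMr//; move: h; rewrite ler_pdivrMr// => h.
  by rewrite mulrC; apply: le_trans h; rewrite lerDl.
have sla := schwartz_dil la0 sTh; have slla := slow_schwartz sla.
have slo := schwartz_dil la0 sTo.
move=> psi sps; rewrite (multiplierE _ slla sps) (toDE _ (schwartz_T slla sps)).
have -> : cint leb (fun x => phi x * T (fun xi => Th (la *: xi)) psi x) =
   cint leb (fun x => T (fun xi => Th (- (la *: xi))) phi x * psi x).
  have eS : (fun xi => Th (- (la *: - xi))) = (fun xi => Th (la *: xi)).
    by apply/funext => xi; rewrite scalerN opprK.
  have E0 := cint_T (m := fun xi => Th (- (la *: xi))) (slow_schwartz slo) sp sps.
  by rewrite eS in E0; exact: (esym E0).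
have sT := schwartz_T (slow_schwartz slo) sp.
have ci : cintgr leb (fun x => T (fun xi => Th (- (la *: xi))) phi x * psi x).
  by apply: schwartz_cintgr; exact: schwartzM.
have ip := cintgr_modulus (schwartz_cintgr sps).
apply: le_trans (modulus_cint_le ci) _.
rewrite -RintegralZl//; apply: le_Rintegral => //; [exact: cintgr_modulus ci|exact: integrableRZ|].
move=> x _; rewrite modulusM ler_wpM2r//.
have := T_sup x H slo sp; rewrite (Np_kern_dilate H la0 sTo) -mulrA -/c.
by move/le_trans; apply.
Unshelve. all: by end_near. Qed.

(** The symbol is even, so it can be moved from the test function [psi] to [phi]. Then [zsum_bound],
    applied to the distribution [toD psi], bounds the sum by the [L^q] norm of [psi], as membership
    of the lift in [L^p] requires. *)
Lemma As_toD (p q : R) s phi : hpair p q -> - (n%:R / q) < s -> schwartz phi ->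
  exists2 w, As chi s (toD phi) w & Qd q w.
Proof.
move=> H hs sp; have H' := hpairC H; have [p1 q1 pq] := H.
have [K1 [D [K10 sD hb]]] := zsum_bound hchi H hs.
set B := (\int[leb]_x modulus (phi x) + Np leb p (T D phi)) in hb.
have eT psi j : schwartz psi -> toD phi (T (sy s j) psi) = toD psi (T (sy s j) phi).
  move=> sps; have sT := schwartz_T (ssy s j) sp; have sTs := schwartz_T (ssy s j) sps.
  rewrite (toDE _ sTs) (toDE _ sT).
  have E0 := cint_T (ssy s j) sp sps; rewrite sy_even in E0.
  by apply: (etrans (esym E0)); apply: eq_cint => x; rewrite mulrC.
have hz psi : schwartz psi -> exists2 z, zsum (fun j => toD phi (T (sy s j) psi)) z &
    modulus z <= K1 * Np leb q psi * (\int[leb]_x modulus (phi x) + Np leb p (T D phi)).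
  move=> sps; have [z h1 h2] := hb (toD psi) (Np leb q psi) phi (lin0_toD sps) (Np_ge0 _ _ _) (Lb_toD H' sps) sp.
  have eF : (fun j => toD psi (T (sy s j) phi)) = (fun j => toD phi (T (sy s j) psi)).
    by apply/funext => j; exact: (esym (eT _ _ sps)).
  by exists z; [exact: (eq_ind _ (fun F => zsum F z) h1 _ eF)|exact: h2].
have [w [lw hw]] := mk_sum (s := s) (lin0_toD sp) (fun psi sps =>
  let: ex_intro2 z hz _ := hz psi sps in ex_intro _ z hz).
have B0 : 0 <= \int[leb]_x modulus (phi x) + Np leb p (T D phi).
  by rewrite addr_ge0 ?Np_ge0//; apply: Rintegral_ge0 => x _.
have bw : Lb q (K1 * (\int[leb]_x modulus (phi x) + Np leb p (T D phi))) w.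
  move=> psi sps; have [z h1 h2] := hz _ sps.
  by rewrite (zsum_unique (hw _ sps) h1) mulrAC.
have Qw : Qd q w by split => //; exists (K1 * (\int[leb]_x modulus (phi x) + Np leb p (T D phi))); first exact: mulr_ge0.
by exists w => //; split => //; exact: (Qd_tempered H' Qw).
Qed.

Lemma As_unique s u w w' : As chi s u w -> As chi s u w' -> w = w'.
Proof.
move=> [tw h] [tw' h']; apply: dist_eq; try exact: tempered_lin0.
by move=> phi sp; exact: zsum_unique (h _ sp) (h' _ sp).
Qed.

Lemma HnormE s (p : R) u w : As chi s u w -> Hnorm chi s p u = dLnorm p%:E w.
Proof.
move=> A; rewrite /Hnorm.
have -> : [set dLnorm p%:E w0 | w0 in dzsum (fun j => fracDelta chi s j u)] = [set dLnorm p%:E w].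
  apply/seteqP; split => [_ [w' /(dzsumE hchi) A' <-]|_ ->]; first by rewrite (As_unique A A').
  by exists w => //; exact/(dzsumE hchi).
by rewrite ereal_inf1.
Qed.

Lemma HdotE (p q : R) s u : hpair p q ->
  Hdot chi s p u <-> Shb u /\ exists2 w, As chi s u w & Qd q w.
Proof.
move=> H; split=> [[/Sh'E su]|[su [w A Qw]]].
  move=> /ereal_inf_lt[_ [w /(dzsumE hchi) A <-] lt]; split => //; exists w => //.
  have [K [K0 _ tw bw]] := dLnorm_fin H lt.
  by split; [exact: tempered_lin0|exists K].
split; first exact/Sh'E.
have [lw [K K0 bw]] := Qw; rewrite (HnormE _ A).
by apply: le_lt_trans (dLnorm_le H K0 lw bw) _; exact: ltry.
Qed.

Lemma As_lin s (c : C) u v w w' : lin0 u -> lin0 v -> As chi s u w -> As chi s v w' ->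
  tempered (fun f => c * w f + w' f) -> As chi s (fun f => c * u f + v f) (fun f => c * w f + w' f).
Proof. by move=> lu lv [tw h] [tw' h'] tt; split => // phi sp; exact: zsum_lin (h _ sp) (h' _ sp). Qed.

Lemma temperedP (c : C) u v : tempered u -> tempered v -> tempered (fun f => c * u f + v f).
Proof.
move=> tu tv; have [l0 ll] := lin0P c (tempered_lin0 tu) (tempered_lin0 tv); split => //.
have [k1 [N1 [K1 [K10 h1]]]] := tempered_bound tu; have [k2 [N2 [K2 [K20 h2]]]] := tempered_bound tv.
exists (maxn (maxn k1 N1) (maxn k2 N2)), (modulus c * K1 + K2) => f M sf /schwartz_leE hf.
have M0 := Sle_ge0 hf.
have f1 : Sle k1 N1 M f by apply: Sle_mono hf => //; rewrite !leq_max leqnn ?orbT.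
have f2 : Sle k2 N2 M f by apply: Sle_mono hf => //; rewrite !leq_max leqnn ?orbT.
apply: le_trans (modulusD _ _) _; rewrite modulusM mulrDl lerD ?h2// -mulrA ler_wpM2l//.
exact: h1.
Qed.

Lemma Shb_lin (c : C) u v : Shb u -> Shb v -> Shb (fun f => c * u f + v f).
Proof.
move=> [tu hu] [tv hv]; split; first exact: temperedP.
move=> Th cT e e0; have c1 : 0 < 2 * (modulus c + 1) by rewrite mulr_gt0// ltr_wpDl.
apply: filterS (filterI (hu _ cT _ (divr_gt0 e0 c1)) (hv _ cT _ (divr_gt0 e0 (ltr0n R 2)))) => la [h1 h2].
move=> phi sp; have i0 : 0 <= \int[leb]_x modulus (phi x) by apply: Rintegral_ge0 => x _.
rewrite (multiplier_lin c u v (slow_dil la (slow_schwartz (Cc_smooth_schwartz cT)))).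
apply: le_trans (modulusD _ _) _; rewrite modulusM [e in leRHS]splitr mulrDl; apply: lerD (h2 _ sp).
apply: le_trans (ler_wpM2l (modulus_ge0 c) (h1 _ sp)) _.
rewrite mulrA ler_wpM2r//; have c2 : 0 < modulus c + 1 by rewrite ltr_wpDl.
have -> : modulus c * (e / (2 * (modulus c + 1))) = e / 2 * (modulus c / (modulus c + 1)).
  by field; rewrite gt_eqF.
by rewrite ler_piMr ?divr_ge0 ?(ltW e0)// ler_pdivrMr// mul1r lerDl.
Qed.

Lemma Hdot_lin (p q : R) s (c : C) u v : hpair p q -> Hdot chi s p u -> Hdot chi s p v ->
  Hdot chi s p (fun f => c * u f + v f).
Proof.
move=> H /(HdotE s u H)[su [w A Qw]] /(HdotE s v H)[sv [w' A' Qw']].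
apply/(HdotE _ _ H); split; first exact: Shb_lin.
exists (fun f => c * w f + w' f); last exact: Qd_lin.
apply: As_lin => //; [exact/tempered_lin0/su.1|exact/tempered_lin0/sv.1|].
exact: temperedP A.1 A'.1.
Qed.

Lemma lin0_0 : lin0 (fun _ : E -> C => 0 : C).
Proof. by split => [//|c f g _ _]; rewrite mulr0 addr0. Qed.

Lemma Hdot_0 (p q : R) s : hpair p q -> Hdot chi s p (fun _ : E -> C => 0 : C).
Proof.
move=> H; apply/(HdotE _ _ H); have Q0 : Qd q (fun _ : E -> C => 0 : C).
  split; first exact: lin0_0.
  by exists 0 => // phi sp; rewrite modulus0 mul0r.
have t0 : tempered (fun _ : E -> C => 0 : C) by exact: (Qd_tempered (hpairC H) Q0).
split; first split => // Th cT e e0.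
  apply: nearW => la phi sp; rewrite multiplierE ?modulus0 ?mulr_ge0 ?(ltW e0)//.
    by apply: Rintegral_ge0 => x _.
  exact: (slow_dil la (slow_schwartz (Cc_smooth_schwartz cT))).
exists (fun=> 0) => //; split => // phi sp; apply/zsumE => e e0.
apply: (near_prod (near_ge 0) (near_ge 0)) => M N _ _.
by rewrite /psum big1// subrr modulus0 ltW.
Qed.

(** The lift determines the dyadic pieces, and [Shb] recovers the distribution from its pieces;
    polynomials, which have no pieces, are excluded by [Shb]. *)
Lemma As_inj s u v w : Shb u -> Shb v -> As chi s u w -> As chi s v w -> u = v.
Proof.
move=> su sv A A'; have lu := tempered_lin0 su.1; have lv := tempered_lin0 sv.1.
apply: dist_eq => // phi sp.
apply: zsum_unique (Shb_zsum hchi su sp) _; have := Shb_zsum hchi sv sp.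
congr zsum; apply/funext => j; rewrite -(subrr s).
by rewrite -(As_comm hchi (- s) j lu A sp) -(As_comm hchi (- s) j lv A' sp).
Qed.

(** The lift identifies [Y] with a subspace [X] of [L^p], where [Lp_represent] produces a function
    [F] of the conjugate space. The inverse lift of [F] is [u]; its own lift of order [- s] is [F]
    again, so the norm bound [K] is kept exactly. *)
Lemma surj (p q : R) s (Y : set dist) (ell : dist -> C) (K : R) : hpair p q -> - (n%:R / q) < s ->
  (forall v, Y v -> Hdot chi s p v) -> Y (fun=> 0) ->
  (forall (c : C) u v, Y u -> Y v -> Y (fun f => c * u f + v f)) ->
  (forall (c : C) u v, Y u -> Y v -> ell (fun f => c * u f + v f) = c * ell u + ell v) ->
  0 <= K -> (forall v, Y v -> ((modulus (ell v))%:E <= K%:E * Hnorm chi s p v)%E) ->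
  exists u, [/\ Hdot chi (- s) q u, (Hnorm chi (- s) q u <= K%:E)%E &
    forall v, Y v -> bracket chi u v = ell v].
Proof.
move=> H hs YH Y0 Yl ellL K0 ellB; have H' := hpairC H; have [p1 q1 pq] := H.
have p0 : 0 < p by apply: lt_trans p1.
have q0 : 0 < q by apply: lt_trans q1.
(* Here [f] is any representative of the lift of [v]. By [As_inj] it determines [v], so [ell]
   descends to a functional [l] of [f]. *)
pose Z f v := [/\ Y v, Lp leb p f & exists2 w, As chi s v w & represents f w].
pose X : set (E -> C) := [set f | exists v, Z f v].
have Zuniq f v v' : Z f v -> Z f v' -> v = v'.
  move=> [Yv _ [w A rw]] [Yv' _ [w' A' rw']].
  have /(HdotE _ _ H)[sv _] := YH _ Yv; have /(HdotE _ _ H)[sv' _] := YH _ Yv'.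
  have ww : w = w'.
    have [tw _ h] := rw; have [tw' _ h'] := rw'.
    apply: dist_eq; try exact: tempered_lin0.
    by move=> phi sp; have [_ ->] := h _ sp; have [_ ->] := h' _ sp.
  by rewrite -ww in A'; exact: As_inj sv sv' A A'.
pose l f : C := xget 0 [set z | exists2 v, Z f v & z = ell v].
have lE f v : Z f v -> l f = ell v.
  move=> Zf; rewrite /l; case: xgetP => [z _ [v' Zf' ->]|/(_ (ell v)) []]; last by exists v.
  by rewrite (Zuniq _ _ _ Zf Zf').
have Zl c f g u v : Z f u -> Z g v -> Z (fun x => c * f x + g x) (fun h => c * u h + v h).
  move=> [Yu lf [w A rw]] [Yv lg [w' A' rw']].
  have /(HdotE _ _ H)[su _] := YH _ Yu; have /(HdotE _ _ H)[sv _] := YH _ Yv.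
  split; [exact: Yl|by apply: LpD; [exact: ltW|exact: LpZ|]|].
  have rl := represents_lin H c lf lg rw rw'.
  exists (fun h => c * w h + w' h) => //.
  by apply: As_lin => //; [exact/tempered_lin0/su.1|exact/tempered_lin0/sv.1|case: rl].
have Zex v : Y v -> exists f w, [/\ Z f v, As chi s v w, Qd q w & represents f w].
  move=> Yv; have /(HdotE _ _ H)[sv [w A Qw]] := YH _ Yv; have [rw lw] := fun_of_Qd H Qw.
  by exists (fun_of w), w; split => //; split => //; exists w.
have Z0 : Z (fun=> 0) (fun=> 0).
  have [f [w [Zf _ _ _]]] := Zex _ Y0; have := Zl (-1) _ _ _ _ Zf Zf.
  have -> : (fun x => -1 * f x + f x) = fun=> 0 by apply/funext => x; rewrite mulN1r addNr.
  by have -> : (fun h : E -> C => -1 * 0 + 0 : C) = fun=> 0 by apply/funext => x; rewrite mulr0 addr0.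
have [F [lF nF hF]] : exists F, [/\ Lp leb q F, Np leb q F <= K &
    forall g, X g -> cint leb (fun x => F x * g x) = l g].
  apply: (@Lp_represent _ _ _ leb p q p1 q0 pq X l K _ _ _ _ _ K0).
  - by move=> f [v []].
  - by exists (fun=> 0).
  - by move=> c f g [u Zf] [v Zg]; exists (fun h => c * u h + v h); exact: Zl.
  - move=> c f g [u Zf] [v Zg]; rewrite (lE _ _ (Zl c _ _ _ _ Zf Zg)) (lE _ _ Zf) (lE _ _ Zg).
    by case: Zf => Yu _ _; case: Zg => Yv _ _; exact: ellL.
  - move=> f [v Zf]; rewrite (lE _ _ Zf); have [Yv lf [w A rw]] := Zf.
    have := ellB _ Yv; rewrite (HnormE _ A) => h.
    have bw : Lb q (Np leb p f) w.
      have [_ _ hw] := rw; move=> phi sp; have [_ ->] := hw _ sp.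
      exact: (hoelder_cint p0 q0 pq lf (schwartz_Lp (ltW q1) sp)).
    have lw : lin0 w by case: rw => /tempered_lin0.
    have := dLnorm_le H (Np_ge0 _ _ _) lw bw => h2.
    by rewrite -lee_fin EFinM; apply: le_trans h _; apply: lee_wpmul2l; rewrite ?lee_fin.
pose w1 : dist := ext0 schwartz (fun phi => cint leb (fun x => F x * phi x)).
have w1E phi : schwartz phi -> w1 phi = cint leb (fun x => F x * phi x).
  by move=> sp; rewrite /w1 /ext0 /patch mem_set.
have ciF phi : schwartz phi -> cintgr leb (fun x => F x * phi x).
  exact: (Lp_schwartz_cintgr H' lF).
have lw1 : lin0 w1.
  split=> [f nf|c f g sf sg]; first by rewrite /w1 /ext0 /patch memNset.
  rewrite !w1E//; last by apply: schwartzD => //; exact: schwartzZ.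
  rewrite -(cintZ c (ciF _ sf)) -(cintD (cintgrZ c (ciF _ sf)) (ciF _ sg)).
  by apply: eq_cint => x; ring.
have pq' : q^-1 + p^-1 = 1 by rewrite addrC.
have bw1 : Lb p K w1.
  move=> phi sp; rewrite w1E//.
  apply: le_trans (hoelder_cint q0 p0 pq' lF (schwartz_Lp (ltW p1) sp)) _.
  by rewrite ler_wpM2r ?Np_ge0.
have Q1 : Qd p w1 by split => //; exists K.
have rw1 : represents F w1.
  split; [exact: (tempered_Lb (ltW p1) K0 lw1 bw1)|exact: lF.1|].
  by move=> phi sp; split; [exact: ciF|exact: w1E].
have [u [su A1]] := lift H hs Q1.
have A1' : As chi (- s) u w1.
  apply: As_inv => //; last exact: (Qd_tempered H Q1).
  by move=> phi sp; exact: (Qd_zsum hchi H Q1 sp).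
exists u; split.
- by apply/(HdotE _ _ H'); split => //; exists w1.
- by rewrite (HnormE _ A1'); exact: (dLnorm_le H' K0 lw1 bw1).
- move=> v Yv; have [f [w [Zf A Qw rw]]] := Zex _ Yv.
  have /(HdotE _ _ H)[sv _] := YH _ Yv.
  rewrite (bracketE H (tempered_lin0 su.1) (tempered_lin0 sv.1) A1' Q1 A Qw).
  have lf : Lp leb p f by case: Zf.
  rewrite (pair_rep H lF rw1 lf rw) hF; first exact: lE.
  by exists v.
Qed.

End LP2.

(** * Supports under translation and mollification *)

Section supports.
Context {R : realType} {m : nat}.
Local Notation n := m.+1.
Local Notation E := 'rV[R]_n.
Local Notation C := R[i].
Local Notation leb := (lebesgue_rV n).
Local Notation dist := (@dist R n).
Variable chi : E -> R.
Hypothesis hchi : LP_cutoff chi.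
Implicit Types (phi psi : E -> C) (u v w : dist) (G : E -> R).

Definition Lip (L : R) G := 0 <= L /\ forall x y, `|G x - G y| <= L * enorm (x - y).
(** The distribution is supported where [G >= 0]. Adding constants to [G] or changing its sign
    describes all the regions that occur. *)
Definition van G w := forall phi, Cc_smooth [set x | G x < 0] phi -> w phi = 0.

Lemma norm_le_coord (h : R) (x : E) : 0 <= h -> (forall i, `|x ord0 i| <= h) -> `|x| <= h.
Proof.
move=> h0 hx; rewrite [leLHS]mx_normrE; apply/bigmax_leP; split => // -[i j] _ /=.
by rewrite ord1.
Qed.

Lemma Lip_continuous L G : Lip L G -> continuous (G : E -> R^o).
Proof.
move=> [L0 h] x A /= /nbhs_ballP[e /= e0 he].
have c0 : 0 < L * n%:R + 1 by rewrite ltr_wpDl// mulr_ge0.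
have d0 : 0 < e / (L * n%:R + 1) / 2 by rewrite !divr_gt0.
apply/nbhs_ballP; exists (e / (L * n%:R + 1) / 2) => //= y xy; apply: he.
rewrite -ball_normE /=.
have nx : `|x - y| <= e / (L * n%:R + 1) / 2.
  by move: xy; rewrite -ball_normE /= => /ltW.
apply: le_lt_trans (h x y) _.
apply: le_lt_trans (ler_wpM2l L0 (enorm_le_norm _)) _; rewrite mulrA.
apply: le_lt_trans (ler_wpM2l (mulr_ge0 L0 (ler0n R n)) nx) _.
rewrite !mulrA ltr_pdivrMr// ltr_pdivrMr//.
have : 0 <= L * n%:R * e by rewrite !mulr_ge0// ltW.
lra.
Qed.

(** Supports are closures, so a strict margin [c < 0] is required: the support then lies in the
    closed set [G <= c], which the bound [rho] makes compact. *)
Lemma Cc_of_bound L G g (c rho : R) : Lip L G -> smooth g -> c < 0 ->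
  (forall x, g x != 0 -> enorm x <= rho /\ G x <= c) -> Cc_smooth [set x | G x < 0] g.
Proof.
move=> hL sg c0 h.
pose K : set E := [set x | enorm x <= rho] `&` [set x | G x <= c].
have cK : closed K.
  apply: closedI.
    have : closed ((@enorm R n : E -> R^o) @^-1` [set r : R | r <= rho]).
      by apply: closed_comp => [x _|]; [exact: enorm_continuous|exact: closed_le].
    by [].
  have : closed ((G : E -> R^o) @^-1` [set r : R | r <= c]).
    by apply: closed_comp => [x _|]; [exact: (Lip_continuous hL)|exact: closed_le].
  by [].
have sub : fsupport g `<=` K.
  rewrite (_ : K = closure K); last exact/closure_id.
  by apply: closure_subset => x /h[].
split => //; last by move=> x /sub[_ /= le]; exact: le_lt_trans c0.
apply: bounded_closed_compact; last exact: closed_closure.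
exists rho; split; first exact: num_real.
move=> M rM x /sub[/= xr _]; apply: le_trans (norm_le_enorm x) _.
exact: le_trans xr (ltW rM).
Qed.

Lemma Cc_enorm_bound O phi : Cc_smooth O phi ->
  exists2 rho : R, 0 <= rho & forall x, phi x != 0 -> enorm x <= rho.
Proof.
move=> [sp cp _]; have [rho rho0 h] : exists2 rho : R, 0 < rho & forall xi, rho <= enorm xi -> phi xi = 0.
  by apply: Cc_bounded; split.
exists rho; first exact: ltW.
move=> x nz; rewrite leNgt; apply/negP => /ltW /h e; by rewrite e eqxx in nz.
Qed.

Lemma Cc_in O phi x : Cc_smooth O phi -> phi x != 0 -> O x.
Proof. by move=> [_ _ sub] nz; apply: sub; apply: subset_closure. Qed.

Lemma van_mult_chi L G w f (r : R) (c : E) : Lip L G -> 0 < r -> van G w ->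
  represents f w -> G c + L * (4 / 3 * r) < 0 ->
  {ae leb, forall x, f x * ofreal chi (r^-1 *: (x - c)) = 0}.
Proof.
move=> hL r0 vw [tw mf hf] hc; have [L0 lip] := hL.
have ri : r^-1 != 0 by rewrite invr_eq0 gt_eqF.
pose th x := ofreal chi (r^-1 *: (x - c)).
have sth : schwartz th.
  have := schwartz_affine (- (r^-1 *: c)) ri (schwartz_chi hchi).
  by congr schwartz; apply/funext => x; rewrite /th scalerBr.
have Cth : Cc_smooth [set x | G x < 0] th.
  apply: (Cc_of_bound (c := G c + L * (4 / 3 * r)) (rho := 4 / 3 * r + enorm c) hL) => //.
    exact: schwartz_smooth.
  move=> x nz; have lt : enorm (x - c) <= 4 / 3 * r.
    rewrite leNgt; apply/negP => h; move: nz; rewrite /th /ofreal (chi_out hchi) ?rmorph0 ?eqxx//.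
    by rewrite enormZ_pos ?invr_ge0 ?(ltW r0)// ler_pdivlMl// mulrC ltW.
  split.
    have -> : x = (x - c) + c by rewrite subrK.
    by apply: le_trans (enormD _ _) _; rewrite lerD2r.
  have := lip x c; rewrite ler_norml => /andP[_ h]; rewrite -lerBlDl.
  by apply: le_trans h _; rewrite ler_wpM2l.
have e0 phi : (fun x => f x * th x * phi x) = (fun x => f x * (phi x * th x)).
  by apply/funext => x; ring.
have Cp phi : schwartz phi -> Cc_smooth [set x | G x < 0] (fun x => phi x * th x).
  by move=> sp; exact: (Cc_smoothM (schwartz_smooth sp) Cth).
apply: (ae_unique (g := fun=> 0)); [exact: (cmeasM mf (schwartz_cmeas sth))|exact: cmeas_cst| | |].
- move=> phi sp; rewrite e0.
  by have [] := hf _ (Cc_smooth_schwartz (Cp _ sp)).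
- move=> phi sp; have -> : (fun x => 0 * phi x) = fun=> 0 by apply/funext => x; rewrite mul0r.
  exact: cintgr0.
- move=> phi sp; rewrite e0; have [_ e] := hf _ (Cc_smooth_schwartz (Cp _ sp)).
  have -> : (fun x => 0 * phi x) = fun=> 0 by apply/funext => x; rewrite mul0r.
  by rewrite cint0; exact: (etrans (esym e) (vw _ (Cp _ sp))).
Qed.

(** Countably many bumps, centred at the nodes of a grid of mesh [h], suffice for an almost
    everywhere statement: each [x] with [G x < - e] has a node nearby whose bump is 1 at [x] and is
    still supported where [G < 0]. *)
Lemma van_ae L G w f (e : R) : Lip L G -> 0 < e -> van G w -> represents f w ->
  {ae leb, forall x, G x < - e -> f x = 0}.
Proof.
move=> hL e0 vw rf; have [L0 lip] := hL.
have L1 : 0 < 3 * (L + 1) by rewrite mulr_gt0// ltr_wpDl.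
(* A bump reaches [4 / 3 * r] from its node and equals 1 within [3 / 4 * r]; the total variation of
   [G] over both distances is below [3 * L * r <= e]. *)
pose r := e / (3 * (L + 1)); have r0 : 0 < r by exact: divr_gt0.
have n0 : 0 < (2 * n%:R : R) by rewrite mulr_gt0.
pose h := r / (2 * n%:R); have h0 : 0 < h by exact: divr_gt0.
pose pt (z : 'rV[int]_n) : E := \row_i (h * (z ord0 i)%:~R).
have H z : {ae leb, forall x, G (pt z) + L * (4 / 3 * r) < 0 -> f x * ofreal chi (r^-1 *: (x - pt z)) = 0}.
  have [hz|hz] := pselect (G (pt z) + L * (4 / 3 * r) < 0); last first.
    by apply: (@aeW _ _ _ leb) => x hz'.
  by have := van_mult_chi hL r0 vw rf hz; apply: filterS => x hx _.
have H2 : {ae leb, forall x (k : nat) (z : 'rV[int]_n), unpickle k = Some z ->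
    G (pt z) + L * (4 / 3 * r) < 0 -> f x * ofreal chi (r^-1 *: (x - pt z)) = 0}.
  apply: ae_foralln => k; case: (unpickle k) => [z|]; last by apply: (@aeW _ _ _ leb).
  by have := H z; apply: filterS => x hx _ [<-].
apply: filterS H2 => x hx Gx.
pose z : 'rV[int]_n := \row_i Num.floor (x ord0 i / h).
have close : enorm (x - pt z) < 3 / 4 * r.
  apply: le_lt_trans (enorm_le_norm _) _.
  have nx : `|x - pt z| <= h.
    apply: norm_le_coord => [|j]; first exact: ltW.
    rewrite !mxE ler_norml.
    have /andP[f1] : (Num.floor (x ord0 j / h))%:~R <= x ord0 j / h < (Num.floor (x ord0 j / h) + 1)%:~R.
      by first [exact: floor_itv | exact: (real_floor_itv (num_real _))].
    rewrite intrD => f2; rewrite ler_pdivlMr// in f1; rewrite ltr_pdivrMr// in f2.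
    by apply/andP; split; lra.
  apply: le_lt_trans (ler_wpM2l (ler0n R n) nx) _; rewrite /h.
  have gen (N : R) : N != 0 -> N * (r / (2 * N)) = r / 2 by move=> nz; field.
  rewrite gen ?pnatr_eq0//.
  lra.
have Gz : G (pt z) + L * (4 / 3 * r) < 0.
  have := lip x (pt z); rewrite ler_norml => /andP[h1 _].
  have h2 := ler_wpM2l L0 (ltW close).
  have h3 : L * r * 3 <= e.
    have -> : L * r * 3 = e * (L / (L + 1)) by rewrite /r; field; rewrite gt_eqF// ltr_wpDl.
    by rewrite ler_piMr ?(ltW e0)// ler_pdivrMr ?ltr_wpDl// mul1r lerDl.
  have Lr : 0 <= L * r by rewrite mulr_ge0// ltW.
  lra.
have := hx (pickle z) z (pickleK z) Gz; rewrite /ofreal (chi_in hchi) ?rmorph1 ?mulr1//.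
by rewrite enormZ_pos ?invr_ge0 ?(ltW r0)// ltr_pdivrMl// mulrC.
Qed.

Lemma Lip_shift L G (c : R) : Lip L G -> Lip L (fun x => G x + c).
Proof. by move=> [L0 h]; split => // x y; rewrite opprD addrACA subrr addr0. Qed.

Lemma Lip_opp L G (c : R) : Lip L G -> Lip L (fun x => - G x + c).
Proof.
by move=> [L0 h]; split => // x y; rewrite opprD addrACA subrr addr0 -opprD normrN.
Qed.

Lemma pair_separated (p q : R) L G (t : R) w1 w2 : hpair p q -> Lip L G -> 0 < t ->
  Qd p w1 -> Qd q w2 -> van G w1 -> van (fun x => - G x - t) w2 -> pair w1 w2 = 0.
Proof.
move=> H hL t0 Q1 Q2 v1 v2; have [r1 l1] := fun_of_Qd (hpairC H) Q1.
have [r2 l2] := fun_of_Qd H Q2.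
have t3 : 0 < t / 3 by exact: divr_gt0.
have a1 := van_ae hL t3 v1 r1; have a2 := van_ae (Lip_opp (- t) hL) t3 v2 r2.
rewrite /pair -[RHS](cint0 leb); apply: ae_eq_cint; [exact: (cmeasM l1.1 l2.1)|exact: cmeas_cst|].
move: a1 a2; apply: filterS2 => x h1 h2.
have [lt|ge] := ltP (G x) (- (t / 3)); first by rewrite h1// mul0r.
by rewrite h2 ?mulr0//; lra.
Qed.

Lemma van_translate L G w (a : E) (t : R) : Lip L G ->
  (forall x, G (x + a) <= G x + t) -> van G w ->
  forall c, t < c -> van (fun x => G x + c) (multiplier (fun xi => cis (dotprod a xi)) w).
Proof.
move=> hL sh vw c tc phi Cp; have sp := Cc_smooth_schwartz Cp.
rewrite (multiplierE _ (slow_cis a) sp).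
have -> : T (fun xi => cis (dotprod a xi)) phi = (fun x => phi (x - a)).
  by apply/funext => x; rewrite T_cis.
have [rho rho0 hr] := Cc_enorm_bound Cp.
apply: vw; apply: (Cc_of_bound (c := t - c) (rho := rho + enorm a) hL); [|by rewrite subr_lt0|].
  have := smooth_affine 1 (- a) (schwartz_smooth sp).
  by congr smooth; apply/funext => x; rewrite scale1r.
move=> x nz; have := hr _ nz; have /= := Cc_in Cp nz; have := sh (x - a); rewrite subrK => h1 h2 h3.
split; last by lra.
have -> : x = (x - a) + a by rewrite subrK.
by apply: le_trans (enormD _ _) _; rewrite lerD2r.
Qed.

(** The kernel is the cut-off itself, so mollification enlarges supports by a bounded amount. The
    value [mo 0] is the integral of the nonnegative [chi]; if it were 0, then [chi] would vanish
    almost everywhere, so would its transform, and inversion would contradict [chi 0 = 1]. *)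
Lemma moll_ex : exists mo : E -> C, [/\ schwartz mo, mo 0 != 0 & forall x, kern mo x = ofreal chi x].
Proof.
have sc := schwartz_chi hchi; have sif := schwartz_ifourier sc.
have c0 : (2 * pi) ^- n != 0 :> R by rewrite invr_eq0 expf_neq0// mulf_neq0// gt_eqF// pi_gt0.
have c0' : 0 < (2 * pi) ^+ n :> R by rewrite exprn_gt0// mulr_gt0// pi_gt0.
exists (fun xi => ((2 * pi) ^+ n)%:C%C * ifourier (ofreal chi) xi); split.
- exact: schwartzZ.
- apply/eqP => h.
  have : cint leb (ofreal chi) = 0.
    move: h; rewrite /ifourier mulrA -rmorphM /= mulfV ?gt_eqF// rmorph1 mul1r => <-.
    by apply: eq_cint => x; rewrite dotprodC || idtac; rewrite ?dotprod0l ?dotprod0r cis0 mul1r.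
  move/(congr1 (@complex.Re R)) => /= i0.
  have ic := schwartz_cintgr sc; have mc := schwartz_cmeas sc.
  have ae0 : {ae leb, forall x, chi x = 0}.
    apply: ae_Rintegral0 => //; [exact: mc.1|exact: (chi_ge0 hchi)|exact: ic.1|].
    by have -> : \int[leb]_x chi x = 0 by exact: i0.
  have f0 : fourier (ofreal chi) = fun=> 0.
    apply/funext => xi; rewrite fourierE -[RHS](cint0 leb); apply: ae_eq_cint.
    + by apply: cmeasM => //; exact: cis_cmeas.
    + exact: cmeas_cst.
    + by apply: filterS ae0 => x hx; rewrite /ofreal hx rmorph0 mulr0.
  have := ifourierK 0 sc; rewrite f0 /ifourier.
  have -> : cintegral (fun xi : E => cis (dotprod 0 xi) * 0) = 0.
    by rewrite -[RHS](cint0 leb); apply: eq_cint => x; rewrite mulr0.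
  rewrite mulr0 /ofreal (chi_in hchi); last by rewrite enorm0; lra.
  by move/eqP; rewrite eq_sym oner_eq0.
- move=> x; rewrite /kern fourierZ; last exact: schwartz_cintgr.
  by rewrite (fourierK _ sc) mulrA -rmorphM /= mulVf ?mul1r// gt_eqF.
Qed.

Lemma van_moll L G w (mo : E -> C) (e : R) : Lip L G -> 0 < e -> schwartz mo ->
  (forall x, kern mo x = ofreal chi x) -> van G w ->
  forall c, L * (4 / 3 * e) < c -> van (fun x => G x + c) (multiplier (fun xi => mo (e *: xi)) w).
Proof.
move=> hL e0 sm hk vw c hc phi Cp; have sp := Cc_smooth_schwartz Cp; have [L0 lip] := hL.
have sme := schwartz_dil e0 sm; have slm := slow_schwartz sme.
rewrite (multiplierE _ slm sp).
have [rho rho0 hr] := Cc_enorm_bound Cp.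
apply: vw; apply: (Cc_of_bound (c := L * (4 / 3 * e) - c) (rho := rho + 4 / 3 * e) hL).
- exact/schwartz_smooth/schwartz_T.
- by rewrite subr_lt0.
move=> x nz.
have [z [hz nzp]] : exists z, enorm z <= 4 / 3 * e /\ phi (x - z) != 0.
  apply: contrapT => hn; case/negP: nz; apply/eqP.
  rewrite (T_kernC _ sme sp) -[RHS](cint0 leb); apply: eq_cint => z.
  rewrite (kern_dilate _ e0 sm) hk.
  have [le|gt] := leP (enorm z) (4 / 3 * e).
    have [->|nzz] := eqVneq (phi (x - z)) 0; first by rewrite mulr0.
    by exfalso; apply: hn; exists z.
  rewrite /ofreal (chi_out hchi) ?rmorph0 ?mulr0 ?mul0r//.
  by rewrite enormZ_pos ?invr_ge0 ?(ltW e0)// ler_pdivlMl// mulrC ltW.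
have h1 := hr _ nzp; have /= h2 := Cc_in Cp nzp.
have ex : x = (x - z) + z by rewrite subrK.
split; first by rewrite ex; apply: le_trans (enormD _ _) _; exact: lerD.
have := lip x (x - z); rewrite subKr ler_norml => /andP[_ h3].
have h4 := ler_wpM2l L0 hz.
lra.
Qed.

End supports.

(** * Gains of integrability by mollification and by differences *)

Section multipliers.
Context {R : realType} {m : nat}.
Local Notation n := m.+1.
Local Notation E := 'rV[R]_n.
Local Notation C := R[i].
Local Notation leb := (lebesgue_rV n).
Local Notation dist := (@dist R n).
Variable chi : E -> R.
Hypothesis hchi : LP_cutoff chi.
Local Notation sy := (sym chi).
Implicit Types (phi psi : E -> C) (u v w : dist) (G : E -> R).

Lemma As_mult s u w mm : slow mm -> tempered (multiplier mm w) -> As chi s u w ->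
  As chi s (multiplier mm u) (multiplier mm w).
Proof.
move=> sm tw [_ h]; split => // phi sp; rewrite (multiplierE w sm sp).
have e : (fun j => multiplier mm u (T (sy s j) phi)) = (fun j => u (T (sy s j) (T mm phi))).
  apply/funext => j; have ss := slow_sym hchi s j.
  exact: (etrans (multiplierE u sm (schwartz_T ss sp)) (congr1 u (T_compC sm ss sp))).
exact: (eq_ind_r (fun a => zsum a (w (T mm phi))) (h _ (schwartz_T sm sp)) e).
Qed.

Lemma As0_eq u w : Shb u -> As chi 0 u w -> w = u.
Proof.
move=> Su A; apply: (As_unique A); split; first by case: Su.
by move=> phi sp; exact: (Shb_zsum hchi Su sp).
Qed.

Lemma MbM q (K K' : R) (mm mm' : E -> C) : slow mm' -> 0 <= K -> Mb q K mm -> Mb q K' mm' ->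
  Mb q (K * K') (fun xi => mm xi * mm' xi).
Proof.
move=> sm' K0 b b' phi sp.
refine (eq_ind _ (fun g => Np leb q g <= K * K' * Np leb q phi) _ _ (T_comp mm sm' sp)).
apply: le_trans (b _ (schwartz_T sm' sp)) _; rewrite -mulrA.
by apply: ler_wpM2l => //; exact: b'.
Qed.

Lemma Mb_le q (K K' : R) (mm : E -> C) : K <= K' -> Mb q K mm -> Mb q K' mm.
Proof.
move=> KK b phi sp; apply: le_trans (b _ sp) _.
by apply: ler_wpM2r => //; exact: Np_ge0.
Qed.

Lemma MbZ q (c K : R) (mm : E -> C) : 1 <= q -> 0 <= c -> slow mm -> Mb q K mm ->
  Mb q (c * K) (fun xi => c%:C%C * mm xi).
Proof.
move=> q1 c0 sm b phi sp.
refine (eq_ind_r (fun g => Np leb q g <= c * K * Np leb q phi) _ (TZm c%:C%C sm sp)).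
have q0 : 0 < q by exact: lt_le_trans q1.
have e := NpZ c%:C%C q0 (schwartz_Lp q1 (schwartz_T sm sp)).
refine (eq_ind_r (fun r => r <= c * K * Np leb q phi) _ e).
rewrite modulus_ofreal (ger0_norm c0).
by apply: le_trans (ler_wpM2l c0 (b _ sp)) _; rewrite mulrA.
Qed.

Lemma MbB q (K K' : R) (mm mm' : E -> C) : 1 <= q -> slow mm -> slow mm' ->
  Mb q K mm -> Mb q K' mm' -> Mb q (K + K') (fun xi => mm xi - mm' xi).
Proof.
move=> q1 sm sm' b b' phi sp.
refine (eq_ind_r (fun g => Np leb q g <= (K + K') * Np leb q phi) _ (TBm sm sm' sp)).
apply: le_trans (NpB q1 (schwartz_Lp q1 (schwartz_T sm sp)) (schwartz_Lp q1 (schwartz_T sm' sp))) _.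
by rewrite mulrDl; apply: lerD; [exact: b|exact: b'].
Qed.

Lemma Mb_cis q (a : E) : 1 <= q -> Mb q 1 (fun xi => cis (dotprod a xi)).
Proof.
move=> q1 phi sp; rewrite mul1r.
have e : T (fun xi => cis (dotprod a xi)) phi = (fun x => phi (x - a)).
  by apply/funext => x; exact: T_cis.
refine (eq_ind_r (fun g => Np leb q g <= Np leb q phi) _ e).
by rewrite (Np_shift a q1 sp).
Qed.

(** The common pattern of the two gains below: the pieces of [mm] applied to [u], written through
    the function [w], have multiplier bounds that decay geometrically at both ends. The exponent
    [i.+1] on both sides lets [geo_neg] treat both tails. *)
Lemma Qd_series q u w (mm : E -> C) (a : int -> E -> C) (A B al be : R) :
  lin0 u -> slow mm -> Qd q w -> 0 <= A -> 0 <= B -> 0 < al -> 0 < be ->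
  (forall j, slow (a j)) ->
  (forall i : nat, Mb q (A * (2 `^ (- al)) ^+ i.+1) (a (- (i.+1)%:Z))) ->
  (forall i : nat, Mb q (B * (2 `^ (- be)) ^+ i.+1) (a i%:Z)) ->
  (forall phi, schwartz phi -> zsum (fun j => w (T (a j) phi)) (u (T mm phi))) ->
  Qd q (multiplier mm u).
Proof.
move=> lu sm [lw [K K0 bw]] A0 B0 al0 be0 sa ba bb hz; split; first exact: lin0_multiplier.
have d1 : 0 <= 1 - 2 `^ (- al).
  have /andP[_ /ltW h] : 0 <= (2 : R) `^ (- al) < 1 by apply: pow2_lt1; rewrite oppr_lt0.
  by rewrite subr_ge0.
have d2 : 0 <= 1 - 2 `^ (- be).
  have /andP[_ /ltW h] : 0 <= (2 : R) `^ (- be) < 1 by apply: pow2_lt1; rewrite oppr_lt0.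
  by rewrite subr_ge0.
exists (K * (A / (1 - 2 `^ (- al)) + B / (1 - 2 `^ (- be)))).
  by rewrite mulr_ge0// addr_ge0// divr_ge0.
move=> phi sp; rewrite (multiplierE u sm sp).
have N0 : 0 <= Np leb q phi by exact: Np_ge0.
have bnd (c r : R) j : Mb q (c * r) (a j) -> modulus (w (T (a j) phi)) <= K * Np leb q phi * c * r.
  move=> mb; apply: le_trans (bw _ (schwartz_T (sa j) sp)) _.
  apply: le_trans (ler_wpM2l K0 (mb _ sp)) _; apply: le_of_eq.
  by move: (Np leb q phi) => N; ring.
have KA : 0 <= K * Np leb q phi * A by rewrite !mulr_ge0.
have KB : 0 <= K * Np leb q phi * B by rewrite !mulr_ge0.
have h1 (i : nat) := bnd _ _ _ (ba i); have h2 (i : nat) := bnd _ _ _ (bb i).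
have [z zz bz] := @zsum_exists R (fun j => w (T (a j) phi)) _ _ _ _ h1 h2
  (fun N => geo_neg N KA al0) (fun N => geo_neg N KB be0).
rewrite (zsum_unique (hz _ sp) zz); apply: le_trans bz _.
apply: le_of_eq.
move: (Np leb q phi) ((1 - 2 `^ (- al))^-1) ((1 - 2 `^ (- be))^-1) => N x y; ring.
Qed.

Lemma slow_lap k : slow (fun xi : E => ofreal (fun x : E => dotprod x x) xi ^+ k).
Proof.
apply: slowX; have -> : ofreal (fun xi : E => dotprod xi xi) = (fun xi => \sum_(i < n) (xi ord0 i)%:C%C * (xi ord0 i)%:C%C).
  by apply/funext => xi; rewrite /ofreal /dotprod rmorph_sum; apply: eq_bigr => i _; rewrite rmorphM.
by apply: slow_sum => i; apply: slowM; exact: slow_coord.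
Qed.

Lemma C1_ge0 s : 0 <= C1 chi s. Proof. exact: kern1_ge0. Qed.

(** The pieces of [u] are lifts of order [s] of those of [w]. At low frequencies the factor
    [(2 ^ j)] to the power [s] is summable; at high frequencies [mo] absorbs [2 * k > s] powers of
    the frequency into the Schwartz symbol [Dm]. For [s = 0] there is no decay at low frequencies,
    but then [u] is [w]. *)
Lemma Qd_moll p q s u w (mo : E -> C) : hpair p q -> 0 <= s -> Shb u -> As chi (- s) u w ->
  Qd p w -> schwartz mo -> Qd p (multiplier mo u).
Proof.
move=> H s0 Su A Q smo; have slm := slow_schwartz smo.
have [e0|ne0] := eqVneq s 0.
  have := As0_eq Su; rewrite -oppr0 -e0 => /(_ _ A) <-.
  exact: (Qd_multiplier slm (kern1_ge0 _) (young H smo) Q).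
have sp0 : 0 < s by rewrite lt_def ne0.
have lu := tempered_lin0 Su.1.
have hk : s < (2 * Num.bound s)%:R.
  apply: lt_le_trans (archi_boundP s0) _; rewrite ler_nat; lia.
set k := Num.bound s in hk.
pose Dm xi := ofreal (fun x : E => dotprod x x) xi ^+ k * mo xi.
have sD : schwartz Dm := schwartz_slowM (slow_lap k) smo.
have be0 : 0 < (2 * k)%:R - s by rewrite subr_gt0.
have r0 : 0 < (2 : R) `^ (- ((2 * k)%:R - s)) by exact: powR_gt0.
(* The division in the second constant turns the natural exponent [i] into the [i.+1] of
   [Qd_series]. *)
apply: (@Qd_series p u w mo (fun j xi => sy s j xi * mo xi) (C1 chi s * kern1 mo)
  (C1 chi (s - (2 * k)%:R) * kern1 Dm / 2 `^ (- ((2 * k)%:R - s))) s ((2 * k)%:R - s)) => //.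
- exact: (mulr_ge0 (C1_ge0 _) (kern1_ge0 _)).
- exact: (divr_ge0 (mulr_ge0 (C1_ge0 _) (kern1_ge0 _)) (ltW r0)).
- by move=> j; exact: (slowM (slow_sym hchi s j) slm).
- move=> i; have b := MbM slm (mulr_ge0 (C1_ge0 s) (powR_ge0 _ _)) (Mb_sym hchi s (- (i.+1)%:Z) H) (young H smo).
  apply: (Mb_le _ b); rewrite pow2_neg le_eqVlt; apply/orP; left; apply/eqP.
  by rewrite -!mulrA; congr (_ * _); rewrite mulrC.
- move=> i; have sl := slow_schwartz sD.
  have -> : (fun xi => sy s i xi * mo xi) = (fun xi => sy (s - (2 * k)%:R) i xi * Dm xi).
    by apply/funext => xi; rewrite /Dm (sym_lap hchi s k) mulrA.
  have b := MbM sl (mulr_ge0 (C1_ge0 _) (powR_ge0 _ _)) (Mb_sym hchi (s - (2 * k)%:R) i H) (young H sD).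
  apply: (Mb_le _ b); rewrite pow2_pos le_eqVlt; apply/orP; left; apply/eqP.
  rewrite opprB exprS in r0 *; move: r0; set r := 2 `^ (s - _) => r0.
  have rn : r != 0 by rewrite gt_eqF.
  by move: (C1 chi _) (kern1 Dm) (r ^+ i) => a b' c; field.
- move=> phi sp; have sT := schwartz_T slm sp.
  refine (eq_ind_r (fun a => zsum a (u (T mo phi))) (Shb_zsum hchi Su sT) _).
  apply/funext => j; rewrite -(T_comp _ slm sp) (As_comm hchi s j lu A sT).
  by rewrite addNr.
Qed.

Variable d : E.

(** The symbol of an iterated difference in direction [d] with steps [l], based at the translation
    by [tau]. The base separates supports; one difference per list entry lets the steps be removed
    one at a time. *)
Fixpoint dl (l : seq R) (tau : R) (xi : E) : C :=
  if l is r :: l' then dl l' (tau + r) xi - dl l' tau xi else cis (dotprod (tau *: d) xi).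

Lemma slow_dl l tau : slow (dl l tau).
Proof.
elim: l tau => [|r l IH] tau; first exact: slow_cis.
exact: (slowB (IH (tau + r)) (IH tau)).
Qed.

Lemma dlD l tau r xi : dl l (tau + r) xi = cis (dotprod (r *: d) xi) * dl l tau xi.
Proof.
elim: l tau => [|r' l IH] tau /=; first by rewrite scalerDl dotprodDl addrC cisD.
by rewrite addrAC !IH mulrBr.
Qed.

Lemma Mb_dl q l tau : 1 <= q -> Mb q (2 ^+ size l) (dl l tau).
Proof.
move=> q1; elim: l tau => [|r l IH] tau; first exact: Mb_cis.
have := MbB q1 (slow_dl l (tau + r)) (slow_dl l tau) (IH _) (IH _).
by apply: Mb_le => /=; rewrite exprS mulr_natl mulr2n.
Qed.

(** The symbol is a product of factors [cis - 1], one per step, and each vanishes at the origin. At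
    scale [e] each gives a factor [e * jb x], for derivatives up to order [k] as well. *)
Lemma dl_bound l tau k : exists2 M, 0 <= M & forall e, 0 <= e <= 1 ->
  Bw k (fun x => M * (e * jb x) ^+ size l) (fun x => dl l tau (e *: x)).
Proof.
elim: l tau => [|r l IH] tau.
  pose M0 := 1 + `|tau| * enorm d.
  have M1 : 1 <= M0 by rewrite lerDl mulr_ge0// enorm_ge0.
  exists (M0 ^+ k); first by rewrite exprn_ge0// (le_trans ler01).
  move=> e /andP[e0 e1].
  have -> : (fun x => dl [::] tau (e *: x)) = (fun x => cis (dotprod ((e * tau) *: d) x)).
    by apply/funext => x; rewrite /= dotprodZr !dotprodZl mulrA.
  have hi i : `|((e * tau) *: d) ord0 i| <= M0.
    rewrite mxE !normrM (ger0_norm e0).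
    have h : `|tau| * `|d ord0 i| <= `|tau| * enorm d by apply: ler_wpM2l => //; exact: coord_le_enorm.
    have : e * (`|tau| * `|d ord0 i|) <= `|tau| * `|d ord0 i| by rewrite ler_piMl// mulr_ge0.
    rewrite /M0 -mulrA; lra.
  move=> a x ha; rewrite [size _]/= expr0 mulr1.
  have bc : Bw k (fun=> M0 ^+ k) (fun y => cis (dotprod ((e * tau) *: d) y)) := Bw_cis hi M1.
  exact (bc a x ha).
have [M2 M20 h2] := IH tau.
pose M1 := 1 + enorm (r *: d); have M11 : 1 <= M1 by rewrite lerDl enorm_ge0.
have hM i : `|(r *: d) ord0 i| <= M1 by apply: le_trans (coord_le_enorm _ i) _; rewrite lerDr.
have M10 : 0 <= M1 ^+ k.+1 by rewrite exprn_ge0// (le_trans ler01).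
pose c1 := 2 * M1 ^+ k.+1 * n%:R + M1 ^+ k.+1.
have c10 : 0 <= c1 by rewrite addr_ge0// !mulr_ge0.
exists (2 ^+ k * (c1 * M2)); first by rewrite !mulr_ge0.
move=> e he.
have sg := slow_cis (r *: d); have sge : slow (fun x : E => cis (dotprod (r *: d) (e *: x)) - cis (dotprod (r *: d) 0)).
  by apply: slowB; [exact: (slow_dil e sg)|exact: slow_cst].
have hc : Bw k.+1 (fun=> M1 ^+ k.+1) (fun y => cis (dotprod (r *: d) y)) := Bw_cis hM M11.
have b1 : Bw k (fun x => e * ((2 * M1 ^+ k.+1 * n%:R + M1 ^+ k.+1) * jb x)) _ :=
  Bw_dilate_sub (slow_smooth sg) hc he.
have b := BwM (slow_smooth sge) (slow_smooth (slow_dil e (slow_dl l tau))) b1 (h2 e he).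
have -> : (fun x => dl (r :: l) tau (e *: x)) =
    (fun x => (cis (dotprod (r *: d) (e *: x)) - cis (dotprod (r *: d) 0)) * dl l tau (e *: x)).
  by apply/funext => x; rewrite /= dlD dotprod0r cis0 mulrBl mul1r.
apply: Bw_mono (leqnn k) _ b => x.
apply: le_of_eq.
have -> : (e * jb x) ^+ size (r :: l) = e * jb x * (e * jb x) ^+ size l by exact: exprS.
rewrite /c1.
by move: (jb x) ((e * jb x) ^+ size l) (n%:R : R) (M1 ^+ k.+1) (2 ^+ k) => x1 x2 x3 x4 x5; ring.
Qed.

(** The pieces of [v] are lifts of order [- s] of those of [w]. High frequencies are summable as
    they stand; at low frequencies the growth is beaten by [dl_bound], since [size l > s]. There the
    symbol is not a dilate of a fixed one, and [kern1_Sle] is applied to its rescaling [mj]. *)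
Lemma Qd_diff p q s v w l tau : hpair p q -> 0 <= s -> s < (size l)%:R -> Shb v ->
  As chi s v w -> Qd q w -> Qd q (multiplier (dl l tau) v).
Proof.
move=> H s0 hk Sv A Q; have [_ q1 _] := H; have q1' := ltW q1.
have sd := slow_dl l tau; have mb := @Mb_dl q l tau q1'.
have d0 : 0 <= (2 : R) ^+ size l by exact: exprn_ge0.
have [e0|ne0] := eqVneq s 0.
  have := As0_eq Sv; rewrite -e0 => /(_ _ A) <-.
  exact: (Qd_multiplier sd d0 mb Q).
have sp0 : 0 < s by rewrite lt_def ne0.
have lv := tempered_lin0 Sv.1.
have [C0 [k0 [L0 [C00 hC]]]] := @kern1_Sle R n.
have [M M0 hM] := dl_bound l tau k0.
have s0c := schwartz_sym0 hchi (- s).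
have [M' hM'] := schwartz_Sle k0 (L0 + size l) s0c.
have M'0 := Sle_ge0 hM'.
have r0 : 0 < (2 : R) `^ (- s) by exact: powR_gt0.
have al0 : 0 < (size l)%:R - s by rewrite subr_gt0.
apply: (@Qd_series q v w (dl l tau) (fun j xi => sy (- s) j xi * dl l tau xi)
  (C0 * (2 ^+ k0 * (M * M'))) (C1 chi (- s) * 2 ^+ size l / 2 `^ (- s)) ((size l)%:R - s) s) => //.
- by rewrite !mulr_ge0// exprn_ge0.
- by rewrite divr_ge0 ?(ltW r0)// mulr_ge0// C1_ge0.
- by move=> j; exact: (slowM (slow_sym hchi (- s) j) sd).
- move=> i; set j : int := - (i.+1)%:Z; set e : R := 2 ^ j.
  have e0 : 0 < e by exact: pow2_gt0.
  have e1 : e <= 1 by rewrite /e /j pow2N invf_le1 ?exprz_gt0// -exprnP exprn_ege1// ler1n.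
  have he : 0 <= e <= 1 by rewrite (ltW e0).
  pose mj eta := dl l tau (e *: eta) * ofreal (sym0 chi (- s)) eta.
  have smj : schwartz mj := schwartz_slowM (slow_dil e sd) s0c.
  have bM : Bw k0 (fun x => M * e ^+ size l * jb x ^+ size l) (fun x => dl l tau (e *: x)).
    by apply: Bw_mono (leqnn k0) _ (hM e he) => x; rewrite exprMn mulrA.
  have k1 := hC _ _ smj (SleM (slow_smooth (slow_dil e sd)) (schwartz_smooth s0c) bM hM').
  have ei0 : 0 < e^-1 by rewrite invr_gt0.
  have sme : schwartz (fun xi => mj (e^-1 *: xi)) := schwartz_dil ei0 smj.
  have -> : (fun xi => sy (- s) j xi * dl l tau xi) = (fun xi => (e `^ (- s))%:C%C * mj (e^-1 *: xi)).
    apply/funext => xi; rewrite symE /mj scalerA mulfV ?gt_eqF// scale1r -/e -mulrA.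
    by congr (_ * _); exact: mulrC.
  have b := MbZ q1' (powR_ge0 e (- s)) (slow_schwartz sme) (young (hpairC H) sme).
  apply: (Mb_le _ b); rewrite (kern1_dilate ei0 smj).
  apply: le_trans (ler_wpM2l (powR_ge0 _ _) k1) _.
  have -> : (2 `^ (- ((size l)%:R - s))) ^+ i.+1 = e `^ (- s) * e ^+ size l :> R.
    rewrite -pow2_neg -/j -/e -powR_mulrn ?(ltW e0)// -powRD; last by rewrite (gt_eqF e0) implybT.
    by congr (_ `^ _); rewrite addrC.
  by apply: le_of_eq; ring.
- move=> i; have b := MbM sd (mulr_ge0 (C1_ge0 _) (powR_ge0 _ _)) (Mb_sym hchi (- s) i (hpairC H)) mb.
  apply: (Mb_le _ b); rewrite pow2_pos le_eqVlt; apply/orP; left; apply/eqP.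
  rewrite exprS; move: r0; set r := 2 `^ (- s) => r0.
  have rn : r != 0 by rewrite gt_eqF.
  by move: (C1 chi _) (2 ^+ size l) (r ^+ i) => a b' c; field.
- move=> phi sp; have sT := schwartz_T sd sp.
  refine (eq_ind_r (fun a => zsum a (v (T (dl l tau) phi))) (Shb_zsum hchi Sv sT) _).
  apply/funext => j; rewrite -(T_comp _ sd sp) (As_comm hchi (- s) j lv A sT).
  by rewrite subrr.
Qed.

(** Nonnegative steps only push the support further away from the domain, so the base [tau] alone
    determines the distance. *)
Lemma van_dl L G v : Lip L G -> lin0 v -> (forall x t, G (x + t *: d) = G x + t) ->
  van (fun x => - G x) v -> forall l tau (c : R), all (fun r => 0 <= r) l -> - tau < c ->
  van (fun x => - G x + c) (multiplier (dl l tau) v).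
Proof.
move=> hL lv hd hv; elim => [|r l IH] tau c.
  move=> _ hc; apply: (van_translate (G := fun x => - G x) (t := - tau) (L := L)) => //.
    by have := Lip_opp 0 hL; congr (Lip L _); apply/funext => x; rewrite addr0.
  by move=> x; rewrite hd opprD.
move=> /= /andP[r0 al] hc phi Cp; have sp := Cc_smooth_schwartz Cp.
have z1 := IH (tau + r) c al _ phi Cp; have z2 := IH tau c al hc phi Cp.
rewrite (multiplierE v (slow_dl l (tau + r)) sp) in z1.
rewrite (multiplierE v (slow_dl l tau) sp) in z2.
rewrite (multiplierE v (slow_dl (r :: l) tau) sp).
etransitivity; first exact: (uTB lv (slow_dl l (tau + r)) (slow_dl l tau) sp).
by rewrite z1 ?z2 ?subrr//; lra.
Qed.

(** The bracket is computed twice by [bracketE]: with orders [- s] and [s] it is the pairing of the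
    modified lifts, and with order 0 it is the pairing of two functions with separated supports. *)
Lemma pair_moll_diff p q s L G u v w1 w2 (mo : E -> C) e l tau : hpair p q -> 0 <= s ->
  Lip L G -> (forall x t, G (x + t *: d) = G x + t) ->
  Shb u -> As chi (- s) u w1 -> Qd p w1 -> Shb v -> As chi s v w2 -> Qd q w2 ->
  van G u -> van (fun x => - G x) v -> schwartz mo -> (forall x, kern mo x = ofreal chi x) ->
  0 < e -> L * (4 / 3 * e) < tau -> s < (size l)%:R -> all (fun r => 0 <= r) l ->
  pair (multiplier (fun xi => mo (e *: xi)) w1) (multiplier (dl l tau) w2) = 0.
Proof.
move=> H s0 hL hd Su A1 Q1 Sv A2 Q2 vu vv sm hk e0 het hl al.
have [_ q1 _] := H.
have sme := schwartz_dil e0 sm; have slm := slow_schwartz sme; have sd := slow_dl l tau.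
have QU := Qd_moll H s0 Su A1 Q1 sme; have QV := Qd_diff tau H s0 hl Sv A2 Q2.
have lu := tempered_lin0 Su.1; have lv := tempered_lin0 Sv.1.
have QU1 := Qd_multiplier slm (kern1_ge0 _) (young H sme) Q1.
have QV2 := Qd_multiplier sd (exprn_ge0 (size l) (ler0n R 2)) (@Mb_dl q l tau (ltW q1)) Q2.
have B1 := As_mult slm (Qd_tempered H QU1) A1.
have B2 := As_mult sd (Qd_tempered (hpairC H) QV2) A2.
have lU := lin0_multiplier slm lu; have lV := lin0_multiplier sd lv.
rewrite -(bracketE hchi H lU lV B1 QU1 B2 QV2).
have z1 : As chi (- 0) (multiplier (fun xi => mo (e *: xi)) u) (multiplier (fun xi => mo (e *: xi)) u).
  rewrite oppr0; split; first exact: (Qd_tempered H QU).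
  by move=> phi sp; exact: (Qd_zsum hchi H QU sp).
have z2 : As chi 0 (multiplier (dl l tau) v) (multiplier (dl l tau) v).
  split; first exact: (Qd_tempered (hpairC H) QV).
  by move=> phi sp; exact: (Qd_zsum hchi (hpairC H) QV sp).
rewrite (bracketE hchi H lU lV z1 QU z2 QV).
set de := L * _ in het.
(* The level halfway between the mollification radius [de] and the translation [tau] leaves a strict
   margin on both sides. *)
have t0 : 0 < (tau - (de + tau) / 2) / 2 by lra.
have hc : de < (de + tau) / 2 by lra.
apply: (pair_separated hchi H (Lip_shift ((de + tau) / 2) hL) t0 QU QV).
  exact: (van_moll hchi hL e0 sm hk vu hc).
have -> : (fun x => - (G x + (de + tau) / 2) - (tau - (de + tau) / 2) / 2) =
    (fun x => - G x + (- ((de + tau) / 2) - (tau - (de + tau) / 2) / 2)).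
  by apply/funext => x; rewrite opprD addrA.
by apply: (van_dl hL lv hd vv al); lra.
Qed.

End multipliers.

(** * Removal of differences, translations and mollifications *)

Section limits.
Context {R : realType} {m : nat}.
Local Notation n := m.+1.
Local Notation E := 'rV[R]_n.
Local Notation C := R[i].
Local Notation leb := (lebesgue_rV n).
Local Notation dist := (@dist R n).
Implicit Types (phi psi : E -> C) (u v w : dist) (G : E -> R).

Lemma pair_mult_toD p q w1 (mm : E -> C) phi : hpair p q -> slow mm -> Qd p w1 -> schwartz phi ->
  pair w1 (multiplier mm (toD phi)) = w1 (T (fun xi => mm (- xi)) phi).
Proof.
move=> H sm Q1 sp; have so := slow_opp sm.
have e : multiplier mm (toD phi) = toD (T (fun xi => mm (- xi)) phi).
  rewrite -(multiplier_toD so sp); congr multiplier.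
  by apply/funext => xi; rewrite opprK.
by rewrite e; exact: (pair_toD H Q1 (schwartz_T so sp)).
Qed.

Lemma T_cst (c : C) phi : schwartz phi -> T (fun=> c) phi = (fun x => c * phi x).
Proof.
move=> sp; have := TZm c (slow_cst 1) sp; rewrite (T1 sp) => <-.
by congr T; apply/funext => xi; rewrite mulr1.
Qed.

(** By density [w1] may be taken Schwartz too. As [jb (r *: d) <= jb (x + r *: d) * jb x], one order
    of decay of each function turns into the factor [1 / jb (r *: d)] for the overlap. *)
Lemma pair_trans_limD p q (d : E) w1 phi : hpair p q -> d != 0 -> Qd p w1 -> schwartz phi ->
  forall eps, 0 < eps -> \forall r \near (+oo : set_system R),
    modulus (w1 (fun x => phi (x + r *: d))) <= eps.
Proof.
move=> H d0 Q1 sp; have [p1 q1 _] := H.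
have ss r : schwartz (fun x => phi (x + r *: d)).
  have := schwartz_affine (r *: d) (oner_neq0 R) sp.
  by congr schwartz; apply/funext => x; rewrite scale1r.
apply: (@lim_by_density R n q p (hpairC H) R (+oo : set_system R) _
  (fun r w => w (fun x => phi (x + r *: d))) (Np leb p phi) (Np_ge0 _ _ _) _ _ _ w1 Q1) => //.
- move=> r w K lw K0 bw; apply: le_trans (bw _ (ss r)) _.
  have -> : (fun x => phi (x + r *: d)) = (fun x => phi (x - (- (r *: d)))).
    by apply/funext => x; rewrite opprK.
  by rewrite (Np_shift (- (r *: d)) (ltW p1) sp) mulrC.
move=> psi sps eps e0.
have ed0 : 0 < enorm d.
  by rewrite lt_def enorm_ge0 andbT; apply: contra_neq d0; exact: enorm_eq0.
have [M hM] := schwartz_Sle 0 1 sp; have [M' hM'] := schwartz_Sle 0 (2 * n + 1) sps.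
have M0 := Sle_ge0 hM; have M'0 := Sle_ge0 hM'.
have J0 := jbint_ge0 (R := R) (n := n).
near=> r.
have r0 : 0 < r by near: r; exact: nbhs_pinfty_gt (num_real _).
have jr : r * enorm d <= jb (r *: d).
  by rewrite /jb enormZ (gtr0_norm r0) lerDr.
have jr0 : 0 < jb (r *: d) by exact: jb_gt0.
rewrite (toDE _ (ss r)).
have cm : cmeas (fun x => psi x * phi (x + r *: d)).
  by apply: cmeasM; apply: schwartz_cmeas.
have b : Sle 0 (2 * n) (M' * M / jb (r *: d)) (fun x => psi x * phi (x + r *: d)).
  apply/Bw0 => x; rewrite modulusM.
  have b1 := (Bw0 _ _).1 hM' x; have b2 := (Bw0 _ _).1 hM (x + r *: d).
  have jx : jb (r *: d) <= jb (x + r *: d) * jb x.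
    have -> : jb x = jb (- x) by rewrite /jb enormN.
    by have := jbD (x + r *: d) (- x); rewrite addrAC subrr add0r.
  have k : jb (x + r *: d) ^- 1 <= jb x / jb (r *: d).
    by rewrite expr1 ler_pdivlMr// ler_pdivrMl ?jb_gt0.
  apply: le_trans (ler_pM (modulus_ge0 _) (modulus_ge0 _) b1 (le_trans b2 (ler_wpM2l M0 k))) _.
  have jn := lt0r_neq0 (jb_gt0 x).
  have gen (a b z : R) : z != 0 -> M' * (a * z^-1) * (M * (z * b)) = M' * M * b * a.
    by move=> zn; field.
  have -> : jb x ^- (2 * n + 1) = jb x ^- (2 * n) * (jb x)^-1 by rewrite addn1 exprSr invfM.
  by rewrite (gen _ _ _ jn).
have ci := schwartz_cintgr (schwartzM sps (ss r)).
apply: le_trans (modulus_cint_le ci) _; apply: le_trans (Sle_int_le cm b) _.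
have h : M' * M * @jbint R n / (eps * enorm d) <= r.
  by near: r; exact: nbhs_pinfty_ge (num_real _).
rewrite mulrAC ler_pdivrMr//; rewrite ler_pdivrMr ?mulr_gt0// in h.
apply: le_trans h _; rewrite mulrCA; exact: (ler_wpM2l (ltW e0) jr).
Unshelve. all: by end_near. Qed.

Lemma Qd_cis q (a : E) w : 1 <= q -> Qd q w -> Qd q (multiplier (fun xi => cis (dotprod a xi)) w).
Proof. by move=> q1 Q; exact: (Qd_multiplier (slow_cis a) ler01 (Mb_cis a q1) Q). Qed.

Lemma pair_trans_lim p q (d : E) w1 w2 : hpair p q -> d != 0 -> Qd p w1 -> Qd q w2 ->
  forall eps, 0 < eps -> \forall r \near (+oo : set_system R),
    modulus (pair w1 (multiplier (fun xi => cis (dotprod (r *: d) xi)) w2)) <= eps.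
Proof.
move=> H d0 Q1 Q2; have [_ q1 _] := H; have [l1 [K1 K10 b1]] := Q1.
apply: (@lim_by_density R n p q H R (+oo : set_system R) _
  (fun r w => pair w1 (multiplier (fun xi => cis (dotprod (r *: d) xi)) w)) K1 K10 _ _ _ w2 Q2).
- move=> r c u v Qu Qv.
  exact: (etrans (congr1 (pair w1) (multiplier_lin c u v (slow_cis (r *: d))))
    (pair_linr H c Q1 (Qd_cis _ (ltW q1) Qu) (Qd_cis _ (ltW q1) Qv))).
- move=> r u K lu K0 bu; have s := slow_cis (r *: d).
  have b := Lb_multiplier s K0 bu (Mb_cis (r *: d) (ltW q1)).
  apply: le_trans (pair_le H K10 (mulr_ge0 K0 ler01) l1 (lin0_multiplier s lu) b1 b) _.
  by rewrite mulr1.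
- move=> phi sp eps e0; apply: filterS (pair_trans_limD H d0 Q1 sp e0) => r.
  rewrite (pair_mult_toD H (slow_cis (r *: d)) Q1 sp).
  suff -> : T (fun xi => cis (dotprod (r *: d) (- xi))) phi = (fun x => phi (x + r *: d)) by [].
  have -> : (fun xi => cis (dotprod (r *: d) (- xi))) = (fun xi => cis (dotprod (- (r *: d)) xi)).
    by apply/funext => xi; rewrite dotprodNl dotprodNr.
  by apply/funext => x; rewrite (T_cis _ _ sp) opprK.
Qed.

(** The difference with the additional step [r] pairs to 0, so translating [dl l] by [r *: d] does
    not change the pairing, for any [r >= 0]. Translates tend weakly to 0, hence the pairing itself
    is 0, and one step is gone. *)
Lemma remove_dl p q (d : E) w1 w2 tau k : hpair p q -> d != 0 -> Qd p w1 -> Qd q w2 ->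
  (forall l, size l = k -> all (fun r => 0 <= r) l -> pair w1 (multiplier (dl d l tau) w2) = 0) ->
  pair w1 (multiplier (fun xi => cis (dotprod (tau *: d) xi)) w2) = 0.
Proof.
move=> H d0 Q1 Q2; have [_ q1 _] := H; have q1' := ltW q1.
elim: k => [|k IH] h; first exact: (h [::]).
apply: IH => l hl al.
have Qm l' : Qd q (multiplier (dl d l' tau) w2).
  exact: (Qd_multiplier (slow_dl d l' tau) (exprn_ge0 (size l') (ler0n R 2)) (@Mb_dl _ _ d q l' tau q1') Q2).
have e r : 0 <= r -> pair w1 (multiplier (fun xi => cis (dotprod (r *: d) xi)) (multiplier (dl d l tau) w2)) =
    pair w1 (multiplier (dl d l tau) w2).
  move=> r0; have sr := slow_cis (r *: d); have sl := slow_dl d l tau.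
  have E1 : multiplier (fun xi => cis (dotprod (r *: d) xi)) (multiplier (dl d l tau) w2) =
      (fun f => 1 * multiplier (dl d (r :: l) tau) w2 f + multiplier (dl d l tau) w2 f).
    apply: dist_eq.
    - exact: (lin0_multiplier sr (Qm l).1).
    - exact: (lin0P 1 (Qm (r :: l)).1 (Qm l).1).
    move=> phi sp; rewrite (multiplier_comp w2 sr sl) mul1r.
    rewrite (multiplierE w2 (slowM sl sr) sp) (multiplierE w2 (slow_dl d (r :: l) tau) sp) (multiplierE w2 sl sp).
    have e1 : w2 (T (dl d (r :: l) tau) phi) = w2 (T (dl d l (tau + r)) phi) - w2 (T (dl d l tau) phi).
      exact: (uTB Q2.1 (slow_dl d l (tau + r)) sl sp).
    rewrite e1 subrK; congr (w2 (T _ phi)); apply/funext => xi.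
    by rewrite dlD mulrC.
  rewrite E1; apply: etrans (pair_linr H 1 Q1 (Qm (r :: l)) (Qm l)) _.
  by rewrite h ?mulr0 ?add0r//= ?hl// r0.
apply: modulus_eq0; apply/eqP; rewrite eq_le modulus_ge0 andbT; apply/ler_addgt0Pr => eps e0.
rewrite add0r.
have [r [r0 hr]] := filter_ex (filterI (nbhs_pinfty_ge (num_real (0 : R)))
  (pair_trans_lim H d0 Q1 (Qm l) e0)).
by rewrite -(e _ r0).
Qed.

(** The pairing with the dilated symbol tends to [g 0] times the pairing, so its vanishing for small
    [e] is inherited when [g 0 != 0]. It is applied both to the translation ([cis]) and to the
    mollifier ([mo]); the uniform bound [KM] lets density do the limit. *)
Lemma approx_zero p q w1 w2 (g : E -> C) (KM e0 : R) : hpair p q -> slow g ->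
  (forall l, exists M, Bw l (fun=> M) g) -> 0 <= KM ->
  (forall e, 0 < e -> Mb q KM (fun xi => g (e *: xi))) -> Qd p w1 -> Qd q w2 -> 0 < e0 ->
  (forall e, 0 < e -> e < e0 -> pair w1 (multiplier (fun xi => g (e *: xi)) w2) = 0) ->
  g 0 != 0 -> pair w1 w2 = 0.
Proof.
move=> H sg bg KM0 mb Q1 Q2 e00 hz g0; have [p1 q1 _] := H; have [l1 [K1 K10 b1]] := Q1.
pose ei (i : nat) : R := i.+1%:R^-1.
have ei0 i : 0 < ei i by rewrite invr_gt0.
have ei1 i : ei i <= 1 by rewrite invf_le1// ler1n.
have sgi i : slow (fun xi => g (ei i *: xi)) by exact: (slow_dil (ei i) sg).
have Qgi i u : Qd q u -> Qd q (multiplier (fun xi => g (ei i *: xi)) u).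
  by move=> Qu; exact: (Qd_multiplier (sgi i) KM0 (mb _ (ei0 i)) Qu).
pose F i w := pair w1 (multiplier (fun xi => g (ei i *: xi)) w) - g 0 * pair w1 w.
have KF0 : 0 <= K1 * KM + modulus (g 0) * K1 by rewrite addr_ge0// mulr_ge0// modulus_ge0.
have lim : forall eps, 0 < eps -> \forall i \near \oo, modulus (F i w2) <= eps.
  apply: (@lim_by_density R n p q H nat \oo _ F _ KF0 _ _ _ w2 Q2).
  - move=> i c u v Qu Qv; rewrite /F.
    have e1 := etrans (congr1 (pair w1) (multiplier_lin c u v (sgi i)))
      (pair_linr H c Q1 (Qgi i _ Qu) (Qgi i _ Qv)).
    rewrite e1 (pair_linr H c Q1 Qu Qv).
    by move: (pair _ _) (pair _ _) (pair _ _) (pair _ _) => a b a' b'; ring.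
  - move=> i u K lu K0 bu; rewrite /F.
    have b := Lb_multiplier (sgi i) K0 bu (mb _ (ei0 i)).
    have k1 := pair_le H K10 (mulr_ge0 K0 KM0) l1 (lin0_multiplier (sgi i) lu) b1 b.
    have k2 := pair_le H K10 K0 l1 lu b1 bu.
    apply: le_trans (modulusB _ _) _; rewrite modulusM.
    have k3 := ler_wpM2l (modulus_ge0 (g 0)) k2.
    apply: le_trans (lerD k1 k3) _; apply: le_of_eq.
    by move: (modulus (g 0)) => a; ring.
  - move=> phi sp eps ep.
    have bgo l : exists M, Bw l (fun=> M) (fun xi => g (- xi)).
      have [M hM] := bg l; have := Bw_affine (-1) 0 (slow_smooth sg) hM.
      have -> : (fun xi : E => g (- xi)) = (fun xi : E => g ((-1) *: xi + 0)).
        by apply/funext => xi; rewrite scaleN1r addr0.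
      by move=> hb; eexists; exact: hb.
    have [K K0 hK] := approx_id 0 (2 * n) (slow_opp sg) bgo sp.
    have J0 : 0 <= (@jbint R n) `^ p^-1 by exact: powR_ge0.
    pose c := K1 * (K * (@jbint R n) `^ p^-1); have c0 : 0 <= c by rewrite !mulr_ge0.
    have de0 : 0 < eps / (c + 1) by rewrite divr_gt0// ltr_wpDl.
    near=> i.
    have hi : ei i < eps / (c + 1).
      by near: i; exact: (near_infty_natSinv_lt (PosNum de0)).
    have hF : F i (toD phi) = w1 (T (fun xi => g (- (ei i *: xi)) - g (- 0)) phi).
      rewrite /F (pair_mult_toD H (sgi i) Q1 sp) (pair_toD H Q1 sp).
      have so := slow_opp (sgi i).
      have -> : (fun xi => g (- (ei i *: xi)) - g (- 0)) = (fun xi => g (ei i *: - xi) - g 0).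
        by apply/funext => xi; rewrite scalerN oppr0.
      have e1 : w1 (T (fun xi => g (ei i *: - xi) - g 0) phi) =
          w1 (T (fun xi => g (ei i *: - xi)) phi) - w1 (T (fun=> g 0) phi).
        exact: (uTB l1 so (slow_cst (g 0)) sp).
      by rewrite e1 (T_cst _ sp) (lin0Z _ l1 sp).
    rewrite hF.
    have ss : slow (fun xi => g (- (ei i *: xi)) - g (- 0)).
      by apply: slowB; [exact: (slow_dil (ei i) (slow_opp sg))|exact: slow_cst].
    have sT := schwartz_T ss sp.
    have hi1 : 0 < ei i <= 1 by rewrite ei0 ei1.
    have [_ hN] := Sle_Lp (ltW p1) (schwartz_cmeas sT) (hK _ hi1).
    apply: le_trans (b1 _ sT) _; apply: le_trans (ler_wpM2l K10 hN) _.
    have -> : K1 * (K * ei i * (@jbint R n) `^ p^-1) = c * ei i.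
      by rewrite /c; move: (_ `^ _) (ei i) => a b; ring.
    rewrite ltr_pdivlMr ?ltr_wpDl// in hi.
    apply: le_trans (ltW hi); rewrite mulrDr mulr1 (mulrC c) lerDl; exact: ltW.
apply: modulus_eq0; apply/eqP; rewrite eq_le modulus_ge0 andbT; apply/ler_addgt0Pr => eps ep.
rewrite add0r.
have gp : 0 < modulus (g 0) by exact: modulus_gt0.
have [i [/= hi]] := filter_ex (filterI (near_infty_natSinv_lt (PosNum e00)) (lim _ (mulr_gt0 gp ep))).
rewrite /F (hz _ (ei0 i) hi) sub0r modulusN modulusM => h.
by rewrite ler_pM2l in h.
Unshelve. all: by end_near. Qed.

End limits.

(** * Vanishing of the bracket for opposite supports *)

Section vanishing.
Context {R : realType} {m : nat}.
Local Notation n := m.+1.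
Local Notation E := 'rV[R]_n.
Local Notation dist := (@dist R n).
Variable chi : E -> R.
Hypothesis hchi : LP_cutoff chi.
Implicit Types (u v w : dist) (G : E -> R) (d : E).

Lemma pair_vanish_ge0 p q s L G d u v w1 w2 : hpair p q -> 0 <= s -> Lip L G ->
  (forall x t, G (x + t *: d) = G x + t) ->
  Shb u -> As chi (- s) u w1 -> Qd p w1 -> Shb v -> As chi s v w2 -> Qd q w2 ->
  van G u -> van (fun x => - G x) v -> pair w1 w2 = 0.
Proof.
move=> H s0 hL hd Su A1 Q1 Sv A2 Q2 vu vv; have [p1 q1 _] := H; have q1' := ltW q1; have [L0 _] := hL.
have d0 : d != 0.
  apply/eqP => dz; have := hd 0 1; rewrite dz scaler0 addr0 => h.
  have : G 0 + 1 <= G 0 by rewrite -h.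
  by rewrite gerDl ler10.
have [mo [sm mo0 hk]] := moll_ex hchi.
have bm l : exists M, Bw l (fun=> M) mo.
  have [M hM] := schwartz_Sle l 0 sm; exists M.
  by apply: Bw_mono (leqnn l) _ hM => x; rewrite expr0 invr1 mulr1.
apply: (@approx_zero _ _ p q w1 w2 (fun xi => cis (dotprod d xi)) 1 1 H (slow_cis d) _ ler01 _ Q1 Q2 ltr01).
- move=> l; have hM i : `|d ord0 i| <= 1 + enorm d.
    by apply: le_trans (coord_le_enorm _ i) _; rewrite lerDr.
  have M1 : 1 <= 1 + enorm d by rewrite lerDl enorm_ge0.
  exists ((1 + enorm d) ^+ l); exact (Bw_cis hM M1).
- move=> e e0; have -> : (fun xi => cis (dotprod d (e *: xi))) = (fun xi => cis (dotprod (e *: d) xi)).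
    by apply/funext => xi; rewrite dotprodZl dotprodZr.
  exact: Mb_cis.
- move=> tau t0 _; have -> : (fun xi => cis (dotprod d (tau *: xi))) = (fun xi => cis (dotprod (tau *: d) xi)).
    by apply/funext => xi; rewrite dotprodZl dotprodZr.
  rewrite pairC.
  (* The mollification radius is chosen after the translation, so that [L * (4 / 3 * e) < tau]. The
     summand 1 covers the case [L = 0]. *)
  have e00 : 0 < tau / (L * (4 / 3) + 1) by rewrite divr_gt0// ltr_wpDl// mulr_ge0.
  apply: (@approx_zero _ _ q p _ w1 mo (kern1 mo) _ (hpairC H) (slow_schwartz sm) bm
    (kern1_ge0 mo) _ (Qd_cis (tau *: d) q1' Q2) Q1 e00) => //.
    by move=> e e0; rewrite -(kern1_dilate e0 sm); exact: (young H (schwartz_dil e0 sm)).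
  move=> e e0 he; rewrite pairC.
  have sme := schwartz_dil e0 sm.
  have QU1 := Qd_multiplier (slow_schwartz sme) (kern1_ge0 _) (young H sme) Q1.
  apply: (remove_dl (k := Num.bound s) H d0 QU1 Q2) => l hl al.
  apply: (pair_moll_diff hchi H s0 hL hd Su A1 Q1 Sv A2 Q2 vu vv sm hk e0 _ _ al).
    rewrite ltr_pdivlMr ?ltr_wpDl ?mulr_ge0// in he; nra.
  by rewrite hl; exact: archi_boundP.
- by rewrite dotprod0r cis0 oner_neq0.
Qed.

(* Adjointness exchanges the two sides of the graph and the sign of [s]. *)
Lemma pair_vanish p q s L G d u v w1 w2 : hpair p q -> Lip L G ->
  (forall x t, G (x + t *: d) = G x + t) ->
  Shb u -> As chi (- s) u w1 -> Qd p w1 -> Shb v -> As chi s v w2 -> Qd q w2 ->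
  van G u -> van (fun x => - G x) v -> pair w1 w2 = 0.
Proof.
move=> H hL hd Su A1 Q1 Sv A2 Q2 vu vv; have [s0|s0] := leP 0 s.
  exact: (pair_vanish_ge0 H s0 hL hd Su A1 Q1 Sv A2 Q2 vu vv).
rewrite pairC.
have s0' : 0 <= - s by rewrite oppr_ge0 ltW.
have hL' : Lip L (fun x => - G x).
  by have := Lip_opp 0 hL; congr (Lip L _); apply/funext => x; rewrite addr0.
have hd' x t : - G (x + t *: - d) = - G x + t by rewrite scalerN -scaleNr hd opprD opprK.
have A2' : As chi (- - s) v w2 by rewrite opprK.
have vu' : van (fun x => - - G x) u.
  by move: vu; congr (van _ u); apply/funext => x; rewrite opprK.
exact: (pair_vanish_ge0 (hpairC H) s0' hL' hd' Sv A2' Q2 Su A1 Q1 vv vu').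
Qed.

Lemma bracket_vanish p q s L G d u v : hpair p q -> Lip L G ->
  (forall x t, G (x + t *: d) = G x + t) -> Hdot chi (- s) q u -> Hdot chi s p v ->
  van G u -> van (fun x => - G x) v -> bracket chi u v = 0.
Proof.
move=> H hL hd /(HdotE hchi _ _ (hpairC H))[Su [w1 A1 Q1]] /(HdotE hchi _ _ H)[Sv [w2 A2 Q2]] vu vv.
rewrite (bracketE hchi H (tempered_lin0 Su.1) (tempered_lin0 Sv.1) A1 Q1 A2 Q2).
exact: (pair_vanish H hL hd Su A1 Q1 Sv A2 Q2 vu vv).
Qed.

End vanishing.

(** * Algebra of the bracket and representation of functionals *)

Section bracket.
Context {R : realType} {m : nat}.
Local Notation n := m.+1.
Local Notation E := 'rV[R]_n.
Local Notation C := R[i].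
Local Notation dist := (@dist R n).
Variable chi : E -> R.
Hypothesis hchi : LP_cutoff chi.
Implicit Types (u v w : dist) (phi : E -> C).

Lemma Hdot_data p q s u : hpair p q -> Hdot chi s p u -> exists w (K : R),
  [/\ As chi s u w, Qd q w, 0 <= K, Hnorm chi s p u = K%:E & Lb q K w].
Proof.
move=> H hu; have [Su [w A Q]] := (HdotE hchi s u H).1 hu.
have [lw [K K0 b]] := Q.
have fin : (dLnorm p%:E w < +oo)%E by apply: le_lt_trans (dLnorm_le H K0 lw b) (ltry _).
have [K' [K'0 e _ b']] := dLnorm_fin H fin.
by exists w, K'; split => //; rewrite (HnormE hchi p A).
Qed.

Lemma Hdot_lin0 p q s u : hpair p q -> Hdot chi s p u -> lin0 u.
Proof. by move=> H /(HdotE hchi _ _ H)[[/tempered_lin0]]. Qed.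

Lemma bracket_le p q s u v : hpair p q -> Hdot chi (- s) q u -> Hdot chi s p v ->
  ((modulus (bracket chi u v))%:E <= Hnorm chi (- s) q u * Hnorm chi s p v)%E.
Proof.
move=> H hu hv; have lu := Hdot_lin0 (hpairC H) hu; have lv := Hdot_lin0 H hv.
have [w1 [K1 [A1 Q1 K10 e1 b1]]] := Hdot_data (hpairC H) hu.
have [w2 [K2 [A2 Q2 K20 e2 b2]]] := Hdot_data H hv.
rewrite (bracketE hchi H lu lv A1 Q1 A2 Q2) e1 e2 -EFinM lee_fin.
exact: (pair_le H K10 K20 Q1.1 Q2.1 b1 b2).
Qed.

Lemma bracketC p q s u v : hpair p q -> Hdot chi (- s) q u -> Hdot chi s p v ->
  bracket chi u v = bracket chi v u.
Proof.
move=> H hu hv; have lu := Hdot_lin0 (hpairC H) hu; have lv := Hdot_lin0 H hv.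
have [w1 [K1 [A1 Q1 _ _ _]]] := Hdot_data (hpairC H) hu.
have [w2 [K2 [A2 Q2 _ _ _]]] := Hdot_data H hv.
have A2' : As chi (- - s) v w2 by rewrite opprK.
rewrite (bracketE hchi H lu lv A1 Q1 A2 Q2).
by rewrite (bracketE hchi (hpairC H) lv lu A2' Q2 A1 Q1) pairC.
Qed.

Lemma bracket_linr p q s (c : C) u v v' : hpair p q -> Hdot chi (- s) q u ->
  Hdot chi s p v -> Hdot chi s p v' ->
  bracket chi u (fun f => c * v f + v' f) = c * bracket chi u v + bracket chi u v'.
Proof.
move=> H hu hv hv'; have lu := Hdot_lin0 (hpairC H) hu.
have lv := Hdot_lin0 H hv; have lv' := Hdot_lin0 H hv'.
have [w1 [K1 [A1 Q1 _ _ _]]] := Hdot_data (hpairC H) hu.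
have [w2 [K2 [A2 Q2 _ _ _]]] := Hdot_data H hv.
have [w3 [K3 [A3 Q3 _ _ _]]] := Hdot_data H hv'.
have Q := Qd_lin c Q2 Q3.
have A := As_lin lv lv' A2 A3 (Qd_tempered (hpairC H) Q).
rewrite (bracketE hchi H lu (lin0P c lv lv') A1 Q1 A Q) (bracketE hchi H lu lv A1 Q1 A2 Q2).
by rewrite (bracketE hchi H lu lv' A1 Q1 A3 Q3); exact: (pair_linr H c Q1 Q2 Q3).
Qed.

Lemma bracket_linl p q s (c : C) u u' v : hpair p q -> Hdot chi (- s) q u ->
  Hdot chi (- s) q u' -> Hdot chi s p v ->
  bracket chi (fun f => c * u f + u' f) v = c * bracket chi u v + bracket chi u' v.
Proof.
move=> H hu hu' hv; have hl := Hdot_lin hchi c (hpairC H) hu hu'.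
rewrite (bracketC H hl hv) (bracketC H hu hv) (bracketC H hu' hv).
have hv' : Hdot chi (- - s) p v by rewrite opprK.
exact: (bracket_linr c (hpairC H) hv' hu hu').
Qed.

Lemma Hdot_toD p q s phi : hpair p q -> - (n%:R / q) < s -> schwartz phi ->
  Hdot chi s p (toD phi).
Proof.
by move=> H hs sp; apply/(HdotE hchi _ _ H); split; [exact: (Shb_toD H)|exact: (As_toD hchi H hs)].
Qed.

(** Testing a representative is thus a special case of the bracket; injectivity of both
    identifications and the support of representatives are read off from it. *)
Lemma bracket_toD p q s u phi : hpair p q -> - (n%:R / q) < s -> Hdot chi (- s) q u ->
  schwartz phi -> bracket chi u (toD phi) = u phi.
Proof.
move=> H hs hu sp; have [Su [w1 A1 Q1]] := (HdotE hchi (- s) u (hpairC H)).1 hu.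
have [w2 A2 Q2] := As_toD hchi H hs sp.
have lu := tempered_lin0 Su.1; have lp := lin0_toD sp.
rewrite (bracketE hchi H lu lp A1 Q1 A2 Q2).
apply: zsum_unique (pair_zsum hchi H Q1 Q2) _.
refine (eq_ind_r (fun a => zsum a (u phi)) (Shb_zsum hchi Su sp) _).
apply/funext => j; have ss := slow_sym hchi s j; have s0 := slow_sym hchi 0 j.
have e1 : multiplier (sym chi 0 j) w2 = multiplier (sym chi s j) (toD phi).
  apply: dist_eq.
  - exact: (lin0_multiplier s0 Q2.1).
  - exact: (lin0_multiplier ss lp).
  move=> psi sps; rewrite (multiplierE w2 s0 sps) (multiplierE (toD phi) ss sps).
  by rewrite (As_comm hchi 0 j lp A2 sps) addr0.
rewrite e1 (pair_mult_toD H ss Q1 sp).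
have -> : (fun xi => sym chi s j (- xi)) = sym chi s j.
  by apply/funext => xi; exact: sym_even.
by rewrite (As_comm hchi s j lu A1 sp) addNr.
Qed.

(* The norm is approached from above by rescaling, which avoids dividing by a
   vanishing norm. *)
Lemma surj_sup p q s (Y : set dist) (ell : dist -> C) (D : \bar R) : hpair p q ->
  - (n%:R / q) < s -> (forall v, Y v -> Hdot chi s p v) -> Y (fun=> 0) ->
  (forall (c : C) u v, Y u -> Y v -> Y (fun f => c * u f + v f)) ->
  (forall (c : C) u v, Y u -> Y v -> ell (fun f => c * u f + v f) = c * ell u + ell v) ->
  (D < +oo)%E ->
  (forall v, Y v -> (Hnorm chi s p v <= 1)%E -> ((modulus (ell v))%:E <= D)%E) ->
  exists u, [/\ Hdot chi (- s) q u, (Hnorm chi (- s) q u <= D)%E &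
    forall v, Y v -> bracket chi u v = ell v].
Proof.
move=> H hs YH Y0 Yl el Doo hD.
(* The multiple [c * v] is written as [(c - 1) * v + v], the form in which closure and linearity are
   assumed. *)
have scale v (K c : R) : Y v -> Hnorm chi s p v = K%:E -> 0 <= c -> c * K <= 1 ->
    ((c * modulus (ell v))%:E <= D)%E.
  move=> Yv eK c0 cK; pose v' : dist := fun f => (c%:C%C - 1) * v f + v f.
  have Yv' : Y v' by exact: Yl.
  have [w [K' [A Q K'0 e b]]] := Hdot_data H (YH _ Yv).
  have eKK : K' = K by move: e; rewrite eK => -[].
  have lv := Hdot_lin0 H (YH _ Yv).
  have Q' := Qd_lin (c%:C%C - 1) Q Q.
  have A' := As_lin lv lv A A (Qd_tempered (hpairC H) Q').
  have nv : (Hnorm chi s p v' <= 1)%E.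
    rewrite (HnormE hchi p A'); apply: (dLnorm_le H ler01 Q'.1) => phi sp.
    have -> : (c%:C%C - 1) * w phi + w phi = c%:C%C * w phi by ring.
    rewrite modulusM modulus_ofreal ger0_norm//.
    apply: le_trans (ler_wpM2l c0 (b _ sp)) _; rewrite mulrA eKK.
    by apply: ler_wpM2r => //; exact: Np_ge0.
  have := hD _ Yv' nv; rewrite /v' (el _ _ _ Yv Yv).
  have -> : (c%:C%C - 1) * ell v + ell v = c%:C%C * ell v by ring.
  by rewrite modulusM modulus_ofreal ger0_norm.
have [Dr eD] : exists Dr : R, D = Dr%:E.
  have [w [K [_ _ _ e _]]] := Hdot_data H (YH _ Y0).
  have := scale _ _ 0 Y0 e (lexx 0); rewrite !mul0r => /(_ ler01).
  by case: D Doo {hD scale} => // r _ _; exists r.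
subst D; have Dr0 : 0 <= Dr.
  have [w [K [_ _ _ e _]]] := Hdot_data H (YH _ Y0).
  by have := scale _ _ 0 Y0 e (lexx 0); rewrite !mul0r lee_fin => /(_ ler01).
apply: (surj hchi H hs YH Y0 Yl el Dr0) => v Yv.
have [w [K [_ _ K0 e _]]] := Hdot_data H (YH _ Yv).
rewrite e -EFinM lee_fin; apply/ler_addgt0Pr => eps e0.
pose t := K + eps / (Dr + 1).
have D1 : 0 < Dr + 1 by rewrite ltr_wpDl.
have x0 : 0 < eps / (Dr + 1) by exact: divr_gt0.
have t0 : 0 < t by rewrite /t; lra.
have ti0 : 0 <= t^-1 by rewrite invr_ge0 ltW.
have tK : t^-1 * K <= 1 by rewrite ler_pdivrMl// mulr1 /t lerDl ltW.
have := scale v K t^-1 Yv e ti0 tK; rewrite lee_fin ler_pdivrMl// => h.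
apply: le_trans h _; rewrite /t mulrDl (mulrC K) lerD2l.
have -> : eps / (Dr + 1) * Dr = eps - eps / (Dr + 1) by field; rewrite gt_eqF.
by rewrite gerBl ltW.
Qed.

End bracket.

(** * Special Lipschitz domains, supports and restrictions *)

Section domain.
Context {R : realType} {m : nat}.
Local Notation n := m.+1.
Local Notation E := 'rV[R]_n.
Local Notation C := R[i].
Local Notation dist := (@dist R n).
Variable chi : E -> R.
Hypothesis hchi : LP_cutoff chi.
Implicit Types (u v w : dist) (phi psi : E -> C) (G : E -> R).

Lemma special_lipschitz_graph (Omega : set E) : special_lipschitz Omega ->
  exists L G d, [/\ Lip L G, forall x t, G (x + t *: d) = G x + t & Omega = [set x | 0 < G x]].
Proof.
move=> [f /pinfty_ex_gt0[M M0 hM] ->].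
exists (1 + M), (fun x : E => x ord0 ord_max - f (col' ord_max x)), (delta_mx ord0 ord_max); split.
- split; first by rewrite addr_ge0// ltW.
  move=> x y.
  have h1 : `|x ord0 ord_max - y ord0 ord_max| <= enorm (x - y).
    by have := coord_le_enorm (x - y) ord_max; rewrite !mxE.
  have h2 : `|f (col' ord_max x) - f (col' ord_max y)| <= M * enorm (x - y).
    have := hM (col' ord_max x, col' ord_max y) _; move=> /(_ _)/= h.
    apply: le_trans (h _) _ => //; apply: ler_wpM2l; first exact: ltW.
    rewrite [leLHS]mx_normrE; apply/bigmax_leP; split; first exact: enorm_ge0.
    move=> [i j] _ /=; rewrite ord1 !mxE.
    by have := coord_le_enorm (x - y) (fintype.lift ord_max j); rewrite !mxE.
  have -> : x ord0 ord_max - f (col' ord_max x) - (y ord0 ord_max - f (col' ord_max y)) =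
      (x ord0 ord_max - y ord0 ord_max) - (f (col' ord_max x) - f (col' ord_max y)) by ring.
  apply: le_trans (ler_normB _ _) _.
  by rewrite mulrDl mul1r; exact: lerD.
- move=> x t.
  have -> : col' ord_max (x + t *: delta_mx ord0 ord_max) = col' ord_max x.
    apply/rowP => j; have nl : (fintype.lift ord_max j == ord_max :> 'I_n) = false.
      by rewrite eq_sym (negbTE (neq_lift _ _)).
    by rewrite !mxE nl andbF mulr0 addr0.
  by rewrite !mxE !eqxx mulr1 addrAC.
- by apply/seteqP; split => x /=; rewrite subr_gt0.
Qed.

Lemma toD_disjoint O O' phi psi : Cc_smooth O phi -> Cc_smooth O' psi -> O `&` O' = set0 ->
  toD phi psi = 0.
Proof.
move=> Cp Cq dis; rewrite (toDE _ (Cc_smooth_schwartz Cq)) -[RHS](cint0 (lebesgue_rV n)).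
apply: eq_cint => x; have [->|nz] := eqVneq (phi x) 0; first by rewrite mul0r.
have [->|nz'] := eqVneq (psi x) 0; first by rewrite mulr0.
have : (O `&` O') x by split; [exact: (Cc_in Cp nz)|exact: (Cc_in Cq nz')].
by rewrite dis.
Qed.

Lemma bump_schwartz (z : E) (r : R) : 0 < r -> schwartz (fun x => ofreal chi (r^-1 *: (x - z))).
Proof.
move=> r0; have ri : r^-1 != 0 by rewrite invr_eq0 gt_eqF.
have := schwartz_affine (- (r^-1 *: z)) ri (schwartz_chi hchi).
by congr schwartz; apply/funext => x; rewrite scalerBr.
Qed.

Lemma bump_Cc (O : set E) (z : E) (r : R) : 0 < r ->
  (forall x, enorm (x - z) <= 4 / 3 * r -> O x) -> Cc_smooth O (fun x => ofreal chi (r^-1 *: (x - z))).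
Proof.
move=> r0 hO; set g := fun x => _.
have cE : continuous (fun x : E => enorm (x - z) : R^o).
  move=> x; apply: (continuous_comp (f := fun x : E => x - z)).
    by apply: continuousB; [exact: cvg_id|exact: cst_continuous].
  exact: enorm_continuous.
have cK : closed [set x : E | enorm (x - z) <= 4 / 3 * r].
  have : closed ((fun x : E => enorm (x - z) : R^o) @^-1` [set t : R | t <= 4 / 3 * r]).
    by apply: closed_comp => [x _|]; [exact: cE|exact: closed_le].
  by [].
have sub : fsupport g `<=` [set x : E | enorm (x - z) <= 4 / 3 * r].
  rewrite [X in _ `<=` X](closure_id _).1//; apply: closure_subset => x /= nz.
  rewrite leNgt; apply/negP => h; move: nz; rewrite /g /ofreal (chi_out hchi) ?rmorph0 ?eqxx//.
  by rewrite enormZ_pos ?invr_ge0 ?(ltW r0)// ler_pdivlMl// mulrC ltW.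
split; [exact: schwartz_smooth (bump_schwartz z r0)| |by move=> x /sub/hO].
apply: bounded_closed_compact; last exact: closed_closure.
exists (4 / 3 * r + enorm z); split; first exact: num_real.
move=> M rM x /sub /= xr; apply: le_trans (norm_le_enorm x) _.
have -> : x = (x - z) + z by rewrite subrK.
by apply: le_trans (enormD _ _) _; apply: le_trans (ltW rM); rewrite lerD2r.
Qed.

(** A partition of unity in product form. Finitely many bumps, on which [u] vanishes, cover the
    support of [phi], each point lying where some bump equals 1. Multiplying [phi] by the factors
    [1 - bump] one after the other does not change the value of [u], and the full product is 0. *)
Lemma dsupport_vanish u (O : set E) phi : lin0 u -> dsupport u `<=` ~` O -> Cc_smooth O phi ->
  u phi = 0.
Proof.
move=> lu hu Cp; have [sp cp sub] := Cp; have sc := Cc_smooth_schwartz Cp.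
pose good (zr : E * R) := 0 < zr.2 /\
  forall psi, smooth psi -> u (fun x => psi x * ofreal chi (zr.2^-1 *: (x - zr.1))) = 0.
have ex x : fsupport phi x -> exists2 r : R, 0 < r & good (x, r).
  move=> Sx; have /existsNP[V hV] : ~ dsupport u x by move=> /hu; apply; exact: sub.
  have [Vo Vx hn] : [/\ open V, V x & ~ exists2 phi, Cc_smooth V phi & u phi <> 0].
    by split; [apply: contrapT => h; apply: hV => /h|apply: contrapT => h; apply: hV => _ /h|move=> h; apply: hV].
  have /nbhs_ballP[e /= e0 he] := open_nbhs_nbhs (conj Vo Vx).
  have r0 : 0 < e / 2 by rewrite divr_gt0.
  exists (e / 2) => //; split => //= psi spsi; apply: contrapT => nz; apply: hn.
  exists (fun y => psi y * ofreal chi ((e / 2)^-1 *: (y - x))) => //.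
  apply: (Cc_smoothM spsi); apply: bump_Cc => // y hy; apply: he; rewrite -ball_normE /=.
  rewrite distrC; apply: le_lt_trans (norm_le_enorm _) _; apply: le_lt_trans hy _; lra.
have := cp; rewrite compact_cover => /(_ (E * R)%type good (fun zr => [set x | enorm (x - zr.1) < 3 / 4 * zr.2])).
case.
- move=> [z r] _ /=.
  have cE : continuous (fun x : E => enorm (x - z) : R^o).
    move=> x; apply: (continuous_comp (f := fun x : E => x - z)).
      by apply: continuousB; [exact: cvg_id|exact: cst_continuous].
    exact: enorm_continuous.
  have : open ((fun x : E => enorm (x - z) : R^o) @^-1` [set t : R | t < 3 / 4 * r]).
    by apply: open_comp => [x _|]; [exact: cE|exact: open_lt].
  by [].
- move=> x Sx; have [r r0 g] := ex _ Sx; exists (x, r) => //=.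
  by rewrite subrr enorm0 mulr_gt0.
move=> D' hD cov.
have prod (l : seq (E * R)) : (forall zr, zr \in l -> good zr) ->
    smooth (fun x => \prod_(zr <- l) (1 - ofreal chi (zr.2^-1 *: (x - zr.1)))) /\
    u (fun x => phi x * \prod_(zr <- l) (1 - ofreal chi (zr.2^-1 *: (x - zr.1)))) = u phi.
  elim: l => [|zr l IH] hl.
    split.
      have -> : (fun x : E => \prod_(zr <- [::]) (1 - ofreal chi (zr.2^-1 *: (x - zr.1)))) = (fun=> 1 : C).
        by apply/funext => x; rewrite big_nil.
      exact: smooth_cst.
    by congr u; apply/funext => x; rewrite big_nil mulr1.
  have [|IH1 IH2] := IH; first by move=> z zl; apply: hl; rewrite inE zl orbT.
  have [r0 gz] := hl zr (mem_head _ _).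
  have sb := bump_schwartz zr.1 r0.
  pose P x := \prod_(zr <- l) (1 - ofreal chi (zr.2^-1 *: (x - zr.1))).
  have e x : \prod_(zr <- zr :: l) (1 - ofreal chi (zr.2^-1 *: (x - zr.1))) =
      P x - P x * ofreal chi (zr.2^-1 *: (x - zr.1)).
    by rewrite big_cons mulrBl mul1r (mulrC (ofreal _ _)).
  split.
    have -> : (fun x => \prod_(zr <- zr :: l) (1 - ofreal chi (zr.2^-1 *: (x - zr.1)))) =
      (fun x => P x - P x * ofreal chi (zr.2^-1 *: (x - zr.1))) by apply/funext.
    by apply: smoothB => //; apply: smoothM => //; exact: schwartz_smooth sb.
  have sP1 : schwartz (fun x => phi x * P x).
    have -> : (fun x => phi x * P x) = (fun x => P x * phi x) by apply/funext => x; rewrite mulrC.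
    exact: (Cc_smooth_schwartz (Cc_smoothM IH1 Cp)).
  have sP2 : schwartz (fun x => phi x * P x * ofreal chi (zr.2^-1 *: (x - zr.1))) by exact: schwartzM.
  have -> : (fun x => phi x * \prod_(zr <- zr :: l) (1 - ofreal chi (zr.2^-1 *: (x - zr.1)))) =
      (fun x => phi x * P x - phi x * P x * ofreal chi (zr.2^-1 *: (x - zr.1))).
    by apply/funext => x; rewrite e mulrBr mulrA.
  rewrite (lin0B lu sP1 sP2).
  have z := gz _ (schwartz_smooth sP1).
  by apply: etrans (congr2 (fun a b => a - b) IH2 z) _; rewrite subr0.
have [_ <-] := prod (finmap.enum_fset D') (fun zr h => set_mem (hD zr h)).
rewrite -(lin00 lu); congr u; apply/funext => x.
have [->|nz] := eqVneq (phi x) 0; first by rewrite mul0r.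
have Sx : fsupport phi x by apply: subset_closure.
have [zr hz hx] := cov x Sx.
have [r0 _] := set_mem (hD zr hz).
rewrite (big_rem zr hz) /= /ofreal (chi_in hchi) ?rmorph1 ?subrr ?mul0r ?mulr0//.
by rewrite enormZ_pos ?invr_ge0 ?(ltW r0)// ltr_pdivrMl// mulrC.
Qed.

Lemma dsupport_closure u (Omega : set E) : lin0 u ->
  dsupport u `<=` closure Omega <-> forall phi, Cc_smooth (~` closure Omega) phi -> u phi = 0.
Proof.
move=> lu; split => [hu phi|hu x hx].
  by apply: (dsupport_vanish lu); rewrite setCK.
apply: contrapT => nx.
have [||phi Cp nz] := hx (~` closure Omega) => //; last exact: (nz (hu _ Cp)).
by apply: closed_openC; exact: closed_closure.
Qed.

Lemma restriction_in (Omega : set E) u phi : Cc_smooth Omega phi -> restriction Omega u phi = u phi.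
Proof. by move=> Cp; rewrite /restriction /ext0 /patch mem_set. Qed.

Lemma restriction_out (Omega : set E) u phi : ~ Cc_smooth Omega phi -> restriction Omega u phi = 0.
Proof. by move=> Cp; rewrite /restriction /ext0 /patch memNset. Qed.

Lemma restriction_lin (Omega : set E) (c : C) u v :
  restriction Omega (fun f => c * u f + v f) =
  (fun f => c * restriction Omega u f + restriction Omega v f).
Proof.
apply/funext => f; have [Cf|nC] := pselect (Cc_smooth Omega f).
  by rewrite !restriction_in.
by rewrite !restriction_out// mulr0 addr0.
Qed.

Lemma restriction_eq (Omega : set E) u v : (forall phi, Cc_smooth Omega phi -> u phi = v phi) ->
  restriction Omega u = restriction Omega v.
Proof.
move=> h; apply/funext => f; have [Cf|nC] := pselect (Cc_smooth Omega f).
  by rewrite !restriction_in// h.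
by rewrite !restriction_out.
Qed.

End domain.

(** * The two duality isomorphisms *)

Section duality.
Context {R : realType} {m : nat}.
Local Notation n := m.+1.
Local Notation E := 'rV[R]_n.
Local Notation C := R[i].
Local Notation dist := (@dist R n).
Variable chi : E -> R.
Hypothesis hchi : LP_cutoff chi.
Variable Omega : set E.
Hypothesis hO : special_lipschitz Omega.
Variables (p q s : R).
Hypotheses (H : hpair p q) (hs : - (n%:R / q) < s).
Implicit Types (u v w U V : dist) (phi : E -> C).
Local Notation rest := (restriction Omega).
Local Notation X := (Hdot chi s p).
Local Notation Y := (Hdot chi (- s) q).
Local Notation X0 := (Hdot0 chi Omega s p).
Local Notation Y0 := (Hdot0 chi Omega (- s) q).
Local Notation NX := (Hnorm chi s p).
Local Notation NY := (Hnorm chi (- s) q).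
Local Notation br := (bracket chi).

Lemma Omega_sep : exists L G d, [/\ Lip L G, forall x t, G (x + t *: d) = G x + t,
  forall u, lin0 u -> dsupport u `<=` closure Omega -> van G u &
  forall u, (forall phi, Cc_smooth Omega phi -> u phi = 0) -> van (fun x => - G x) u].
Proof.
have [L [G [d [hL hd eO]]]] := special_lipschitz_graph hO; exists L, G, d; split => //.
  move=> u lu hu phi Cp; apply: ((dsupport_closure hchi Omega lu).1 hu).
  case: Cp => sp cp sub; split => // x /sub /= Gx cx.
  have cG : closed ((G : E -> R^o) @^-1` [set t : R | 0 <= t]).
    by apply: closed_comp => [y _|]; [exact: (Lip_continuous hL)|exact: closed_ge].
  have : ((G : E -> R^o) @^-1` [set t : R | 0 <= t]) x.
    rewrite ((closure_id _).1 cG); apply: closure_subset cx.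
    by rewrite eO => y /= /ltW.
  by rewrite /= leNgt Gx.
move=> u hu phi Cp; apply: hu; case: Cp => sp cp sub; split => // x /sub /=.
by rewrite oppr_lt0 eO.
Qed.

(** The difference of the two extensions vanishes in the domain. The arguments are exchanged because
    [bracket_vanish] expects the one supported in the closure of the domain first. *)
Lemma bracket_restr u u' v : Y u -> Y u' -> X0 v -> rest u = rest u' -> br u v = br u' v.
Proof.
move=> hu hu' [hv sv] e; have [L [G [d [hL hd h1 h2]]]] := Omega_sep.
have hz := Hdot_lin hchi (-1) (hpairC H) hu' hu.
have z0 : br (fun f => -1 * u' f + u f) v = 0.
  have hv' : Hdot chi (- - s) p v by rewrite opprK.
  rewrite (bracketC hchi H hz hv).
  apply: (bracket_vanish hchi (hpairC H) hL hd hv' hz).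
    exact: (h1 _ (Hdot_lin0 hchi H hv) sv).
  apply: h2 => phi Cp; have := congr1 (fun w => w phi) e.
  by rewrite !restriction_in// => ->; rewrite mulN1r addNr.
move: z0; rewrite (bracket_linl hchi (-1) H hu' hu hv) mulN1r addrC.
by move/eqP; rewrite subr_eq0 => /eqP.
Qed.

Lemma bracket_restr' u v v' : Y0 u -> X v -> X v' -> rest v = rest v' -> br u v = br u v'.
Proof.
move=> [hu su] hv hv' e; have [L [G [d [hL hd h1 h2]]]] := Omega_sep.
have hz := Hdot_lin hchi (-1) H hv' hv.
have z0 : br u (fun f => -1 * v' f + v f) = 0.
  apply: (bracket_vanish hchi H hL hd hu hz).
    exact: (h1 _ (Hdot_lin0 hchi (hpairC H) hu) su).
  apply: h2 => phi Cp; have := congr1 (fun w => w phi) e.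
  by rewrite !restriction_in// => ->; rewrite mulN1r addNr.
move: z0; rewrite (bracket_linr hchi (-1) H hu hv' hv) mulN1r addrC.
by move/eqP; rewrite subr_eq0 => /eqP.
Qed.

Lemma Hdot0_lin p' q' s' (c : C) u v : hpair p' q' -> Hdot0 chi Omega s' p' u ->
  Hdot0 chi Omega s' p' v -> Hdot0 chi Omega s' p' (fun f => c * u f + v f).
Proof.
move=> H' [hu su] [hv sv]; have lu := Hdot_lin0 hchi H' hu; have lv := Hdot_lin0 hchi H' hv.
split; first exact: (Hdot_lin hchi c H' hu hv).
apply/(dsupport_closure hchi Omega (lin0P c lu lv)) => phi Cp.
by rewrite ((dsupport_closure hchi Omega lu).1 su _ Cp) ((dsupport_closure hchi Omega lv).1 sv _ Cp) mulr0 addr0.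
Qed.

Lemma disjoint_closure : Omega `&` ~` closure Omega = set0.
Proof. by apply/seteqP; split => // x [Ox /(_ (subset_closure Ox))]. Qed.

(** Test functions of the domain lie in the space of supported distributions; they separate
    restrictions in [J1_inj]. *)
Lemma X0_toD phi : Cc_smooth Omega phi -> X0 (toD phi).
Proof.
move=> Cp; have sp := Cc_smooth_schwartz Cp; split; first exact: (Hdot_toD hchi H hs sp).
apply/(dsupport_closure hchi Omega (lin0_toD sp)) => psi Cq.
exact: (toD_disjoint Cp Cq disjoint_closure).
Qed.

Lemma Hdot0_0 : X0 (fun=> 0).
Proof.
have h := Hdot_0 hchi s H; split => //.
by apply/(dsupport_closure hchi Omega (Hdot_lin0 hchi H h)).
Qed.

Lemma NY_ge0 u : Y u -> (0 <= NY u)%E.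
Proof. by move=> hu; have [w [K [_ _ K0 -> _]]] := Hdot_data hchi (hpairC H) hu; rewrite lee_fin. Qed.

Lemma NX_ge0 v : X v -> (0 <= NX v)%E.
Proof. by move=> hu; have [w [K [_ _ K0 -> _]]] := Hdot_data hchi H hu; rewrite lee_fin. Qed.

Lemma NY_fin u : Y u -> (NY u < +oo)%E. Proof. by case. Qed.

Lemma abs_bound (a K : R) (N : \bar R) : (0 <= N)%E -> (a%:E <= K%:E * N)%E -> (N <= 1)%E ->
  (a%:E <= `|K|%:E)%E.
Proof.
move=> N0 h N1; apply: (le_trans h).
apply: (@le_trans _ _ (`|K|%:E * N)%E).
  by apply: lee_wpmul2r => //; rewrite lee_fin ler_norm.
by rewrite -[leRHS]mule1; apply: lee_wpmul2l => //; rewrite lee_fin.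
Qed.

Lemma lin_at0 (D : set dist) (l : dist -> C) : D (fun=> 0) ->
  (forall (c : C) u v, D u -> D v -> l (fun f => c * u f + v f) = c * l u + l v) -> l (fun=> 0) = 0.
Proof.
move=> D0 hl; have := hl 1 _ _ D0 D0.
have -> : (fun f : E -> C => 1 * 0 + 0 : C) = (fun=> 0) by apply/funext => f; rewrite mulr0 addr0.
by move/eqP; rewrite mul1r -subr_eq subrr eq_sym => /eqP.
Qed.

(** The extension of [U] is an arbitrary choice, which [bracket_restr] makes irrelevant; the value 0
    outside the space is the convention of [dual]. *)
Definition J1 U v : C := if `[< X0 v >] then br (xget (fun=> 0) [set u | Y u /\ rest u = U]) v else 0.

Lemma J1E u v : Y u -> X0 v -> J1 (rest u) v = br u v.
Proof.
move=> hu hv; rewrite /J1 (asboolT hv).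
have [hz ez] : [set u' | Y u' /\ rest u' = rest u] (xget (fun=> 0) [set u' | Y u' /\ rest u' = rest u]).
  by apply: xgetPex; exists u.
exact: bracket_restr.
Qed.

Lemma J1_out U v : ~ X0 v -> J1 U v = 0.
Proof. by move=> nv; rewrite /J1 (asboolF nv). Qed.

Lemma J1_inj u u' : Y u -> Y u' -> (forall v, X0 v -> br u v = br u' v) -> rest u = rest u'.
Proof.
move=> hu hu' e; apply: restriction_eq => phi Cp; have sp := Cc_smooth_schwartz Cp.
by rewrite -(bracket_toD hchi H hs hu sp) -(bracket_toD hchi H hs hu' sp) (e _ (X0_toD Cp)).
Qed.

Lemma bracket_le1 u v : Y u -> X v -> (NX v <= 1)%E -> ((modulus (br u v))%:E <= NY u)%E.
Proof.
move=> hu hv n1; apply: le_trans (bracket_le hchi H hu hv) _.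
by rewrite -[leRHS]mule1; apply: lee_wpmul2l => //; exact: NY_ge0.
Qed.

(** Both constants are 1. Every extension bounds the dual norm from above, and [surj_sup] returns an
    extension of norm at most the dual norm; by [J1_inj] it has the same restriction. *)
Lemma dual_iso1 : dual_iso (HdotO chi Omega (- s) q) (HnormO chi Omega (- s) q) X0 NX J1.
Proof.
have XX v : X0 v -> X v by case.
have Xl (c : C) u v : X0 u -> X0 v -> X0 (fun f => c * u f + v f) by exact: (Hdot0_lin c H).
have lb u : Y u -> forall (c : C) v v', X0 v -> X0 v' ->
    br u (fun f => c * v f + v' f) = c * br u v + br u v'.
  by move=> hu c v v' [hv _] [hv' _]; exact: (bracket_linr hchi c H hu hv hv').
have up u : Y u -> (dual_norm X0 NX (J1 (rest u)) <= NY u)%E.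
  move=> hu; apply: ge_ereal_sup => _ [v [hv n1] <-].
  by rewrite (J1E hu hv); apply: bracket_le1 => //; exact: XX.
split; [split|move=> c _ _ [u hu <-] [v hv <-]; apply/funext => w|exists 1, 1; split => // _ [u hu <-]].
- move=> _ [u hu <-]; split.
  + exact: J1_out.
  + by move=> c v v' hv hv'; rewrite (J1E hu (Xl c _ _ hv hv')) (J1E hu hv) (J1E hu hv'); exact: lb.
  + have [w [K [_ _ K0 e _]]] := Hdot_data hchi (hpairC H) hu.
    by exists K => v hv; rewrite (J1E hu hv) -e; exact: (bracket_le hchi H hu (XX _ hv)).
- move=> U V /set_mem[u hu <-] /set_mem[v hv <-] e; apply: (J1_inj hu hv) => w hw.
  by rewrite -(J1E hu hw) -(J1E hv hw) e.
- move=> l [lo ll [K lK]].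
  have [|u [hu _ e]] := @surj_sup _ _ _ hchi p q s X0 l (`|K|%:E) H hs XX Hdot0_0 Xl ll (ltry _).
    by move=> v hv n1; exact: (abs_bound (NX_ge0 (XX _ hv)) (lK _ hv) n1).
  exists (rest u); first by exists u.
  apply/funext => v; have [hv|nv] := pselect (X0 v); first by rewrite (J1E hu hv) e.
  by rewrite (J1_out _ nv) lo.
- have hl := Hdot_lin hchi c (hpairC H) hu hv.
  rewrite -restriction_lin; have [hw|nw] := pselect (X0 w); last by rewrite !J1_out// mulr0 addr0.
  by rewrite (J1E hl hw) (J1E hu hw) (J1E hv hw); exact: (bracket_linl hchi c H hu hv (XX _ hw)).
- rewrite !mul1e; apply/andP; split; last first.
    by apply: le_ereal_inf_tmp => _ [u' [hu' e] <-]; rewrite -e; exact: up.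
  have [|||u' [hu' nu' e]] := @surj_sup _ _ _ hchi p q s X0 (J1 (rest u)) (dual_norm X0 NX (J1 (rest u))) H hs XX Hdot0_0 Xl _ _ _.
  + by move=> c v v' hv hv'; rewrite (J1E hu (Xl c _ _ hv hv')) (J1E hu hv) (J1E hu hv'); exact: lb.
  + exact: le_lt_trans (up _ hu) (NY_fin hu).
  + by move=> v hv n1; apply: ereal_sup_ubound; exists v.
  apply: le_trans nu'; apply: ereal_inf_lbound; exists u' => //; split => //.
  by apply: (J1_inj hu' hu) => v hv; rewrite (e _ hv) (J1E hu hv).
Qed.

Definition J2 u V : C :=
  if `[< HdotO chi Omega s p V >] then br u (xget (fun=> 0) [set v | X v /\ rest v = V]) else 0.

Lemma J2E u v : Y0 u -> X v -> J2 u (rest v) = br u v.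
Proof.
move=> hu hv; have hV : HdotO chi Omega s p (rest v) by exists v.
rewrite /J2 (asboolT hV).
have [hz ez] : [set v' | X v' /\ rest v' = rest v] (xget (fun=> 0) [set v' | X v' /\ rest v' = rest v]).
  by apply: xgetPex; exists v.
exact: bracket_restr'.
Qed.

Lemma J2_out u V : ~ HdotO chi Omega s p V -> J2 u V = 0.
Proof. by move=> nv; rewrite /J2 (asboolF nv). Qed.

Lemma J2_inj u u' : Y u -> Y u' -> (forall v, X v -> br u v = br u' v) -> u = u'.
Proof.
move=> hu hu' e; apply: dist_eq; [exact: (Hdot_lin0 hchi (hpairC H) hu)|exact: (Hdot_lin0 hchi (hpairC H) hu')|].
move=> phi sp; rewrite -(bracket_toD hchi H hs hu sp) -(bracket_toD hchi H hs hu' sp).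
by apply: e; exact: (Hdot_toD hchi H hs sp).
Qed.

Lemma HnormO_le v : X v -> (HnormO chi Omega s p (rest v) <= NX v)%E.
Proof. by move=> hv; apply: ereal_inf_lbound; exists v. Qed.

Lemma HnormO_ge0 V : (0 <= HnormO chi Omega s p V)%E.
Proof. by apply: le_ereal_inf_tmp => _ [v [hv _] <-]; exact: NX_ge0. Qed.

Lemma J2_le u v (K : R) : Y0 u -> X v -> 0 < K -> (NY u <= K%:E)%E ->
  ((modulus (J2 u (rest v)))%:E <= K%:E * HnormO chi Omega s p (rest v))%E.
Proof.
move=> hu hv K0 hK; rewrite -lee_pdivrMl//; apply: le_ereal_inf_tmp => _ [v' [hv' e] <-].
rewrite lee_pdivrMl// -e (J2E hu hv'); apply: le_trans (bracket_le hchi H hu.1 hv') _.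
by apply: lee_wpmul2r => //; exact: NX_ge0.
Qed.

Lemma dual_iso2 : dual_iso Y0 NY (HdotO chi Omega s p) (HnormO chi Omega s p) J2.
Proof.
have lJ u : Y0 u -> forall (c : C) V V', HdotO chi Omega s p V -> HdotO chi Omega s p V' ->
    J2 u (fun f => c * V f + V' f) = c * J2 u V + J2 u V'.
  move=> hu c _ _ [v hv <-] [v' hv' <-]; rewrite -restriction_lin.
  rewrite (J2E hu hv) (J2E hu hv') (J2E hu (Hdot_lin hchi c H hv hv')).
  exact: (bracket_linr hchi c H hu.1 hv hv').
have X00 : X (fun=> 0) := Hdot_0 hchi s H.
have Xl (c : C) u v : X u -> X v -> X (fun f => c * u f + v f) by exact: (Hdot_lin hchi c H).
have XX v : X v -> X v by [].
split; [split|move=> c u v hu hv; apply/funext => V|exists 1, 2; split => // u hu].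
- move=> u hu; split; [exact: J2_out|exact: lJ|].
  have [w [K [_ _ K0 e _]]] := Hdot_data hchi (hpairC H) hu.1.
  exists (K + 1) => _ [v hv <-]; apply: J2_le => //; first by rewrite ltr_wpDl.
  by rewrite e lee_fin lerDl.
- move=> u u' /set_mem hu /set_mem hu' e; apply: (J2_inj hu.1 hu'.1) => v hv.
  by rewrite -(J2E hu hv) -(J2E hu' hv) e.
- move=> l [lo ll [K lK]].
  have rl (c : C) v v' : X v -> X v' -> l (rest (fun f => c * v f + v' f)) = c * l (rest v) + l (rest v').
    by move=> hv hv'; rewrite restriction_lin; apply: ll; [exists v|exists v'].
  have [|u [hu _ e]] := @surj_sup _ _ _ hchi p q s X (fun v => l (rest v)) (`|K|%:E) H hs XX X00 Xl rl (ltry _).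
    move=> v hv n1; apply: (abs_bound (HnormO_ge0 (rest v)) (lK _ _)); first by exists v.
    exact: le_trans (HnormO_le hv) n1.
  have r0 : rest (fun=> 0) = (fun=> 0).
    apply/funext => f; have [Cf|nC] := pselect (Cc_smooth Omega f); first by rewrite restriction_in.
    by rewrite restriction_out.
  have O0 : HdotO chi Omega s p (fun=> 0) by exists (fun=> 0).
  (* A Schwartz function supported outside the closure restricts to 0, so the functional vanishes on
     it, and [bracket_toD] reads this as the vanishing of [u]. *)
  have hu0 : Y0 u.
    split => //; apply/(dsupport_closure hchi Omega (Hdot_lin0 hchi (hpairC H) hu)) => phi Cp.
    have sp := Cc_smooth_schwartz Cp; have hp := Hdot_toD hchi H hs sp.
    rewrite -(bracket_toD hchi H hs hu sp) (e _ hp).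
    have -> : rest (toD phi) = (fun=> 0).
      rewrite -r0; apply: restriction_eq => psi Cq.
      by apply: (toD_disjoint Cp Cq); rewrite setIC; exact: disjoint_closure.
    exact: (lin_at0 O0 ll).
  exists u => //; apply/funext => V.
  have [[v hv <-]|nV] := pselect (HdotO chi Omega s p V); first by rewrite (J2E hu0 hv) e.
  by rewrite (J2_out _ nV) lo.
- have hl := Hdot0_lin c (hpairC H) hu hv.
  have [[w hw <-]|nV] := pselect (HdotO chi Omega s p V); last by rewrite !J2_out// mulr0 addr0.
  rewrite (J2E hl hw) (J2E hu hw) (J2E hv hw).
  exact: (bracket_linl hchi c H hu.1 hv.1 hw).
(* A restriction of norm at most 1 need not have an extension of norm at most 1, since the infimum
   may not be attained; an extension of norm below 2 exists, whence the constant 2. *)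
- have up : (dual_norm (HdotO chi Omega s p) (HnormO chi Omega s p) (J2 u) <= 2%:E * NY u)%E.
    apply: ge_ereal_sup => _ [V [[v hv <-] n1] <-].
    have lt2 : (HnormO chi Omega s p (rest v) < 2%:E)%E.
      by apply: le_lt_trans n1 _; rewrite lte_fin ltr1n.
    have [_ [v' [hv' e] <-] lt] := ereal_inf_lt lt2.
    rewrite -e (J2E hu hv'); apply: le_trans (bracket_le hchi H hu.1 hv') _.
    by rewrite muleC; apply: lee_wpmul2r; [exact: NY_ge0 hu.1|exact: ltW].
  apply/andP; split => //; rewrite mul1e.
  have [|||u' [hu' nu' e]] := @surj_sup _ _ _ hchi p q s X (br u) (dual_norm (HdotO chi Omega s p) (HnormO chi Omega s p) (J2 u)) H hs XX X00 Xl _ _ _.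
  + by move=> c v v' hv hv'; exact: (bracket_linr hchi c H hu.1 hv hv').
  + apply: le_lt_trans up _; have [w [K [_ _ K0 -> _]]] := Hdot_data hchi (hpairC H) hu.1.
    by rewrite -EFinM ltry.
  + move=> v hv n1; apply: ereal_sup_ubound; exists (rest v); last by rewrite (J2E hu hv).
    by split; [exists v|exact: le_trans (HnormO_le hv) n1].
  have eu := J2_inj hu' hu.1 e; rewrite eu in nu'; exact: nu'.
Qed.

End duality.

(* The dimension is n = m.+1 >= 2, [q] is the Hoelder conjugate p' of [p], and
   [chi] is the cut-off generating the Littlewood-Paley family. *)
Theorem proposition3p14 (R : realType) (m : nat) (hm : (1 <= m)%N)
    (chi : 'rV[R]_m.+1 -> R) (hchi : LP_cutoff chi)
    (Omega : set 'rV[R]_m.+1) (hOmega : special_lipschitz Omega)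
    (p q s : R) (hp : 1 < p) (hpq : p^-1 + q^-1 = 1)
    (hs : - (m.+1%:R / q) < s) :
  (exists J : dist -> dist -> R[i],
     (forall u v, Hdot chi (- s) q u -> Hdot0 chi Omega s p v ->
        J (restriction Omega u) v = bracket chi u v) /\
     dual_iso (HdotO chi Omega (- s) q) (HnormO chi Omega (- s) q)
              (Hdot0 chi Omega s p) (Hnorm chi s p) J) /\
  (exists J : dist -> dist -> R[i],
     (forall u v, Hdot0 chi Omega (- s) q u -> Hdot chi s p v ->
        J u (restriction Omega v) = bracket chi u v) /\
     dual_iso (Hdot0 chi Omega (- s) q) (Hnorm chi (- s) q)
              (HdotO chi Omega s p) (HnormO chi Omega s p) J).
Proof.
have p0 : 0 < p by exact: lt_trans hp.
have p1 : p^-1 < 1 by rewrite invf_lt1.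
have pi0 : 0 < p^-1 by rewrite invr_gt0.
have q0 : 0 < q by rewrite -invr_gt0; move: hpq; lra.
have q1 : q^-1 < 1 by move: hpq; lra.
have H : hpair p q by split => //; rewrite invf_lt1 in q1.
split.
  exists (J1 chi Omega p q s); split; last exact: dual_iso1.
  by move=> u v hu hv; exact: J1E.
exists (J2 chi Omega p s); split; last exact: dual_iso2.
by move=> u v hu hv; exact: (J2E hchi hOmega H hu hv).
Qed.
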